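(* Suppose $k=1=\beta$ or $1<\beta<k\wedge2$ (with $k\ge1$ an integer), and $d=\frac{2(k+1)}{2-\beta}$. Let $\hat v=(\hat v(t,x),\,t\in\mathbb{R}_+,\,x\in\mathbb{R}^k)$ be the ($\mathbb{R}^d$-valued, continuous) solution of the linear system of stochastic wave equations $$\frac{\partial^2}{\partial t^2}\hat v_j(t,x)=\Delta\hat v_j(t,x)+\dot{\hat W}_j(t,x),\quad j=1,\dots,d,\qquad \hat v(0,x)=0,\quad\frac{\partial}{\partial t}\hat v(0,x)=0,\quad x\in\mathbb{R}^k,$$ driven by the noise $\hat W$ described in the context. Then points are polar for $\hat v$, that is, for all $z\in\mathbb{R}^d$, $$P\{\exists(t,x)\in\,]0,+\infty[\,\times\mathbb{R}^k:\ \hat v(t,x)=z\}=0.$$ In particular, in the case where $k=1=\beta$, $\hat W$ is space-time white noise and $d=4$, points are polar for $\hat v$.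
   Context: Noise: $\hat W=(\hat W_1,\dots,\hat W_d)$ is a centered Gaussian family indexed by $C^\infty$ test functions with compact support on $\mathbb{R}\times\mathbb{R}^k$, with independent components, white in time. If $1<\beta<k\wedge2$, it is spatially homogeneous with Riesz-kernel covariance: $E(\hat W_\ell(\varphi)\hat W_j(\psi))=\delta_{\ell,j}\int_{\mathbb{R}_+}dr\int_{\mathbb{R}^k}dy\int_{\mathbb{R}^k}dz\,\varphi(r,y)|y-z|^{-\beta}\psi(r,z)$. If $k=1=\beta$, it is space-time white noise: $E(\hat W_\ell(\varphi)\hat W_j(\psi))=\delta_{\ell,j}\int_{\mathbb{R}_+}dr\int_{\mathbb{R}}dy\,\varphi(r,y)\psi(r,y)$. Solution: $\hat v_j(t,x)=\int_0^t\int_{\mathbb{R}^k}S(t-s,x-y)\,\hat W_j(ds,dy)$, where $S$ is the fundamental solution of the wave equation, whose Fourier transform in space is $\mathcal{F}S(t,\cdot)(\xi)=\sin(t|\xi|)/|\xi|$, and the stochastic integral is defined through its Fourier-space covariance (Dalang's extension of Walsh's integral). Thus $\hat v$ is a centered Gaussian random field with i.i.d. components and covariance $$E[\hat v_j(t,x)\hat v_j(s,y)]=c_{k,\beta}\int_0^{t\wedge s}dr\int_{\mathbb{R}^k}d\xi\,|\xi|^{\beta-k-2}\,e^{-i\xi\cdot(x-y)}\sin((t-r)|\xi|)\sin((s-r)|\xi|),$$ where $c_{k,\beta}>0$ is the constant such that $\int\int\varphi(y)|y-z|^{-\beta}\psi(z)\,dy\,dz=c_{k,\beta}\int|\xi|^{\beta-k}\mathcal{F}\varphi(\xi)\overline{\mathcal{F}\psi(\xi)}\,d\xi$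 for real test functions, with $\mathcal{F}\varphi(\xi)=\int e^{-i\xi\cdot x}\varphi(x)\,dx$ (and $c_{1,1}=(2\pi)^{-1}$ in the white noise case). $\hat v$ denotes the version with continuous sample paths. *)

(* Defs.v *)
From HB Require Import structures.
From mathcomp Require Import all_boot all_order all_algebra.
From mathcomp Require Import all_classical all_reals all_analysis.
From mathcomp Require Import complex.

Set Implicit Arguments.
Unset Strict Implicit.
Unset Printing Implicit Defensive.

Import Order.TTheory GRing.Theory Num.Theory.
Import numFieldNormedType.Exports.

Local Open Scope classical_set_scope.
Local Open Scope ring_scope.

(* Points of R^k are row vectors 'rV[R]_k, which carry the topology and the
   normed structure; the library's product sigma-algebra lives on k-tuples, so
   Lebesgue measure is built there and [to_row] passes from one to the other. *)
Section lebesgue_Rk.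
Context {R : realType}.

Definition cons_pair n (p : measurableTypeR R * n.-tuple (measurableTypeR R)) :
  n.+1.-tuple (measurableTypeR R) := [tuple of p.1 :: p.2].

Lemma measurable_cons_pair n : measurable_fun setT (@cons_pair n).
Proof. exact: measurable_cons measurable_fst measurable_snd. Qed.

Section cons_lebesgue.
Variables (n : nat) (m : {measure set (n.-tuple (measurableTypeR R)) -> \bar R}).

HB.instance Definition _ :=
  isMeasurableFun.Build _ _ _ _ (@cons_pair n) (@measurable_cons_pair n).

(* The product \x^ only needs its left factor to be sigma-finite. *)
Definition cons_lebesgue :=
  pushforward (lebesgue_measure \x^ m)%E (@cons_pair n).

Let cons_lebesgue0 : cons_lebesgue set0 = 0%E.
Proof. exact: measure0. Qed.

Let cons_lebesgue_ge0 A : (0 <= cons_lebesgue A)%E.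
Proof. exact: measure_ge0. Qed.

Let cons_lebesgue_sigma_additive : semi_sigma_additive cons_lebesgue.
Proof. exact: measure_semi_sigma_additive. Qed.

HB.instance Definition _ := isMeasure.Build _ _ _ cons_lebesgue
  cons_lebesgue0 cons_lebesgue_ge0 cons_lebesgue_sigma_additive.

End cons_lebesgue.

Fixpoint lebesgue_tuple n :
    {measure set (n.-tuple (measurableTypeR R)) -> \bar R} :=
  match n with
  | 0 => \d_([tuple] : 0.-tuple (measurableTypeR R))
  | m.+1 => cons_lebesgue (lebesgue_tuple m)
  end.

Definition to_row k (u : k.-tuple (measurableTypeR R)) : 'rV[R]_k :=
  \row_(i < k) tnth u i.

Definition integral_Rk k (f : 'rV[R]_k -> \bar R) : \bar R :=
  (\int[lebesgue_tuple k]_u f (to_row u))%E.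

Definition dotp k (x y : 'rV[R]_k) : R := \sum_(i < k) x 0 i * y 0 i.

(* Euclidean norm; the library's norm `|x| on row vectors is the sup norm. *)
Definition enorm k (x : 'rV[R]_k) : R := Num.sqrt (dotp x x).

End lebesgue_Rk.

Section fourier.
Context {R : realType}.
Local Open Scope complex_scope.

Definition expNi (a : R) : R[i] := cos a -i* sin a.

(* F f (xi) = int e^{-i xi.x} f(x) dx for real-valued f *)
Definition fourier k (f : 'rV[R]_k -> R) (xi : 'rV[R]_k) : R[i] :=
  fine (integral_Rk (fun x => (cos (dotp xi x) * f x)%:E)) -i*
  fine (integral_Rk (fun x => (sin (dotp xi x) * f x)%:E)).

End fourier.

Section test_functions.
Context {R : realType}.

Fixpoint is_Cn (V : normedModType R) (n : nat) (f : V -> R) : Prop :=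
  continuous f /\
  match n with
  | 0 => True
  | m.+1 => forall v : V, (forall x, derivable f x v) /\ is_Cn m ('D_v f)
  end.

Definition smooth (V : normedModType R) (f : V -> R) : Prop :=
  forall n, is_Cn n f.

Definition compactly_supported (V : normedModType R) (f : V -> R) : Prop :=
  compact (closure [set p | f p != 0]).

End test_functions.

Record test_function (R : realType) (k : nat) := TestFunction {
  test_fun :> R * 'rV[R]_k -> R ;
  test_fun_smooth : smooth test_fun ;
  test_fun_supp : compactly_supported test_fun }.

Section noise.
Context {R : realType} {disp : measure_display} {T : measurableType disp}.
Variable P : probability T R.

(* [normal_prob] with zero standard deviation is not the Dirac mass, so the
   degenerate Gaussian law is singled out. *)
Definition centered_gaussian (X : T -> R) : Prop :=
  exists2 s : R, 0 <= s &
    forall A : set R, measurable A ->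
      P (X @^-1` A) = if s == 0 then \d_(0 : R) A else normal_prob 0 s A.

Definition centered_gaussian_family (I : Type) (X : I -> {RV P >-> R}) : Prop :=
  forall s : seq (R * I),
    centered_gaussian (fun w => \sum_(a <- s) a.1 * X a.2 w).

(* The family is jointly Gaussian over components and test functions, so the
   vanishing cross-covariances make the components independent. *)
Definition noise_with_covariance k d
    (cov : test_function R k -> test_function R k -> \bar R)
    (W : 'I_d -> test_function R k -> {RV P >-> R}) : Prop :=
  centered_gaussian_family (fun a : 'I_d * test_function R k => W a.1 a.2) /\
  forall (l j : 'I_d) (phi psi : test_function R k),
    'E_P[(fun w => W l phi w * W j psi w)%R]%E =
      if l == j then cov phi psi else 0%E.

Definition white_cov k (phi psi : test_function R k) : \bar R :=
  (\int[lebesgue_measure]_(r in `[0%R, +oo[)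
     integral_Rk (fun y => (phi (r, y) * psi (r, y))%:E))%E.

(* On the null set y = z the power is 0 by convention, as 0 `^ a = 0 for a != 0. *)
Definition riesz_cov k (beta : R) (phi psi : test_function R k) : \bar R :=
  (\int[lebesgue_measure]_(r in `[0%R, +oo[)
     integral_Rk (fun y => integral_Rk (fun z =>
       (phi (r, y) * enorm (y - z) `^ (- beta) * psi (r, z))%:E)))%E.

Definition is_white_noise k d
    (W : 'I_d -> test_function R k -> {RV P >-> R}) : Prop :=
  noise_with_covariance (@white_cov k) W.

Definition is_riesz_noise k d (beta : R)
    (W : 'I_d -> test_function R k -> {RV P >-> R}) : Prop :=
  noise_with_covariance (@riesz_cov k beta) W.

(* Squared distance between a test function phi and an integrand given by its
   spatial Fourier transform G(r, .), in the norm
     int_0^oo dr int dxi |xi|^(beta - k) |F(r)(xi)|^2,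
   which up to the factor c_{k,beta} is the covariance norm of the noise; the
   factor is irrelevant for convergence.  For k = beta = 1 the weight is 1. *)
Definition spectral_dist2 k (beta : R) (phi : test_function R k)
    (G : R -> 'rV[R]_k -> R[i]) : \bar R :=
  (\int[lebesgue_measure]_(r in `[0%R, +oo[)
     integral_Rk (fun xi : 'rV[R]_k =>
       (enorm xi `^ (beta - k%:R) *
        Normc.normc (fourier (fun y => phi (r, y)) xi - G r xi) ^+ 2)%:E))%E.

(* X is the integral of the deterministic integrand with spatial Fourier
   transform G against the noise Wj: the isometric extension of
   phi |-> Wj(phi) to the completion of the test functions. *)
Definition is_stochastic_integral k (beta : R)
    (Wj : test_function R k -> {RV P >-> R})
    (G : R -> 'rV[R]_k -> R[i]) (X : T -> R) : Prop :=
  exists phi : nat -> test_function R k,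
    (fun n => spectral_dist2 beta (phi n) G) @ \oo --> 0%E /\
    (fun n => 'E_P[(fun w => (Wj (phi n) w - X w) ^+ 2)%R]%E) @ \oo --> 0%E.

End noise.

Section wave.
Context {R : realType}.
Local Open Scope complex_scope.

(* F S(t, .)(xi) *)
Definition wave_fourier k (t : R) (xi : 'rV[R]_k) : R :=
  sin (t * enorm xi) / enorm xi.

(* Fourier transform in y of 1_{s < t} S(t - s, x - y); S(t, .) is even. *)
Definition wave_integrand k (t : R) (x : 'rV[R]_k) (s : R) (xi : 'rV[R]_k) :
    R[i] :=
  if s < t then expNi (dotp xi x) * (wave_fourier (t - s) xi)%:C else 0.

Definition is_wave_solution k d (beta : R)
    (disp : measure_display) (T : measurableType disp) (P : probability T R)
    (W : 'I_d -> test_function R k -> {RV P >-> R})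
    (v : T -> R -> 'rV[R]_k -> 'rV[R]_d) : Prop :=
  [/\ forall (j : 'I_d) (t : R) (x : 'rV[R]_k), 0 <= t ->
        measurable_fun [set: T] (fun w => v w t x 0 j),
      forall (j : 'I_d) (t : R) (x : 'rV[R]_k), 0 <= t ->
        is_stochastic_integral beta (W j) (wave_integrand t x)
          (fun w => v w t x 0 j)
    & forall w : T,
        {within [set p : R * 'rV[R]_k | 0 <= p.1],
          continuous (fun p => v w p.1 p.2)}].

Definition points_polar k d
    (disp : measure_display) (T : measurableType disp) (P : probability T R)
    (v : T -> R -> 'rV[R]_k -> 'rV[R]_d) : Prop :=
  forall z : 'rV[R]_d,
    let hit := [set w : T | exists t x, 0 < t /\ v w t x = z] in
    measurable hit /\ P hit = 0%E.

End wave.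

(* Main.v *)
(* On a small cube Q of space-time, compare v with the field obtained by replacing its value at a
   corner x0 by an independent copy: X(x) + gain(x) (X(x0)' - X(x0)) has the law of v.  Given v, it
   hits z at x exactly when X(x0)' hits a random target y(x), and by the regularity of
   cov(v(x), v(x0)), which is smoother than v itself, the target oscillates like v.  As X(x0)' has a
   bounded density, the hitting probability is at most the expected d-dimensional covering content
   of the path of targets.  In the critical dimension a dyadic cube of side 2^-l costs 2^(-l(k+1)),
   its share of the volume of Q.  Independent copies and characteristic functions show that with
   probability bounded below an increment is small at each of infinitely many scales, even jointly
   with the past; covering by the first good scale makes the total cost arbitrarily small.
   The moments and covariances of v are read off the spectral isometry of the noise, which for the
   Riesz kernel is the subordination |y|^-b = C int s^(b-1) exp(-s^2 |y|^2) ds. *)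

Require Import Defs.
From HB Require Import structures.
From mathcomp Require Import all_boot all_order all_algebra.
From mathcomp Require Import all_classical all_reals all_analysis.
From mathcomp Require Import measurable_realfun.
From mathcomp Require Import complex.
From mathcomp Require Import ring lra zify.
Import Order.TTheory GRing.Theory Num.Theory.
Import numFieldNormedType.Exports.
Set Implicit Arguments.
Unset Strict Implicit.
Unset Printing Implicit Defensive.
Local Open Scope classical_set_scope.
Local Open Scope ring_scope.

Local Notation mbl f := (measurable_fun setT f).
Local Notation itg mu f := (mu.-integrable setT (EFin \o f)).
Local Notation Borel := measurableTypeR.
Local Notation le_via y := (@le_trans _ _ y).

(** Every Gaussian fact is expressed as an identity between expectations of cosines of finite linear
    combinations ([gaussian]), and is carried over to trapezoid functions, which are superpositions
    of cosines with an integrable density. Independent copies are the coordinates of a product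
    space. The obstacle is criticality. With Hoelder exponent H = (2 - beta) / 2 and d = (k + 1) /
    H, covering the path by cubes of one fixed side costs a constant that does not shrink with the
    side; something is gained only by looking, around each point, for a scale at which the
    increments are atypically small. The covariance with the value at a fixed point has order 3H/2 >
    H, which serves twice: [gain] does not spoil the oscillation of the targets, and increments at
    well separated scales are nearly uncorrelated, so that a second moment argument finds a good
    scale. Moments of order 2d beat the number 2^(n k) = a0^(- d k) of cubes [k] generations down,
    so that one sum controls all generations at once. *)

Lemma le_of_eq d (T : porderType d) (x y : T) : x = y -> (x <= y)%O.
Proof. by move=> ->. Qed.

(** * Measurability of elementary real functions *)

Section measurable_real_functions.
Context d (T : measurableType d) (R : realType).
Implicit Types f g : T -> R.

(** The inverse jumps at 0, so it is rewritten as [f] times the power -1 of [f ^+ 2], real powers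
    being measurable; both sides vanish where [f] does. *)
Lemma measurable_funV f : mbl f -> mbl (fun x => (f x)^-1).
Proof.
move=> mf; rewrite (_ : (fun x => _) = fun x => f x * (f x ^+ 2) `^ (- 1)).
  apply: measurable_funM => //.
  by apply: (measurableT_comp (measurable_powR (- 1))); exact: measurable_funX.
apply/funext => x; rewrite powR_inv1 ?sqr_ge0 //.
have [->|x0] := eqVneq (f x) 0; first by rewrite invr0 mul0r.
by field.
Qed.

Lemma measurable_fun_cos f : mbl f -> mbl (fun x => cos (f x)).
Proof. by move=> mf; apply: (measurableT_comp _ mf); exact: continuous_measurable_fun (@continuous_cos R). Qed.

Lemma measurable_fun_sin f : mbl f -> mbl (fun x => sin (f x)).
Proof. by move=> mf; apply: (measurableT_comp _ mf); exact: continuous_measurable_fun (@continuous_sin R). Qed.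

Lemma measurable_fun_expR f : mbl f -> mbl (fun x => expR (f x)).
Proof. exact: (measurableT_comp (@measurable_expR R)). Qed.

Lemma measurable_fun_powR f b : mbl f -> mbl (fun x => f x `^ b).
Proof. exact: (measurableT_comp (measurable_powR b)). Qed.

Lemma measurable_fun_norm f : mbl f -> mbl (fun x => `|f x|).
Proof. exact: (measurableT_comp (@normr_measurable R setT)). Qed.

Lemma measurable_fun_sqrt f : mbl f -> mbl (fun x => Num.sqrt (f x)).
Proof. by move=> mf; apply: (measurableT_comp _ mf); exact: continuous_measurable_fun (@sqrt_continuous R). Qed.

End measurable_real_functions.

(** A hook, redefined whenever new measurable functions appear; [mauto] tries it before taking the
    function apart. *)
Ltac mleaf := fail.
Ltac mauto :=
  match goal with
  | |- forall _, _ => intro; mauto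
  | |- measurable_fun _ (fun x => if _ then _ else _) => apply: measurable_fun_ifT; mauto
  | |- measurable_fun _ (fun x => _ && _) => apply: measurable_and; mauto
  | |- measurable_fun _ (fun x => Order.lt _ _) => apply: measurable_fun_ltr; mauto
  | |- measurable_fun _ (fun x => Order.le _ _) => apply: measurable_fun_ler; mauto
  | |- measurable_fun _ _ => first
    [ assumption | exact: measurable_id | exact: measurable_cst | exact: measurable_fst
    | exact: measurable_snd | exact: normr_measurable | mleaf
    | match goal with H : _ |- _ => solve [simple apply H; done] end
    | lazymatch goal with
      | |- measurable_fun _ (EFin \o _) => apply/measurable_EFinP
      | |- measurable_fun _ (fun x => EFin (@?f x)) => apply/measurable_EFinP
      | |- measurable_fun _ (fun x => (@?f x, @?g x)) => apply: measurable_fun_pair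
      | |- measurable_fun _ (fun x => mule _ (@?g x)) => apply: emeasurable_funM
      | |- measurable_fun _ (fun x => adde _ (oppe _)) => apply: emeasurable_funB
      | |- measurable_fun _ (fun x => adde _ _) => apply: emeasurable_funD
      | |- measurable_fun _ (fun x => cos _) => apply: measurable_fun_cos
      | |- measurable_fun _ (fun x => sin _) => apply: measurable_fun_sin
      | |- measurable_fun _ (fun x => expR _) => apply: measurable_fun_expR
      | |- measurable_fun _ (fun x => powR _ ?b) => apply: measurable_fun_powR
      | |- measurable_fun _ (fun x => Num.sqrt _) => apply: measurable_fun_sqrt
      | |- measurable_fun _ (fun x => GRing.inv _) => apply: measurable_funV
      | |- measurable_fun _ (fun x => GRing.mul _ _) => apply: measurable_funM
      | |- measurable_fun _ (fun x => GRing.exp _ _) => apply: measurable_funX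
      | |- measurable_fun _ (fun x => GRing.add _ (GRing.opp _)) => apply: measurable_funB
      | |- measurable_fun _ (fun x => GRing.add _ _) => apply: measurable_funD
      | |- measurable_fun _ (fun x => GRing.opp _) => apply: measurable_funN
      | |- measurable_fun _ (fun x => Num.norm _) => apply: measurable_fun_norm
      | |- measurable_fun _ (fun x => ?h (@?g x)) => apply: (measurableT_comp (f := h) (g := g))
      end; mauto ]
  | |- _ => done
  end.

(** * Lebesgue measure on tuples: boxes, Fubini, dilations *)

Section tuple_lebesgue.
Context {R : realType}.
Local Open Scope ereal_scope.
Local Notation mu := (@lebesgue_measure R).
Local Notation TR n := (n.-tuple (Borel R)).

(** A separate name for [lebesgue_tuple], to which the sigma-finite structure required by Fubini is
    attached below. *)
Definition leb n : set (TR n) -> \bar R := @lebesgue_tuple R n.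
HB.instance Definition _ n := Measure.on (@leb n).

Definition box n (N : R) := [set u : TR n | forall i, (`|tnth u i| <= N)%R].

Arguments box : clear implicits.

Lemma measurable_box n (N : R) : measurable (box n N).
Proof.
have -> : box n N =
    \bigcap_(i in [set: 'I_n]) ((fun u : TR n => tnth u i) @^-1` `[(- N)%R, N]).
  apply/seteqP; split=> u /= h i; last by rewrite ler_norml; have := h i I; rewrite /= in_itv.
  by move=> _ /=; rewrite in_itv /= -ler_norml.
apply: fin_bigcap_measurable => // i _.
by rewrite -[X in measurable X]setTI; apply: measurable_tnth.
Qed.

Lemma leb_box n (N : R) : leb (box n N) < +oo.
Proof.
elim: n => [|n IH].
  by rewrite /leb /= /dirac /= indicE ltry.
rewrite /leb /= /cons_lebesgue /pushforward /product_measure2 /=.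
(* The side length of the box is taken in absolute value, so that the majorant stays nonnegative for
   negative [N]. *)
have N2 : (0 <= `|N - - N|)%R by [].
apply: (@le_lt_trans _ _ (\int[leb (n:=n)]_u (`|N - - N|%:E * (\1_(box n N) u)%:E))).
  apply: ge0_le_integral => //.
  - apply: measurable_fun_ysection.
    rewrite -[X in measurable X]setTI; apply: measurable_cons_pair => //.
    exact: measurable_box.
  - by apply: measurable_funeM; apply/measurable_EFinP/measurable_indic; exact: measurable_box.
  - move=> u _; rewrite indicE; have [uN|uN] /= := boolP (u \in box n N).
      rewrite mule1; apply: (le_via (mu `[(- N)%R, N])).
        apply: le_measure; rewrite ?inE //.
          apply: measurable_ysection; rewrite -[X in measurable X]setTI.
          by apply: measurable_cons_pair => //; exact: measurable_box.
        move=> x; rewrite /ysection /= inE /= /cons_pair /= => /(_ ord0).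
        by rewrite tnth0 /= in_itv /= -ler_norml.
      rewrite lebesgue_measure_itv /=; case: ifP => _; last by rewrite lee_fin.
      by rewrite -EFinD lee_fin ler_norm.
    rewrite mule0 [X in mu X](_ : _ = set0) ?measure0 //.
    apply/seteqP; split=> x //; rewrite /ysection /= inE /= => h.
    move: uN; rewrite notin_setE; apply => i.
    by have := h (lift ord0 i); rewrite tnthS.
rewrite ge0_integralZl_EFin //; last first.
  by apply/measurable_EFinP/measurable_indic; exact: measurable_box.
rewrite integral_indic ?setIT //; last exact: measurable_box.
by rewrite lte_mul_pinfty // lee_fin.
Qed.

Lemma leb_sigma_finite n : sigma_finite setT (@leb n).
Proof.
exists (fun k => box n k%:R); last first.
  by move=> k; split; [exact: measurable_box|exact: leb_box].
apply/esym; rewrite -subTset => u _.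
exists (Num.truncn (\sum_(i < n) `|tnth u i|)%R).+1 => // i /=.
rewrite (bigD1 i) //=; apply/ltW/(le_lt_trans _ (truncnS_gt _)).
by rewrite lerDl sumr_ge0.
Qed.
HB.instance Definition _ n := Measure_isSigmaFinite.Build _ _ _ (@leb n) (leb_sigma_finite n).

(** The definition goes through [\x^], Fubini through [\x]; now that [leb] is sigma-finite,
    uniqueness of the product measure identifies the two. *)
Lemma leb_pushforward n (A : set (TR n.+1)) : measurable A ->
  leb A = pushforward (mu \x leb (n:=n)) (@cons_pair R n) A.
Proof.
move=> mA; symmetry.
rewrite [RHS](_ : _ = (mu \x^ leb (n:=n)) (@cons_pair R n @^-1` A)) // [LHS]/pushforward.
apply: product_measure_unique.
  by move=> B C mB mC; rewrite /= product_measure2E.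
by rewrite -[X in measurable X]setTI; apply: measurable_cons_pair.
Qed.

Lemma integral_lebS n (F : TR n.+1 -> \bar R) :
  mbl F -> (forall u, 0 <= F u) ->
  \int[leb (n:=n.+1)]_u F u = \int[leb (n:=n)]_u \int[mu]_x F (cons_pair (x, u)).
Proof.
move=> mF F0.
rewrite (eq_measure_integral (pushforward (mu \x leb (n:=n)) (@cons_pair R n))); last first.
  by move=> A mA _; exact: leb_pushforward.
rewrite (ge0_integral_pushforward (@measurable_cons_pair R n)) //=.
rewrite preimage_setT (fubini_tonelli2 (F \o (@cons_pair R n))) //.
  by apply: measurableT_comp => //; exact: measurable_cons_pair.
by move=> z; exact: F0.
Qed.

Lemma integral_leb0 (F : TR 0 -> \bar R) : \int[leb (n:=0)]_u F u = F [tuple].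
Proof.
rewrite (eq_measure_integral (dirac ([tuple] : TR 0))) // integral_dirac //.
  by rewrite diracT mul1e.
move=> _ B mB; rewrite setTI.
have [h|h] := pselect (B (F [tuple])).
  by rewrite (_ : _ @^-1` _ = setT) //; apply/seteqP; split=> u //= _; rewrite (tuple0 u).
by rewrite (_ : _ @^-1` _ = set0) //; apply/seteqP; split=> u //=; rewrite (tuple0 u).
Qed.

Lemma integrable_lebS n (F : TR n.+1 -> \bar R) :
  (leb (n:=n.+1)).-integrable setT F ->
  (mu \x leb (n:=n)).-integrable setT (F \o @cons_pair R n).
Proof.
move=> /integrableP[mF iF].
have mF' : mbl (F \o @cons_pair R n).
  by apply: measurableT_comp => //; exact: measurable_cons_pair.
apply/integrable21ltyP => //.
move: iF; rewrite integral_lebS //; exact: measurableT_comp.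
Qed.

Lemma integral_lebS_int n (F : TR n.+1 -> \bar R) :
  (leb (n:=n.+1)).-integrable setT F ->
  \int[leb (n:=n.+1)]_u F u = \int[leb (n:=n)]_u \int[mu]_x F (cons_pair (x, u)).
Proof.
move=> iF; have iF' := integrable_lebS iF.
rewrite (eq_measure_integral (pushforward (mu \x leb (n:=n)) (@cons_pair R n))); last first.
  by move=> A mA _; exact: leb_pushforward.
rewrite (integral_pushforward (@measurable_cons_pair R n)) //=; last first.
  exact: measurable_int iF.
by rewrite preimage_setT -(integral21_prod_meas1 iF').
Qed.

Definition scaleR (c : R) (x : Borel R) : Borel R := (c * x)%R.

Lemma measurable_scaleR c : mbl (scaleR c).
Proof. exact: measurable_funM. Qed.
HB.instance Definition _ c := isMeasurableFun.Build _ _ _ _ (scaleR c) (measurable_scaleR c).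

(** Uniqueness of Lebesgue measure: [c] times the pushforward gives every half-open interval its
    length. *)
Lemma pushforward_scale (c : R) (A : set (Borel R)) : (0 < c)%R -> measurable A ->
  pushforward mu (scaleR c) A = (c^-1)%:E * mu A.
Proof.
move=> c0 mA.
pose f := scaleR c.
pose m0 := mscale (NngNum (ltW c0)) (pushforward mu f) : {measure set (Borel R) -> \bar R}.
pose m := m0 (measurable_scaleR c).
have : mu A = m A.
  apply: (@lebesgue_measure_unique _ m) => // X [[a b] _ <-] /=.
  rewrite /m /m0 /mscale /= /pushforward.
  rewrite (_ : f @^-1` _ = `](a/c)%R, (b/c)%R]%classic); last first.
    apply/seteqP; split => x /=; rewrite !in_itv /= /f /= ltr_pdivrMr // ler_pdivlMr // mulrC //.
  rewrite !lebesgue_measure_itv /= !lte_fin ltr_pM2r ?invr_gt0 //.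
  case: ifP => _; last by rewrite mule0.
  by rewrite -!EFinD -EFinM; congr _%:E; field; rewrite gt_eqF.
rewrite /m /m0 /mscale /= => ->; rewrite muleA -EFinM mulVf ?gt_eqF // mul1e.
by [].
Qed.

Lemma ge0_integral_scale1 (c : R) (F : Borel R -> \bar R) : (0 < c)%R ->
  mbl F -> (forall x, 0 <= F x) ->
  \int[mu]_x F (c * x)%R = (c^-1)%:E * \int[mu]_x F x.
Proof.
move=> c0 mF F0.
have ci0 : (0 <= c^-1)%R by rewrite invr_ge0 ltW.
rewrite -(ge0_integral_mscale mu measurableT (NngNum ci0) mF) //.
rewrite -[LHS](ge0_integral_pushforward (measurable_scaleR c) mu measurableT mF) //.
by apply: eq_measure_integral => A mA _; exact: (pushforward_scale c0 mA).
Qed.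

Definition scale_tuple n (c : R) (u : TR n) : TR n := [tuple (c * tnth u i)%R | i < n].

Lemma measurable_scale_tuple n c : mbl (@scale_tuple n c).
Proof.
apply/measurable_fun_tnthP => i.
rewrite (_ : _ \o _ = fun u : TR n => (c * tnth u i)%R : Borel R); last first.
  by apply/funext => u /=; rewrite tnth_mktuple.
by apply: measurable_funM => //; exact: measurable_tnth.
Qed.

Lemma scale_tuple_cons n c x (u : TR n) :
  scale_tuple c (cons_pair (x, u)) = cons_pair ((c * x)%R, scale_tuple c u).
Proof.
apply: eq_from_tnth => i; rewrite tnth_mktuple.
have [->|[j ->]] : i = ord0 \/ exists j, i = lift ord0 j.
  by case: (unliftP ord0 i) => [j ->|->]; [right; exists j|left].
  by rewrite !tnth0.
by rewrite !tnthS /= tnth_mktuple.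
Qed.

Lemma ge0_integral_scale n (c : R) (F : TR n -> \bar R) : (0 < c)%R ->
  mbl F -> (forall x, 0 <= F x) ->
  \int[leb (n:=n)]_u F (scale_tuple c u) = (c ^- n)%:E * \int[leb (n:=n)]_u F u.
Proof.
move=> c0; elim: n F => [|n IH] F mF F0.
  rewrite !integral_leb0 expr0 invr1 mul1e; congr F; exact: tuple0.

have mcons := @measurable_cons_pair R n.
rewrite integral_lebS //; last first.
  by apply: measurableT_comp => //; exact: measurable_scale_tuple.
under eq_integral => u _ do under eq_integral => x _ do rewrite scale_tuple_cons.
pose G (u : TR n) := \int[mu]_x F (cons_pair (x, u)).
have mG : mbl G.
  apply: (measurable_fun_fubini_tonelli_G (m1:=mu) (F \o @cons_pair R n)); last by move=> z; exact: F0.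
  exact: measurableT_comp.
transitivity (\int[leb (n:=n)]_u ((c^-1)%:E * G (scale_tuple c u))).
  apply: eq_integral => u _; rewrite (@ge0_integral_scale1 c (fun x => F (cons_pair (x, scale_tuple c u)))) //.
  by mauto.
have ci0 : (0 <= c^-1)%R by rewrite invr_ge0 ltW.
have G0 u : 0 <= G u by apply: integral_ge0.
rewrite ge0_integralZl_EFin //; last first.
  by apply: measurableT_comp => //; exact: measurable_scale_tuple.
by rewrite (IH G mG G0) [in RHS]integral_lebS // muleA -EFinM exprS invfM.
Qed.
End tuple_lebesgue.

(** * Integrability of powers of a norm, by dyadic dilation *)

Section integral_of_limit.
Context d (T : measurableType d) (R : realType) (mu : {measure set T -> \bar R}).
Local Open Scope ereal_scope.

Lemma ge0_integral_le_of_cvg (F : nat -> T -> \bar R) (G : T -> \bar R) (M : \bar R) :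
  (forall n, mbl (F n)) -> (forall n x, 0 <= F n x) ->
  (forall x, F ^~ x @ \oo --> G x) -> (forall n, \int[mu]_x F n x <= M) ->
  \int[mu]_x G x <= M.
Proof.
move=> mF F0 FG FM.
have : \int[mu]_x limn_einf (F^~ x) <= limn_einf (fun n => \int[mu]_x F n x).
  exact: fatou.
rewrite (eq_integral G) => [h|x _]; last by rewrite (cvg_limn_einf_sup (FG x)).1.
apply: (le_trans h); rewrite limn_einf_lim; apply: lime_le; first exact: is_cvg_einfs.
apply: nearW => n; apply: le_trans (FM n).
by apply: ereal_inf_lbound; exists n => /=.
Qed.

End integral_of_limit.

(** The bound is the fixed point of a = C + q a. Extended real values allow the recursion to
    establish finiteness rather than to presuppose it. *)
Lemma affine_rec_bound (R : realType) (a : nat -> \bar R) (C q : R) :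
  0 <= C -> 0 <= q < 1 -> (a 0%N <= 0)%E ->
  (forall n, a n.+1 <= C%:E + q%:E * a n)%E ->
  forall n, (a n <= (C / (1 - q))%:E)%E.
Proof.
move=> C0 /andP[q0 q1] a0 aS; have q1' : 0 < 1 - q by rewrite subr_gt0.
elim=> [|n IH]; first by apply: (le_trans a0); rewrite lee_fin divr_ge0 // ltW.
apply: (le_trans (aS n)).
apply: (le_via (C%:E + q%:E * (C / (1 - q))%:E)%E).
  by rewrite leeD2l //; apply: lee_wpmul2l; rewrite ?lee_fin.
rewrite -EFinM -EFinD lee_fin le_eqVlt; apply/orP; left; apply/eqP.
by field; rewrite gt_eqF.
Qed.

Lemma powR2_lt1 (R : realType) (x : R) : x < 0 -> 2 `^ x < 1.
Proof. by move=> x0; rewrite /powR pnatr_eq0 /= expR_lt1 pmulr_llt0 // ln_gt0 // ltr1n. Qed.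

Section dilation.
Context d (T : measurableType d) (R : realType) (mu : {measure set T -> \bar R}).
Variables (D : T -> T) (N : T -> R) (k : R).
Hypothesis mD : mbl D.
Hypothesis mN : mbl N.
Hypothesis N0 : forall x, 0 <= N x.
Hypothesis ND : forall x, N (D x) = N x / 2.
Hypothesis muN : forall r : R, (mu [set x | (N x <= r)%R] < +oo)%E.
Hypothesis intD : forall F : T -> \bar R, mbl F -> (forall x, 0 <= F x)%E ->
  (\int[mu]_x F (D x) = (2 `^ k)%:E * \int[mu]_x F x)%E.

Let band (l u a : R) (x : T) : R := if (l < N x) && (N x <= u) then N x `^ a else 0.

Let measurable_band l u a : mbl (band l u a).
Proof.
apply: measurable_fun_ifT => //; last exact: (measurableT_comp (measurable_powR a) mN).
by apply: measurable_and; [exact: measurable_fun_ltr|exact: measurable_fun_ler].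
Qed.

Let band_ge0 l u a x : 0 <= band l u a x.
Proof. by rewrite /band; case: ifP => // _; exact: powR_ge0. Qed.

Let band_fin (l u a : R) : 0 < l -> exists2 C : R, 0 <= C & (\int[mu]_x (band l u a x)%:E <= C%:E)%E.
Proof.
move=> l0.
pose c := Num.max (l `^ a) (u `^ a).
have c0 : 0 <= c by rewrite le_max powR_ge0.
have mE : measurable [set x | (N x <= u)%R].
  by rewrite -[X in measurable X]setTI; apply: (measurable_fun_ler mN (measurable_cst u)) => //; exact: measurable_set1.
exists (c * fine (mu [set x | (N x <= u)%R])).
  by rewrite mulr_ge0 // fine_ge0.
rewrite EFinM fineK; last by rewrite ge0_fin_numE.
rewrite -(setIT [set x | (N x <= u)%R]) -integral_indic // -ge0_integralZl_EFin //; last first.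
  by mauto.
apply: ge0_le_integral => //.
- by move=> x _; rewrite lee_fin band_ge0.
- by mauto.
- by mauto.
move=> x _; rewrite -EFinM lee_fin indicE /band; case: ifP => [/andP[lx xu]|_]; last first.
  by rewrite mulr_ge0.
rewrite mem_set ?mulr1 // /c le_max.
have [a0|a0] := leP 0 a.
  by apply/orP; right; rewrite ge0_ler_powR // ?nnegrE // (le_trans (N0 x)).
apply/orP; left.
rewrite -(opprK a) !(powRN _ (- a)) lef_pV2 ?posrE ?powR_gt0 //; last exact: lt_trans lx.
by rewrite ge0_ler_powR // ?nnegrE ?oppr_ge0 // ltW.
Qed.

(** A substitute for polar coordinates. Splitting the integral over 2^-(n+1) < N <= 1 at 1/2 and
    dilating the lower part gives I_(n+1) <= C + 2^-(a+k) I_n, a contraction exactly when a > - k;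
    the limit is taken by Fatou. The setting is abstract so as to cover both the Euclidean norm on
    tuples and the absolute value on the line. *)
Lemma dilation_integral_small (a : R) : - k < a ->
  (\int[mu]_x (if (0 < N x) && (N x <= 1) then N x `^ a else 0)%:E < +oo)%E.
Proof.
move=> ka.
have h2 : 0 < 2^-1 :> R by rewrite invr_gt0.
have [C C0 CP] := band_fin 1 a h2.
have q1 : 2 `^ (- (a + k)) < 1 :> R.
  by apply: powR2_lt1; lra.
have rec n : (\int[mu]_x (band (2 ^- n.+1) 1 a x)%:E <=
    C%:E + (2 `^ (- (a + k)))%:E * \int[mu]_x (band (2 ^- n) 1 a x)%:E)%E.
  have -> : (\int[mu]_x (band (2 ^- n.+1) 1 a x)%:E =
      \int[mu]_x (band 2^-1 1 a x)%:E + \int[mu]_x (band (2 ^- n.+1) 2^-1 a x)%:E)%E.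
    rewrite -ge0_integralD //; last 4 first.
    - by move=> x _; rewrite lee_fin band_ge0.
    - by mauto.
    - by move=> x _; rewrite lee_fin band_ge0.
    - by mauto.
    apply: eq_integral => x _; rewrite -EFinD; congr _%:E; rewrite /band.
    have n2 : 2 ^- n.+1 <= 2^-1 :> R.
      by rewrite exprS invfM ler_piMr // invf_le1 ?exprn_ege1 ?exprn_gt0 ?ler1n.
    have [xh|xh] := leP (N x) 2^-1.
      rewrite /= add0r andbT; congr (if _ then _ else _).
      by rewrite (le_trans xh) ?andbT // invf_le1 // ler1n.
    by rewrite andbF addr0 (le_lt_trans n2 xh).
  apply: leeD => //.
  have := @intD (fun x => (band (2 ^- n.+1) 2^-1 a x)%:E) _ _.
  rewrite (eq_integral (fun x => ((2 `^ (- a))%:E * (band (2 ^- n) 1 a x)%:E)%E)); last first.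
    move=> x _; rewrite -EFinM; congr _%:E; rewrite /band ND exprS invfM mulrC.
    rewrite ltr_pM2r // ler_pdivrMr // mulVf //.
    case: ifP => _; last by rewrite mulr0.
    by rewrite powRM // ?invr_ge0 // -powR_inv1 // -powRrM mulN1r mulrC.
  rewrite ge0_integralZl_EFin ?powR_ge0 //; last 2 first.
  - by move=> x _; rewrite lee_fin band_ge0.
  - by mauto.
  move=> h.
  have {}h : (\int[mu]_x (band (2 ^- n.+1) 2^-1 a x)%:E =
     (2 `^ (- k))%:E * ((2 `^ (- a))%:E * \int[mu]_x (band (2 ^- n) 1 a x)%:E))%E.
    rewrite h; last 2 first.
    - by mauto.
    - by move=> x; rewrite lee_fin band_ge0.
    by rewrite muleA -EFinM -powRD ?addNr ?powRr0 ?mul1e // pnatr_eq0 implybT.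
  rewrite h muleA -EFinM -powRD ?pnatr_eq0 ?implybT //.
  by rewrite opprD [(- a - k)]addrC.
have bnd := @affine_rec_bound R (fun n => (\int[mu]_x (band (2 ^- n) 1 a x)%:E)%E) C
  (2 `^ (- (a + k))) C0 _ _ rec.
apply: (@le_lt_trans _ _ (C / (1 - 2 `^ (- (a + k))))%:E); last exact: ltry.
apply: (@ge0_integral_le_of_cvg _ _ _ mu (fun n x => (band (2 ^- n) 1 a x)%:E)).
- by mauto.
- by move=> n x; rewrite lee_fin band_ge0.
- move=> x; apply: cvg_near_cst.
  have [x0|x0] := leP (N x) 0.
    by apply: nearW => n; rewrite /band ltNge (le_trans x0).
  near=> n; rewrite /band; congr (if _ && _ then _ else _)%:E.
  rewrite -div1r; near: n.
  exact: (near_infty_natSinv_expn_lt (PosNum x0)).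
- apply: bnd; first by rewrite powR_ge0 q1.
  rewrite expr0 invr1; rewrite integral0_eq // => x _; rewrite /band.
  by case: ifP => // /andP[/lt_le_trans h /h]; rewrite ltxx.
Unshelve. all: by end_near. Qed.

(** Mirror image of the previous argument: the bands grow outwards, are split at 2, and the ratio
    2^(b+k) is below 1 exactly when b < - k. *)
Lemma dilation_integral_large (b : R) : b < - k ->
  (\int[mu]_x (if 1 < N x then N x `^ b else 0)%:E < +oo)%E.
Proof.
move=> kb.
have [C C0 CP] := band_fin 2 b (@ltr01 R).
have q1 : 2 `^ (b + k) < 1 :> R by apply: powR2_lt1; lra.
have rec n : (\int[mu]_x (band 1 (2 ^+ n.+1) b x)%:E <=
    C%:E + (2 `^ (b + k))%:E * \int[mu]_x (band 1 (2 ^+ n) b x)%:E)%E.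
  have -> : (\int[mu]_x (band 1 (2 ^+ n.+1) b x)%:E =
      \int[mu]_x (band 1 2 b x)%:E + \int[mu]_x (band 2 (2 ^+ n.+1) b x)%:E)%E.
    rewrite -ge0_integralD //; last 4 first.
    - by move=> x _; rewrite lee_fin band_ge0.
    - by mauto.
    - by move=> x _; rewrite lee_fin band_ge0.
    - by mauto.
    apply: eq_integral => x _; rewrite -EFinD; congr _%:E; rewrite /band.
    have n2 : 2 <= 2 ^+ n.+1 :> R.
      by rewrite exprS ler_peMr // exprn_ege1 // ler1n.
    have [xh|xh] := leP (N x) 2.
      by rewrite /= addr0 (le_trans xh n2).
    by rewrite andbF add0r (lt_trans _ xh) ?ltr1n.
  apply: leeD => //.
  have := @intD (fun x => (band 1 (2 ^+ n) b x)%:E) _ _.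
  rewrite (eq_integral (fun x => ((2 `^ (- b))%:E * (band 2 (2 ^+ n.+1) b x)%:E)%E)); last first.
    move=> x _; rewrite -EFinM; congr _%:E; rewrite /band ND exprS.
    rewrite ltr_pdivlMr // mul1r ler_pdivrMr // [_ ^+ n * _]mulrC.
    case: ifP => _; last by rewrite mulr0.
    by rewrite powRM // ?invr_ge0 // -powR_inv1 // -powRrM mulN1r mulrC.
  rewrite ge0_integralZl_EFin ?powR_ge0 //; last 2 first.
  - by move=> x _; rewrite lee_fin band_ge0.
  - by mauto.
  move=> h.
  rewrite powRD ?pnatr_eq0 ?implybT // EFinM -muleA -h; last 2 first.
  - by mauto.
  - by move=> x; rewrite lee_fin band_ge0.
  by rewrite muleA -EFinM -powRD ?pnatr_eq0 ?implybT // subrr powRr0 mul1e.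
have bnd := @affine_rec_bound R (fun n => (\int[mu]_x (band 1 (2 ^+ n) b x)%:E)%E) C
  (2 `^ (b + k)) C0 _ _ rec.
apply: (@le_lt_trans _ _ (C / (1 - 2 `^ (b + k)))%:E); last exact: ltry.
apply: (@ge0_integral_le_of_cvg _ _ _ mu (fun n x => (band 1 (2 ^+ n) b x)%:E)).
- by mauto.
- by move=> n x; rewrite lee_fin band_ge0.
- move=> x; apply: cvg_near_cst.
  near=> n; rewrite /band -[in RHS](andbT (1 < N x)); congr (if _ && _ then _ else _)%:E.
  apply/ltW; near: n.
  have x1 : 0 < N x + 1 by rewrite ltr_wpDl.
  have x2 : 0 < (N x + 1)^-1 by rewrite invr_gt0.
  have := near_infty_natSinv_expn_lt (PosNum x2).
  apply: filterS => n /=; rewrite div1r ltf_pV2 ?posrE ?exprn_gt0 //.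
  by apply: lt_trans; rewrite ltrDl.
- apply: bnd; first by rewrite powR_ge0 q1.
  rewrite expr0; rewrite integral0_eq // => x _; rewrite /band.
  by case: ifP => // /andP[/lt_le_trans h /h]; rewrite ltxx.
Unshelve. all: by end_near. Qed.

(** The zero set of [N] is invariant under [D], so its measure m is finite and satisfies m = 2^k
    m. *)
Lemma dilation_null : 0 < k -> mu [set x | N x = 0] = 0%E.
Proof.
move=> k0.
have mE : measurable [set x | N x = 0].
  rewrite (_ : [set x | N x = 0] = [set x | (N x <= 0)%R]); last first.
    by apply/seteqP; split=> x /= => [->//|x0]; apply/eqP; rewrite eq_le x0 N0.
  by rewrite -[X in measurable X]setTI; apply: (measurable_fun_ler mN (measurable_cst (0 : R))) => //; exact: measurable_set1.
have fE : mu [set x | N x = 0] \is a fin_num.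
  rewrite ge0_fin_numE //; apply: le_lt_trans (muN 0); apply: le_measure; rewrite ?inE //.
    by rewrite -[X in measurable X]setTI; apply: (measurable_fun_ler mN (measurable_cst (0 : R))) => //; exact: measurable_set1.
  by move=> x /= ->.
pose E := [set x | N x = 0].
have := @intD (fun x => (\1_E x : R)%:E) _ _.
rewrite (eq_integral (fun x => (\1_E x : R)%:E)); last first.
  move=> x _; rewrite !indicE; congr (nat_of_bool _)%:R%:E.
  apply/idP/idP; rewrite !inE /E /= ND => /eqP; last by move=> /eqP ->; rewrite mul0r.
  by rewrite mulf_eq0 invr_eq0 pnatr_eq0 orbF => /eqP.
rewrite integral_indic // setIT => h.
have {}h : mu E = ((2 `^ k)%:E * mu E)%E.
  by apply: h => [|x]; [exact/measurable_EFinP/measurable_indic|rewrite lee_fin].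
move: h; rewrite -(fineK fE) -EFinM => -[] h; congr _%:E; apply/eqP.
have : fine (mu E) * (2 `^ k - 1) == 0.
  by rewrite mulrBr mulr1 mulrC -h subrr.
rewrite mulf_eq0 => /orP[//|]; rewrite subr_eq0 gt_eqF //.
by rewrite /powR pnatr_eq0 /= expR_gt1 mulr_gt0 // ln_gt0 // ltr1n.
Qed.

End dilation.

Section radial.
Context {R : realType}.
Local Notation mu := (@lebesgue_measure R).
Local Notation TR n := (n.-tuple (Borel R)).

Definition tn k (u : TR k) : R := enorm (to_row u).

Lemma dotp_to_row k (u v : TR k) : dotp (to_row u) (to_row v) = \sum_(i < k) tnth u i * tnth v i.
Proof. by apply: eq_bigr => i _; rewrite !mxE. Qed.

Lemma dotp_ge0 k (x : 'rV[R]_k) : 0 <= dotp x x.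
Proof. by apply: sumr_ge0 => i _; rewrite -expr2 sqr_ge0. Qed.

Lemma enorm_ge0 k (x : 'rV[R]_k) : 0 <= enorm x.
Proof. exact: sqrtr_ge0. Qed.

Lemma sqr_enorm k (x : 'rV[R]_k) : enorm x ^+ 2 = dotp x x.
Proof. by rewrite sqr_sqrtr // dotp_ge0. Qed.

Lemma measurable_tn k : mbl (@tn k).
Proof.
apply: measurableT_comp => //; first exact: continuous_measurable_fun (@sqrt_continuous R).
rewrite (_ : (fun u => _) = fun u : TR k => \sum_(i < k) tnth u i * tnth u i); last first.
  by apply/funext => u; rewrite dotp_to_row.
by apply: measurable_sum => i; apply: measurable_funM; exact: measurable_tnth.
Qed.

Lemma tn_scale k c (u : TR k) : 0 <= c -> tn (scale_tuple c u) = c * tn u.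
Proof.
move=> c0; rewrite /tn /enorm !dotp_to_row.
under eq_bigr do rewrite !tnth_mktuple mulrACA.
by rewrite -mulr_sumr sqrtrM ?mulr_ge0 // -expr2 sqrtr_sqr ger0_norm.
Qed.

Lemma le_tn k (u : TR k) i : `|tnth u i| <= tn u.
Proof.
rewrite -sqrtr_sqr ler_wsqrtr // dotp_to_row (bigD1 i) //= expr2 lerDl.
by apply: sumr_ge0 => j _; rewrite -expr2 sqr_ge0.
Qed.

Lemma leb_ball k (r : R) : (leb [set u : TR k | (tn u <= r)%R] < +oo)%E.
Proof.
apply: le_lt_trans (leb_box k r); apply: le_measure; rewrite ?inE.
- by rewrite -[X in measurable X]setTI; apply: (measurable_fun_ler (@measurable_tn k) (measurable_cst r)) => //; exact: measurable_set1.
- exact: measurable_box.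
- by move=> u /= ur i; exact: le_trans (le_tn u i) ur.
Qed.

Lemma halving k (F : TR k -> \bar R) : mbl F -> (forall x, 0 <= F x)%E ->
  (\int[leb (n:=k)]_x F (scale_tuple 2^-1 x) = (2 `^ k%:R)%:E * \int[leb (n:=k)]_x F x)%E.
Proof.
by move=> mF F0; rewrite ge0_integral_scale ?invr_gt0 // powR_mulrn // exprVn invrK.
Qed.

Let tnh k (u : TR k) : tn (scale_tuple 2^-1 u) = tn u / 2.
Proof. by rewrite tn_scale ?invr_ge0 // mulrC. Qed.

Let tn0 k (u : TR k) : 0 <= tn u. Proof. exact: enorm_ge0. Qed.

Lemma leb_tn0 k : (0 < k)%N -> leb [set u : TR k | tn u = 0] = 0%E.
Proof.
by move=> k0; apply: (dilation_null (@measurable_tn k) (@tn0 k) (@tnh k) (@leb_ball k) (@halving k)); rewrite ltr0n.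
Qed.

Lemma integral_tn_small k (a : R) : - k%:R < a ->
  (\int[leb (n:=k)]_x (if (0 < tn x) && (tn x <= 1) then tn x `^ a else 0)%:E < +oo)%E.
Proof.
exact: (dilation_integral_small (@measurable_tn k) (@tn0 k) (@tnh k) (@leb_ball k) (@halving k)).
Qed.

Lemma integral_tn_large k (b : R) : b < - k%:R ->
  (\int[leb (n:=k)]_x (if 1 < tn x then tn x `^ b else 0)%:E < +oo)%E.
Proof.
exact: (dilation_integral_large (@measurable_tn k) (@tn0 k) (@tnh k) (@leb_ball k) (@halving k)).
Qed.

Let ball1 (r : R) : (mu [set x : R | (`|x| <= r)%R] < +oo)%E.
Proof.
rewrite (_ : [set x : R | _] = `[- r, r]%classic); last first.
  by apply/seteqP; split=> x /=; rewrite in_itv /= ler_norml.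
by rewrite lebesgue_measure_itv /=; case: ifP => _; rewrite ?ltry // -EFinD ltry.
Qed.

Let halving1 (F : Borel R -> \bar R) : mbl F -> (forall x, 0 <= F x)%E ->
  (\int[mu]_x F (2^-1 * x)%R = (2 `^ 1)%:E * \int[mu]_x F x)%E.
Proof.
by move=> mF F0; rewrite ge0_integral_scale1 ?invr_gt0 // powRr1 // invrK.
Qed.

Let absh (x : R) : `|2^-1 * x| = `|x| / 2.
Proof. by rewrite normrM gtr0_norm ?invr_gt0 // mulrC. Qed.

Lemma integral_abs_large (b : R) : b < - 1 ->
  (\int[mu]_x (if 1%R < `|x| then `|x| `^ b else 0)%:E < +oo)%E.
Proof.
apply: (@dilation_integral_large _ (Borel R) R mu (fun x => 2^-1 * x) (fun x => `|x|)
  1 _ _ absh ball1 halving1) => //; exact: normr_measurable.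
Qed.

End radial.

Ltac mleaf ::= first [ exact: measurable_tn | exact: measurable_scale_tuple ].

(** * Lipschitz and quadratic bounds for sine and cosine *)

Section trigo_bounds.
Context {R : realType}.
Implicit Types x y : R.

Lemma sin_lipschitz x y : `|sin x - sin y| <= `|x - y|.
Proof.
wlog xy : x y / y <= x => [h|].
  have [/h//|/ltW/h] := leP y x; by rewrite distrC [X in _ <= X]distrC.
have [c _ ->] := @MVT_segment R sin cos y x xy (fun z _ => is_derive_sin z)
  (continuous_subspaceT (@continuous_sin R)).
by rewrite normrM ler_piMl // cos_max.
Qed.

Lemma cos_lipschitz x y : `|cos x - cos y| <= `|x - y|.
Proof. by rewrite -!sinDpihalf (le_trans (sin_lipschitz _ _)) // opprD addrACA subrr addr0. Qed.

Lemma sin_le_norm x : `|sin x| <= `|x|.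
Proof. by have := sin_lipschitz x 0; rewrite sin0 !subr0. Qed.

Lemma cosB_cosD (p q : R) : cos (p - q) - cos (p + q) = 2 * (sin p * sin q).
Proof. by rewrite cosB cosD; ring. Qed.

Lemma onem_cos_le x : 1 - cos x <= x ^+ 2 / 2.
Proof.
have := cosB_cosD (x / 2) (x / 2); rewrite subrr cos0 -splitr => ->.
have := sin_le_norm (x / 2); rewrite -ler_sqr ?nnegrE // !real_normK ?num_real //.
rewrite exprMn; lra.
Qed.

End trigo_bounds.

Lemma eq_integral_leb (R : realType) (f g : R -> \bar R) : f =1 g ->
  (\int[@lebesgue_measure R]_x f x = \int[@lebesgue_measure R]_x g x)%E.
Proof. by move=> fg; apply: eq_integral => x _; exact: fg. Qed.

(** * Trapezoid functions as superpositions of cosines *)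

Section trapezoid.
Context {R : realType}.
Local Notation mu := (@lebesgue_measure R).
Implicit Types (s e x a b eta : R).

(** Common majorant of the one-dimensional Fourier integrands: bounded near 0 and integrable as soon
    as [b < - 1]. *)
Definition decay b eta : R := if `|eta| <= 1 then 1 else `|eta| `^ b.

Lemma decay_ge0 b eta : 0 <= decay b eta.
Proof. by rewrite /decay; case: ifP => // _; exact: powR_ge0. Qed.

Lemma measurable_decay b : mbl (decay b).
Proof. by rewrite /decay; mauto. Qed.

Lemma integrable_decay b : b < - 1 -> itg mu (decay b).
Proof.
move=> b1; apply/integrableP; split; first by apply/measurable_EFinP; exact: measurable_decay.
have m1 : measurable [set x : Borel R | `|x| <= 1].
  rewrite (_ : [set x | _] = `[- 1, 1]%classic) //.
  by apply/seteqP; split=> x /=; rewrite in_itv /= ler_norml.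
have mL : mbl (fun x : Borel R => if 1 < `|x| then `|x| `^ b else 0).
  by mauto.
rewrite (@eq_integral_leb _ _ (fun x => ((\1_[set x : Borel R | `|x| <= 1] x : R)%:E +
   (if 1%R < `|x| then `|x| `^ b else 0)%:E)%E)); last first.
  move=> x; rewrite /= ger0_norm ?decay_ge0 // /decay indicE -EFinD ltNge.
  have [x1|x1] := boolP (`|x| <= 1).
    by rewrite mem_set // addr0.
  by rewrite memNset ?add0r //=; exact/negP.
rewrite ge0_integralD //; last 3 first.
- by mauto.
- by move=> x _; rewrite lee_fin; case: ifP => // _; exact: powR_ge0.
- by mauto.
rewrite integral_indic // setIT.
apply: lte_add_pinfty; last exact: integral_abs_large.
rewrite (_ : [set x : R | _] = `[- 1, 1]%classic); last first.
  by apply/seteqP; split=> x /=; rewrite in_itv /= ler_norml.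
by rewrite /= lebesgue_measure_itv /=; case: ifP => _; rewrite ?ltry // -EFinD ltry.
Qed.

Let F eta : R := (1 - cos eta) / eta ^+ 2.

Let F_ge0 eta : 0 <= F eta.
Proof. by rewrite /F divr_ge0 ?sqr_ge0 // subr_ge0 cos_le1. Qed.

Let mF a : mbl (fun eta => (1 - cos (a * eta)) / eta ^+ 2).
Proof. by mauto. Qed.

Lemma decay2_ge eta c k : 0 <= k -> `|c| <= k * eta ^+ 2 -> `|c| <= k -> `|c / eta ^+ 2| <= k * decay (- 2) eta.
Proof.
move=> k0 c1 c2; rewrite normrM normfV (ger0_norm (sqr_ge0 _)) /decay.
have [->|e0] := eqVneq eta 0; first by rewrite expr0n /= invr0 mulr0 normr0 ler01 mulr1.
have e20 : 0 < eta ^+ 2 by rewrite exprn_even_gt0.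
case: ifP => h; first by rewrite mulr1 ler_pdivrMr.
by rewrite powR_invn // real_normK ?num_real // ler_wpM2r // invr_ge0 ltW.
Qed.

Let F_bound a eta : `|(1 - cos (a * eta)) / eta ^+ 2| <= (a ^+ 2 / 2 + 2) * decay (- 2) eta.
Proof.
have a0 : 0 <= a ^+ 2 / 2 by rewrite divr_ge0 ?sqr_ge0.
apply: decay2_ge; first by rewrite addr_ge0.
  rewrite ger0_norm ?subr_ge0 ?cos_le1 // (le_trans (onem_cos_le _)) // exprMn mulrDl.
  by rewrite mulrAC lerDl mulr_ge0 ?sqr_ge0.
apply: (le_trans (ler_normB _ _)); rewrite normr1.
have := cos_max (a * eta); lra.
Qed.

Let intF a : itg mu (fun eta => (1 - cos (a * eta)) / eta ^+ 2).
Proof.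
apply: (@le_integrable _ _ _ mu _ measurableT _ (fun eta => ((a ^+ 2 / 2 + 2)%:E * (decay (- 2) eta)%:E)%E)).
- by mauto.
- by move=> x _; rewrite /= lee_fin (le_trans (F_bound a x)) // ler_norm.
- by apply: integrableZl => //; apply: integrable_decay; rewrite ltrN2 ltr1n.
Qed.

(** Classically equal to pi: the normalising constant of the representation of |x| as an integral of
    (1 - cos(x eta)) / eta^2. *)
Definition abs_const : R := \int[mu]_eta F eta.

Lemma abs_const_gt0 : 0 < abs_const.
Proof.
have i1 := intF 1.
have iE : (\int[mu]_eta (F eta)%:E = abs_const%:E)%E.
  rewrite /abs_const /Rintegral fineK //.
  apply: integrable_fin_num => //; apply: eq_integrable i1 => // x _.
  by rewrite /= mul1r.
have cos1 : cos 1 < 1 :> R.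
  by rewrite -[ltRHS]cos0 ltr_cos ?in_itv /= ?ler01 ?lexx ?pi_ge0 //= (le_trans _ (pi_ge2 R)) // ler1n.
rewrite -lte_fin -iE.
apply: (@lt_le_trans _ _ (\int[mu]_(eta in `[1%R, 2%R]) ((1 - cos 1) / 4)%:E)%E).
  rewrite integral_cst //= lebesgue_measure_itv /= lte_fin ltr1n /= -EFinD -EFinM lte_fin.
  by rewrite mulr_gt0 // ?divr_gt0 ?subr_gt0 ?ltr0n // ltr1n.
apply: (le_via (\int[mu]_(eta in `[1%R, 2%R]) (F eta)%:E)%E).
  apply: ge0_le_integral => //.
  - apply/measurable_EFinP; apply: measurable_funTS.
    by have := mF 1; under eq_fun do rewrite mul1r.
  move=> x; rewrite /= in_itv /= => /andP[x1 x2]; rewrite lee_fin /F.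
  have x20 : 0 < x ^+ 2 by rewrite exprn_gt0 // (lt_le_trans ltr01).
  apply: ler_pM; [by rewrite subr_ge0 cos_le1|by rewrite invr_ge0| |].
    rewrite lerB // ; have [->//|xn1] := eqVneq x 1.
    apply/ltW; rewrite ltr_cos ?in_itv /= ?ler01 ?(le_trans _ (pi_ge2 R)) ?ler1n //=; last by rewrite (le_trans ler01).
    by rewrite lt_neqAle eq_sym xn1.
  rewrite lef_pV2 ?posrE // (_ : 4 = 2 ^+ 2); last by rewrite -natrX.
  by rewrite ler_sqr ?nnegrE // (le_trans ler01).
apply: ge0_subset_integral => //.
- by have := mF 1; under eq_fun do rewrite mul1r; move=> h; apply/measurable_EFinP.
- by move=> x _; rewrite lee_fin.
Qed.

Lemma abs_integral x : (\int[mu]_eta ((1 - cos (x * eta)) / eta ^+ 2)%:E = (abs_const * `|x|)%:E)%E.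
Proof.
have i1 := intF 1.
have iE : (\int[mu]_eta (F eta)%:E = abs_const%:E)%E.
  rewrite /abs_const /Rintegral fineK //.
  apply: integrable_fin_num => //; apply: eq_integrable i1 => // y _.
  by rewrite /= mul1r.
have mF1 : mbl (fun eta => (F eta)%:E).
  by apply/measurable_EFinP; have := mF 1; under eq_fun do rewrite mul1r.
wlog x0 : x / 0 <= x => [h|].
  have [/h//|/ltW x0] := leP 0 x.
  rewrite -normrN -h ?oppr_ge0 //; apply: eq_integral => y _.
  by rewrite mulNr cosN.
move: x0; rewrite le_eqVlt => /orP[/eqP <-|x0].
  rewrite normr0 mulr0 integral0_eq // => y _.
  by rewrite mul0r cos0 subrr mul0r.
rewrite (@eq_integral_leb _ _ (fun y => ((x ^+ 2)%:E * (F (x * y)%R)%:E)%E)); last first.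
  move=> y; rewrite -EFinM /F; congr _%:E.
  have [->|y0] := eqVneq y 0; first by rewrite mulr0 cos0 subrr !mul0r mulr0.
  by field; rewrite y0 gt_eqF.
rewrite ge0_integralZl_EFin ?sqr_ge0 //; last 2 first.
- by move=> y _; rewrite lee_fin.
- by apply: (measurableT_comp mF1); exact: measurable_funM.
rewrite (@ge0_integral_scale1 R x (fun y => (F y)%:E)) // iE -!EFinM gtr0_norm //; congr _%:E.
by field; rewrite gt_eqF.
Qed.

(** The function equal to 1 on [-s, s], to 0 outside [-s-e, s+e] and affine in between. It is
    written as a combination of absolute values, because [abs_integral] turns each of these into an
    integral of cosines. *)
Definition trap s e x : R := (`|x + s + e| - `|x + s| - `|x - s| + `|x - s - e|) / (2 * e).

(** Cosine density of [trap]: insert [abs_integral] into the four absolute values; their signs add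
    up to zero, so the constants 1 cancel. Its eta^-2 decay is what an indicator function would not
    provide. *)
Definition trap_hat s e eta : R := (cos (s * eta) - cos ((s + e) * eta)) / eta ^+ 2 / (abs_const * e).

Lemma trap_itv s e x : 0 <= s -> 0 < e -> 0 <= trap s e x <= 1.
Proof.
move=> s0 e0; rewrite /trap.
rewrite ler_pdivrMr ?mulr_gt0 // mul1r divr_ge0 //=; last by rewrite mulr_ge0 // ltW.
  by case: (ler0P (x + s + e)); case: (ler0P (x + s)); case: (ler0P (x - s)); case: (ler0P (x - s - e)) => *; lra.
by case: (ler0P (x + s + e)); case: (ler0P (x + s)); case: (ler0P (x - s)); case: (ler0P (x - s - e)) => *; lra.
Qed.

Lemma trap1 s e x : 0 <= s -> 0 < e -> `|x| <= s -> trap s e x = 1.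
Proof.
move=> s0 e0; rewrite ler_norml => /andP[x1 x2]; rewrite /trap.
rewrite (@ger0_norm _ (x + s + e)) ?(@ger0_norm _ (x + s)) ?(@ler0_norm _ (x - s)) ?(@ler0_norm _ (x - s - e)); try lra.
by field; rewrite gt_eqF.
Qed.

Lemma trap0 s e x : 0 <= s -> 0 < e -> s + e <= `|x| -> trap s e x = 0.
Proof.
move=> s0 e0; rewrite /trap ler_normr => /orP[x1|x1].
  have -> : `|x + s + e| = x + s + e by rewrite ger0_norm //; lra.
  have -> : `|x + s| = x + s by rewrite ger0_norm //; lra.
  have -> : `|x - s| = x - s by rewrite ger0_norm //; lra.
  have -> : `|x - s - e| = x - s - e by rewrite ger0_norm //; lra.
  by field; rewrite gt_eqF.
have -> : `|x + s + e| = - (x + s + e) by rewrite ler0_norm //; lra.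
have -> : `|x + s| = - (x + s) by rewrite ler0_norm //; lra.
have -> : `|x - s| = - (x - s) by rewrite ler0_norm //; lra.
have -> : `|x - s - e| = - (x - s - e) by rewrite ler0_norm //; lra.
by field; rewrite gt_eqF.
Qed.

Lemma measurable_trap_hat s e : mbl (trap_hat s e).
Proof. by rewrite /trap_hat; mauto. Qed.

Lemma measurable_trap s e : mbl (trap s e).
Proof. by rewrite /trap; mauto. Qed.

(** Near 0 the difference of cosines is a product of two sines, hence of order eta^2; elsewhere it
    is at most 2. *)
Lemma trap_hat_bound s e eta : 0 <= s -> 0 < e ->
  `|trap_hat s e eta| <= ((2 * s + e) * e / 2 + 2) / (abs_const * e) * decay (- 2) eta.
Proof.
move=> s0 e0; rewrite /trap_hat normrM [`|_^-1|]gtr0_norm; last first.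
  by rewrite invr_gt0 mulr_gt0 // abs_const_gt0.
rewrite [leRHS]mulrAC ler_wpM2r //; first by rewrite invr_ge0 mulr_ge0 ?ltW ?abs_const_gt0.
have a0 : 0 <= (2 * s + e) * e / 2 by rewrite divr_ge0 // mulr_ge0 ?addr_ge0 ?mulr_ge0 // ltW.
apply: decay2_ge; first by rewrite addr_ge0.
  rewrite (_ : s * eta = (2 * s + e) / 2 * eta - e / 2 * eta); last by field.
  rewrite (_ : (s + e) * eta = (2 * s + e) / 2 * eta + e / 2 * eta); last by field.
  rewrite cosB_cosD normrM normrM (@ger0_norm _ 2) //.
  apply: (le_via (2 * (`|(2 * s + e) / 2 * eta| * `|e / 2 * eta|))).
    by rewrite ler_wpM2l // ler_pM // sin_le_norm.
  rewrite !normrM !(@ger0_norm _ e) ?(@ger0_norm _ (2 * s + e)) ?(@ger0_norm _ 2^-1) //; [|lra..].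
  rewrite -(real_normK (num_real eta)); nra.
apply: (le_trans (ler_normB _ _)).
have := cos_max (s * eta); have := cos_max ((s + e) * eta); lra.
Qed.

Lemma integrable_trap_hat s e : 0 <= s -> 0 < e -> itg mu (trap_hat s e).
Proof.
move=> s0 e0.
apply: (@le_integrable _ _ _ mu _ measurableT _ (fun eta => ((((2 * s + e) * e / 2 + 2) / (abs_const * e))%:E * (decay (- 2) eta)%:E)%E)).
- apply/measurable_EFinP; exact: measurable_trap_hat.
- by move=> x _; rewrite /= lee_fin (le_trans (trap_hat_bound x s0 e0)) // ler_norm.
- by apply: integrableZl => //; apply: integrable_decay; rewrite ltrN2 ltr1n.
Qed.

Lemma trapE s e x : 0 <= s -> 0 < e ->
  (\int[mu]_eta (trap_hat s e eta * cos (eta * x))%:E = (trap s e x)%:E)%E.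
Proof.
move=> s0 e0; have c0 := abs_const_gt0.
pose G a eta := (1 - cos (a * eta)) / eta ^+ 2.
pose r : R := (2 * abs_const * e)^-1.
rewrite (@eq_integral_leb _ _ (fun eta => ((r%:E * (G (x + s + e)%R eta)%:E - r%:E * (G (x + s)%R eta)%:E) +
   (r%:E * (G (x - s - e)%R eta)%:E - r%:E * (G (x - s)%R eta)%:E))%E)); last first.
  move=> y; rewrite -!EFinM -!EFinB -EFinD /trap_hat /G; congr _%:E.
  rewrite (_ : (x + s + e) * y = y * x + (s + e) * y); last by ring.
  rewrite (_ : (x + s) * y = y * x + s * y); last by ring.
  rewrite (_ : (x - s - e) * y = y * x - (s + e) * y); last by ring.
  rewrite (_ : (x - s) * y = y * x - s * y); last by ring.
  rewrite !cosD !cosN !sinN /r.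
  have [->|y0] := eqVneq y 0; first by rewrite expr0n /= invr0 !(mulr0, mul0r); ring.
  by field; rewrite y0 !gt_eqF.
have iG a : mu.-integrable setT (fun eta => r%:E * (G a eta)%:E)%E by exact: (integrableZl measurableT r (intF a)).
have vG a : (\int[mu]_eta (r%:E * (G a eta)%:E) = (r * (abs_const * `|a|))%:E)%E.
  by rewrite (integralZl measurableT (intF a)) abs_integral.
rewrite integralD //; [|exact: integrableB|exact: integrableB].
rewrite !integralB // !vG -!EFinB -EFinD /trap /r; congr _%:E.
by field; rewrite !gt_eqF.
Qed.

End trapezoid.

(** * Expectations of bounded functions *)

Section bounded_expectation.
Context d (T : measurableType d) (R : realType) (P : probability T R).

Lemma bounded_integrable (f : T -> R) (M : R) : mbl f ->
  (forall x, `|f x| <= M) -> itg P f.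
Proof.
move=> mf fM; apply: measurable_bounded_integrable => //.
  by apply: (le_lt_trans (probability_le1 P measurableT)); exact: ltry.
exists M; split; first exact: num_real.
by move=> N MN x _ /=; apply: le_trans (fM x) (ltW MN).
Qed.

Lemma integral_Rintegral (f : T -> R) : itg P f ->
  (\int[P]_x (f x)%:E = (\int[P]_x f x)%:E)%E.
Proof. by move=> fi; rewrite /Rintegral fineK //; exact: integrable_fin_num. Qed.

Lemma Rintegral_le_bound (f : T -> R) (M : R) : mbl f ->
  (forall x, `|f x| <= M) -> `|\int[P]_x f x| <= M.
Proof.
move=> mf fM.
have fi := bounded_integrable mf fM.
apply: (le_trans (le_normr_Rintegral measurableT fi)).
rewrite -lee_fin -integral_Rintegral; last first.
  by apply: (@bounded_integrable _ M); [exact: measurable_fun_norm|move=> x; rewrite normr_id].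
apply: (le_via (\int[P]_x (cst M%:E x))%E).
  apply: ge0_le_integral => //.
  - by mauto.
  - by move=> x _; rewrite lee_fin.
by rewrite integral_cst //= probability_setT mule1.
Qed.

End bounded_expectation.
Local Notation integrable_by M := (@bounded_integrable _ _ _ _ _ M).

(** * From characteristic functions to expectations of products of trapezoids *)

Section trapezoid_products.
Context {R : realType}.
Local Notation mu := (@lebesgue_measure R).

(* A factor [(i, s, e, a)] stands for the trapezoid in [X_i - a] of parameters [s] and [e]. *)
Record factor (I : Type) := Factor { fi : I; fac_s : R; fe : R; fa : R }.

Definition factor_ok I (q : factor I) := 0 <= fac_s q /\ 0 < fe q.

Section products.
Variables (I T : Type) (X : I -> T -> R).

Definition lin (L : seq (R * I)) (x : T) : R := \sum_(p <- L) p.1 * X p.2 x.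

Definition tprod (l : seq (factor I)) (x : T) : R :=
  \prod_(q <- l) trap (fac_s q) (fe q) (X (fi q) x - fa q).

Lemma tprod_itv l x : (forall q, List.In q l -> factor_ok q) -> 0 <= tprod l x <= 1.
Proof.
elim: l => [|q l IH] h; first by rewrite /tprod big_nil ler01 lexx.
rewrite /tprod big_cons.
have [s0 e0] := h q (or_introl erefl).
have /andP[a0 a1] := trap_itv (X (fi q) x - fa q) s0 e0.
have /andP[b0 b1] := IH (fun q' hq => h q' (or_intror hq)).
by rewrite mulr_ge0 //= mulr_ile1.
Qed.
End products.

Section one_space.
Context (I : Type) d (T : measurableType d) (P : probability T R) (X : I -> T -> R).
Hypothesis mX : forall i, mbl (X i).

(** Interpolates between a characteristic function ([l] empty) and an expectation of trapezoids ([L]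
    empty and [c = 0]); the factors of [l] are converted one at a time into frequencies of [L]. The
    phase [c] takes the place of the imaginary part and absorbs the centres of the trapezoids. *)
Definition tmean l c L : R := \int[P]_x (tprod X l x * cos (lin X L x + c)).

Lemma measurable_lin L : mbl (lin X L).
Proof. by apply: measurable_sum => p; mauto. Qed.

Lemma measurable_tprod l : mbl (tprod X l).
Proof.
elim: l => [|q l IH].
  by rewrite (_ : tprod X _ = cst 1) //; apply/funext => x; rewrite /tprod big_nil.
rewrite (_ : tprod X _ = fun x => trap (fac_s q) (fe q) (X (fi q) x - fa q) * tprod X l x); last first.
  by apply/funext => x; rewrite /tprod big_cons.
apply: measurable_funM => //.
by apply: (measurableT_comp (measurable_trap _ _)); exact: measurable_funB.
Qed.

(** Write the first trapezoid as a cosine integral and exchange the integrals: the density is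
    integrable and the rest is bounded by 1. The product of two cosines then becomes the half sum of
    the cosines with frequencies [eta] and [- eta]. *)
Lemma tmean_cons q l c L : factor_ok q -> (forall q, List.In q l -> factor_ok q) ->
  let g eta := trap_hat (fac_s q) (fe q) eta * (2^-1 *
    (tmean l (c - eta * fa q) ((eta, fi q) :: L) + tmean l (c + eta * fa q) ((- eta, fi q) :: L))) in
  mbl g /\ (\int[mu]_eta (g eta)%:E = (tmean (q :: l) c L)%:E)%E.
Proof.
move=> [s0 e0] hl g.
pose rho := trap_hat (fac_s q) (fe q).
pose K (z : T * R) := rho z.2 * (cos (z.2 * (X (fi q) z.1 - fa q)) * (tprod X l z.1 * cos (lin X L z.1 + c))).
have mK : mbl K.
  have h1 : mbl (fun z : T * R => rho z.2) by apply: (measurableT_comp (measurable_trap_hat _ _)).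
  have h2 : mbl (fun z : T * R => X (fi q) z.1) by mauto.
  have h3 : mbl (fun z : T * R => tprod X l z.1) by exact: (measurableT_comp (measurable_tprod _)).
  have h4 : mbl (fun z : T * R => lin X L z.1) by exact: (measurableT_comp (measurable_lin _)).
  by rewrite /K; mauto.
have hG x : `|tprod X l x * cos (lin X L x + c)| <= 1.
  have /andP[b0 b1] := @tprod_itv I T X l x hl.
  by rewrite normrM (ger0_norm b0) mulr_ile1 ?cos_max.
have Kb z : `|K z| <= `|rho z.2|.
  by rewrite /K normrM ler_piMr // normrM mulr_ile1 ?cos_max.
have irho := integrable_trap_hat s0 e0.
have iK : itg (P \x mu)%E K.
  apply/integrable12ltyP; first exact/measurable_EFinP.
  apply: (@le_lt_trans _ _ (\int[P]_x \int[mu]_y `|(rho y)%:E|)%E).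
    apply: ge0_le_integral => //.
    - by move=> x _; exact: integral_ge0.
    - apply: (@measurable_fun_fubini_tonelli_F _ _ T _ R mu (fun z => `|(EFin \o K) z|)%E) => //.
      by mauto.
    move=> x _; apply: ge0_le_integral => //.
    - by mauto.
    - by apply: measurableT_comp => //; apply/measurable_EFinP; exact: measurable_trap_hat.
    - by move=> y _; rewrite lee_fin; exact: (Kb (x, y)).
  rewrite integral_cst //= probability_setT mule1.
  by have /integrableP[] := irho.
have F1 x : (\int[mu]_y (K (x, y))%:E = (tprod X (q :: l) x * cos (lin X L x + c))%:E)%E.
  rewrite /K /=.
  rewrite (@eq_integral_leb _ _ (fun y => ((tprod X l x * cos (lin X L x + c))%:E * (rho y * cos (y * (X (fi q) x - fa q)))%:E)%E)); last first.
    by move=> y; rewrite -EFinM; congr _%:E; ring.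
  rewrite integralZl //; last first.
    apply: (le_integrable _ _ _ irho) => //.
      apply/measurable_EFinP; have := @measurable_trap_hat R (fac_s q) (fe q); rewrite -/rho => ?; mauto.
    by move=> y _; rewrite /= lee_fin normrM ler_piMr // cos_max.
  by rewrite trapE // -EFinM /tprod big_cons; congr _%:E; ring.
have F2 y : (\int[P]_x (K (x, y))%:E = (g y)%:E)%E.
  pose A x := tprod X l x * cos (lin X ((y, fi q) :: L) x + (c - y * fa q)).
  pose B x := tprod X l x * cos (lin X ((- y, fi q) :: L) x + (c + y * fa q)).
  have hA x : `|A x| <= 1.
    have /andP[b0 b1] := @tprod_itv I T X l x hl.
    by rewrite normrM (ger0_norm b0) mulr_ile1 ?cos_max.
  have hB x : `|B x| <= 1.
    have /andP[b0 b1] := @tprod_itv I T X l x hl.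
    by rewrite normrM (ger0_norm b0) mulr_ile1 ?cos_max.
  have mA : mbl A.
    by have := measurable_tprod l; have := measurable_lin ((y, fi q) :: L) => ? ?; rewrite /A; mauto.
  have mB : mbl B.
    by have := measurable_tprod l; have := measurable_lin ((- y, fi q) :: L) => ? ?; rewrite /B; mauto.
  have iA := bounded_integrable P mA hA; have iB := bounded_integrable P mB hB.
  rewrite (eq_integral (fun x => ((rho y / 2)%:E * ((A x)%:E + (B x)%:E))%E)); last first.
    move=> x _; rewrite -EFinD -EFinM; congr _%:E.
    rewrite /K /A /B /= /lin !big_cons /= -/(lin X L x).
    set Z := lin X L x; set t := tprod _ _ _.
    rewrite (_ : y * X (fi q) x + Z + (c - y * fa q) = (Z + c) + y * (X (fi q) x - fa q)); last by ring.
    rewrite (_ : - y * X (fi q) x + Z + (c + y * fa q) = (Z + c) - y * (X (fi q) x - fa q)); last by ring.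
    by move: (Z + c) (y * _) => u v; rewrite cosD cosB; field.
  rewrite integralZl //; last exact: integrableD.
  rewrite integralD // !integral_Rintegral // -EFinD -EFinM /g /tmean -/rho; congr _%:E.
  by rewrite mulrA.
have gE : (fun y => (g y)%:E) = fubini_G P (EFin \o K).
  by apply/funext => y; rewrite /fubini_G /= F2.
split.
  by apply/measurable_EFinP; rewrite /comp gE; exact: (measurable_fubini_G iK).
rewrite (@eq_integral_leb _ _ (fubini_G P (EFin \o K))); last first.
  by move=> y; rewrite -gE.
rewrite (integral21_prod_meas1 iK) -(integral12_prod_meas1 iK).
rewrite /fubini_F (eq_integral (fun x => (tprod X (q :: l) x * cos (lin X L x + c))%:E)); last first.
  by move=> x _; rewrite -F1.
rewrite integral_Rintegral //; apply: (integrable_by 1).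
  by have := measurable_tprod (q :: l); have := measurable_lin L => ? ?; mauto.
move=> x; have /andP[b0 b1] : 0 <= tprod X (q :: l) x <= 1.
  by apply: tprod_itv => q' [<-//|]; exact: hl.
by rewrite normrM (ger0_norm b0) mulr_ile1 ?cos_max.
Qed.

End one_space.

Section comparison.
Context (I : Type) d1 (T1 : measurableType d1) (P1 : probability T1 R) (X : I -> T1 -> R).
Context d2 (T2 : measurableType d2) (P2 : probability T2 R) (Y : I -> T2 -> R).
Hypothesis mX : forall i, mbl (X i).
Hypothesis mY : forall i, mbl (Y i).
Variables (b kap : R) (w : R -> R).
Hypothesis w0 : forall x, 0 <= w x.
Hypothesis wN : forall x, w (- x) = w x.
Hypothesis mw : mbl w.
Hypothesis kap0 : 0 <= kap.
Hypothesis chf : forall L c, `|tmean P1 X [::] c L - b * tmean P2 Y [::] c L| <= kap * \prod_(p <- L) w p.1.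

(* Every trapezoid is a superposition of cosines, so a bound on characteristic functions passes to
   expectations of products of trapezoids. *)
Lemma comparison (B : factor I -> R) (l : seq (factor I)) :
  (forall q, List.In q l -> factor_ok q) ->
  (forall q, List.In q l -> \int[mu]_eta (`|trap_hat (fac_s q) (fe q) eta| * w eta)%:E <= (B q)%:E)%E ->
  forall c L, `|tmean P1 X l c L - b * tmean P2 Y l c L| <=
    kap * (\prod_(q <- l) B q) * \prod_(p <- L) w p.1.
Proof.
elim: l => [|q l IH] hl hB c L; first by rewrite big_nil mulr1.
have hq := hl q (or_introl erefl); have [s0 e0] := hq.
have hl' q' : List.In q' l -> factor_ok q' by move=> h; apply: hl; right.
have {}IH := IH hl' (fun q' h => hB q' (or_intror h)).
have [mg1 E1] := @tmean_cons I _ T1 P1 X mX q l c L hq hl'.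
have [mg2 E2] := @tmean_cons I _ T2 P2 Y mY q l c L hq hl'.
pose rho := trap_hat (fac_s q) (fe q).
have irho := integrable_trap_hat s0 e0.
have tm1 d0 (T0 : measurableType d0) (P0 : probability T0 R) (Z : I -> T0 -> R) c' L' :
    (forall i, mbl (Z i)) -> `|tmean P0 Z l c' L'| <= 1.
  move=> mZ; apply: Rintegral_le_bound.
    by have := measurable_tprod mZ l; have := measurable_lin mZ L' => ? ?; mauto.
  move=> x; have /andP[b0 b1] := @tprod_itv I T0 Z l x hl'.
  by rewrite normrM (ger0_norm b0) mulr_ile1 ?cos_max.
have int_ d0 (T0 : measurableType d0) (P0 : probability T0 R) (Z : I -> T0 -> R) :
    (forall i, mbl (Z i)) ->
    itg mu (fun eta => rho eta * (2^-1 *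
    (tmean P0 Z l (c - eta * fa q) ((eta, fi q) :: L) + tmean P0 Z l (c + eta * fa q) ((- eta, fi q) :: L)))).
  move=> mZ; have [mg _] := @tmean_cons I _ T0 P0 Z mZ q l c L hq hl'.
  apply: (le_integrable _ _ _ irho) => //; first exact/measurable_EFinP.
  move=> y _; rewrite /= lee_fin normrM ler_piMr // normrM ger0_norm ?invr_ge0 //.
  rewrite ler_pdivrMl // mulr1 (le_trans (ler_normD _ _)) // -[2]/(1 + 1) lerD // tm1 //.
have i1 := int_ _ _ P1 X mX; have i2 := int_ _ _ P2 Y mY.
pose W := kap * (\prod_(q <- l) B q) * \prod_(p <- L) w p.1.
have B0 : 0 <= \prod_(q0 <- l) B q0.
  elim: (l) hB => [|q' l0 IHl] hB; first by rewrite big_nil.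
  rewrite big_cons mulr_ge0 //.
    rewrite -lee_fin; apply: le_trans (hB q' (or_intror (or_introl erefl))).
    by apply: integral_ge0 => x _; rewrite lee_fin mulr_ge0.
  apply: IHl => q0 [h|h]; apply: hB; [by left|by right; right].
have W0 : 0 <= W.
  by rewrite !mulr_ge0 // prodr_ge0.
rewrite [leRHS](_ : _ = B q * W); last by rewrite /W !big_cons; ring.
rewrite -lee_fin EFinM.
apply: (le_via (W%:E * \int[mu]_eta (`|rho eta| * w eta)%:E)%E); last first.
  by rewrite muleC; apply: lee_wpmul2r => //; apply: hB; left.
rewrite -ge0_integralZl_EFin //; last 2 first.
- by move=> x _; rewrite lee_fin mulr_ge0.
- by have := @measurable_trap_hat R (fac_s q) (fe q); rewrite -/rho => ?; mauto.
rewrite -abse_EFin EFinB EFinM -E1 -E2.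
rewrite -integralZl // -integralB //; last exact: integrableZl.
apply: (le_trans (le_abse_integral _ _ _)) => //.
  apply: (measurable_int mu); apply: integrableB => //; exact: (integrableZl measurableT b i2).
apply: ge0_le_integral => //.
- apply: measurableT_comp => //; apply: (measurable_int mu); apply: integrableB => //; exact: (integrableZl measurableT b i2).
- by have := @measurable_trap_hat R (fac_s q) (fe q); rewrite -/rho => ?; apply: measurable_funeM; mauto.
move=> y _; rewrite -EFinM -EFinB abse_EFin lee_fin /=.
set a1 := tmean P1 _ _ _ _; set a2 := tmean P1 _ _ _ _; set c1 := tmean P2 _ _ _ _; set c2 := tmean P2 _ _ _ _.
have h1 : `|a1 - b * c1| <= W * w y.
  by apply: (le_trans (IH _ _)); rewrite big_cons /= /W; apply: le_of_eq; ring.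
have h2 : `|a2 - b * c2| <= W * w y.
  by apply: (le_trans (IH _ _)); rewrite big_cons /= wN /W; apply: le_of_eq; ring.
rewrite (_ : _ - _ = rho y * (2^-1 * ((a1 - b * c1) + (a2 - b * c2)))); last by rewrite -/rho; ring.
rewrite normrM mulrCA -mulrA ler_wpM2l // normrM ger0_norm ?invr_ge0 // ler_pdivrMl // .
apply: (le_trans (ler_normD _ _)).
by rewrite (_ : 2 * _ = W * w y + W * w y); [exact: lerD|rewrite /W; ring].
Qed.

End comparison.
End trapezoid_products.

(** * Gaussian families and their linear images *)

Section bilinear.
Context {R : realType}.
Implicit Types I J : Type.

Definition bil I (G : I -> I -> R) (L1 L2 : seq (R * I)) : R :=
  \sum_(p <- L1) \sum_(q <- L2) p.1 * q.1 * G p.2 q.2.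

Definition expand I J (M : J -> seq (R * I)) (L : seq (R * J)) : seq (R * I) :=
  flatten [seq [seq (p.1 * a.1, a.2) | a <- M p.2] | p <- L].

Lemma lin_expand I J (M : J -> seq (R * I)) T (X : I -> T -> R) L x :
  lin X (expand M L) x = lin (fun j => lin X (M j)) L x.
Proof.
rewrite /lin /expand big_flatten big_map; apply: eq_bigr => p _.
by rewrite big_map mulr_sumr; apply: eq_bigr => a _; rewrite mulrA.
Qed.

Lemma bil_expand I J (M : J -> seq (R * I)) G L1 L2 :
  bil G (expand M L1) (expand M L2) = bil (fun i j => bil G (M i) (M j)) L1 L2.
Proof.
rewrite /bil /expand big_flatten big_map; apply: eq_bigr => p _.
rewrite big_map exchange_big big_flatten /= big_map; apply: eq_bigr => q _.
rewrite big_map mulr_sumr exchange_big /=; apply: eq_bigr => a _.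
by rewrite mulr_sumr; apply: eq_bigr => b _; ring.
Qed.

End bilinear.

Section gaussian_families.
Context {R : realType}.
Local Notation mu := (@lebesgue_measure R).

(** Joint Gaussianity given by the characteristic functions of all finite linear combinations, with
    a phase instead of complex exponentials. This form is stable under linear maps and independent
    unions, and covers degenerate covariances. *)
Record gaussian I d (T : measurableType d) (P : probability T R) (X : I -> T -> R)
    (G : I -> I -> R) : Prop := Gaussian {
  gaussian_measurable : forall i, mbl (X i) ;
  gaussian_chf : forall L c,
    \int[P]_x cos (lin X L x + c) = cos c * expR (- bil G L L / 2) }.

Lemma tmean_nil I d (T : measurableType d) (P : probability T R) (X : I -> T -> R) c L :
  tmean P X [::] c L = \int[P]_x cos (lin X L x + c).
Proof. by apply: eq_Rintegral => x _; rewrite /tprod big_nil mul1r. Qed.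

Lemma tmean_tprod I d (T : measurableType d) (P : probability T R) (X : I -> T -> R) l :
  tmean P X l 0 [::] = \int[P]_x tprod X l x.
Proof. by apply: eq_Rintegral => x _; rewrite /lin big_nil addr0 cos0 mulr1. Qed.

Lemma tprod_itvN I T (X : I -> T -> R) l x :
  (forall q, List.In q l -> factor_ok q) -> `|tprod X l x| <= 1.
Proof. by move=> h; have /andP[a b] := @tprod_itv R I T X l x h; rewrite ger0_norm. Qed.

(** Positivity of the covariance follows from the characteristic functions: the expectation of a
    cosine has absolute value at most 1, so the exponent at phase 0 cannot be positive. *)
Lemma bil_ge0 I d (T : measurableType d) (P : probability T R) (X : I -> T -> R) G L :
  gaussian P X G -> 0 <= bil G L L.
Proof.
move=> [mX chf]; have := chf L 0; rewrite cos0 mul1r => h.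
have : `|expR (- bil G L L / 2)| <= 1.
  rewrite -h; apply: Rintegral_le_bound => [|x]; last exact: cos_max.
  by have := measurable_lin mX L => ?; mauto.
by rewrite ger0_norm ?expR_ge0 // -expR0 ler_expR mulNr oppr_le0 pmulr_lge0.
Qed.

Lemma gaussian_lin I J (M : J -> seq (R * I)) d (T : measurableType d) (P : probability T R)
    (X : I -> T -> R) G : gaussian P X G ->
  gaussian P (fun j => lin X (M j)) (fun i j => bil G (M i) (M j)).
Proof.
move=> [mX chf]; split=> [i|L c]; first exact: measurable_lin.
under eq_Rintegral do rewrite -lin_expand.
by rewrite chf bil_expand.
Qed.

Lemma eq_gaussian I d (T : measurableType d) (P : probability T R) (X Y : I -> T -> R) G H :
  gaussian P X G -> (forall i x, X i x = Y i x) -> (forall i j, G i j = H i j) -> gaussian P Y H.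
Proof.
move=> gX XY GH; have <- : X = Y by apply/funext => i; apply/funext => x.
by have <- : G = H by apply/funext => i; apply/funext => j.
Qed.

Lemma Rfubini_bounded d1 (T1 : measurableType d1) (P1 : probability T1 R)
    d2 (T2 : measurableType d2) (P2 : probability T2 R) (f : T1 * T2 -> R) (M : R) :
  mbl f -> (forall z, `|f z| <= M) ->
  mbl (fun x => \int[P2]_y f (x, y)) /\
  \int[(P1 \x P2)%E]_z f z = \int[P1]_x \int[P2]_y f (x, y).
Proof.
move=> mf fM.
have iP : itg (P1 \x P2)%E f by exact: bounded_integrable mf fM.
have E : (fun x => (\int[P2]_y f (x, y))%:E) = fubini_F P2 (EFin \o f).
  apply/funext => x; rewrite /fubini_F integral_Rintegral //.
  apply: (integrable_by M) => //.
  by mauto.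
split.
  by apply/measurable_EFinP; rewrite /comp E; exact: (measurable_fubini_F iP).
rewrite /Rintegral; congr fine.
by rewrite E -(integral12_prod_meas1 iP).
Qed.

Definition lefts I1 I2 (L : seq (R * (I1 + I2))) : seq (R * I1) :=
  pmap (fun p => if p.2 is inl i then Some (p.1, i) else None) L.
Definition rights I1 I2 (L : seq (R * (I1 + I2))) : seq (R * I2) :=
  pmap (fun p => if p.2 is inr i then Some (p.1, i) else None) L.

Definition sum_field I1 I2 T1 T2 (X1 : I1 -> T1 -> R) (X2 : I2 -> T2 -> R)
  (i : I1 + I2) (z : T1 * T2) : R :=
  match i with inl i => X1 i z.1 | inr i => X2 i z.2 end.

Definition sum_cov I1 I2 (G1 : I1 -> I1 -> R) (G2 : I2 -> I2 -> R) (i j : I1 + I2) : R :=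
  match i, j with inl i, inl j => G1 i j | inr i, inr j => G2 i j | _, _ => 0 end.

Lemma lin_sum I1 I2 T1 T2 (X1 : I1 -> T1 -> R) (X2 : I2 -> T2 -> R) L z :
  lin (sum_field X1 X2) L z = lin X1 (lefts L) z.1 + lin X2 (rights L) z.2.
Proof.
rewrite /lin; elim: L => [|[a [i|i]] L IH] /=; first by rewrite !big_nil addr0.
  by rewrite !big_cons IH /= addrA.
by rewrite !big_cons IH /= addrCA.
Qed.

Lemma bil_sum I1 I2 (G1 : I1 -> I1 -> R) (G2 : I2 -> I2 -> R) L L' :
  bil (sum_cov G1 G2) L L' = bil G1 (lefts L) (lefts L') + bil G2 (rights L) (rights L').
Proof.
have hl a i : \sum_(q <- L') a * q.1 * sum_cov G1 G2 (inl i) q.2 = \sum_(q <- lefts L') a * q.1 * G1 i q.2.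
  elim: L' => [|[b [j|j]] L' IH] /=; rewrite ?big_nil // !big_cons IH //=.
  by rewrite mulr0 add0r.
have hr a i : \sum_(q <- L') a * q.1 * sum_cov G1 G2 (inr i) q.2 = \sum_(q <- rights L') a * q.1 * G2 i q.2.
  elim: L' {hl} => [|[b [j|j]] L' IH] /=; rewrite ?big_nil // !big_cons IH //=.
  by rewrite mulr0 add0r.
rewrite /bil; elim: L => [|[a [i|i]] L IH] /=; first by rewrite !big_nil addr0.
  by rewrite !big_cons IH /= hl addrA.
by rewrite !big_cons IH /= hr addrCA.
Qed.

(** An independent union, realised on the product space: integrating the second coordinate first
    turns its part of the frequencies into a constant factor. *)
Lemma gaussian_sum I1 I2 d1 (T1 : measurableType d1) (P1 : probability T1 R)
    d2 (T2 : measurableType d2) (P2 : probability T2 R)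
    (X1 : I1 -> T1 -> R) (X2 : I2 -> T2 -> R) G1 G2 :
  gaussian P1 X1 G1 -> gaussian P2 X2 G2 ->
  gaussian (P1 \x P2)%E (sum_field X1 X2) (sum_cov G1 G2).
Proof.
move=> [m1 c1] [m2 c2]; have mX i : mbl (sum_field X1 X2 i).
  case: i => i; first exact: (measurableT_comp (m1 i) measurable_fst).
  exact: (measurableT_comp (m2 i) measurable_snd).
split => // L c.
have mf : mbl (fun z => cos (lin (sum_field X1 X2) L z + c)).
  by have := measurable_lin mX L => ?; mauto.
have [_ ->] := Rfubini_bounded P1 P2 mf (fun z => cos_max _).
under eq_Rintegral do under eq_Rintegral do rewrite lin_sum /= [_ + lin X2 _ _]addrC -addrA.
under eq_Rintegral do rewrite c2.
rewrite RintegralZr //; last first.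
  apply: (integrable_by 1) => [|x]; last exact: cos_max.
  by have := measurable_lin m1 (lefts L) => ?; mauto.
by rewrite c1 bil_sum -mulrA -expRD; congr (_ * expR _); field.
Qed.

(** The growth 1/2 is a compromise. A bound of the difference of two Gaussian characteristic
    functions that is linear in the covariance error would cost a weight 1 + |eta|, which is not
    integrable against the eta^-2 decay of [trap_hat]; taking a square root of the error makes the
    weight integrable. *)
Definition wgt (x : R) : R := Num.sqrt (1 + `|x|).

Lemma wgtN x : wgt (- x) = wgt x. Proof. by rewrite /wgt normrN. Qed.

Lemma measurable_wgt : mbl wgt.
Proof. by rewrite /wgt; mauto. Qed.

(** The factor by which one trapezoid multiplies the error in [comparison] with weight [wgt]. *)
Definition mass I (q : factor I) : R :=
  fine (\int[mu]_eta (`|trap_hat (fac_s q) (fe q) eta| * wgt eta)%:E).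

Lemma massE I (q : factor I) : factor_ok q ->
  (\int[mu]_eta (`|trap_hat (fac_s q) (fe q) eta| * wgt eta)%:E = (mass q)%:E)%E.
Proof.
move=> [s0 e0]; rewrite /mass fineK // ge0_fin_numE; last first.
  by apply: integral_ge0 => x _; rewrite lee_fin mulr_ge0 // sqrtr_ge0.
pose C := ((2 * fac_s q + fe q) * fe q / 2 + 2) / (abs_const * fe q) * 2.
have C0 : 0 <= C.
  have := ltW (@abs_const_gt0 R); have := ltW e0 => ? ?.
  by rewrite /C mulr_ge0 // divr_ge0 ?mulr_ge0 // addr_ge0 // divr_ge0 // mulr_ge0 // addr_ge0 // mulr_ge0.
(* The decay exponent -2 of [trap_hat] and the growth exponent 1/2 of [wgt] add up to -3/2. *)
have h32 : - (3 / 2) < - 1 :> R by lra.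
have /integrableP[_ hint] := integrable_decay h32.
apply: (@le_lt_trans _ _ (\int[mu]_eta (C%:E * (decay (- (3/2)) eta)%:E))%E).
  apply: ge0_le_integral => //.
  - by move=> x _; rewrite lee_fin mulr_ge0 // sqrtr_ge0.
  - by have := @measurable_trap_hat R (fac_s q) (fe q); have := measurable_wgt => ? ?; mauto.
  - by apply: measurable_funeM; apply/measurable_EFinP; exact: measurable_decay.
  move=> y _; rewrite -EFinM lee_fin.
  apply: (le_via (((2 * fac_s q + fe q) * fe q / 2 + 2) / (abs_const * fe q) * decay (- 2) y * wgt y)).
    by rewrite ler_wpM2r ?sqrtr_ge0 // trap_hat_bound.
  rewrite /C -mulrA -[leRHS]mulrA ler_wpM2l //.
    have := ltW (@abs_const_gt0 R); have := ltW e0 => ? ?.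
    by rewrite divr_ge0 ?mulr_ge0 // addr_ge0 // divr_ge0 // mulr_ge0 // addr_ge0 // mulr_ge0.
  rewrite /decay; case: ifPn => [y1|].
    rewrite mul1r mulr1 (_ : 2 = Num.sqrt (2 ^+ 2)); last by rewrite sqrtr_sqr ger0_norm.
    by apply: ler_wsqrtr; rewrite expr2; move: y1; set z := `|y|; lra.
  rewrite -ltNge => y1; have y0 : 0 < `|y| by rewrite (lt_trans ltr01).
  apply: (le_via (`|y| `^ (- 2) * (2 * `|y| `^ (2^-1)))).
    rewrite ler_wpM2l ?powR_ge0 // powR12_sqrt //.
    rewrite (_ : 2 * Num.sqrt `|y| = Num.sqrt (2 ^+ 2 * `|y|)); last first.
      by rewrite sqrtrM ?sqr_ge0 // sqrtr_sqr (@ger0_norm R 2).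
    by apply: ler_wsqrtr; rewrite expr2; move: y1; set z := `|y|; lra.
  rewrite mulrCA -powRD ?(gt_eqF y0) ?implybT //.
  by rewrite (_ : - 2 + 2^-1 = - (3 / 2) :> R) //; lra.
rewrite ge0_integralZl_EFin //; last 2 first.
- by move=> x _; rewrite lee_fin decay_ge0.
- by apply/measurable_EFinP; exact: measurable_decay.
rewrite lte_mul_pinfty //.
move: hint; congr (_ < _)%E; apply: eq_integral_leb => y.
by rewrite /= ger0_norm ?decay_ge0.
Qed.

Lemma mass_ge0 I (q : factor I) : 0 <= mass q.
Proof. by apply: fine_ge0; apply: integral_ge0 => x _; rewrite lee_fin mulr_ge0 // sqrtr_ge0. Qed.

(** The case [kap = 0] of [comparison]: both families have the same characteristic functions. *)
Lemma gaussian_same_law I d1 (T1 : measurableType d1) (P1 : probability T1 R)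
    d2 (T2 : measurableType d2) (P2 : probability T2 R)
    (X : I -> T1 -> R) (Y : I -> T2 -> R) G l :
  gaussian P1 X G -> gaussian P2 Y G -> (forall q, List.In q l -> factor_ok q) ->
  \int[P1]_x tprod X l x = \int[P2]_x tprod Y l x.
Proof.
move=> [mX cX] [mY cY] hl.
have := @comparison R I _ T1 P1 X _ T2 P2 Y mX mY 1 0 wgt (fun x => sqrtr_ge0 _) wgtN measurable_wgt (lexx 0).
move=> /(_ _ (@mass I) l hl _ 0 [::]).
rewrite mul0r mul0r mul1r !tmean_tprod => h; apply/eqP; rewrite -subr_eq0 -normr_le0; apply: h.
  by move=> L c; rewrite mul1r !tmean_nil cX cY subrr normr0 mul0r.
by move=> q hq; rewrite massE //; exact: hl.
Qed.

End gaussian_families.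

Lemma In_cat T (x : T) s t : List.In x (s ++ t) <-> List.In x s \/ List.In x t.
Proof. by elim: s => [|y s IH] /=; [tauto|rewrite IH; tauto]. Qed.

Lemma In_map T U (f : T -> U) s y : List.In y [seq f x | x <- s] <-> exists2 x, List.In x s & y = f x.
Proof.
elim: s => [|x s IH] /=; first by split=> // -[].
rewrite IH; split=> [[<-|[z zs ->]]|[z [<-|zs] ->]].
- by exists x => //; left.
- by exists z => //; right.
- by left.
- by right; exists z.
Qed.

(** * Near independence of weakly correlated groups, and Gaussian densities *)

Section mixing.
Context {R : realType}.
Local Notation mu := (@lebesgue_measure R).

(** The difference is at most 1 and at most |x - y|, so its square is at most |x - y|. *)
Lemma expRN_sqrt_lipschitz (x y : R) : 0 <= x -> 0 <= y ->
  `|expR (- x) - expR (- y)| <= Num.sqrt `|x - y|.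
Proof.
wlog xy : x y / x <= y => [h x0 y0|x0 y0].
  have [xy|/ltW xy] := leP x y; first exact: h.
  by rewrite distrC [X in Num.sqrt X]distrC; exact: h.
rewrite ger0_norm; last by rewrite subr_ge0 ler_expR lerN2.
set t := _ - _.
have t0 : 0 <= t by rewrite subr_ge0 ler_expR lerN2.
have t1 : t <= 1.
  by rewrite lerBlDr (le_trans (_ : _ <= 1)) ?lerDl ?expR_ge0 // -expR0 ler_expR oppr_le0.
have tu : t <= y - x.
  have h : t = expR (- x) * (1 - expR (x - y)).
    by rewrite mulrBr mulr1 -expRD addrA addNr add0r.
  have e1 : expR (- x) <= 1 by rewrite -expR0 ler_expR oppr_le0.
  have e2 := expR_ge1Dx (x - y).
  have e3 : 0 <= 1 - expR (x - y) by rewrite subr_ge0 -expR0 ler_expR subr_le0.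
  rewrite h; apply: (le_via (1 - expR (x - y))); first by rewrite ler_piMl.
  lra.
rewrite distrC ger0_norm ?subr_ge0 // -(ger0_norm t0) -sqrtr_sqr ler_wsqrtr //.
by rewrite (le_trans _ tu) // expr2 ler_piMl.
Qed.

(** Each product of an entry of one group with an entry of the other is a term of the expanded
    right-hand side. *)
Lemma sum_mul_le_prod I (s : I -> bool) (L : seq (R * I)) :
  (\sum_(p <- L | s p.2) `|p.1|) * (\sum_(p <- L | ~~ s p.2) `|p.1|) <= \prod_(p <- L) (1 + `|p.1|).
Proof.
set A := \sum_(p <- L | s p.2) `|p.1|; set B := \sum_(p <- L | ~~ s p.2) `|p.1|.
have A0 : 0 <= A by apply: sumr_ge0.
have B0 : 0 <= B by apply: sumr_ge0.
suff : (1 + A) * (1 + B) <= \prod_(p <- L) (1 + `|p.1|) by apply: le_trans; nra.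
rewrite {A0 B0}/A {}/B; elim: L => [|p L IH]; first by rewrite !big_nil !addr0 mulr1.
rewrite !big_cons.
have A0 : 0 <= \sum_(p <- L | s p.2) `|p.1| by apply: sumr_ge0.
have B0 : 0 <= \sum_(p <- L | ~~ s p.2) `|p.1| by apply: sumr_ge0.
have p0 := normr_ge0 p.1.
apply: (le_via ((1 + `|p.1|) * ((1 + \sum_(p <- L | s p.2) `|p.1|) * (1 + \sum_(p <- L | ~~ s p.2) `|p.1|)))).
  have h1 := mulr_ge0 p0 A0; have h2 := mulr_ge0 p0 B0; have h3 := mulr_ge0 h1 B0.
  case: (s p.2) => /=; move: h1 h2 h3 A0 B0 p0;
    move: (\sum_(j <- L | s j.2) `|j.1|) (\sum_(j <- L | ~~ s j.2) `|j.1|) (`|p.1|) => A B t; nra.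
by rewrite ler_wpM2l // addr_ge0.
Qed.

(** Only the two blocks of mixed pairs survive in the difference, hence the factor 2. *)
Lemma bil_split_le I (s : I -> bool) (G : I -> I -> R) (kap : R) (L : seq (R * I)) : 0 <= kap ->
  (forall i j, s i != s j -> `|G i j| <= kap) ->
  `|bil G L L - bil (fun i j => if s i == s j then G i j else 0) L L| <=
    2 * kap * \prod_(p <- L) (1 + `|p.1|).
Proof.
move=> k0 hG; rewrite /bil -sumrB.
rewrite (eq_bigr (fun p => \sum_(q <- L) (p.1 * q.1 * G p.2 q.2 -
  p.1 * q.1 * (if s p.2 == s q.2 then G p.2 q.2 else 0)))) => [|p _]; last by rewrite sumrB.
apply: (le_trans (ler_norm_sum _ _ _)).
apply: (le_via (\sum_(p <- L) `|p.1| * kap * \sum_(q <- L | s p.2 != s q.2) `|q.1|)).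
  apply: ler_sum => p _; apply: (le_trans (ler_norm_sum _ _ _)).
  rewrite mulr_sumr [leRHS]big_mkcond; apply: ler_sum => q _.
  rewrite -mulrBr normrM normrM; have [h|h] /= := boolP (s p.2 == s q.2).
    by rewrite subrr normr0 mulr0.
  by rewrite subr0 mulrAC ler_wpM2r // ler_wpM2l // hG.
rewrite (bigID (fun p => s p.2)) /=.
rewrite (eq_bigr (fun p => `|p.1| * (kap * \sum_(q <- L | ~~ s q.2) `|q.1|))); last first.
  by move=> p sp; rewrite mulrA; congr (_ * _); apply: eq_bigl => q; rewrite sp; case: (s q.2).
rewrite [X in _ + X](eq_bigr (fun p => `|p.1| * (kap * \sum_(q <- L | s q.2) `|q.1|))); last first.
  by move=> p /negbTE sp; rewrite mulrA; congr (_ * _); apply: eq_bigl => q; rewrite sp; case: (s q.2).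
rewrite -!mulr_suml.
have := @sum_mul_le_prod I s L; nra.
Qed.

Lemma prod_sqrt I (L : seq (R * I)) :
  \prod_(p <- L) wgt p.1 = Num.sqrt (\prod_(p <- L) (1 + `|p.1|)).
Proof.
elim: L => [|p L IH]; first by rewrite !big_nil sqrtr1.
by rewrite !big_cons IH sqrtrM // addr_ge0.
Qed.

(** Reading the two groups off different coordinates of [P \x P] keeps the covariances inside each
    group and erases those between them. *)
Lemma gaussian_cut I d (T : measurableType d) (P : probability T R) (X : I -> T -> R) G (s : I -> bool) :
  gaussian P X G ->
  gaussian (P \x P)%E (fun i z => X i (if s i then z.1 else z.2))
    (fun i j => if s i == s j then G i j else 0).
Proof.
move=> gX.
have := gaussian_lin (fun i => [:: (1, if s i then inl i else inr i)]) (gaussian_sum gX gX).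
move/eq_gaussian; apply=> [i z|i j].
  by rewrite /lin big_seq1 mul1r; case: (s i).
by rewrite /bil !big_seq1 !mul1r /=; case: (s i); case: (s j).
Qed.

Lemma integral_tprod_cut I d (T : measurableType d) (P : probability T R) (X : I -> T -> R) (s : I -> bool) l1 l2 :
  (forall i, mbl (X i)) ->
  (forall q, List.In q (l1 ++ l2) -> factor_ok q) ->
  (forall q, List.In q l1 -> s (fi q)) -> (forall q, List.In q l2 -> ~~ s (fi q)) ->
  \int[(P \x P)%E]_z tprod (fun i z => X i (if s i then z.1 else z.2)) (l1 ++ l2) z =
  (\int[P]_x tprod X l1 x) * (\int[P]_x tprod X l2 x).
Proof.
move=> mX hok h1 h2.
have ok1 q : List.In q l1 -> factor_ok q by move=> h; apply: hok; apply/In_cat; left.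
have ok2 q : List.In q l2 -> factor_ok q by move=> h; apply: hok; apply/In_cat; right.
have E z : tprod (fun i z => X i (if s i then z.1 else z.2)) (l1 ++ l2) z = tprod X l1 z.1 * tprod X l2 z.2.
  rewrite /tprod big_cat /=; congr (_ * _).
    elim: (l1) h1 => [|q l IH] h; rewrite ?big_nil // !big_cons IH; last by move=> q' hq; apply: h; right.
    by rewrite (h q) //; left.
  elim: (l2) h2 => [|q l IH] h; rewrite ?big_nil // !big_cons IH; last by move=> q' hq; apply: h; right.
  by rewrite (negbTE (h q _)) //; left.
have m1 := measurable_tprod mX l1; have m2 := measurable_tprod mX l2.
have mf : mbl (fun z : T * T => tprod X l1 z.1 * tprod X l2 z.2).
  by mauto.
under eq_Rintegral do rewrite E.
have [|_ ->] := @Rfubini_bounded R _ T P _ T P _ 1 mf.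
  by move=> z; rewrite normrM mulr_ile1 // tprod_itvN.
have i2 : itg P (tprod X l2).
  by apply: (integrable_by 1) => // y; exact: tprod_itvN.
under eq_Rintegral do rewrite /= (RintegralZl _ measurableT i2).
rewrite RintegralZr //; by apply: (integrable_by 1) => // y; exact: tprod_itvN.
Qed.

(** Compare the family with its cut version, under which the expectation factorises. The covariance
    error [kap] enters [comparison] through its square root. *)
Lemma gaussian_mixing I d (T : measurableType d) (P : probability T R) (X : I -> T -> R) G
    (s : I -> bool) (kap : R) l1 l2 :
  gaussian P X G -> 0 <= kap -> (forall i j, s i != s j -> `|G i j| <= kap) ->
  (forall q, List.In q (l1 ++ l2) -> factor_ok q) ->
  (forall q, List.In q l1 -> s (fi q)) -> (forall q, List.In q l2 -> ~~ s (fi q)) ->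
  `|\int[P]_x tprod X (l1 ++ l2) x - (\int[P]_x tprod X l1 x) * (\int[P]_x tprod X l2 x)| <=
    Num.sqrt kap * \prod_(q <- l1 ++ l2) mass q.
Proof.
move=> gX k0 hG hok h1 h2; have gY := gaussian_cut s gX.
have [mX cX] := gX; have [mY cY] := gY.
rewrite -(@integral_tprod_cut I _ T P X s) //.
have := @comparison R I _ T P X _ _ (P \x P)%E _ mX mY 1 (Num.sqrt kap) wgt (fun x => sqrtr_ge0 _) wgtN measurable_wgt (sqrtr_ge0 _).
move=> /(_ _ (@mass R I) (l1 ++ l2) hok _ 0 [::]).
rewrite big_nil mulr1 mul1r !tmean_tprod; apply; last by move=> q hq; rewrite massE //; exact: hok.
move=> L c; rewrite mul1r !tmean_nil cX cY -mulrBr normrM.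
apply: (le_via (1 * Num.sqrt (kap * \prod_(p <- L) (1 + `|p.1|)))); last first.
  by rewrite mul1r sqrtrM // prod_sqrt.
apply: ler_pM => //; first exact: cos_max.
rewrite !mulNr; apply: (le_trans (expRN_sqrt_lipschitz _ _)).
- by rewrite divr_ge0 // (bil_ge0 L gX).
- by rewrite divr_ge0 // (bil_ge0 L gY).
(* The factor 2 of [bil_split_le] cancels the 1/2 in the Gaussian exponent. *)
rewrite ler_wsqrtr // -mulrBl normrM (@ger0_norm _ 2^-1) ?invr_ge0 // ler_pdivrMr // mulrC mulrA.
exact: bil_split_le.
Qed.

(** Bounds the density of a Gaussian variable of variance [v], up to a factor. It collects |trap_hat
    rho rho| <= (3/2) rho / abs_const and exp(- v y^2 / 2) <= (1 + 2/v) decay(-2)(y). *)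
Definition density_const (v : R) : R :=
  (3 / 2) / abs_const * (1 + 2 / v) * fine (\int[mu]_eta (decay (- 2) eta)%:E).

Lemma density_const_ge0 v : 0 < v -> 0 <= density_const v.
Proof.
move=> v0; have c0 := ltW (@abs_const_gt0 R).
rewrite /density_const !mulr_ge0 ?invr_ge0 ?addr_ge0 ?divr_ge0 ?(ltW v0) //.
by apply: fine_ge0; apply: integral_ge0 => x _; rewrite lee_fin decay_ge0.
Qed.

Lemma gaussian_trap_le I d (T : measurableType d) (P : probability T R) (X : I -> T -> R) G i (rho a : R) :
  gaussian P X G -> 0 < G i i -> 0 < rho ->
  \int[P]_x tprod X [:: Factor i rho rho a] x <= density_const (G i i) * rho.
Proof.
move=> [mX cX] v0 r0; set v := G i i.
pose q := Factor i rho rho a.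
have hq : factor_ok q by split; rewrite ?ltW.
have c0 := @abs_const_gt0 R.
have [mg E] := @tmean_cons R I _ T P X mX q [::] 0 [::] hq (fun q h => False_ind _ h).
rewrite -tmean_tprod -lee_fin -E.
have i2 : itg mu (decay (- 2)) by apply: integrable_decay; lra.
have dfin : (\int[mu]_eta (decay (- 2) eta)%:E = (fine (\int[mu]_eta (decay (- 2) eta)%:E))%:E)%E.
  by rewrite fineK //; exact: (integrable_fin_num measurableT i2).
rewrite (_ : density_const v * rho = (3 / 2) * rho / abs_const * (1 + 2 / v) * fine (\int[mu]_eta (decay (- 2) eta)%:E)); last first.
  by rewrite /density_const; ring.
rewrite EFinM -dfin -ge0_integralZl_EFin //; last 3 first.
- by move=> x _; rewrite lee_fin decay_ge0.
- by apply/measurable_EFinP; exact: measurable_decay.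
- by rewrite mulr_ge0 ?divr_ge0 ?mulr_ge0 ?addr_ge0 // ?divr_ge0 ?ltW.
apply: le_trans (_ : _ <= \int[mu]_eta `|(trap_hat rho rho eta * (2^-1 *
    (tmean P X [::] (0 - eta * a) [:: (eta, i)] + tmean P X [::] (0 + eta * a) [:: (- eta, i)])))%:E|)%E _.
  apply: (le_trans (lee_abs _)); apply: le_abse_integral => //.
  by mauto.
apply: ge0_le_integral => //.
- by mauto.
- by apply: measurable_funeM; apply/measurable_EFinP; exact: measurable_decay.
move=> y _; rewrite abse_EFin -EFinM lee_fin normrM.
(* Uniformly in [y]: the product of sines gains y^2, which cancels the denominator, and rho^2, of
   which one power is left. *)
have th : `|trap_hat rho rho y| <= (3 / 2) * rho / abs_const.
  rewrite /trap_hat normrM (ger0_norm (_ : 0 <= (abs_const * rho)^-1)); last first.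
    by rewrite invr_ge0 mulr_ge0 ?ltW.
  rewrite ler_pdivrMr ?mulr_gt0 // (_ : _ * (abs_const * rho) = 3 / 2 * rho ^+ 2); last first.
    by field; rewrite gt_eqF.
  have [->|y0] := eqVneq y 0.
    by rewrite !mulr0 cos0 subrr mul0r normr0 mulr_ge0 ?sqr_ge0.
  rewrite normrM normfV (ger0_norm (sqr_ge0 _)) ler_pdivrMr ?exprn_even_gt0 //.
  rewrite (_ : rho * y = 3 / 2 * rho * y - rho / 2 * y); last by field.
  rewrite (_ : (rho + rho) * y = 3 / 2 * rho * y + rho / 2 * y); last by field.
  rewrite cosB_cosD normrM normrM (@ger0_norm _ 2) //.
  apply: (le_via (2 * (`|3 / 2 * rho * y| * `|rho / 2 * y|))).
    by rewrite ler_wpM2l // ler_pM // sin_le_norm.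
  rewrite !normrM !(@gtr0_norm _ rho) // (@ger0_norm _ 3) // !(@ger0_norm _ 2^-1) ?invr_ge0 //.
  by rewrite -(real_normK (num_real y)); apply: le_of_eq; field.
rewrite -[leRHS]mulrA; apply: ler_pM => //.
rewrite !tmean_nil !cX /bil !big_seq1 /= -/v.
rewrite mulrNN -mulrDl mulrA normrM (ger0_norm (expR_ge0 _)).
apply: (le_via (1 * expR (- (y * y * v) / 2))).
  rewrite ler_wpM2r ?expR_ge0 // normrM ger0_norm ?invr_ge0 // ler_pdivrMl // mulr1.
  by rewrite (le_trans (ler_normD _ _)) // -[2]/(1 + 1) lerD // cos_max.
rewrite mul1r; have w0 : 0 < 1 + 2 / v by rewrite addr_gt0 // divr_gt0.
have ev : expR (- (y * y * v) / 2) <= 1.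
  by rewrite -expR0 ler_expR mulNr oppr_le0 divr_ge0 // mulr_ge0 ?(ltW v0) // -expr2 sqr_ge0.
rewrite /decay; case: ifPn => y1.
  by rewrite mulr1 (le_trans ev) // lerDl divr_ge0 // ltW.
rewrite -ltNge in y1; rewrite powR_invn // real_normK ?num_real //.
have y20 : 0 < y ^+ 2 by rewrite -(real_normK (num_real y)) exprn_gt0 // (lt_trans ltr01).
rewrite mulNr expRN (le_trans (_ : _ <= (y ^+ 2 * v / 2)^-1)) //.
  have y2v : 0 < y ^+ 2 * v / 2 by rewrite divr_gt0 // mulr_gt0.
  rewrite -expr2 lef_pV2 ?posrE ?expR_gt0 //.
  by have := expR_ge1Dx (y ^+ 2 * v / 2); lra.
rewrite (_ : (y ^+ 2 * v / 2)^-1 = 2 / v * y ^- 2); last first.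
  have y0 : y != 0 by apply: contraTneq y1 => ->; rewrite normr0 -leNgt ler01.
  by field; rewrite y0 gt_eqF.
by rewrite ler_wpM2r ?invr_ge0 ?ltW // ltrDr.
Qed.

(** Distinct coordinates are uncorrelated, so [gaussian_mixing] with [kap = 0] factorises the
    expectation exactly. *)
Lemma gaussian_density (I : eqType) d (T : measurableType d) (P : probability T R) (X : I -> T -> R) G
    (v rho : R) (a : I -> R) (r : seq I) :
  gaussian P X G -> 0 < v -> (forall i j, G i j = if i == j then v else 0) -> 0 < rho -> uniq r ->
  \int[P]_x tprod X [seq Factor i rho rho (a i) | i <- r] x <= (density_const v * rho) ^+ size r.
Proof.
move=> gX v0 hG r0; have [mX _] := gX.
elim: r => [|i r IH] /=.
  move=> _; under eq_Rintegral do rewrite /tprod big_nil.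
  by rewrite Rintegral_cst //= probability_setT /= mulr1 expr0.
move=> /andP[ir ur].
have hok q : List.In q ([:: Factor i rho rho (a i)] ++ [seq Factor i rho rho (a i) | i <- r]) -> factor_ok q.
  move=> /In_cat[[<-|//]|]; first by split; rewrite ?ltW.
  by move=> /In_map[j _ ->]; split; rewrite ?ltW.
have := @gaussian_mixing I _ T P X G (pred1 i) 0 [:: Factor i rho rho (a i)] [seq Factor i rho rho (a i) | i <- r] gX (lexx 0).
rewrite sqrtr0 mul0r normr_le0 subr_eq0 /= => h.
have /eqP -> : \int[P]_x tprod X (Factor i rho rho (a i) :: [seq Factor i rho rho (a i) | i <- r]) x ==
   \int[P]_x tprod X [:: Factor i rho rho (a i)] x * \int[P]_x tprod X [seq Factor i rho rho (a i) | i <- r] x.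
  apply: h => //.
  - by move=> j k; rewrite hG; have [->|_ _] := eqVneq j k; rewrite ?eqxx // normr0.
  - by move=> q [<-|//] /=; rewrite eqxx.
  - elim: (r) ir => [|j r' IHr] //=; rewrite inE negb_or => /andP[ij ir'] q [<- /=|]; first by rewrite eq_sym.
    exact: IHr.
have ge0 l : (forall q, List.In q l -> factor_ok q) -> 0 <= \int[P]_x tprod X l x.
  by move=> hl; apply: Rintegral_ge0 => x _; have /andP[] := @tprod_itv R I T X l x hl.
rewrite exprS; apply: ler_pM; rewrite ?ge0 //.
- by move=> q hq; apply: hok; apply/In_cat; left.
- by move=> q hq; apply: hok; apply/In_cat; right.
- have := @gaussian_trap_le I _ T P X G i rho (a i) gX; rewrite hG eqxx; exact.
- exact: IH.
Qed.

End mixing.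

(** * Dyadic indices and chaining along ancestors *)

Section dyadic.
Context {R : realType} {n : nat}.
Local Notation idx := {ffun 'I_n -> nat}.
Implicit Types (i q : idx) (x y : 'I_n -> R).

Definition child i (b : {ffun 'I_n -> bool}) : idx := [ffun c => (b c + (i c).*2)%N].
Definition children i : seq idx := [seq child i b | b <- enum {: {ffun 'I_n -> bool}}].

(* The indices of the dyadic subcubes of depth [k] of the cube of index [i]. *)
Fixpoint desc k i : seq idx :=
  if k is k'.+1 then flatten [seq desc k' j | j <- children i] else [:: i].

Definition half i : idx := [ffun c => (i c)./2].
Definition pt l i : 'I_n -> R := fun c => (i c)%:R / 2 ^+ l.
Definition near_points l x y := forall c, `|x c - y c| <= 2 ^- l.
Definition fl l x : idx := [ffun c => Num.truncn (2 ^+ l * x c)].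
Definition inside l i := forall c, (i c < 2 ^ l)%N.

Lemma half_child i b : half (child i b) = i.
Proof. by apply/ffunP => c; rewrite !ffunE half_bit_double. Qed.

Lemma mem_children i q : (q \in children i) = (half q == i).
Proof.
apply/mapP/eqP => [[b _ ->]|<-]; first exact: half_child.
exists [ffun c => odd (q c)]; first by rewrite mem_enum.
by apply/ffunP => c; rewrite !ffunE odd_double_half.
Qed.

Lemma mem_desc k i q : (q \in desc k i) = (iter k half q == i).
Proof.
elim: k i q => [|k IH] i q /=; first by rewrite inE.
apply/flattenP/eqP => [[s /mapP[j]]|<-].
  by rewrite mem_children => /eqP <- ->; rewrite IH => /eqP <-.
exists (desc k (iter k half q)); last by rewrite IH.
by apply/mapP; exists (iter k half q) => //; rewrite mem_children.
Qed.

Lemma size_desc k i : size (desc k i) = ((2 ^ n) ^ k)%N.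
Proof.
elim: k i => [|k IH] i //=.
rewrite size_flatten /shape -map_comp sumnE big_map (eq_bigr (fun=> ((2 ^ n) ^ k)%N)) => [|j _]; last exact: IH.
rewrite big_const_seq count_predT iter_addn_0 /children size_map -cardE card_ffun card_bool card_ord.
by rewrite mulnC expnS.
Qed.

Lemma inside_half l q : inside l q -> inside l.-1 (half q).
Proof.
move=> h c; rewrite ffunE; have := h c; case: l {h} => [|l] /=; first by rewrite expn0 ltnS leqn0 => /eqP ->.
by rewrite expnS mul2n; lia.
Qed.

Lemma inside_desc l k i q : inside l i -> q \in desc k i -> inside (l + k) q.
Proof.
rewrite mem_desc => h /eqP qi c.
have E j : (iter j half q c = q c %/ 2 ^ j)%N.
  elim: j => [|j IH] /=; first by rewrite divn1.
  by rewrite ffunE IH -divn2 -divnMA expnSr.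
have := h c; rewrite -qi E expnD [(2 ^ l * _)%N]mulnC.
by rewrite ltn_divLR ?expn_gt0 // mulnC.
Qed.

Lemma inside_iter l k q : inside (l + k) q -> inside l (iter k half q).
Proof.
elim: k l => [|k IH] l; first by rewrite addn0.
by rewrite addnS -addSn => /IH h; exact: (inside_half h).
Qed.

Lemma near_half l q : near_points l.+1 (pt l.+1 q) (pt l (half q)).
Proof.
move=> c; rewrite /pt ffunE.
have -> : (q c)%:R / 2 ^+ l.+1 - (q c)./2%:R / 2 ^+ l = (odd (q c))%:R / 2 ^+ l.+1 :> R.
  rewrite -{1}(odd_double_half (q c)) natrD -muln2 natrM exprS.
  by field; rewrite expf_neq0.
rewrite ger0_norm; last by rewrite divr_ge0 // exprn_ge0.
by rewrite ler_pdivrMr ?exprn_gt0 // mulVf ?expf_neq0 //; case: odd; rewrite ?ler01.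
Qed.

Lemma pt_double l q : pt l.+1 [ffun c => (q c).*2] = pt l q.
Proof.
apply/funext => c; rewrite /pt ffunE -muln2 natrM exprS.
by field; rewrite expf_neq0.
Qed.

(** The lower corner of a cube is also the lower corner of one of its children, obtained by doubling
    the index; hence the grids are nested. *)
Lemma desc_refine l k j i q : q \in desc k i ->
  exists2 q', q' \in desc (k + j) i & pt (l + (k + j)) q' = pt (l + k) q.
Proof.
move=> h; elim: j => [|j [q' h' <-]]; first by exists q; rewrite addn0.
exists [ffun c => (q' c).*2]; rewrite ?addnS ?pt_double //.
rewrite mem_desc iterSr; move: h'; rewrite mem_desc; congr (iter _ _ _ == _).
by apply/ffunP => c; rewrite !ffunE doubleK.
Qed.

Lemma sum_desc (V : nmodType) (F : idx -> V) j k i :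
  \sum_(q <- desc (j + k) i) F q = \sum_(p <- desc j i) \sum_(q <- desc k p) F q.
Proof.
elim: j i => [|j IH] i; first by rewrite big_seq1.
rewrite addSn /= !big_flatten !big_map; apply: eq_bigr => p _; exact: IH.
Qed.

Definition origin : idx := [ffun=> 0%N].

Lemma mem_desc_origin l q : (q \in desc l origin) <-> inside l q.
Proof.
split=> [/(@inside_desc 0)|h]; first by rewrite add0n; apply=> c; rewrite ffunE.
rewrite mem_desc; apply/eqP/ffunP => c.
have := @inside_iter 0 l q h c; rewrite expn0 ltnS leqn0 => /eqP ->.
by rewrite ffunE.
Qed.

(** Telescoping from [q] to its ancestor [i], with geometrically decreasing steps. The induction
    carries the exact partial sum B (1 - r^k) / (1 - r). *)
Lemma chain (f : ('I_n -> R) -> R) l i B r : 0 <= B -> 0 <= r < 1 ->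
  (forall k q, q \in desc k.+1 i ->
    `|f (pt (l + k).+1 q) - f (pt (l + k) (half q))| <= B * r ^+ k) ->
  forall k q, q \in desc k i -> `|f (pt (l + k) q) - f (pt l i)| <= B / (1 - r).
Proof.
move=> B0 /andP[r0 r1] h k q hq.
have r1' : 0 < 1 - r by rewrite subr_gt0.
suff : `|f (pt (l + k) q) - f (pt l i)| <= B * (1 - r ^+ k) / (1 - r).
  move/le_trans; apply; rewrite ler_pM2r ?invr_gt0 // ler_piMr //.
  by rewrite lerBlDr lerDl exprn_ge0.
elim: k q hq => [|k IH] q hq.
  by move: hq; rewrite mem_desc /= => /eqP ->; rewrite addn0 subrr normr0 expr0 subrr mulr0 mul0r.
have hq' : half q \in desc k i by move: hq; rewrite !mem_desc iterSr.
apply: (le_trans (ler_distD (f (pt (l + k) (half q))) _ _)).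
rewrite addnS; apply: (le_trans (lerD (h _ _ hq) (IH _ hq'))).
apply: le_of_eq; rewrite exprS; field.
by rewrite gt_eqF.
Qed.

End dyadic.

(** * Finite covers, Markov and second moment bounds *)

Section second_moment.
Context {R : realType}.

Lemma expr_small (r e : R) : 0 <= r < 1 -> 0 < e -> exists J, forall j, (J <= j)%N -> r ^+ j <= e.
Proof.
move=> /andP[r0 r1] e0.
have h : (fun j => r ^+ j) @ \oo --> (0 : R) by apply: cvg_expr; rewrite ger0_norm.
have /cvgrPdist_le /(_ _ e0) [J _ hJ] := h.
exists J => j Jj; have := hJ j Jj; rewrite /= sub0r normrN ger0_norm //.
by rewrite exprn_ge0.
Qed.

Lemma mem_In (I : eqType) (s : seq I) i : i \in s -> List.In i s.
Proof. by elim: s => [|j s IH] //; rewrite inE => /orP[/eqP ->|/IH]; [left|right]. Qed.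

Lemma mem_In' (I : eqType) (s : seq I) i : List.In i s -> i \in s.
Proof. by elim: s => [|j s IH] //= [->|/IH h]; rewrite inE ?eqxx ?h ?orbT. Qed.

Lemma measurable_prod_list I d (T : measurableType d) (s : seq I) (h : I -> T -> R) :
  (forall i, mbl (h i)) -> mbl (fun x => \prod_(i <- s) h i x).
Proof.
move=> mh; elim: s => [|i s IH].
  by rewrite (_ : (fun x => _) = cst 1) //; apply/funext => x; rewrite big_nil.
rewrite (_ : (fun x => _) = (fun x => h i x * \prod_(j <- s) h j x)); first exact: measurable_funM.
by apply/funext => x; rewrite big_cons.
Qed.

Lemma measure_list_cover I d (T : measurableType d) (P : {measure set T -> \bar R}) (s : seq I)
    (A : set T) (B : I -> set T) :
  measurable A -> (forall i, measurable (B i)) ->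
  (forall x, A x -> exists2 i, List.In i s & B i x) -> (P A <= \sum_(i <- s) P (B i))%E.
Proof.
move=> + mB; elim: s A => [|i s IH] A mA hA.
  rewrite big_nil (_ : A = set0) ?measure0 //.
  by apply/seteqP; split => // x /hA [].
rewrite big_cons.
have mA' : measurable (A `\` B i) by exact: measurableD.
apply: (le_via (P (B i `|` (A `\` B i)))%E).
  apply: le_measure; rewrite ?inE //; first by apply: measurableU.
  by move=> x Ax; have [h|h] := pselect (B i x); [left|right].
apply: (le_trans (measureU2 P (mB i) mA')); rewrite leeD2l // IH // => x [/hA [j [<-|js] Bj] h] //.
by exists j.
Qed.

Lemma markov_ge0 d (T : measurableType d) (P : {measure set T -> \bar R}) (F : T -> \bar R) (a : R) :
  mbl F -> (forall x, 0 <= F x)%E -> 0 <= a ->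
  (a%:E * P [set x | (a%:E <= F x)%E] <= \int[P]_x F x)%E.
Proof.
move=> mF F0 a0; set A := [set x | _].
have mA : measurable A.
  by rewrite -[A]setTI; exact: (emeasurable_fun_c_infty measurableT mF a%:E).
rewrite -integral_cst //; apply: (le_via (\int[P]_(x in A) F x)%E).
  by apply: ge0_le_integral => //; apply: measurable_funS mF.
by apply: ge0_subset_integral.
Qed.

Lemma gaussian_double I d (T : measurableType d) (P : probability T R) (X : I -> T -> R) G :
  gaussian P X G ->
  gaussian (P \x P)%E (fun i z => (X i z.1 - X i z.2) / Num.sqrt 2) G.
Proof.
move=> gX; pose r : R := (Num.sqrt 2)^-1.
have rr : r * r = 2^-1 by rewrite -invfM -expr2 sqr_sqrtr.
have := gaussian_lin (fun i => [:: (r, inl i); (- r, inr i)]) (gaussian_sum gX gX).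
move/eq_gaussian; apply=> [i z|i j].
  by rewrite /lin !big_cons big_nil /= addr0 mulNr -mulrBr mulrC.
rewrite /bil !big_cons !big_nil /= !mulr0 !addr0 !add0r mulrNN rr.
by field.
Qed.

(** [gaussian_mixing] asks for small covariances between all indices of the two groups. Replacing
    every index outside the two lists by the empty combination, that is by the zero variable,
    reduces this to the indices that occur. *)
Lemma gaussian_mixing_on (I : eqType) d (T : measurableType d) (P : probability T R)
    (X : I -> T -> R) G (kap : R) l1 l2 :
  gaussian P X G -> 0 <= kap ->
  (forall i j, i \in [seq fi q | q <- l1] -> j \in [seq fi q | q <- l2] ->
    [/\ i != j, `|G i j| <= kap & `|G j i| <= kap]) ->
  (forall q, List.In q (l1 ++ l2) -> factor_ok q) ->
  `|\int[P]_x tprod X (l1 ++ l2) x - (\int[P]_x tprod X l1 x) * (\int[P]_x tprod X l2 x)| <=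
    Num.sqrt kap * \prod_(q <- l1 ++ l2) mass q.
Proof.
move=> gX k0 hG hok.
pose s1 := [seq fi q | q <- l1]; pose s2 := [seq fi q | q <- l2].
pose M i : seq (R * I) := if (i \in s1) || (i \in s2) then [:: (1, i)] else [::].
have gY := gaussian_lin M gX.
have E l : {subset [seq fi q | q <- l] <= s1 ++ s2} -> tprod (fun j => lin X (M j)) l = tprod X l.
  move=> hl; apply/funext => x; rewrite /tprod.
  elim: l hl => [|q l IH] hl; first by rewrite !big_nil.
  rewrite !big_cons IH; last by move=> i il; apply: hl; rewrite /= inE il orbT.
  have : fi q \in s1 ++ s2 by apply: hl; rewrite /= mem_head.
  by rewrite mem_cat /M /lin => ->; rewrite big_seq1 mul1r.
have := @gaussian_mixing R I _ T P _ _ (fun i => i \in s1) kap l1 l2 gY k0 _ hok.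
rewrite E => [|i]; last by rewrite map_cat.
rewrite E => [|i]; last by rewrite mem_cat => ->.
rewrite E => [|i]; last by rewrite mem_cat => ->; rewrite orbT.
have Ins (q : factor I) l : List.In q l -> fi q \in [seq fi q | q <- l].
  elim: l => [//|q' l IH] /= [->|/IH h]; first exact: mem_head.
  by rewrite inE h orbT.
apply; first last.
- move=> q /Ins h; apply/negP => h1; have [+ _ _] := hG _ _ h1 h.
  by rewrite eqxx.
- by move=> q /Ins.
move=> i j; rewrite /M.
case: (boolP (i \in s1)) => i1; case: (boolP (j \in s1)) => j1 //= _.
- case: (boolP (j \in s2)) => j2; last by rewrite /bil big_seq1 big_nil normr0.
  by rewrite /bil !big_seq1 !mul1r; have [] := hG _ _ i1 j2.
- case: (boolP (i \in s2)) => i2; last by rewrite /bil big_nil normr0.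
  by rewrite /bil !big_seq1 !mul1r; have [] := hG _ _ j1 i2.
Qed.

(** Chebyshev: on the event that all [F i] vanish, their sum is at least [m * del] below its mean,
    while its variance is at most m + m^2 eta. *)
Lemma second_moment d (T : measurableType d) (P : probability T R) m (F : 'I_m -> T -> R) (del eta : R) :
  (forall i, mbl (F i)) -> (forall i x, 0 <= F i x <= 1) -> 0 < del ->
  (forall i, del <= \int[P]_x F i x) -> 0 <= eta ->
  (forall i j : 'I_m, (i < j)%N -> `|\int[P]_x (F i x * F j x) - (\int[P]_x F i x) * \int[P]_x F j x| <= eta) ->
  (0 < m)%N ->
  (P (\bigcap_(i in [set: 'I_m]) [set x | F i x = 0%R]) <= ((m%:R^-1 + eta) / del ^+ 2)%:E)%E.
Proof.
move=> mF F01 d0 hF e0 hc m0.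
pose p i := \int[P]_x F i x.
have p01 i : 0 <= p i <= 1.
  rewrite (le_trans (ltW d0) (hF i)) /=.
  have : `|p i| <= 1.
    by apply: Rintegral_le_bound => // x; have /andP[a b] := F01 i x; rewrite ger0_norm.
  by apply: le_trans; rewrite ler_norm.
have Fb i x : `|F i x| <= 1 by have /andP[a b] := F01 i x; rewrite ger0_norm.
have iF i : itg P (F i) by exact: bounded_integrable.
have mFF i j : mbl (fun x => F i x * F j x) by mauto.
have iFF i j : itg P (fun x => F i x * F j x).
  by apply: (integrable_by 1) => // x; rewrite normrM mulr_ile1.
pose S x := (\sum_(i < m) (F i x - p i)) ^+ 2.
have mS : mbl S.
  by apply: measurable_funX; apply: measurable_sum => i; apply: measurable_funB.
pose E i j := \int[P]_x (F i x * F j x) - p i * p j.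
have SE : (\int[P]_x (S x)%:E = (\sum_i \sum_j E i j)%:E)%E.
  have e1 x : (S x)%:E = (\sum_i \sum_j ((F i x * F j x - p i * F j x) - (p j * F i x - p i * p j))%:E)%E.
    rewrite /S expr2 big_distrlr /= -sumEFin; apply: eq_bigr => i _.
    by rewrite -sumEFin; apply: eq_bigr => j _; congr (_%:E); ring.
  under eq_integral do rewrite e1.
  have ic i j : P.-integrable setT (fun x => ((F i x * F j x - p i * F j x) - (p j * F i x - p i * p j))%:E).
    apply: (integrable_by 1).
      by mauto.
    move=> x; rewrite (_ : _ - _ = (F i x - p i) * (F j x - p j)); last by ring.
    rewrite normrM; have /andP[a1 b1] := F01 i x; have /andP[a2 b2] := F01 j x.
    have /andP[a3 b3] := p01 i; have /andP[a4 b4] := p01 j.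
    by apply: mulr_ile1 => //; rewrite ler_norml; apply/andP; split; lra.
  rewrite integral_sum //; last by move=> i; apply: integrable_sum.
  rewrite -sumEFin; apply: eq_bigr => i _; rewrite integral_sum // -sumEFin; apply: eq_bigr => j _.
  have iM c k : itg P (fun x => c * F k x).
    apply: (integrable_by `|c|) => [|x]; first exact: measurable_funM.
    by rewrite normrM ler_piMr.
  have sub01 (u v : R) : 0 <= u <= 1 -> 0 <= v <= 1 -> `|u - v| <= 1.
    by move=> /andP[a1 b1] /andP[a2 b2]; rewrite ler_norml; apply/andP; split; lra.
  have mul01 (u v : R) : 0 <= u <= 1 -> 0 <= v <= 1 -> 0 <= u * v <= 1.
    by move=> /andP[a1 b1] /andP[a2 b2]; rewrite mulr_ge0 //= mulr_ile1.
  have i1 : itg P (fun x => F i x * F j x - p i * F j x).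
    apply: (integrable_by 1) => [|x]; last by rewrite sub01 ?mul01.
    by mauto.
  have i2 : itg P (fun x => p j * F i x - p i * p j).
    apply: (integrable_by 1) => [|x]; last by rewrite sub01 ?mul01.
    by mauto.
  have -> : (\int[P]_x (F i x * F j x - p i * F j x - (p j * F i x - p i * p j))%:E =
    (\int[P]_x (F i x * F j x - p i * F j x - (p j * F i x - p i * p j)))%:E)%E.
    by rewrite -integral_Rintegral //; exact: ic.
  congr (_%:E).
  rewrite (@RintegralB _ _ _ P setT (fun x => F i x * F j x - p i * F j x)) //.
  rewrite (@RintegralB _ _ _ P setT (fun x => F i x * F j x)) // (@RintegralB _ _ _ P setT (fun x => p j * F i x)) //; last first.
    by apply: (integrable_by `|p i * p j|).
  have R1 c k : \int[P]_x (c * F k x) = c * p k by rewrite RintegralZl.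
  have -> : \int[P]__ (p i * p j) = p i * p j.
    by rewrite Rintegral_cst //= probability_setT /= mulr1.
  by rewrite !R1 /E; ring.
(* Variances are bounded crudely by 1; the quasi-independence is used off the diagonal. *)
have Eb i j : E i j <= (i == j)%:R + eta.
  case: (ltngtP i j) => ij.
  - have /negbTE -> : i != j by apply: contraTneq ij => ->; rewrite ltnn.
    by rewrite add0r (le_trans (ler_norm _)) // hc.
  - have /negbTE -> : i != j by apply: contraTneq ij => ->; rewrite ltnn.
    rewrite add0r (le_trans (ler_norm _)) // /E (mulrC (p i)).
    by under eq_Rintegral do rewrite mulrC; exact: hc.
  - rewrite (ord_inj ij) eqxx; have /andP[a1 b1] := p01 j.
    have pp := mulr_ge0 a1 a1; rewrite -[true%:R]/(1 : R).
    suff : \int[P]_x (F j x * F j x) <= 1 by rewrite /E; lra.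
    apply: (le_trans (ler_norm _)); apply: Rintegral_le_bound => // x.
    by rewrite normrM mulr_ile1.
have m0' : 0 < m%:R :> R by rewrite ltr0n.
have ub : \sum_i \sum_j E i j <= m%:R + m%:R ^+ 2 * eta.
  apply: (le_via (\sum_(i < m) (1 + m%:R * eta))).
    apply: ler_sum => i _; apply: (le_trans (ler_sum _ (fun j _ => Eb i j))).
    rewrite big_split /= (bigD1 i) //= eqxx big1 ?addr0; last first.
      by move=> j /negbTE; rewrite eq_sym => ->.
    by rewrite sumr_const card_ord mulr_natl.
  by rewrite sumr_const card_ord -[leLHS]mulr_natl mulrDr mulr1 mulrA -expr2.
set Z := \bigcap_(i in _) _.
have mZ : measurable Z.
  apply: fin_bigcap_measurable => [|i _]; first exact: finite_finset.
  by rewrite -[X in measurable X]setTI; exact: (mF i measurableT _ (measurable_set1 0)).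
have lb : (((m%:R * del) ^+ 2)%:E * P Z <= \int[P]_x (S x)%:E)%E.
  rewrite -[X in (_ * P X)%E]setIT -integral_indic // -ge0_integralZl_EFin //; last 2 first.
  - by mauto.
  - by rewrite exprn_ge0 // mulr_ge0 // ltW.
  apply: ge0_le_integral => //.
  - by move=> x _; rewrite -EFinM lee_fin mulr_ge0 // exprn_ge0 // mulr_ge0 // ltW.
  - by mauto.
  - by mauto.
  move=> x _; rewrite -EFinM lee_fin indicE; case: (boolP (x \in Z)) => [|_]; last by rewrite mulr0 /S sqr_ge0.
  rewrite inE mulr1 => hx; rewrite /S (eq_bigr (fun i => - p i)) => [|i _]; last first.
    by have /= -> := hx i I; rewrite sub0r.
  rewrite sumrN sqrrN lerXn2r ?nnegrE ?mulr_ge0 ?(ltW d0) //.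
    by apply: sumr_ge0 => i _; have /andP[] := p01 i.
  by rewrite mulr_natl -[X in _ *+ X](card_ord m) -sumr_const; apply: ler_sum => i _; exact: hF.
have Pf : P Z \is a fin_num by rewrite fin_num_measure.
rewrite -(fineK Pf) lee_fin ler_pdivlMr ?exprn_gt0 //.
move: lb; rewrite SE -(fineK Pf) -EFinM lee_fin => /le_trans /(_ ub).
rewrite exprMn => h.
have m2 : 0 < m%:R ^+ 2 :> R by rewrite exprn_gt0.
rewrite -(ler_pM2l m2) mulrDr.
rewrite [X in _ <= X + _](_ : _ = m%:R); last by field; rewrite gt_eqF.
by apply: le_trans h; rewrite /= [fine _ * _]mulrC mulrA.
Qed.

End second_moment.

(** * Increments of a critical field over dyadic cubes *)

Section field.
Context {R : realType} {n d : nat} {disp : measure_display} {T : measurableType disp}.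
Variable P : probability T R.
Local Notation idx := {ffun 'I_n -> nat}.
Local Notation site := ('I_d * ('I_n -> R))%type.

Definition field_cov (K : ('I_n -> R) -> ('I_n -> R) -> R) (i j : site) : R :=
  if i.1 == j.1 then K i.2 j.2 else 0.

(* The last three constants encode [a0 = 2^-H], [b0 = 2^-theta] with [H < theta] and [H * d = n]. *)
Record critical_field (X : 'I_d -> ('I_n -> R) -> T -> R) (K : ('I_n -> R) -> ('I_n -> R) -> R)
    (a0 b0 rho C : R) : Prop := CriticalField {
  cf_gaussian : gaussian P (fun i : site => X i.1 i.2) (field_cov K) ;
  cf_moment : forall c l x y, near_points l x y ->
    (\int[P]_w ((X c x w - X c y w) ^+ (2 * d))%:E <= (C * (a0 ^+ l) ^+ (2 * d))%:E)%E ;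
  cf_sym : forall x y, K x y = K y x ;
  cf_smooth : forall l x y z, near_points l x y -> `|K x z - K y z| <= C * b0 ^+ l ;
  cf_pos : forall x, K (pt 0 origin) (pt 0 origin) <= 2 * K x (pt 0 origin) ;
  cf_var : 0 < K (pt 0 origin) (pt 0 origin) ;
  cf_C : 0 <= C ;
  cf_b0 : 0 < b0 ; cf_a0 : b0 < a0 ; cf_rho : a0 < rho ^+ 2 ; cf_rho1 : 0 < rho < 1 ;
  cf_d : (0 < d)%N ;
  cf_critical : a0 ^+ d = 2 ^- n }.

Variables (X : 'I_d -> ('I_n -> R) -> T -> R) (K : ('I_n -> R) -> ('I_n -> R) -> R).
Variables a0 b0 rho C : R.
Hypothesis cf : critical_field X K a0 b0 rho C.

Lemma a0_gt0 : 0 < a0. Proof. exact: lt_trans (cf_b0 cf) (cf_a0 cf). Qed.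
Lemma a0_lt1 : a0 < 1.
Proof.
have /andP[r0 r1] := cf_rho1 cf; apply: (lt_trans (cf_rho cf)).
by rewrite exprn_ilt1 // ltW.
Qed.
Lemma rho_gt0 : 0 < rho. Proof. by have /andP[] := cf_rho1 cf. Qed.

Lemma measurable_field c x : mbl (X c x).
Proof. by have [m _] := cf_gaussian cf; exact: (m (c, x)). Qed.

(** Increments [k] generations below level [l] have typical size a0^(l+k), but are measured in the
    larger unit rho^k a0^l. The slack a0 < rho^2 makes the expected 2d-th powers summable over all
    cubes and generations, while rho < 1 keeps the chaining sum finite. *)
Definition scl l k : R := rho ^+ k * a0 ^+ l.
Lemma scl_gt0 l k : 0 < scl l k.
Proof. by rewrite mulr_gt0 // exprn_gt0 // ?a0_gt0 ?rho_gt0. Qed.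

(* The edge [(l, k, q, c)] joins the point [q] of level [l + k + 1] to its parent; its increment is
   measured relatively to a cube of level [l]. *)
Definition edge := (nat * nat * idx * 'I_d)%type.
Implicit Type e : edge.

Definition incr_lin e : seq (R * site) := let: (l, k, q, c) := e in
  [:: ((scl l k)^-1, (c, pt (l + k).+1 q)); (- (scl l k)^-1, (c, pt (l + k) (half q)))].
Definition incr e : T -> R := lin (fun i : site => X i.1 i.2) (incr_lin e).
Definition incr_cov e e' := bil (field_cov K) (incr_lin e) (incr_lin e').

Lemma incrE l k q c w :
  incr (l, k, q, c) w = (X c (pt (l + k).+1 q) w - X c (pt (l + k) (half q)) w) / scl l k.
Proof. by rewrite /incr /lin !big_cons big_nil /= addr0 mulNr -mulrBr mulrC. Qed.

Lemma gaussian_incr : gaussian P incr incr_cov.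
Proof. exact: (gaussian_lin incr_lin (cf_gaussian cf)). Qed.

Lemma measurable_incr e : mbl (incr e).
Proof. by have [m _] := gaussian_incr; exact: m. Qed.

Lemma moment_incr l k q c :
  (\int[P]_w (incr (l, k, q, c) w ^+ (2 * d))%:E <= (C * ((a0 / rho) ^+ k) ^+ (2 * d))%:E)%E.
Proof.
have s0 := scl_gt0 l k.
have mX x := measurable_field c x.
rewrite (eq_integral (fun w => ((scl l k ^- (2 * d))%:E *
  ((X c (pt (l + k).+1 q) w - X c (pt (l + k) (half q)) w) ^+ (2 * d))%:E)%E)); last first.
  by move=> w _; rewrite incrE expr_div_n mulrC EFinM.
rewrite ge0_integralZl_EFin //; last 3 first.
- by move=> w _; rewrite lee_fin exprn_even_ge0 // mul2n odd_double.
- by mauto.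
- by rewrite invr_ge0 exprn_ge0 // ltW.
apply: (le_via ((scl l k ^- (2 * d))%:E * (C * (a0 ^+ (l + k).+1) ^+ (2 * d))%:E)%E).
  apply: lee_wpmul2l; first by rewrite lee_fin invr_ge0 exprn_ge0 // ltW.
  by apply: (cf_moment cf); exact: near_half.
rewrite -EFinM lee_fin mulrCA ler_wpM2l ?(cf_C cf) //.
rewrite -exprVn -exprMn lerXn2r ?nnegrE //.
- by rewrite mulr_ge0 ?invr_ge0 ?exprn_ge0 // ltW // a0_gt0.
- by rewrite exprn_ge0 // divr_ge0 // ltW // ?a0_gt0 // rho_gt0.
rewrite /scl mulrC ler_pdivrMr // expr_div_n -addnS exprD [leRHS](_ : _ = a0 ^+ l * a0 ^+ k).
  by rewrite ler_wpM2l ?exprn_ge0 ?(ltW a0_gt0) // exprS ler_piMl ?exprn_ge0 ?(ltW a0_gt0) // ltW // a0_lt1.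
by field; rewrite expf_neq0 // gt_eqF // rho_gt0.
Qed.

Definition level_edges l k (i : idx) : seq edge :=
  [seq (l, k, p.1, p.2) | p <- allpairs pair (desc k.+1 i) (enum 'I_d)].

Lemma mem_level_edges l k i q c : q \in desc k.+1 i -> (l, k, q, c) \in level_edges l k i.
Proof.
by move=> h; apply/mapP; exists (q, c) => //; apply: allpairs_f => //; rewrite mem_enum.
Qed.

Lemma size_level_edges l k i : size (level_edges l k i) = ((2 ^ n) ^ k.+1 * d)%N.
Proof. by rewrite size_map size_allpairs size_desc size_enum_ord. Qed.

Definition lev l k i w : R := \sum_(e <- level_edges l k i) incr e w ^+ (2 * d).

Lemma incr_even_ge0 e w : 0 <= incr e w ^+ (2 * d).
Proof. by rewrite exprn_even_ge0 // mul2n odd_double. Qed.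

Lemma lev_ge0 l k i w : 0 <= lev l k i w.
Proof. by apply: sumr_ge0 => e _; exact: incr_even_ge0. Qed.

Lemma measurable_lev l k i : mbl (lev l k i).
Proof. by apply: measurable_sum => e; apply: measurable_funX; exact: measurable_incr. Qed.

(** Ratio of the expected contributions of two successive generations: 2^n as many points, each with
    moment (a0 / rho)^(2d) times smaller. Since a0^d = 2^-n, the product is (a0 / rho^2)^d < 1. *)
Definition kappa : R := (a0 / rho ^+ 2) ^+ d.

Lemma kappa_itv : 0 <= kappa < 1.
Proof.
have r2 : 0 < rho ^+ 2 by rewrite exprn_gt0 // rho_gt0.
have h0 : 0 <= a0 / rho ^+ 2 by rewrite divr_ge0 // ltW // a0_gt0.
rewrite exprn_ge0 //= exprn_ilt1 //; last by rewrite ltr_pdivrMr // mul1r (cf_rho cf).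
by rewrite -lt0n (cf_d cf).
Qed.

Definition tail_const : R := 2 ^+ n * d%:R * C / (1 - kappa).

Lemma tail_const_ge0 : 0 <= tail_const.
Proof.
have /andP[k0 k1] := kappa_itv.
by rewrite divr_ge0 ?subr_ge0 ?(ltW k1) // !mulr_ge0 ?(cf_C cf) // exprn_ge0.
Qed.

Lemma integral_lev l k i :
  (\int[P]_w (lev l k i w)%:E <= (2 ^+ n * d%:R * C * kappa ^+ k)%:E)%E.
Proof.
under eq_integral do rewrite /lev -sumEFin.
rewrite ge0_integral_sum //; last 2 first.
- by move=> e; apply/measurable_EFinP; apply: measurable_funX; exact: measurable_incr.
- by move=> e w _; rewrite lee_fin incr_even_ge0.
apply: (le_via (\sum_(e <- level_edges l k i) (C * ((a0 / rho) ^+ k) ^+ (2 * d))%:E)%E).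
  rewrite /level_edges !big_map; apply: lee_sum => -[q c] _; exact: moment_incr.
rewrite sumEFin lee_fin big_const_seq count_predT iter_addr_0 size_level_edges.
have E : 2 ^+ n * a0 ^+ d = 1 :> R by rewrite (cf_critical cf) mulfV // expf_neq0.
rewrite -[X in X <= _]mulr_natr natrM !natrX le_eqVlt; apply/orP; left; apply/eqP.
have -> : ((a0 / rho) ^+ k) ^+ (2 * d) = (a0 ^+ d * kappa) ^+ k.
  rewrite -exprM mulnC exprM; congr (_ ^+ k).
  rewrite /kappa exprM -exprMn; congr (_ ^+ d).
  by field; rewrite gt_eqF // rho_gt0.
rewrite exprMn exprS.
transitivity (2 ^+ n * d%:R * C * kappa ^+ k * (2 ^+ n * a0 ^+ d) ^+ k); last by rewrite E expr1n mulr1.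
by rewrite exprMn; ring.
Qed.

(** A sum of 2d-th powers dominates their maximum, so one bound on [tail] controls simultaneously
    all increments from generation [J] on. *)
Definition tail J l i w : \bar R := (\sum_(k <oo) (lev l (J + k) i w)%:E)%E.

Lemma tail_ge0 J l i w : (0 <= tail J l i w)%E.
Proof. by apply: nneseries_ge0 => k _ _; rewrite lee_fin lev_ge0. Qed.

Lemma measurable_tail J l i : mbl (tail J l i).
Proof.
apply: ge0_emeasurable_sum => [k x _ _|k _]; first by rewrite lee_fin lev_ge0.
by apply/measurable_EFinP; exact: measurable_lev.
Qed.

Lemma integral_tail J l i : (\int[P]_w tail J l i w <= (tail_const * kappa ^+ J)%:E)%E.
Proof.
have /andP[k0 k1] := kappa_itv.
have k1' : 0 < 1 - kappa by rewrite subr_gt0.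
rewrite integral_nneseries //; last 2 first.
- by move=> k; apply/measurable_EFinP; exact: measurable_lev.
- by move=> k w _; rewrite lee_fin lev_ge0.
apply: lime_le; first by apply: is_cvg_nneseries => k _ _; apply: integral_ge0 => w _; rewrite lee_fin lev_ge0.
apply: nearW => N.
apply: (le_via (\sum_(0 <= k < N) (2 ^+ n * d%:R * C * kappa ^+ (J + k))%:E)%E).
  by apply: lee_sum => k _; exact: integral_lev.
rewrite sumEFin lee_fin.
suff -> : \sum_(0 <= k < N) (2 ^+ n * d%:R * C * kappa ^+ (J + k)) =
    tail_const * kappa ^+ J * (1 - kappa ^+ N).
  apply: ler_piMr; first exact: mulr_ge0 tail_const_ge0 (exprn_ge0 _ k0).
  by rewrite lerBlDr lerDl exprn_ge0.
elim: N => [|N IH]; first by rewrite big_geq // expr0 subrr mulr0.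
rewrite big_nat_recr //= IH /tail_const exprD exprS; field.
by rewrite gt_eqF.
Qed.

Lemma tail_incr J l i w eps k q c : 0 <= eps -> (tail J l i w <= (eps ^+ (2 * d))%:E)%E ->
  q \in desc (J + k).+1 i -> `|incr (l, J + k, q, c)%N w| <= eps.
Proof.
move=> e0 h hq.
have h1 : lev l (J + k) i w <= eps ^+ (2 * d).
  rewrite -lee_fin; apply: le_trans h.
  apply: (le_via (\sum_(0 <= j < k.+1) (lev l (J + j) i w)%:E)%E); last first.
    by apply: nneseries_lim_ge => j _ _; rewrite lee_fin lev_ge0.
  rewrite big_nat_recr //= leeDr // sumEFin lee_fin sumr_ge0 // => j _; exact: lev_ge0.
have h2 : incr (l, J + k, q, c)%N w ^+ (2 * d) <= eps ^+ (2 * d).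
  apply: le_trans h1; rewrite /lev (big_rem _ (mem_level_edges l c hq)) /= lerDl.
  by apply: sumr_ge0 => e _; exact: incr_even_ge0.
rewrite -(@ler_pXn2r _ (2 * d)) ?nnegrE //; last by rewrite muln_gt0 (cf_d cf).
by rewrite -normrX ger0_norm // incr_even_ge0.
Qed.

Lemma chain_field l i w eps c : 0 <= eps ->
  (forall k q, q \in desc k.+1 i -> `|incr (l, k, q, c) w| <= eps) ->
  forall k q, q \in desc k i ->
  `|X c (pt (l + k) q) w - X c (pt l i) w| <= eps * a0 ^+ l / (1 - rho).
Proof.
move=> e0 h; have /andP[r0 r1] := cf_rho1 cf.
apply: (@chain _ _ (fun x => X c x w)); rewrite ?mulr_ge0 ?exprn_ge0 ?(ltW a0_gt0) ?(ltW r0) //.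
move=> k q hq; have := h k q hq; rewrite incrE normrM normfV (gtr0_norm (scl_gt0 _ _)).
by rewrite ler_pdivrMr ?scl_gt0 // /scl -mulrA [a0 ^+ l * _]mulrC.
Qed.

Definition gate_edges J l i : seq edge := flatten [seq level_edges l k i | k <- iota 0 J].
(** Used through [tprod], a smooth version of the event that the listed increments are at most
    [eps]: the product is 1 when all are at most eps/2 and vanishes as soon as one reaches [eps]. *)
Definition gate (eps : R) (es : seq edge) : seq (factor edge) :=
  [seq Factor e (eps / 2) (eps / 2) 0 | e <- es].

(** The number of edges is the same for all cubes and levels, which makes the mixing error uniform
    over scales. *)
Lemma size_gate_edges J l i : size (gate_edges J l i) = size (gate_edges J 0 origin).
Proof.
rewrite !size_flatten /shape -!map_comp; congr sumn.
by apply: eq_map => k /=; rewrite !size_level_edges.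
Qed.

Lemma mem_gate_edges J l i k q c : (k < J)%N -> q \in desc k.+1 i -> (l, k, q, c) \in gate_edges J l i.
Proof.
move=> kJ hq; apply/flattenP; exists (level_edges l k i); last exact: mem_level_edges.
by apply/mapP; exists k => //; rewrite mem_iota.
Qed.

Lemma gate_edgesP J l i e : e \in gate_edges J l i -> exists k q c,
  [/\ e = (l, k, q, c), (k < J)%N & q \in desc k.+1 i].
Proof.
move=> /flattenP[s /mapP[k kJ ->] /mapP[[q c] /allpairsP[[q' c'] /= [hq _ [-> ->]]] ->]].
by exists k, q', c'; split => //; rewrite mem_iota in kJ.
Qed.

Lemma gate_ok eps es q : 0 < eps -> List.In q (gate eps es) -> factor_ok q.
Proof. by move=> e0 /In_map[e _ ->]; split; rewrite /= ?divr_ge0 ?divr_gt0 // ltW. Qed.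

Lemma fi_gate eps es : [seq fi q | q <- gate eps es] = es.
Proof. by rewrite -map_comp map_id_in. Qed.

Lemma prod_mass_gate eps es :
  \prod_(q <- gate eps es) mass q = mass (@Factor R unit tt (eps / 2) (eps / 2) 0) ^+ size es.
Proof.
rewrite big_map (eq_bigr (fun=> mass (@Factor R unit tt (eps / 2) (eps / 2) 0))) //.
by rewrite big_const_seq count_predT /= iter_mulr_1.
Qed.

Lemma tprod_gateE T' (Y : edge -> T' -> R) eps es w :
  tprod Y (gate eps es) w = \prod_(e <- es) trap (eps / 2) (eps / 2) (Y e w).
Proof. by rewrite /tprod big_map; apply: eq_bigr => e _; rewrite subr0. Qed.

Lemma gate_neq0 T' (Y : edge -> T' -> R) eps es w e : 0 < eps -> e \in es ->
  tprod Y (gate eps es) w != 0 -> `|Y e w| <= eps.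
Proof.
move=> e0 he; rewrite tprod_gateE prodf_seq_neq0 => /allP /(_ _ he) /=.
apply: contra_neqT; rewrite -ltNge => h.
by apply: trap0; rewrite ?divr_ge0 ?divr_gt0 ?(ltW e0) //; lra.
Qed.

Lemma gate_eq1 T' (Y : edge -> T' -> R) eps es w : 0 < eps ->
  (forall e, e \in es -> `|Y e w| <= eps / 2) -> tprod Y (gate eps es) w = 1.
Proof.
move=> e0 h; rewrite tprod_gateE big_seq big1 // => e /h.
by apply: trap1; rewrite ?divr_ge0 ?divr_gt0 // ltW.
Qed.

(* Two independent copies fall into the same cell of a finite partition with positive probability,
   and [(U - U') / sqrt 2] has the law of [U]. *)
Lemma small_ball eps : 0 < eps -> exists2 del, 0 < del & exists J0, forall J l i, (J0 <= J)%N ->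
  del <= \int[P]_w tprod incr (gate eps (gate_edges J l i)) w.
Proof.
move=> e0; have t0 := tail_const_ge0; have /andP[k0 k1] := kappa_itv.
pose A0 := 1 + 4 * tail_const.
have A1 : 1 <= A0 by rewrite lerDl mulr_ge0.
have d2 : (0 < 2 * d)%N by rewrite muln_gt0 (cf_d cf).
(* By Markov the whole tail then exceeds [A0 ^+ (2 * d)] with probability at most 1/4; [J0] is
   chosen next so that the same holds for the tail from [J0] on with the threshold [e']. *)
have A2 : 4 * tail_const <= A0 ^+ (2 * d).
  apply: (le_via A0); first by rewrite /A0; lra.
  by rewrite -[leLHS]expr1 ler_weXn2l.
pose e' := eps / 4; have e'0 : 0 < e' by rewrite divr_gt0.
have [J0 hJ0] : exists J, forall j, (J <= j)%N -> kappa ^+ j <= e' ^+ (2 * d) / (4 * (1 + tail_const)).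
  apply: expr_small; first exact/andP.
  by rewrite divr_gt0 ?exprn_gt0 // mulr_gt0 // ltr_pwDl.
pose h := eps / 2; have h0 : 0 < h by rewrite divr_gt0.
(* Number of cells of width eps/2 that cover [-A0, A0]. Only the generations before [J0] are
   discretised, so the number of cells, and with it [del], does not depend on [J], [l] or [i]. *)
pose Nb := (Num.truncn (2 * A0 / h)).+1.
pose N0 := size (gate_edges J0 0 origin).
pose Nc := #|{ffun 'I_N0 -> 'I_Nb}|.
have Nc0 : (0 < Nc)%N by rewrite /Nc card_ffun !card_ord expn_gt0.
pose del : R := (2 * Nc%:R)^-1.
have del0 : 0 < del by rewrite invr_gt0 mulr_gt0 // ltr0n.
exists (del ^+ 2); first by rewrite exprn_gt0.
exists J0 => J l i J0J.
pose E0 := gate_edges J0 l i.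
have sE0 : size E0 = N0 by exact: size_gate_edges.
pose e_ (j : 'I_N0) := tnth (tcast sE0 (in_tuple E0)) j.
have e_P e : e \in E0 -> exists j, e = e_ j.
  move=> he; have : e \in tcast sE0 (in_tuple E0) by rewrite memtE val_tcast.
  by move=> /tnthP.
have e_E j : e_ j \in E0.
  have := mem_tnth j (tcast sE0 (in_tuple E0)).
  by rewrite memtE val_tcast.
have mI := measurable_incr; have mT J' := measurable_tail J' l i.
pose A := [set w | (tail 0 l i w <= (A0 ^+ (2 * d))%:E)%E] `&` [set w | (tail J0 l i w <= (e' ^+ (2 * d))%:E)%E].
pose cell (c : {ffun 'I_N0 -> 'I_Nb}) := \bigcap_(j in [set: 'I_N0])
  [set w | (c j)%:R * h - A0 <= incr (e_ j) w <= (c j).+1%:R * h - A0].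
have mle J' (a : R) : measurable [set w | (tail J' l i w <= a%:E)%E].
  by rewrite -[X in measurable X]setTI; exact: (emeasurable_fun_infty_c measurableT (mT J') a%:E).
have mA : measurable A by exact: measurableI.
have mcell c : measurable (cell c).
  apply: fin_bigcap_measurable => [|j _]; first exact: finite_finset.
  rewrite (_ : [set w | _] = incr (e_ j) @^-1` `[(c j)%:R * h - A0, (c j).+1%:R * h - A0]); last first.
    by apply/seteqP; split => w /=; rewrite in_itv.
  by rewrite -[X in measurable X]setTI; apply: mI.
have cover w : A w -> exists2 c, List.In c (enum {ffun 'I_N0 -> 'I_Nb}) & (A `&` cell c) w.
  move=> [w1 w2].
  have bd j : - A0 <= incr (e_ j) w <= A0.
    rewrite -ler_norml; have [k [q [c [-> kJ hq]]]] := gate_edgesP (e_E j).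
    by apply: (@tail_incr 0 l i w A0 k q c) => //; rewrite (le_trans ler01).
  exists [ffun j => inord (Num.truncn ((incr (e_ j) w + A0) / h))].
    by apply: mem_In; rewrite mem_enum.
  split => // j _ /=; rewrite ffunE.
  have /andP[b1 b2] := bd j.
  have p0 : 0 <= (incr (e_ j) w + A0) / h by rewrite divr_ge0 ?(ltW h0) //; lra.
  have /andP[q1 q2] := truncn_itv p0.
  rewrite inordK; last first.
    rewrite ltnS; apply: le_truncn; rewrite ler_pM2r ?invr_gt0 //; lra.
  rewrite ler_pdivlMr // in q1; rewrite ltr_pdivrMr // in q2.
  by apply/andP; split; lra.
have PA : (2^-1%:E <= P A)%E.
  have mk J' (a : R) : 0 < a -> tail_const * kappa ^+ J' <= a / 4 ->
      (P (~` [set w | (tail J' l i w <= a%:E)%E]) <= 4^-1%:E)%E.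
    move=> ag ha; have := markov_ge0 P (mT J') (tail_ge0 J' l i) (ltW ag).
    move/le_trans/(_ (integral_tail J' l i)) => H.
    apply: (le_via (P [set w | (a%:E <= tail J' l i w)%E])).
      apply: le_measure; rewrite ?inE; first exact: measurableC.
        by rewrite -[X in measurable X]setTI; exact: (emeasurable_fun_c_infty measurableT (mT J') a%:E).
      by move=> w /= /negP; rewrite -ltNge => /ltW.
    set p := P _; have {}H : (a%:E * p <= (tail_const * kappa ^+ J')%:E)%E by exact: H.
    have pf : p \is a fin_num by rewrite /p fin_num_measure //;
      rewrite -[X in measurable X]setTI; exact: (emeasurable_fun_c_infty measurableT (mT J') a%:E).
    move: H; rewrite -(fineK pf) -EFinM !lee_fin => H.
    rewrite -(ler_pM2l ag); apply: le_trans H _; exact: ha.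
  have P1 := mk 0%N (A0 ^+ (2 * d)); have P2 := mk J0 (e' ^+ (2 * d)).
  have A00 : 0 < A0 ^+ (2 * d) by rewrite exprn_gt0 // (lt_le_trans ltr01).
  have {}P1 := P1 A00; have {}P2 := P2 (exprn_gt0 _ e'0).
  have {}P1 : (P (~` [set w | (tail 0 l i w <= (A0 ^+ (2 * d))%:E)%E]) <= 4^-1%:E)%E.
    by apply: P1; rewrite expr0 mulr1 ler_pdivlMr // mulrC.
  have {}P2 : (P (~` [set w | (tail J0 l i w <= (e' ^+ (2 * d))%:E)%E]) <= 4^-1%:E)%E.
    apply: P2; have := hJ0 J0 (leqnn _).
    rewrite ler_pdivlMr ?mulr_gt0 ?ltr_pwDl // => H.
    have K0 : 0 <= kappa ^+ J0 by rewrite exprn_ge0.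
    rewrite ler_pdivlMr //; apply: le_trans H; nra.
  have PC : (P (~` A) <= 2^-1%:E)%E.
    rewrite /A setCI; apply: (le_trans (measureU2 _ _ _)); try exact: measurableC.
    by apply: (le_trans (leeD P1 P2)); rewrite -EFinD lee_fin; lra.
  move: PC; rewrite probability_setC // -(@fineK _ (P A)) ?fin_num_measure //.
  by rewrite -EFinB !lee_fin; lra.
(* Pigeonhole: an event of probability at least 1/2 is shared among [Nc] cells. *)
have [c hc] : exists c, (del%:E <= P (A `&` cell c))%E.
  apply/not_existsP => hn.
  have : (P A <= \sum_(c <- enum {ffun 'I_N0 -> 'I_Nb}) P (A `&` cell c))%E.
    by apply: measure_list_cover => // c; exact: measurableI.
  apply/negP; rewrite -ltNge; apply: lt_le_trans PA.
  apply: (@lt_le_trans _ _ (\sum_(c <- enum {ffun 'I_N0 -> 'I_Nb}) del%:E)%E).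
    rewrite big_enum_cond /= [ltRHS]big_enum_cond /=.
    have fP c : P (A `&` cell c) \is a fin_num by rewrite fin_num_measure //; exact: measurableI.
    under eq_bigr do rewrite -(fineK (fP _)).
    rewrite !sumEFin lte_fin; apply: ltr_sum => [|c _].
      by apply/hasP; exists [ffun=> ord0]; rewrite ?mem_index_enum.
    by rewrite -lte_fin (fineK (fP _)) ltNge; apply/negP => ?; apply: (hn c).
  rewrite sumEFin lee_fin big_const_seq count_predT iter_addr_0 -cardE -[leLHS]mulr_natr -/Nc /del.
  by rewrite [X in X * _ <= _]invfM -mulrA mulVf ?mulr1 // pnatr_eq0 -lt0n.
pose B := A `&` cell c.
have mB : measurable B by exact: measurableI.
have gY := gaussian_double gaussian_incr.
rewrite (gaussian_same_law gaussian_incr gY) => [|q]; last exact: gate_ok.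
set Y := fun e z => _ in gY *.
have [mY _] := gY.
have ok := fun q => @gate_ok eps (gate_edges J l i) q e0.
rewrite -lee_fin -integral_Rintegral; last first.
  apply: (integrable_by 1) => [|z]; first exact: measurable_tprod.
  exact: tprod_itvN.
apply: (le_via ((P \x P)%E (B `*` B))).
  rewrite product_measure1E //; apply: (le_via (del%:E * del%:E)%E).
    by rewrite -EFinM expr2.
  by apply: lee_pmul => //; rewrite lee_fin ltW.
rewrite -[X in (_ \x _)%E X]setIT -integral_indic //; last exact: measurableX.
apply: ge0_le_integral => //.
- by apply/measurable_EFinP; apply: measurable_indic; exact: measurableX.
- by apply/measurable_EFinP; exact: measurable_tprod.
move=> [w w'] _; rewrite lee_fin indicE; case: (boolP (_ \in _)) => [|_]; last first.
  by have /andP[] := tprod_itv Y (w, w') ok.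
rewrite inE => -[/= [[a1 a2] a3] [[b1 b2] b3]].
rewrite gate_eq1 // => e he; rewrite /Y /=.
(* Two increments in one cell differ by at most eps/2, two increments beyond [J0] by at most 2 e' =
   eps/2; dividing by sqrt 2 only helps. *)
have s2 : 1 <= Num.sqrt (2 : R) by rewrite -[leLHS]sqrtr1 ler_wsqrtr // ler1n.
rewrite normrM normfV (@ger0_norm _ (Num.sqrt 2)) ?sqrtr_ge0 // ler_pdivrMr; last by rewrite (lt_le_trans _ s2).
apply: (le_via (eps / 2)); last by rewrite ler_peMr // divr_ge0 // ltW.
have [k [q [c' [ee kJ hq]]]] := gate_edgesP he.
have [kJ0|kJ0] := ltnP k J0.
  have /e_P[j ->] : e \in E0 by rewrite ee; exact: mem_gate_edges.
  have /= /andP[u1 u2] := a3 j I; have /= /andP[v1 v2] := b3 j I.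
  have H1 : (c j).+1%:R * h = (c j)%:R * h + h by rewrite -natr1 mulrDl mul1r.
  rewrite ler_norml; rewrite H1 in u2 v2; rewrite -/h.
  by apply/andP; split; lra.
have T1 : `|incr e w| <= e'.
  by rewrite ee -(subnKC kJ0); apply: tail_incr a2 _; rewrite ?(subnKC kJ0) // ltW.
have T2 : `|incr e w'| <= e'.
  by rewrite ee -(subnKC kJ0); apply: tail_incr b2 _; rewrite ?(subnKC kJ0) // ltW.
apply: (le_trans (ler_normB _ _)); apply: (le_trans (lerD T1 T2)).
by rewrite /e'; lra.
Qed.

(** The early generations fail when the smooth gate vanishes, not when an increment exceeds a
    threshold: the gates are the variables to which [gaussian_mixing] and [second_moment] apply.
    Outside [bad] every increment below the cube is at most [eps]. *)
Definition bad eps J l i : set T :=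
  [set w | tprod incr (gate eps (gate_edges J l i)) w = 0] `|`
  [set w | ((eps ^+ (2 * d))%:E <= tail J l i w)%E].

Lemma measurable_bad eps J l i : measurable (bad eps J l i).
Proof.
apply: measurableU; rewrite -[X in measurable X]setTI.
  have mt := measurable_tprod measurable_incr (gate eps (gate_edges J l i)).
  exact: (mt measurableT _ (measurable_set1 0)).
exact: (emeasurable_fun_c_infty measurableT (measurable_tail J l i)).
Qed.

Lemma good_incr eps J l i w k q c : 0 < eps -> ~ bad eps J l i w -> q \in desc k.+1 i ->
  `|incr (l, k, q, c) w| <= eps.
Proof.
move=> e0 /not_orP[/eqP h1 /negP]; rewrite -ltNge => /ltW h2 hq.
have [kJ|Jk] := ltnP k J; first by apply: gate_neq0 h1; rewrite ?mem_gate_edges.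
by rewrite -(subnKC Jk); apply: tail_incr h2 _; rewrite ?(subnKC Jk) // ltW.
Qed.

Lemma incr_cov_sym e e' : incr_cov e e' = incr_cov e' e.
Proof.
have S i j : field_cov K i j = field_cov K j i.
  by rewrite /field_cov eq_sym; case: eqP => // _; rewrite (cf_sym cf).
case: e => [[[l k] q] c]; case: e' => [[[l' k'] q'] c'].
rewrite /incr_cov /bil /incr_lin !big_cons !big_nil /=.
rewrite (S (c', pt (l' + k').+1 q')) (S (c', pt (l' + k').+1 q')).
rewrite (S (c', pt (l' + k') (half q'))) (S (c', pt (l' + k') (half q'))).
by ring.
Qed.

(** A covariance of increments is a double difference of [K]. Smoothness at the finer edge gives
    b0^l2, once for each end of the coarser edge; dividing by the units leaves a0^-l1 (b0 / a0)^l2,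
    small when l2 is far beyond l1. *)
Lemma incr_cov_le J l1 k1 q1 c1 l2 k2 q2 c2 : (k1 < J)%N -> (k2 < J)%N ->
  `|incr_cov (l1, k1, q1, c1) (l2, k2, q2, c2)| <=
  2 * C / rho ^+ (2 * J) * a0 ^- l1 * (b0 / a0) ^+ l2.
Proof.
move=> h1 h2; have /andP[r0 r1] := cf_rho1 cf; have a00 := a0_gt0.
have C0 := cf_C cf; have b00 := cf_b0 cf.
have b1 : b0 <= 1 by rewrite ltW // (lt_trans (cf_a0 cf)) // a0_lt1.
have R0 : 0 <= 2 * C / rho ^+ (2 * J) * a0 ^- l1 * (b0 / a0) ^+ l2.
  by rewrite !mulr_ge0 ?exprn_ge0 ?invr_ge0 ?exprn_ge0 ?divr_ge0 //; exact: ltW.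
rewrite /incr_cov /bil /incr_lin !big_cons !big_nil /= /field_cov /=.
case: eqP => _; last by rewrite !(mulr0, addr0, normr0).
rewrite !addr0.
set p1 := pt _ q1; set p2 := pt _ (half q1).
have hn p : `|K (pt (l2 + k2).+1 q2) p - K (pt (l2 + k2) (half q2)) p| <= C * b0 ^+ l2.
  apply: (le_trans (cf_smooth cf p (near_half _ _))); rewrite ler_wpM2l // -addnS exprD.
  by rewrite ler_piMr ?exprn_ge0 ?exprn_ile1 // ltW.
have := hn p1; have := hn p2; rewrite !(cf_sym cf _ p1) !(cf_sym cf _ p2) => n2 n1.
rewrite (_ : _ + _ = (scl l1 k1)^-1 * (scl l2 k2)^-1 *
  ((K p1 (pt (l2 + k2).+1 q2) - K p1 (pt (l2 + k2) (half q2))) -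
   (K p2 (pt (l2 + k2).+1 q2) - K p2 (pt (l2 + k2) (half q2))))); last by ring.
have sl l k : (k < J)%N -> (scl l k)^-1 <= rho ^- J * a0 ^- l.
  move=> kJ; rewrite /scl invfM ler_wpM2r ?invr_ge0 ?exprn_ge0 ?(ltW a00) //.
  rewrite lef_pV2 ?posrE ?exprn_gt0 //.
  by apply: ler_wiXn2l; [exact: ltW|exact: ltW|exact: ltnW].
have sp l k : 0 <= (scl l k)^-1 by rewrite invr_ge0 ltW // scl_gt0.
rewrite normrM ger0_norm ?mulr_ge0 //.
apply: (le_via ((rho ^- J * a0 ^- l1) * (rho ^- J * a0 ^- l2) * (C * b0 ^+ l2 + C * b0 ^+ l2))).
  apply: ler_pM; rewrite ?mulr_ge0 //; first by apply: ler_pM; rewrite ?sl.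
  by apply: (le_trans (ler_normB _ _)); exact: lerD.
rewrite le_eqVlt; apply/orP; left; apply/eqP.
rewrite mul2n -addnn exprD expr_div_n; field.
by rewrite !expf_neq0 // gt_eqF.
Qed.

(** Choosing each scale beyond a threshold that depends on its predecessor alone is enough, because
    the threshold then works for all later scales too. *)
Lemma exists_scales L0 (B kap : R) : 0 <= B -> 0 < kap -> exists ls : nat -> nat,
  [/\ (L0 <= ls 0)%N, {homo ls : i j / (i < j)%N} &
    forall i j, (i < j)%N -> B * a0 ^- ls i * (b0 / a0) ^+ ls j <= kap].
Proof.
move=> B0 k0; have a00 := a0_gt0; have b00 := cf_b0 cf.
have r01 : 0 <= b0 / a0 < 1 by rewrite divr_ge0 ?(ltW a00) ?(ltW b00) //= ltr_pdivrMr // mul1r (cf_a0 cf).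
have step l : exists l', (l < l')%N /\ forall j, (l' <= j)%N -> B * a0 ^- l * (b0 / a0) ^+ j <= kap.
  have D0 : 0 < 1 + B * a0 ^- l by rewrite ltr_pwDl // mulr_ge0 // invr_ge0 exprn_ge0 // ltW.
  have [J hJ] := expr_small r01 (divr_gt0 k0 D0).
  exists (maxn l.+1 J); split; first by rewrite leq_maxl.
  move=> j; rewrite geq_max => /andP[_ /hJ]; rewrite ler_pdivlMr // => h.
  apply: le_trans h; rewrite mulrC ler_wpM2l ?exprn_ge0 ?lerDr //.
  by case/andP: r01.
have [nx hnx] := choice step.
pose ls := fix f i := if i is i'.+1 then nx (f i') else L0.
have lsS i : (ls i < ls i.+1)%N by have [] := hnx (ls i).
have lsh : {homo ls : i j / (i < j)%N} by apply: homo_ltn => // y x z; exact: ltn_trans.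
exists ls; split => // i j ij.
have [_ h] := hnx (ls i); apply: h.
rewrite -[nx (ls i)]/(ls i.+1); move: ij; rewrite leq_eqVlt => /orP[/eqP <- //|/lsh /ltnW //].
Qed.

(** At each of [m] scales the gate is open with mean at least [del], by [small_ball], and the gates
    are nearly independent. The budget [beta] is split in three: 1/m, the correlations, and the
    tails. The scales depend neither on the cube [q] nor on the finest level [N]. [J] is fixed
    before the scales, since their spacing depends on it. *)
Lemma bad_prob eps beta L0 : 0 < eps -> 0 < beta -> exists s J, path leq L0 s /\
  forall N, (forall l, l \in s -> (l <= N)%N) -> forall q,
  (P (\bigcap_(l in [set` s]) bad eps J l (iter (N - l) half q)) <= beta%:E)%E.
Proof.
move=> e0 be0; have E3 : 2 / 3 * beta + beta / 3 = beta by field.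
have t0 := tail_const_ge0.
have [del del0 [J0 hsb]] := small_ball e0.
have d20 : 0 < del ^+ 2 by rewrite exprn_gt0.
pose m := (Num.truncn (3 / (beta * del ^+ 2))).+1.
have hm : m%:R^-1 <= beta * del ^+ 2 / 3.
  rewrite -[leRHS]invrK lef_pV2 ?posrE ?invr_gt0 ?divr_gt0 ?mulr_gt0 ?ltr0n //.
  by rewrite invf_div ltW // truncnS_gt.
pose eta := beta * del ^+ 2 / 3.
have eta0 : 0 < eta by rewrite divr_gt0 // mulr_gt0.
have e2 : 0 < eps ^+ (2 * d) by rewrite exprn_gt0.
have [J1 hJ1] : exists J, forall j, (J <= j)%N -> kappa ^+ j <= beta / 3 * eps ^+ (2 * d) / (m%:R * (1 + tail_const)).
  apply: expr_small; first exact: kappa_itv.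
  by rewrite divr_gt0 ?mulr_gt0 ?divr_gt0 ?ltr0n // ltr_pwDl.
pose J := maxn J0 J1.
pose nE := size (gate_edges J 0 origin).
pose mm := mass (@Factor R unit tt (eps / 2) (eps / 2) 0).
have mm0 : 0 <= mm by exact: mass_ge0.
(* With this value the mixing error, sqrt kap times the masses of two gates of [nE] edges each, is
   at most [eta]. *)
pose kap := (eta / (1 + mm ^+ (nE + nE))) ^+ 2.
have mE0 : 0 < 1 + mm ^+ (nE + nE) by rewrite ltr_pwDl // exprn_ge0.
have kap0 : 0 < kap by rewrite exprn_gt0 // divr_gt0.
have [|ls [ls0 lsh lsk]] := @exists_scales L0 (2 * C / rho ^+ (2 * J)) kap _ kap0.
  by rewrite !mulr_ge0 ?(cf_C cf) ?invr_ge0 ?exprn_ge0 // ltW // rho_gt0.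
exists [seq ls i | i <- iota 0 m], J; split.
  have : forall a k, (L0 <= ls a)%N -> path leq L0 [seq ls i | i <- iota a k].
    move=> a k; elim: k a L0 {ls0} => // k IH a L h /=; rewrite h /=.
    by apply: IH; rewrite ltnW // lsh.
  exact.
move=> N sN q.
pose i_ (j : 'I_m) := iter (N - ls j) half q.
pose F (j : 'I_m) w := tprod incr (gate eps (gate_edges J (ls j) (i_ j))) w.
have ok (j : 'I_m) : forall q0, List.In q0 (gate eps (gate_edges J (ls j) (i_ j))) -> factor_ok q0.
  by move=> q0; exact: gate_ok.
have mF (j : 'I_m) : mbl (F j) by apply: measurable_tprod; exact: measurable_incr.
have F01 (j : 'I_m) w : 0 <= F j w <= 1 by apply: tprod_itv; exact: ok.
have sm := @second_moment R _ T P m F del eta mF F01 del0 _ (ltW eta0) _ (ltn0Sn _).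
pose Z := \bigcap_(j in [set: 'I_m]) [set x | F j x = 0%R].
pose V := [set w | exists j : 'I_m, ((eps ^+ (2 * d))%:E <= tail J (ls j) (i_ j) w)%E].
have mZ : measurable Z.
  apply: fin_bigcap_measurable => [|j _]; first exact: finite_finset.
  by rewrite -[X in measurable X]setTI; exact: (mF j measurableT _ (measurable_set1 0)).
have mv (j : 'I_m) : measurable [set w | ((eps ^+ (2 * d))%:E <= tail J (ls j) (i_ j) w)%E].
  rewrite -[X in measurable X]setTI.
  exact: (emeasurable_fun_c_infty measurableT (measurable_tail J _ _)).
have mI : measurable (\bigcap_(l in [set` [seq ls i | i <- iota 0 m]]) bad eps J l (iter (N - l) half q)).
  by apply: fin_bigcap_measurable => [|l _]; [exact: finite_seq|exact: measurable_bad].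
pose B (o : option 'I_m) := if o is Some j then [set w | ((eps ^+ (2 * d))%:E <= tail J (ls j) (i_ j) w)%E] else Z.
have mB o : measurable (B o) by case: o => [j|]; [exact: mv|].
apply: (le_via (\sum_(o <- None :: [seq Some j | j <- enum 'I_m]) P (B o))%E).
  apply: measure_list_cover => // w hw.
  have [[j hj]|hn] := pselect (V w).
    by exists (Some j) => //; right; apply/In_map; exists j => //; apply: mem_In; rewrite mem_enum.
  exists None; first by left.
  move=> j _ /=; have lj : ls j \in [seq ls i | i <- iota 0 m].
    by apply: map_f; rewrite mem_iota /=.
  by have [//|h] := hw (ls j) lj; case: hn; exists j.
rewrite big_cons big_map.
apply: (le_via ((2 / 3 * beta)%:E + (beta / 3)%:E)%E); last by rewrite -EFinD E3.
apply: leeD.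
  apply: (le_trans (sm _ _)).
  - move=> j; apply: hsb; exact: leq_maxl.
  - move=> j j' jj.
    have hl : (ls j < ls j')%N by exact: lsh.
    pose l1 := gate eps (gate_edges J (ls j) (i_ j)); pose l2 := gate eps (gate_edges J (ls j') (i_ j')).
    have := @gaussian_mixing_on R _ _ T P incr incr_cov kap l1 l2 gaussian_incr (ltW kap0).
    rewrite /l1 /l2 !fi_gate -/l1 -/l2 => /(_ _ _) H.
    have E : (fun w => F j w * F j' w) = tprod incr (l1 ++ l2).
      by apply/funext => w; rewrite /tprod big_cat.
    under eq_Rintegral do rewrite -[_ * _]/((fun w => F j w * F j' w) _) E.
    apply: (le_trans (H _ _)).
    + move=> e e' /gate_edgesP[k [q1 [c [-> kJ _]]]] /gate_edgesP[k' [q2 [c' [-> kJ' _]]]].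
      have hc := le_trans (incr_cov_le (ls j) q1 c (ls j') q2 c' kJ kJ') (lsk _ _ jj).
      split=> //; last by rewrite incr_cov_sym.
      by apply/eqP => -[ee _ _ _]; rewrite ee ltnn in hl.
    + by move=> q0 /In_cat[]; exact: gate_ok.
    rewrite big_cat /= /l1 /l2 !prod_mass_gate !size_gate_edges -/nE -/mm -exprD.
    rewrite /kap sqrtr_sqr ger0_norm; last exact: divr_ge0 (ltW eta0) (ltW mE0).
    by rewrite mulrAC ler_pdivrMr // ler_wpM2l ?(ltW eta0) // lerDr.
  rewrite lee_fin ler_pdivrMr // /eta.
  rewrite (_ : 2 / 3 * beta * del ^+ 2 = eta + eta); last by rewrite /eta; field.
  by rewrite lerD2r.
apply: (le_via (\sum_(j <- enum 'I_m) (beta / 3 / m%:R)%:E)%E); last first.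
  rewrite sumEFin lee_fin big_const_seq count_predT iter_addr_0 size_enum_ord -[_ *+ m]mulr_natr.
  by rewrite divfK // pnatr_eq0.
apply: lee_sum => j _ /=.
have := markov_ge0 P (measurable_tail J (ls j) (i_ j)) (tail_ge0 J _ _) (ltW e2).
move/le_trans/(_ (integral_tail J _ _)) => H.
set p := P _; have {}H : ((eps ^+ (2 * d))%:E * p <= (tail_const * kappa ^+ J)%:E)%E by exact: H.
have pf : p \is a fin_num by rewrite /p fin_num_measure.
move: H; rewrite -(fineK pf) -EFinM !lee_fin => H.
have := hJ1 J (leq_maxr _ _); have m0 : 0 < m%:R :> R by rewrite ltr0n.
rewrite ler_pdivlMr ?mulr_gt0 ?ltr_pwDl // => H2.
rewrite ler_pdivlMr // -(ler_pM2l e2) .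
have K0 : 0 <= kappa ^+ J by rewrite exprn_ge0 //; case/andP: kappa_itv.
apply: (le_via (tail_const * kappa ^+ J * m%:R)).
  by rewrite mulrA ler_wpM2r // ltW.
rewrite [leRHS]mulrC; apply: le_trans H2.
rewrite [leLHS](_ : _ = kappa ^+ J * m%:R * tail_const); last by ring.
by rewrite -mulrA ler_wpM2l // ler_wpM2l ?(ltW m0) // lerDr.
Qed.

(** * Resampling one value, random targets and their covering *)

Section covering.
Variable z : 'I_d -> R.
Local Notation x0 := (pt 0 origin : 'I_n -> R).
Local Notation v0 := (K x0 x0).

(** The regression coefficient: X c x - gain x * X c x0 is uncorrelated with X c x0. *)
Definition gain x : R := K x x0 / v0.

Lemma gain_ge x : 2^-1 <= gain x.
Proof.
have v := cf_var cf; rewrite /gain ler_pdivlMr //.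
by have := cf_pos cf x; lra.
Qed.

(* [target c x w] is the value that a fresh copy of [X c x0] has to take for the mixture
   [X c x w + gain x * (X c x0 w' - X c x0 w)] to hit [z c]. *)
Definition target c x w : R := (z c - X c x w) / gain x + X c x0 w.

(** In each step of the chaining the increment of the field counts twice, as 1 / gain <= 2, and the
    variation of [gain] once; 1 / (1 - rho) sums the steps. *)
Definition osc_const : R := 3 / (1 - rho).

Lemma osc_const_gt0 : 0 < osc_const.
Proof. by have /andP[_ r1] := cf_rho1 cf; rewrite divr_gt0 // subr_gt0. Qed.

(** The term X c x0 cancels in differences of targets. The variation of [gain] contributes 4 A C /
    v0 b0^l, absorbed by eps a0^l at high levels because b0 < a0. *)
Lemma target_osc l i w (eps A : R) c : 0 <= eps -> 0 <= A ->
  (forall k q, q \in desc k i -> `|z c - X c (pt (l + k) q) w| <= A) ->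
  (forall k q, q \in desc k.+1 i -> `|incr (l, k, q, c) w| <= eps) ->
  4 * A * C / v0 * b0 ^+ l <= eps * a0 ^+ l ->
  forall k q, q \in desc k i ->
  `|target c (pt (l + k) q) w - target c (pt l i) w| <= osc_const * eps * a0 ^+ l.
Proof.
move=> e0 A0 hA he hb k q hq; have /andP[r0 r1] := cf_rho1 cf.
have a00 := a0_gt0; have b00 := cf_b0 cf; have v := cf_var cf; have C0 := cf_C cf.
rewrite (_ : osc_const * eps * a0 ^+ l = 3 * eps * a0 ^+ l / (1 - rho)); last by rewrite /osc_const; ring.
apply: (@chain _ _ (fun x => target c x w)) hq; rewrite ?mulr_ge0 ?exprn_ge0 ?(ltW a00) ?(ltW r0) //.
move=> {k q} k q hq.
have hq' : half q \in desc k i by move: hq; rewrite !mem_desc iterSr.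
set p := pt _ q; set p' := pt _ (half q).
have g1 := gain_ge p; have g2 := gain_ge p'.
have gp1 : 0 < gain p by apply: lt_le_trans g1; rewrite invr_gt0.
have gp2 : 0 < gain p' by apply: lt_le_trans g2; rewrite invr_gt0.
have i1 : (gain p)^-1 <= 2 by rewrite -[leRHS]invrK lef_pV2 ?posrE ?invr_gt0.
have i2 : (gain p')^-1 <= 2 by rewrite -[leRHS]invrK lef_pV2 ?posrE ?invr_gt0.
have -> : target c p w - target c p' w =
    (X c p' w - X c p w) / gain p + (z c - X c p' w) * ((gain p)^-1 * (gain p')^-1 * (gain p' - gain p)).
  by rewrite /target; field; rewrite !gt_eqF.
have H1 : `|X c p' w - X c p w| <= eps * (rho ^+ k * a0 ^+ l).
  have := he k q hq; rewrite incrE normrM normfV (gtr0_norm (scl_gt0 _ _)).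
  by rewrite ler_pdivrMr ?scl_gt0 // distrC.
have H2 : `|gain p' - gain p| <= C / v0 * (b0 ^+ l * rho ^+ k).
  rewrite /gain -mulrBl normrM normfV (gtr0_norm v) mulrAC ler_wpM2r ?invr_ge0 ?(ltW v) //.
  rewrite distrC; apply: (le_trans (cf_smooth cf _ (near_half _ _))); rewrite ler_wpM2l //.
  have b1 : b0 <= rho.
    rewrite ltW // (lt_trans (cf_a0 cf)) // (lt_le_trans (cf_rho cf)) // expr2 ler_piMr //; exact: ltW.
  rewrite -addnS exprD ler_wpM2l ?exprn_ge0 ?(ltW b00) //.
  apply: (le_via (b0 ^+ k)); last by apply: lerXn2r => //; rewrite nnegrE ltW.
  by rewrite exprS ler_piMl ?exprn_ge0 ?(ltW b00) // (le_trans b1) // ltW.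
apply: (le_trans (ler_normD _ _)); rewrite !normrM !normfV (gtr0_norm gp1) (gtr0_norm gp2).
rewrite (_ : 3 * eps * a0 ^+ l * rho ^+ k = eps * (rho ^+ k * a0 ^+ l) * 2 + eps * a0 ^+ l * rho ^+ k); last by ring.
apply: lerD; first by apply: ler_pM; rewrite ?invr_ge0 ?(ltW gp1).
apply: (le_via (A * (2 * 2 * (C / v0 * (b0 ^+ l * rho ^+ k))))).
  apply: ler_pM => //; rewrite ?mulr_ge0 ?invr_ge0 ?(ltW gp1) ?(ltW gp2) //; first exact: hA.
  apply: ler_pM => //; first by rewrite mulr_ge0 // invr_ge0 ltW.
  by apply: ler_pM; rewrite ?invr_ge0 ?(ltW gp1) ?(ltW gp2).
rewrite (_ : A * _ = 4 * A * C / v0 * b0 ^+ l * rho ^+ k); last by ring.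
by rewrite ler_wpM2r // exprn_ge0 // ltW.
Qed.

(** A bound on the d-dimensional content by finitely many sup-norm balls, written as centres with
    radii. *)
Definition covered (S : set ('I_d -> R)) (B : R) := exists bs : seq (('I_d -> R) * R),
  [/\ forall b, List.In b bs -> 0 < b.2,
      forall y, S y -> exists2 b, List.In b bs & forall c, `|y c - b.1 c| <= b.2 &
      \sum_(b <- bs) b.2 ^+ d <= B].

Lemma covered_list I (s : seq I) (S : set ('I_d -> R)) (S' : I -> set ('I_d -> R)) (B : I -> R) :
  (forall y, S y -> exists2 i, List.In i s & S' i y) ->
  (forall i, List.In i s -> covered (S' i) (B i)) -> covered S (\sum_(i <- s) B i).
Proof.
elim: s S => [|i s IH] S hS hc.
  by exists [::]; split=> [//|y /hS [] //|]; rewrite !big_nil.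
have [bs [b1 b2 b3]] := hc i (or_introl erefl).
have [bs' [b1' b2' b3']] := IH (\bigcup_(j in [set j | List.In j s]) S' j)
  (fun y => fun '(ex_intro2 j js hj) => ex_intro2 _ _ j js hj) (fun j js => hc j (or_intror js)).
exists (bs ++ bs'); split.
- by move=> b /In_cat[/b1|/b1'].
- move=> y /hS [j [<-|js] hy].
    by have [b hb hb'] := b2 y hy; exists b => //; apply/In_cat; left.
  have [|b hb hb'] := b2' y; first by exists j.
  by exists b => //; apply/In_cat; right.
- by rewrite big_cat big_cons /= lerD.
Qed.

Lemma covered_le S B B' : B <= B' -> covered S B -> covered S B'.
Proof. by move=> BB [bs [b1 b2 b3]]; exists bs; split => //; exact: le_trans BB. Qed.

Definition targets l i w : set ('I_d -> R) :=
  [set y | exists k q, q \in desc k i /\ y = fun c => target c (pt (l + k) q) w].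

(** A point of depth [k], which may be less than [j], is first rewritten by [desc_refine] as a
    corner of depth k + j. *)
Lemma targets_split l j i w y : targets l i w y ->
  exists2 i', List.In i' (desc j i) & targets (l + j) i' w y.
Proof.
move=> [k [q [hq ->]]].
have [q' hq' e] := @desc_refine R n l k j i q hq.
exists (iter k half q').
  apply: mem_In; rewrite mem_desc -iterD addnC; by rewrite mem_desc in hq'.
exists k, q'; split; first by rewrite mem_desc.
by rewrite -addnA [(j + k)%N]addnC e.
Qed.

(** Criticality enters here: the radius is a multiple of eps a0^l, and (a0^l)^d = 2^(-n l), so one
    ball costs eps^d times the volume of the cube. *)
Lemma covered_cube l i w (eps A : R) : 0 < eps -> 0 <= A ->
  (forall c k q, q \in desc k i -> `|z c - X c (pt (l + k) q) w| <= A) ->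
  (forall c k q, q \in desc k.+1 i -> `|incr (l, k, q, c) w| <= eps) ->
  4 * A * C / v0 * b0 ^+ l <= eps * a0 ^+ l ->
  covered (targets l i w) ((osc_const * eps) ^+ d * 2 ^- (n * l)).
Proof.
move=> e0 A0 hA he hb.
have oe : 0 < osc_const * eps by exact: mulr_gt0 osc_const_gt0 e0.
exists [:: (fun c => target c (pt l i) w, osc_const * eps * a0 ^+ l)]; split.
- by move=> b /= [<-|//] /=; apply: mulr_gt0 oe _; rewrite exprn_gt0 // a0_gt0.
- move=> y [k [q [hq ->]]]; exists (fun c => target c (pt l i) w, osc_const * eps * a0 ^+ l); first by left.
  by move=> c; exact: (@target_osc l i w eps A c (ltW e0) A0 (hA c) (he c) hb k q hq).
- have h : (a0 ^+ l) ^+ d = 2 ^- (n * l) by rewrite -exprM [(l * d)%N]mulnC exprM (cf_critical cf) exprVn -exprM.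
  by rewrite big_seq1 /= exprMn h.
Qed.

(** Stopping at the first good scale. At the next scale of the list, a good subcube is covered by
    one ball and a bad one is handed to the induction. The costs of the good cubes add up to at most
    the share of the volume, and a cube of the finest level is paid for only if all its ancestors at
    the listed scales are bad. *)
Lemma cover_rec N (eps : R) J (A : R) w L0 (rad : idx -> R) : 0 < eps -> 0 <= A ->
  (forall c k q, q \in desc k origin -> `|z c - X c (pt k q) w| <= A) ->
  (forall l, (L0 <= l)%N -> 4 * A * C / v0 * b0 ^+ l <= eps * a0 ^+ l) ->
  (forall q, q \in desc N origin -> covered (targets N q w) (rad q)) ->
  (forall q, 0 <= rad q) ->
  forall s l i, (L0 <= l)%N -> path leq l s -> (forall l', l' \in l :: s -> (l' <= N)%N) ->
  i \in desc l origin ->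
  covered (targets l i w) ((osc_const * eps) ^+ d * 2 ^- (n * l) +
    \sum_(q <- desc (N - l) i) \1_(\bigcap_(l' in [set` s]) bad eps J l' (iter (N - l') half q)) w * rad q).
Proof.
move=> e0 A0 hA hb hN r0.
have oe : 0 <= (osc_const * eps) ^+ d by apply: exprn_ge0; apply: ltW; exact: mulr_gt0 osc_const_gt0 e0.
elim=> [|l1 s IH] l i Ll hs sN hi.
  have lN : (l <= N)%N by apply: sN; rewrite mem_head.
  apply: (@covered_le _ (\sum_(q <- desc (N - l) i) rad q)).
    rewrite -[leLHS]add0r; apply: lerD.
      by apply: mulr_ge0 oe _; rewrite invr_ge0 exprn_ge0.
    by apply: ler_sum => q _; rewrite set_nil bigcap_set0 indicT mul1r.
  apply: (@covered_list _ _ _ (fun q => targets (l + (N - l)) q w)).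
    by move=> y /(targets_split (N - l)).
  rewrite subnKC // => q /mem_In'; rewrite mem_desc => qi; apply: hN.
  by rewrite mem_desc -{1}(subnKC lN) iterD (eqP qi) -mem_desc.
move: hs => /= /andP[ll1 hs].
have l1N : (l1 <= N)%N by apply: sN; rewrite !inE eqxx orbT.
rewrite (_ : (N - l)%N = (l1 - l) + (N - l1))%N; last by rewrite addnC addnBA // subnK.
rewrite sum_desc.
apply: (@covered_le _ (\sum_(i' <- desc (l1 - l) i) ((osc_const * eps) ^+ d * 2 ^- (n * l1) +
   \sum_(q <- desc (N - l1) i') \1_(\bigcap_(l' in [set` l1 :: s]) bad eps J l' (iter (N - l') half q)) w * rad q))).
  rewrite big_split /= lerD2r big_const_seq count_predT iter_addr_0 size_desc.
  rewrite -[leLHS]mulr_natr !natrX -mulrA -exprM ler_wpM2l //.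
  rewrite -{1}(subnKC ll1) mulnDr exprD invfM -mulrA mulVf ?mulr1 // expf_neq0 //.
apply: (@covered_list _ _ _ (fun q => targets (l + (l1 - l)) q w)).
  by move=> y /(targets_split (l1 - l)).
rewrite subnKC // => i' /mem_In'; rewrite mem_desc => hi'.
have hi'' : i' \in desc l1 origin.
  by rewrite mem_desc -(subnKC ll1) iterD (eqP hi') -mem_desc.
have Ll1 : (L0 <= l1)%N by exact: leq_trans ll1.
have [hbad|hgood] := pselect (bad eps J l1 i' w).
  apply: covered_le (IH l1 i' Ll1 hs _ hi''); last by move=> l' hl'; apply: sN; rewrite inE hl' orbT.
  rewrite lerD2l big_seq [leRHS]big_seq; apply: ler_sum => q hq.
  rewrite ler_wpM2r // !indicE ler_nat; case: (boolP (w \in _)) => // /set_mem hw.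
  suff -> : w \in \bigcap_(l' in [set` l1 :: s]) bad eps J l' (iter (N - l') half q) by [].
  apply/mem_set => l' /=; rewrite inE => /orP[/eqP ->|l's]; last exact: hw.
  by move: hq; rewrite mem_desc => /eqP ->.
apply: (@covered_le _ ((osc_const * eps) ^+ d * 2 ^- (n * l1))).
  by rewrite lerDl; apply: sumr_ge0 => q _; rewrite mulr_ge0.
apply: (@covered_cube _ _ _ _ A) => //; last exact: hb.
  move=> c k q hq; apply: hA.
  by move: hq; rewrite mem_desc => /eqP h; rewrite mem_desc iterD h -mem_desc.
by move=> c k q hq; apply: (@good_incr eps J l1 i').
Qed.

Definition hit_box (a : 'I_d -> R) (r : R) : set T := [set w | forall c, `|X c x0 w - a c| <= r].

Lemma measurable_hit_box a r : measurable (hit_box a r).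
Proof.
rewrite (_ : hit_box a r = \bigcap_(c in [set: 'I_d]) [set w | `|X c x0 w - a c| <= r]); last first.
  by apply/seteqP; split => w h; [move=> c _; exact: h|move=> c; exact: h].
apply: fin_bigcap_measurable => [|c _]; first exact: finite_finset.
have mf : mbl (fun w => `|X c x0 w - a c|).
  by have := measurable_field c x0 => ?; mauto.
rewrite (_ : [set w | _] = (fun w => `|X c x0 w - a c|) @^-1` `]-oo, r]); last first.
  by apply/seteqP; split => w /=; rewrite in_itv.
by rewrite -[X in measurable X]setTI; exact: mf.
Qed.

(** The indicator of the box is below the product of trapezoids bounded by [gaussian_density]. *)
Lemma box_prob a r : 0 < r -> (P (hit_box a r) <= ((density_const v0 * r) ^+ d)%:E)%E.
Proof.
move=> r0; have v := cf_var cf.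
have gZ : gaussian P (fun c => X c x0) (fun c c' => if c == c' then v0 else 0).
  have := gaussian_lin (fun c => [:: (1, (c, x0))]) (cf_gaussian cf).
  move/eq_gaussian; apply=> [c w|c c']; first by rewrite /lin big_seq1 mul1r.
  by rewrite /bil !big_seq1 !mul1r.
have := gaussian_density a gZ v (fun _ _ => erefl) r0 (enum_uniq 'I_d).
rewrite size_enum_ord -lee_fin; apply: le_trans.
set l := [seq _ | _ <- _].
have ok q : List.In q l -> factor_ok q by move=> /In_map[c _ ->]; split; rewrite /= ?ltW.
have mX c : mbl (X c x0) by exact: measurable_field.
have mt := measurable_tprod mX l.
rewrite -integral_Rintegral; last by apply: (integrable_by 1) => // w; exact: tprod_itvN.
rewrite -[X in P X]setIT -integral_indic //; last exact: measurable_hit_box.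
apply: ge0_le_integral => //.
- by apply/measurable_EFinP; apply: measurable_indic; exact: measurable_hit_box.
- by mauto.
move=> w _; rewrite lee_fin indicE; case: (boolP (w \in _)) => [|_]; last first.
  by have /andP[] := tprod_itv (fun c => X c x0) w ok.
rewrite inE => hw; rewrite /tprod /l big_map big1 // => c _ /=.
exact: trap1 (ltW r0) r0 (hw c).
Qed.

Definition mixture c x (u : T * T) : R := X c x u.1 + gain x * (X c x0 u.2 - X c x0 u.1).

Lemma mixtureE c x u : mixture c x u - z c = gain x * (X c x0 u.2 - target c x u.1).
Proof.
have g : 0 < gain x by apply: lt_le_trans (gain_ge x); rewrite invr_gt0.
by rewrite /mixture /target; field; rewrite gt_eqF.
Qed.

(** The regression residual is uncorrelated with the value at x0, so replacing that value by an
    independent copy leaves all covariances unchanged. *)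
Lemma gaussian_mixture : gaussian (P \x P)%E (fun i : site => mixture i.1 i.2) (field_cov K).
Proof.
have v := cf_var cf.
have := gaussian_lin (fun i : site => [:: (1, inl i); (gain i.2, inr (i.1, x0)); (- gain i.2, inl (i.1, x0))])
  (gaussian_sum (cf_gaussian cf) (cf_gaussian cf)).
move/eq_gaussian; apply=> [[c x] u|[c x] [c' y]].
  by rewrite /lin !big_cons big_nil /= addr0 /mixture; ring.
rewrite /bil !big_cons !big_nil /= /field_cov /=; case: eqP => _; last by rewrite !(mulr0, addr0).
rewrite (cf_sym cf x0 y) /gain; field.
by rewrite gt_eqF.
Qed.

Section approximate_hits.
Variables (d' : measure_display) (T' : measurableType d') (Y : 'I_d -> ('I_n -> R) -> T' -> R).
Hypothesis mY : forall c x, mbl (Y c x).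

Definition hits_at L (r : R) : set T' :=
  [set u | exists2 q, q \in desc L origin & forall c, `|Y c (pt L q) u - z c| <= r].
Definition hits r : set T' := \bigcup_L hits_at L r.
(** A hit up to every precision 1/(m+1) at some dyadic point: a measurable event depending on
    countably many variables. For a continuous path it amounts to a hit on a closed cube. *)
Definition approx_hit : set T' := \bigcap_m hits m.+1%:R^-1.

Lemma measurable_hits_at L r : measurable (hits_at L r).
Proof.
rewrite (_ : hits_at L r = \bigcup_(q in [set` desc L origin]) \bigcap_(c in [set: 'I_d])
    [set u | `|Y c (pt L q) u - z c| <= r]); last first.
  apply/seteqP; split => u [q hq h]; exists q => //; first by move=> c _; exact: h.
  by move=> c; exact: h.
apply: fin_bigcup_measurable => [|q _]; first exact: finite_seq.
apply: fin_bigcap_measurable => [|c _]; first exact: finite_finset.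
have mf : mbl (fun u => `|Y c (pt L q) u - z c|).
  by mauto.
rewrite (_ : [set u | _] = (fun u => `|Y c (pt L q) u - z c|) @^-1` `]-oo, r]); last first.
  by apply/seteqP; split => u /=; rewrite in_itv.
by rewrite -[X in measurable X]setTI; exact: mf.
Qed.

Lemma measurable_hits r : measurable (hits r).
Proof. by apply: bigcupT_measurable => L; exact: measurable_hits_at. Qed.

Lemma measurable_approx_hit : measurable approx_hit.
Proof. by apply: bigcapT_measurable => m; exact: measurable_hits. Qed.

Lemma hits_at_mono r : {homo hits_at ^~ r : L L' / (L <= L')%N >-> (L <= L')%O}.
Proof.
move=> L L' LL; apply/subsetPset => u [q hq h].
have [q' hq' e] := @desc_refine R n 0 L (L' - L) origin q hq.
by exists q'; rewrite -(subnKC LL) // => c; rewrite -[(L + _)%N]add0n e add0n.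
Qed.

Lemma hits_mono r r' : r <= r' -> hits r `<=` hits r'.
Proof. by move=> rr u [L _ [q hq h]]; exists L => //; exists q => // c; exact: le_trans (h c) rr. Qed.
End approximate_hits.

(** Inclusion and exclusion, one factor at a time: multiplying out 1 - [tprod] leaves products of
    trapezoids, whose expectations depend on the covariance alone. *)
Lemma same_law_miss (I : Type) d1 (T1 : measurableType d1) (P1 : probability T1 R)
    d2 (T2 : measurableType d2) (P2 : probability T2 R) (Y1 : I -> T1 -> R) (Y2 : I -> T2 -> R) G
    (ls : seq (seq (factor I))) l' :
  gaussian P1 Y1 G -> gaussian P2 Y2 G ->
  (forall l q, List.In l ls -> List.In q l -> factor_ok q) -> (forall q, List.In q l' -> factor_ok q) ->
  \int[P1]_u ((\prod_(l <- ls) (1 - tprod Y1 l u)) * tprod Y1 l' u) =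
  \int[P2]_u ((\prod_(l <- ls) (1 - tprod Y2 l u)) * tprod Y2 l' u).
Proof.
move=> g1 g2; elim: ls l' => [|l ls IH] l' hls hl'.
  under eq_Rintegral do rewrite big_nil mul1r; under [RHS]eq_Rintegral do rewrite big_nil mul1r.
  exact: gaussian_same_law g1 g2 hl'.
have hl q : List.In q l -> factor_ok q by apply: hls; left.
have hll q : List.In q (l' ++ l) -> factor_ok q by move=> /In_cat[/hl'|/hl].
have hls' l0 q : List.In l0 ls -> List.In q l0 -> factor_ok q by move=> h; apply: hls; right.
have step d0 (T0 : measurableType d0) (P0 : probability T0 R) (Y : I -> T0 -> R) : gaussian P0 Y G ->
  \int[P0]_u ((\prod_(l <- l :: ls) (1 - tprod Y l u)) * tprod Y l' u) =
  \int[P0]_u ((\prod_(l <- ls) (1 - tprod Y l u)) * tprod Y l' u) -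
  \int[P0]_u ((\prod_(l <- ls) (1 - tprod Y l u)) * tprod Y (l' ++ l) u).
  move=> [mY _].
  have mp : mbl (fun u => \prod_(l <- ls) (1 - tprod Y l u)).
    by apply: measurable_prod_list => l0; apply: measurable_funB => //; exact: measurable_tprod.
  have bp u : `|\prod_(l <- ls) (1 - tprod Y l u)| <= 1.
    elim: (ls) hls' => [|l0 s IHs] h; first by rewrite big_nil normr1.
    rewrite big_cons normrM mulr_ile1 //; last by apply: IHs => l1 q h1; apply: h; right.
    have /andP[t0 t1] := tprod_itv Y u (fun q hq => h l0 q (or_introl erefl) hq).
    by rewrite ger0_norm ?subr_ge0 // lerBlDr lerDl.
  have ib l0 : (forall q, List.In q l0 -> factor_ok q) ->
      itg P0 (fun u => (\prod_(l <- ls) (1 - tprod Y l u)) * tprod Y l0 u).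
    move=> h; apply: (integrable_by 1) => [|u].
      by apply: measurable_funM => //; exact: measurable_tprod.
    by rewrite normrM mulr_ile1 // tprod_itvN.
  rewrite -RintegralB //; try exact: ib.
  apply: eq_Rintegral => u _; rewrite big_cons /= /tprod big_cat /=.
  by ring.
by rewrite (step _ _ _ _ g1) (step _ _ _ _ g2) !IH.
Qed.

(** 1 minus the product of the complements of the trapezoids lies between the indicators of a hit
    within [r] and of a hit within 2r, the foot of the trapezoid. *)
Lemma hits_at_law L r : 0 < r -> (P (hits_at X L r) <= (P \x P)%E (hits_at mixture L (2 * r)))%E.
Proof.
move=> r0.
pose l_ (q : idx) : seq (factor site) := [seq Factor (c, pt L q) r r (z c) | c <- enum 'I_d].
have ok q f : List.In f (l_ q) -> factor_ok f by move=> /In_map[c _ ->]; split; rewrite /= ?ltW.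
pose miss T' (Y : site -> T' -> R) u := \prod_(l <- [seq l_ q | q <- desc L origin]) (1 - tprod Y l u).
have tE T' (Y : site -> T' -> R) u q : tprod Y (l_ q) u = \prod_(c <- enum 'I_d) trap r r (Y (c, pt L q) u - z c).
  by rewrite /tprod big_map.
pose X' (i : site) := X i.1 i.2; pose V' (i : site) := mixture i.1 i.2.
have E : \int[P]_u miss _ X' u = \int[(P \x P)%E]_u miss _ V' u.
  have := @same_law_miss _ _ _ P _ _ (P \x P)%E X' V' (field_cov K) [seq l_ q | q <- desc L origin] [::]
    (cf_gaussian cf) gaussian_mixture.
  have tn T' (Y : site -> T' -> R) u : tprod Y [::] u = 1 by rewrite /tprod big_nil.
  move=> H; rewrite -[LHS]/(\int[P]_u (miss _ X' u)).
  transitivity (\int[P]_u (miss _ X' u * tprod X' [::] u)).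
    by apply: eq_Rintegral => u _; rewrite tn mulr1.
  rewrite H //; last by move=> l q /In_map[q' _ ->]; exact: ok.
  by apply: eq_Rintegral => u _; rewrite tn mulr1.
have mmiss d' (T' : measurableType d') (Y : site -> T' -> R) : (forall i, mbl (Y i)) ->
    mbl (miss _ Y).
  by move=> mY; apply: measurable_prod_list => l0; apply: measurable_funB => //; exact: measurable_tprod.
have m01 T' (Y : site -> T' -> R) u : 0 <= miss _ Y u <= 1.
  rewrite /miss big_map; elim: (desc L origin) => [|q s IHs]; first by rewrite big_nil ler01 lexx.
  rewrite big_cons; have /andP[t0 t1] := tprod_itv Y u (@ok q); have /andP[s0 s1] := IHs.
  by rewrite mulr_ge0 ?subr_ge0 //= mulr_ile1 ?subr_ge0 // lerBlDr lerDl.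
have mN T' (Y : site -> T' -> R) u : `|miss _ Y u| <= 1 by have /andP[a b] := m01 _ Y u; rewrite ger0_norm.
have mX c x := measurable_field c x.
have mV c x : mbl (mixture c x).
  by have [m _] := gaussian_mixture; exact: (m (c, x)).
have iX : itg P (miss _ X').
  by apply: (integrable_by 1) => //; apply: mmiss => -[c x]; exact: mX.
have iV : itg (P \x P)%E (miss _ V').
  by apply: (integrable_by 1) => //; apply: mmiss => -[c x]; exact: mV.
have mhX := measurable_hits_at mX L r; have mhV := measurable_hits_at mV L (2 * r).
have hX u : hits_at X L r u -> miss _ X' u = 0.
  move=> [q hq h]; rewrite /miss big_map; apply/eqP; rewrite prodf_seq_eq0; apply/hasP; exists q => //=.
  rewrite tE subr_eq0 eq_sym; apply/eqP; rewrite big1 // => c _.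
  exact: trap1 (ltW r0) r0 (h c).
have hV u : ~ hits_at mixture L (2 * r) u -> miss _ V' u = 1.
  move=> hn; rewrite /miss big_map big_seq big1 // => q hq.
  rewrite tE (_ : \prod_(c <- _) _ = 0) ?subr0 //.
  have [c hc] : exists c, 2 * r < `|mixture c (pt L q) u - z c|.
    apply: contrapT => hc; apply: hn; exists q => // c; rewrite leNgt; apply/negP => h.
    by apply: hc; exists c.
  apply/eqP; rewrite prodf_seq_eq0; apply/hasP; exists c; rewrite ?mem_enum //=.
  by apply/eqP; apply: trap0; rewrite ?ltW //; lra.
have a1 : (P (hits_at X L r) <= (1 - \int[P]_u miss _ X' u)%:E)%E.
  have -> : 1 - \int[P]_u miss _ X' u = \int[P]_u (1 - miss _ X' u).
    rewrite RintegralB //; last by apply: (integrable_by 1) => // u; rewrite normr1.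
    by rewrite Rintegral_cst //= probability_setT mulr1.
  have m1 : mbl (fun u => 1 - miss _ X' u).
    by apply: measurable_funB => //; apply: mmiss => -[c x]; exact: mX.
  rewrite -integral_Rintegral; last first.
    apply: (integrable_by 1) => // u; have /andP[s0 s1] := m01 _ X' u.
    by rewrite ger0_norm ?subr_ge0 // lerBlDr lerDl.
  rewrite -[X in P X]setIT -integral_indic //.
  apply: ge0_le_integral => //.
  - by mauto.
  - by mauto.
  move=> u _; rewrite lee_fin indicE; case: (boolP (u \in _)) => [|_]; last first.
    by have /andP[s0 s1] := m01 _ X' u; rewrite subr_ge0.
  by rewrite inE => /hX ->; rewrite subr0.
have a2 : ((1 - \int[(P \x P)%E]_u miss _ V' u)%:E <= (P \x P)%E (hits_at mixture L (2 * r)))%E.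
  have -> : 1 - \int[(P \x P)%E]_u miss _ V' u = \int[(P \x P)%E]_u (1 - miss _ V' u).
    rewrite RintegralB //; last by apply: (integrable_by 1) => // u; rewrite normr1.
    by rewrite Rintegral_cst //= probability_setT mulr1.
  have m1 : mbl (fun u => 1 - miss _ V' u).
    by apply: measurable_funB => //; apply: mmiss => -[c x]; exact: mV.
  rewrite -integral_Rintegral; last first.
    apply: (integrable_by 1) => // u; have /andP[s0 s1] := m01 _ V' u.
    by rewrite ger0_norm ?subr_ge0 // lerBlDr lerDl.
  rewrite -[X in (_ <= (P \x P)%E X)%E]setIT -integral_indic //.
  apply: ge0_le_integral => //.
  - by move=> u _; rewrite lee_fin; have /andP[s0 s1] := m01 _ V' u; rewrite subr_ge0.
  - by mauto.
  - by mauto.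
  move=> u _; rewrite lee_fin indicE; case: (boolP (u \in _)) => [_|].
    by have /andP[s0 s1] := m01 _ V' u; rewrite lerBlDr lerDl.
  by move=> /negP; rewrite inE => /hV ->; rewrite subrr.
by apply: (le_trans a1); rewrite E.
Qed.

Lemma hits_law r : 0 < r -> (P (hits X r) <= (P \x P)%E (hits mixture (2 * r)))%E.
Proof.
move=> r0; have mX c x := measurable_field c x.
have mV c x : mbl (mixture c x).
  by have [m _] := gaussian_mixture; exact: (m (c, x)).
have c1 := @nondecreasing_cvg_mu _ _ _ P (hits_at X ^~ r) (fun L => measurable_hits_at mX L r)
  (measurable_hits mX r) (hits_at_mono X r).
rewrite -(cvg_lim _ c1) //; apply: lime_le; first by apply/cvg_ex; exists (P (hits X r)).
apply: nearW => L /=; apply: (le_trans (hits_at_law L r0)).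
apply: le_measure; rewrite ?inE; [exact: measurable_hits_at|exact: measurable_hits|].
by move=> u h; exists L.
Qed.

(** The factor 2 lost in passing between the two laws disappears in the intersection over all
    precisions. *)
Lemma approx_hit_law : (P (approx_hit X) <= (P \x P)%E (approx_hit mixture))%E.
Proof.
have mX c x := measurable_field c x.
have mV c x : mbl (mixture c x).
  by have [m _] := gaussian_mixture; exact: (m (c, x)).
pose H m := hits mixture (2 / m.+1%:R).
have mH m : measurable (H m) by exact: measurable_hits.
have iH : \bigcap_m H m = approx_hit mixture.
  apply/seteqP; split => u h m _.
    (* Precision number 2m+1 is 2 / (2m+2) = 1 / (m+1). *)
    apply: (hits_mono _ (h (2 * m).+1 I)); rewrite ler_pdivrMr ?ltr0n //.
    rewrite mulrC ler_pdivlMr ?ltr0n // -natrM ler_nat; lia.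
  by apply: (hits_mono _ (h m I)); rewrite ler_peMl ?invr_ge0 // ler1n.
have := @nonincreasing_cvg_mu _ _ _ (P \x P)%E H.
rewrite iH => /(_ _ mH (measurable_approx_hit mV)) c1.
have h0 : ((P \x P)%E (H 0%N) < +oo)%E.
  by apply: (@le_lt_trans _ _ 1%E); rewrite ?probability_le1 ?ltry.
have h1 : {homo H : m m' / (m <= m')%N >-> (m' <= m)%O}.
  move=> m m' mm; apply/subsetPset; apply: hits_mono.
  by rewrite ler_wpM2l // lef_pV2 ?posrE // ler_nat.
have {h0 h1}c1 := c1 h0 h1.
rewrite -(cvg_lim _ c1) //; apply: lime_ge; first by apply/cvg_ex; eexists; exact: c1.
apply: nearW => m /=; apply: le_trans (hits_law _); last by rewrite invr_gt0.
apply: le_measure; rewrite ?inE; [exact: measurable_approx_hit|exact: measurable_hits|].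
by move=> u h; exact: h.
Qed.

Lemma box_gap (bs : seq (('I_d -> R) * R)) (y : 'I_d -> R) :
  (forall b, List.In b bs -> exists c, b.2 < `|y c - b.1 c|) ->
  exists2 e, 0 < e & forall b, List.In b bs -> exists c, b.2 + e < `|y c - b.1 c|.
Proof.
elim: bs => [|b bs IH] h; first by exists 1.
have [c hc] := h b (or_introl erefl).
have [e e0 he] := IH (fun b hb => h b (or_intror hb)).
exists (Num.min e ((`|y c - b.1 c| - b.2) / 2)).
  by rewrite lt_min e0 /= divr_gt0 // subr_gt0.
move=> b' /= [<-|/he [c' hc']]; [exists c|exists c'].
  apply: (@le_lt_trans _ _ (b.2 + (`|y c - b.1 c| - b.2) / 2)); last by lra.
  by rewrite lerD2l ge_min lexx orbT.
by apply: le_lt_trans hc'; rewrite lerD2l ge_min lexx.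
Qed.

(** For fixed [w], the mixture is close to [z] at a point only if the fresh value is close to the
    target there, since [gain] is at least 1/2. Approximate hits therefore force the fresh value
    into the closed balls of the cover: [box_gap] excludes a positive distance to all of them. *)
Lemma section_prob B w : covered (targets 0 origin w) B ->
  (P (xsection (approx_hit mixture) w) <= (density_const v0 ^+ d * B)%:E)%E.
Proof.
have mX c x := measurable_field c x.
have mV c x : mbl (mixture c x).
  by have [m _] := gaussian_mixture; exact: (m (c, x)).
move=> [bs [b1 b2 b3]]; have dc := density_const_ge0 (cf_var cf).
apply: (le_via (\sum_(b <- bs) P (hit_box b.1 b.2))%E); last first.
  apply: (le_via (\sum_(b <- bs) (density_const v0 ^+ d * b.2 ^+ d)%:E)%E); last first.
    by rewrite sumEFin lee_fin -mulr_sumr ler_wpM2l // exprn_ge0.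
  elim: bs b1 {b2 b3} => [|b bs IH] h; first by rewrite !big_nil.
  rewrite !big_cons; apply: leeD; last by apply: IH => b' hb; apply: h; right.
  by rewrite -exprMn; apply: box_prob; apply: h; left.
apply: measure_list_cover => //.
- exact: measurable_xsection (measurable_approx_hit mV).
- by move=> b; exact: measurable_hit_box.
move=> w'; rewrite /xsection /= inE => hw.
apply: contrapT => hn.
have [|e e0 he] := @box_gap bs (fun c => X c x0 w').
  move=> b hb; apply: contrapT => hc; apply: hn; exists b => // c.
  by rewrite leNgt; apply/negP => h; apply: hc; exists c.
have [m hm] : exists m : nat, m.+1%:R^-1 <= e / 2.
  exists (Num.truncn (2 / e)); rewrite -[leRHS]invrK lef_pV2 ?posrE ?invr_gt0 ?divr_gt0 ?ltr0n //.
  by rewrite invf_div ltW // truncnS_gt.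
have [L _ [q hq h]] := hw m I.
have [b hb hbx] : exists2 b, List.In b bs & forall c, `|target c (pt L q) w - b.1 c| <= b.2.
  by apply: b2; exists L, q; rewrite add0n.
have [c] := he b hb; apply/negP; rewrite -leNgt.
have g := gain_ge (pt L q); have gp : 0 < gain (pt L q) by apply: lt_le_trans g; rewrite invr_gt0.
have := h c; rewrite mixtureE normrM (gtr0_norm gp) /= => h1.
have h2 : `|X c x0 w' - target c (pt L q) w| <= e.
  have n0 := normr_ge0 (X c x0 w' - target c (pt L q) w).
  have h3 : 2^-1 * `|X c x0 w' - target c (pt L q) w| <= e / 2.
    by apply: le_trans hm; apply: le_trans h1; rewrite ler_wpM2r.
  by move: h3; rewrite mulrC ler_pM2r // invr_gt0.
rewrite (_ : X c x0 w' - b.1 c = (target c (pt L q) w - b.1 c) + (X c x0 w' - target c (pt L q) w)); last by ring.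
by apply: (le_trans (ler_normD _ _)); apply: lerD.
Qed.

(** On this event chaining bounds the field over the whole cube, which supplies the constant A of
    [target_osc]. As A1 grows these events exhaust the space up to a null set. *)
Definition tame (A1 : R) : set T :=
  [set w | (tail 0 0 origin w <= (A1 ^+ (2 * d))%:E)%E /\ forall c, `|X c x0 w| <= A1].

Lemma measurable_tame A1 : measurable (tame A1).
Proof.
apply: measurableI; last first.
  suff -> : (fun w => forall c, `|X c x0 w| <= A1) = hit_box (fun=> 0) A1 by exact: measurable_hit_box.
  by apply/seteqP; split => w h c; have := h c; rewrite subr0.
rewrite -[X in measurable X]setTI.
exact: (emeasurable_fun_infty_c measurableT (measurable_tail 0 0 origin) (A1 ^+ (2 * d))%:E).
Qed.

Definition reach A1 : R := \sum_c `|z c| + A1 + A1 / (1 - rho).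

Lemma reach_ge0 A1 : 0 <= A1 -> 0 <= reach A1.
Proof.
have /andP[_ r1] := cf_rho1 cf => a1.
by rewrite !addr_ge0 ?sumr_ge0 // divr_ge0 // subr_ge0 ltW.
Qed.

Lemma tame_reach A1 w c k q : 0 <= A1 -> tame A1 w -> q \in desc k origin ->
  `|z c - X c (pt k q) w| <= reach A1.
Proof.
move=> a1 [h1 h2] hq.
have h3 : `|X c (pt k q) w - X c x0 w| <= A1 / (1 - rho).
  have := @chain_field 0 origin w A1 c a1 _ k q hq; rewrite add0n expr0 mulr1; apply.
  by move=> k' q' hq'; exact: (tail_incr c a1 h1 hq').
rewrite (_ : _ - _ = z c - X c x0 w - (X c (pt k q) w - X c x0 w)); last by ring.
apply: (le_trans (ler_normB _ _)); apply: lerD h3.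
apply: (le_trans (ler_normB _ _)); apply: lerD (h2 c).
by rewrite (bigD1 c) //= lerDl sumr_ge0.
Qed.

Definition cost_const : R := 1 + density_const v0 ^+ d * (2 * osc_const) ^+ d.

Lemma cost_const_ge1 : 1 <= cost_const.
Proof.
rewrite lerDl; apply: mulr_ge0; first by apply: exprn_ge0; apply: density_const_ge0; exact: cf_var cf.
by apply: exprn_ge0; rewrite mulr_ge0 // ltW // osc_const_gt0.
Qed.

Lemma exprD_le (x y : R) m : 0 <= x -> 0 <= y -> (x + y) ^+ m <= 2 ^+ m * (x ^+ m + y ^+ m).
Proof.
wlog xy : x y / x <= y => [h|] hx hy.
  by have [/h|/ltW/h] := leP x y; [exact|rewrite addrC [x ^+ m + _]addrC; exact].
apply: (le_via ((2 * y) ^+ m)).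
  by apply: lerXn2r; rewrite ?nnegrE ?addr_ge0 ?mulr_ge0 //; lra.
by rewrite exprMn ler_wpM2l ?exprn_ge0 // lerDr exprn_ge0.
Qed.

(* At the finest scale the radius is controlled by the tail alone; the bad cubes are paid for by
   [sqrt t <= lam * t + 1 / lam]. *)
Lemma section_cost A1 eps lam N J s L0 w : 0 <= A1 -> 0 < eps -> 0 < lam -> tame A1 w ->
  (forall l, (L0 <= l)%N -> 4 * reach A1 * C / v0 * b0 ^+ l <= eps * a0 ^+ l) ->
  path leq L0 s -> (forall l', l' \in L0 :: s -> (l' <= N)%N) ->
  (P (xsection (approx_hit mixture) w) <= cost_const%:E *
   ((2 * eps ^+ d)%:E + (2 ^- (n * N))%:E * \sum_(q <- desc N origin) (lam%:E * tail 0 N q w +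
     (lam^-1 * \1_(\bigcap_(l' in [set` s]) bad eps J l' (iter (N - l') half q)) w)%:E)))%E.
Proof.
move=> a1 e0 l0 tw hb hs sN; have /andP[r0 r1] := cf_rho1 cf.
have o0 := osc_const_gt0; have a00 := a0_gt0.
pose bb q := \bigcap_(l' in [set` s]) bad eps J l' (iter (N - l') half q).
have L0N : (L0 <= N)%N by apply: sN; rewrite mem_head.
have cc := cost_const_ge1; have cc0 : 0 < cost_const by exact: lt_le_trans cc.
have A0 := reach_ge0 a1.
have s_ge0 q : (0 <= lam%:E * tail 0 N q w + (lam^-1 * \1_(bb q) w)%:E)%E.
  rewrite adde_ge0 ?mule_ge0 ?tail_ge0 ?lee_fin ?(ltW l0) //.
  by rewrite mulr_ge0 // invr_ge0 ltW.
(* If some tail at level [N] is infinite, so is the right-hand side. *)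
have [[q0 hq0 tq0]|fin] := pselect (exists2 q, q \in desc N origin & tail 0 N q w = +oo%E).
  set S := (\sum_(q <- _) _)%E.
  have -> : S = +oo%E.
    apply/eqP; rewrite -leye_eq /S (big_rem _ hq0) /= tq0 gt0_muley ?lte_fin // addye //.
    rewrite gt_eqF // (@lt_le_trans _ _ 0%E) ?ltNye //.
    by apply: sume_ge0 => q _; exact: s_ge0.
  by rewrite gt0_muley ?lte_fin ?invr_gt0 ?exprn_gt0 // addey // gt0_muley ?lte_fin // leey.
have tf q : q \in desc N origin -> tail 0 N q w \is a fin_num.
  move=> hq; rewrite ge0_fin_numE ?tail_ge0 // ltey; apply/eqP => h.
  by apply: fin; exists q.
pose t q := fine (tail 0 N q w).
have t0 q : 0 <= t q by rewrite fine_ge0 // tail_ge0.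
(* At level [N] every cube is good for its own threshold, adapted to its own tail. *)
pose eq q := eps + (t q) `^ ((2 * d)%:R^-1).
have tp q : ((t q) `^ ((2 * d)%:R^-1)) ^+ (2 * d) = t q.
  rewrite -powR_mulrn ?powR_ge0 // -powRrM mulVf ?powRr1 //.
  by rewrite pnatr_eq0 -lt0n muln_gt0 (cf_d cf).
pose rad q := (osc_const * eq q) ^+ d * 2 ^- (n * N).
have eq0 q : 0 < eq q by rewrite ltr_pwDl // powR_ge0.
have rad0 q : 0 <= rad q.
  apply: mulr_ge0; last by rewrite invr_ge0 exprn_ge0.
  by apply: exprn_ge0; apply: ltW; exact: mulr_gt0 o0 (eq0 q).
have hN q : q \in desc N origin -> covered (targets N q w) (rad q).
  move=> hq; apply: (@covered_cube N q w (eq q) (reach A1)) => //.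
  - move=> c k q' hq'; apply: tame_reach => //.
    by move: hq'; rewrite mem_desc => /eqP h; rewrite mem_desc iterD h -mem_desc.
  - move=> c k q' hq'; apply: (le_via ((t q) `^ ((2 * d)%:R^-1))); last by rewrite /eq lerDr ltW.
    have := @tail_incr 0 N q w ((t q) `^ ((2 * d)%:R^-1)) k q' c (powR_ge0 _ _).
    by rewrite add0n tp /t fineK ?tf //; apply.
  - apply: (le_trans (hb N L0N)); rewrite ler_wpM2r ?exprn_ge0 ?(ltW a00) //.
    by rewrite lerDl powR_ge0.
have cov : covered (targets 0 origin w) ((osc_const * eps) ^+ d + \sum_(q <- desc N origin) \1_(bb q) w * rad q).
  apply: (@covered_le _ (\sum_(i <- desc L0 origin) ((osc_const * eps) ^+ d * 2 ^- (n * L0) +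
    \sum_(q <- desc (N - L0) i) \1_(bb q) w * rad q))).
    have -> : \sum_(q <- desc N origin) \1_(bb q) w * rad q =
        \sum_(i <- desc L0 origin) \sum_(q <- desc (N - L0) i) \1_(bb q) w * rad q.
      by rewrite -sum_desc subnKC.
    rewrite big_split /= lerD2r big_const_seq count_predT iter_addr_0 size_desc.
    by rewrite -[leLHS]mulr_natr !natrX -exprM divfK // expf_neq0.
  apply: (@covered_list _ _ _ (fun q => targets (0 + L0) q w)) => [y /(targets_split L0) //|i /mem_In' hi].
  rewrite add0n; apply: (@cover_rec N eps J (reach A1) w L0 rad) => //.
  by move=> c k q hq; exact: tame_reach.
apply: (le_trans (section_prob cov)).
have dc0 : 0 <= density_const v0 ^+ d by apply: exprn_ge0; apply: density_const_ge0; exact: cf_var cf.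
rewrite (eq_big_seq (fun q => (lam * t q + lam^-1 * \1_(bb q) w)%:E)); last first.
  by move=> q hq; rewrite EFinD; congr (_ + _)%E; rewrite EFinM /t fineK // tf.
rewrite sumEFin -(EFinM (2 ^- (n * N))) -EFinD -EFinM lee_fin.
set Q := \sum_(q <- _) (lam * t q + _).
have Q0 : 0 <= Q.
  by apply: sumr_ge0 => q _; rewrite addr_ge0 ?mulr_ge0 ?invr_ge0 ?(ltW l0).
have R1 : (osc_const * eps) ^+ d + \sum_(q <- desc N origin) \1_(bb q) w * rad q <=
    (2 * osc_const) ^+ d * (2 * eps ^+ d + 2 ^- (n * N) * Q).
  have E1 : (osc_const * eps) ^+ d <= (2 * osc_const) ^+ d * eps ^+ d.
    have oe : 0 <= osc_const * eps by exact: mulr_ge0 (ltW o0) (ltW e0).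
    have h2 : osc_const * eps <= 2 * osc_const * eps by rewrite -mulrA ler_peMl // ler1n.
    by rewrite -exprMn; apply: lerXn2r; rewrite ?nnegrE ?(le_trans oe h2).
  have E2 : \sum_(q <- desc N origin) \1_(bb q) w * rad q <=
      \sum_(q <- desc N origin) ((2 * osc_const) ^+ d * 2 ^- (n * N) * (eps ^+ d + (lam * t q + lam^-1 * \1_(bb q) w))).
    apply: ler_sum => q _; rewrite /rad (exprMn d osc_const (eq q)) (exprMn d 2 osc_const).
    pose u := (t q) `^ ((2 * d)%:R^-1); have u0 : 0 <= u by exact: powR_ge0.
    have us : (u ^+ d) ^+ 2 = t q by rewrite -exprM mulnC tp.
    have ud0 : 0 <= u ^+ d by exact: exprn_ge0.
    have o2 : 0 <= osc_const ^+ d by rewrite exprn_ge0 // ltW.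
    have n2 : 0 <= 2 ^- (n * N) :> R by rewrite invr_ge0 exprn_ge0.
    have H : \1_(bb q) w * (eq q) ^+ d <= 2 ^+ d * (eps ^+ d + (lam * t q + lam^-1 * \1_(bb q) w)).
      have il0 : 0 < lam^-1 by rewrite invr_gt0.
      have ed : 0 <= eps ^+ d by rewrite exprn_ge0 // ltW.
      rewrite indicE; case: (w \in bb q) => /=.
        rewrite mul1r mulr1; apply: (le_trans (exprD_le d (ltW e0) u0)).
        rewrite ler_wpM2l ?exprn_ge0 // lerD2l -us -[u ^+ d]mulr1.
        have ll : lam * lam^-1 = 1 by rewrite mulfV // gt_eqF.
        set s' := u ^+ d; rewrite mulr1.
        have -> : lam * s' ^+ 2 + lam^-1 = lam^-1 * ((lam * s') ^+ 2 + 1).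
          by field; rewrite gt_eqF.
        have -> : s' = lam^-1 * (lam * s') by rewrite mulrA mulVf ?mul1r // gt_eqF.
        rewrite [lam * (lam^-1 * _)]mulrA ll mul1r ler_wpM2l ?(ltW il0) //.
        have := sqr_ge0 (lam * s' - 1); rewrite sqrrB1; set y := lam * s'.
        by have := sqr_ge0 y; rewrite -mulr_natr; lra.
      rewrite mul0r mulr0 addr0 mulr_ge0 ?exprn_ge0 ?addr_ge0 ?mulr_ge0 //; exact: ltW.
    rewrite (_ : \1_(bb q) w * _ = osc_const ^+ d * 2 ^- (n * N) * (\1_(bb q) w * eq q ^+ d)); last by ring.
    rewrite (_ : 2 ^+ d * osc_const ^+ d * _ * _ = osc_const ^+ d * 2 ^- (n * N) *
      (2 ^+ d * (eps ^+ d + (lam * t q + lam^-1 * \1_(bb q) w)))); last by ring.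
    by rewrite ler_wpM2l // mulr_ge0.
  apply: (le_trans (lerD E1 E2)).
  rewrite -mulr_sumr big_split /= big_const_seq count_predT iter_addr_0 size_desc -/Q.
  rewrite -[eps ^+ d *+ _]mulr_natr !natrX -exprM.
  apply: le_of_eq; field.
  by rewrite expf_neq0.
rewrite /cost_const mulrDl mul1r; apply: (le_via (density_const v0 ^+ d * ((2 * osc_const) ^+ d * (2 * eps ^+ d + 2 ^- (n * N) * Q)))).
  by rewrite ler_wpM2l.
rewrite mulrA lerDr addr_ge0 ?mulr_ge0 ?exprn_ge0 ?invr_ge0 ?exprn_ge0 //; exact: ltW.
Qed.

Lemma exists_scale A (eps : R) : 0 <= A -> 0 < eps -> exists L0, forall l, (L0 <= l)%N ->
  A * b0 ^+ l <= eps * a0 ^+ l.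
Proof.
move=> A0 e0; have a00 := a0_gt0; have b00 := cf_b0 cf.
have r01 : 0 <= b0 / a0 < 1 by rewrite divr_ge0 ?(ltW a00) ?(ltW b00) //= ltr_pdivrMr // mul1r (cf_a0 cf).
have A1 : 0 < 1 + A by rewrite ltr_pwDl.
have [L0 h] := expr_small r01 (divr_gt0 e0 A1).
exists L0 => l /h; rewrite ler_pdivlMr // expr_div_n mulrAC ler_pdivrMr ?exprn_gt0 //.
by apply: le_trans; rewrite mulrC ler_wpM2l ?exprn_ge0 ?(ltW b00) // lerDr.
Qed.

(** All parameters are tied to [h]: eps = lam = h, and bad probability h^2, so that 1 / lam times
    that probability is again h. The bound is therefore linear in [h]. *)
Lemma tame_hit_small A1 (h : R) : 0 <= A1 -> 0 < h <= 1 ->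
  ((P \x P)%E (approx_hit mixture `&` (tame A1 `*` setT)) <= (cost_const * (3 + tail_const) * h)%:E)%E.
Proof.
move=> a1 /andP[h0 h1].
have mV c x : mbl (mixture c x).
  by have [m _] := gaussian_mixture; exact: (m (c, x)).
have cc0 : 0 <= cost_const by apply: le_trans cost_const_ge1.
have [L0 hb] : exists L0, forall l, (L0 <= l)%N -> 4 * reach A1 * C / v0 * b0 ^+ l <= h * a0 ^+ l.
  apply: exists_scale => //; rewrite !mulr_ge0 ?reach_ge0 ?(cf_C cf) //.
  by rewrite invr_ge0 ltW // (cf_var cf).
have [s [J [hs hbad]]] := bad_prob L0 h0 (mulr_gt0 h0 h0).
pose N := \max_(l <- L0 :: s) l.
have sN l : l \in L0 :: s -> (l <= N)%N by move=> hl; apply: leq_bigmax_seq.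
have {}hbad := hbad N (fun l hl => sN l (mem_behead (s := L0 :: s) hl)).
pose bb q := \bigcap_(l' in [set` s]) bad h J l' (iter (N - l') half q).
have mbb q : measurable (bb q).
  by apply: fin_bigcap_measurable => [|l _]; [exact: finite_seq|exact: measurable_bad].
have mAH := measurable_approx_hit mV.
have mtX : measurable (tame A1 `*` [set: T]) by apply: measurableX => //; exact: measurable_tame.
pose g q w := (h%:E * tail 0 N q w + (h^-1 * \1_(bb q) w)%:E)%E.
have g0 q w : (0 <= g q w)%E.
  rewrite /g adde_ge0 ?mule_ge0 ?tail_ge0 ?lee_fin ?(ltW h0) //.
  by rewrite mulr_ge0 // invr_ge0 ltW.
have mg q : mbl (g q).
  apply: emeasurable_funD; first by apply: measurable_funeM; exact: measurable_tail.
  by mauto.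
pose F w := (cost_const%:E * ((2 * h ^+ d)%:E + (2 ^- (n * N))%:E * \sum_(q <- desc N origin) g q w))%E.
have S0 w : (0 <= \sum_(q <- desc N origin) g q w)%E by apply: sume_ge0.
have mS : mbl (fun w => \sum_(q <- desc N origin) g q w)%E by apply: emeasurable_sum.
have h20 : 0 <= 2 * h ^+ d by rewrite mulr_ge0 // exprn_ge0 // ltW.
have n20 : 0 <= 2 ^- (n * N) :> R by rewrite invr_ge0 exprn_ge0.
have mF' : mbl (fun w => ((2 * h ^+ d)%:E + (2 ^- (n * N))%:E * \sum_(q <- desc N origin) g q w)%E).
  by apply: emeasurable_funD => //; apply: measurable_funeM.
have F'0 w : (0 <= (2 * h ^+ d)%:E + (2 ^- (n * N))%:E * \sum_(q <- desc N origin) g q w)%E.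
  by rewrite adde_ge0 ?mule_ge0 ?lee_fin.
apply: (le_via (\int[P]_w F w)%E).
  rewrite /product_measure1 /=; apply: ge0_le_integral => //.
  - by apply: measurable_fun_xsection; exact: measurableI.
  - by apply: measurable_funeM.
  move=> w _ /=; have [tw|ntw] := pselect (tame A1 w); last first.
    rewrite (_ : xsection _ w = set0) ?measure0 /F ?mule_ge0 ?lee_fin //.
    by apply/seteqP; split => // w'; rewrite /xsection /= inE => -[_ [/ntw]].
  have sc := @section_cost A1 h h N J s L0 w a1 h0 h0 tw hb hs sN.
  apply: le_trans sc.
  apply: le_measure; rewrite ?inE; [exact: measurable_xsection (measurableI _ _ mAH mtX)|exact: measurable_xsection|].
  by move=> w'; rewrite /xsection /= !inE => -[].
rewrite /F ge0_integralZl_EFin // [X in (_ <= X)%E](_ : _ = cost_const%:E * ((3 + tail_const) * h)%:E)%E; last by rewrite -EFinM mulrA.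
apply: lee_wpmul2l; first by rewrite lee_fin.
rewrite ge0_integralD //; last 2 first.
- by move=> w _; rewrite mule_ge0 ?lee_fin.
- by mauto.
rewrite integral_cst //= probability_setT mule1 ge0_integralZl_EFin // ge0_integral_sum //.
have Ig q : (\int[P]_w g q w <= (h * (1 + tail_const))%:E)%E.
  rewrite ge0_integralD //; last 4 first.
  - by move=> w _; rewrite mule_ge0 ?tail_ge0 ?lee_fin ?(ltW h0).
  - by apply: measurable_funeM; exact: measurable_tail.
  - by move=> w _; rewrite lee_fin mulr_ge0 // invr_ge0 ltW.
  - by mauto.
  rewrite ge0_integralZl_EFin ?(ltW h0) //; last 2 first.
  - by move=> w _; rewrite tail_ge0.
  - exact: measurable_tail.
  under [X in (_ + X)%E]eq_integral do rewrite EFinM.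
  rewrite ge0_integralZl_EFin ?invr_ge0 ?(ltW h0) //; last first.
    by mauto.
  rewrite integral_indic // setIT (_ : h * (1 + tail_const) = h * tail_const + h); last by ring.
  rewrite EFinD; apply: leeD.
    rewrite EFinM; apply: lee_wpmul2l; first by rewrite lee_fin ltW.
    by apply: le_trans (integral_tail 0 N q) _; rewrite expr0 mulr1.
  apply: (le_via (h^-1%:E * (h * h)%:E)%E).
    by apply: lee_wpmul2l; [rewrite lee_fin invr_ge0 ltW|exact: hbad].
  by rewrite -EFinM mulrA mulVf ?mul1r // gt_eqF.
apply: (le_via ((2 * h ^+ d)%:E + (2 ^- (n * N))%:E * (\sum_(q <- desc N origin) (h * (1 + tail_const))%:E))%E).
  by rewrite leeD2l //; apply: lee_wpmul2l; [rewrite lee_fin|apply: lee_sum => q _; exact: Ig].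
rewrite sumEFin -(EFinM (2 ^- (n * N))) -EFinD lee_fin big_const_seq count_predT iter_addr_0 size_desc.
rewrite -[_ *+ ((2 ^ n) ^ N)%N]mulr_natl !natrX -exprM mulKf ?expf_neq0 //.
have : h ^+ d <= h by rewrite -[leRHS]expr1; apply: ler_wiXn2l; rewrite ?(ltW h0) // (cf_d cf).
by lra.
Qed.

(** Pass to the mixture, let h tend to 0 on each tame event, and exhaust the space; what remains has
    an infinite tail, of probability 0 by Markov. *)
Lemma approx_hit_null : P (approx_hit X) = 0%E.
Proof.
have mX c x := measurable_field c x.
have mV c x : mbl (mixture c x).
  by have [m _] := gaussian_mixture; exact: (m (c, x)).
have mAH := measurable_approx_hit mV.
apply/eqP; rewrite eq_le measure_ge0 andbT; apply: (le_trans approx_hit_law).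
have mtX A1 : measurable (tame A1 `*` [set: T]) by apply: measurableX => //; exact: measurable_tame.
have Tn (m : nat) : (P \x P)%E (approx_hit mixture `&` (tame m%:R `*` setT)) = 0%E.
  apply/eqP; rewrite eq_le measure_ge0 andbT.
  have D0 : 0 < 1 + cost_const * (3 + tail_const).
    rewrite ltr_pwDl //; apply: mulr_ge0 (le_trans ler01 cost_const_ge1) _.
    by rewrite addr_ge0 ?tail_const_ge0.
  apply/lee_addgt0Pr => e e0; rewrite add0e.
  pose h := Num.min 1 (e / (1 + cost_const * (3 + tail_const))).
  have h01 : 0 < h <= 1 by rewrite lt_min ltr01 divr_gt0 //= ge_min lexx.
  apply: (le_trans (tame_hit_small (ler0n _ m) h01)); rewrite lee_fin.
  have /andP[h0 h1] := h01.
  have h2 : h <= e / (1 + cost_const * (3 + tail_const)) by rewrite ge_min lexx orbT.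
  move: h2; rewrite ler_pdivlMr // => h2; apply: le_trans h2.
  by rewrite mulrC ler_wpM2l ?(ltW h0) // lerDr.
pose Ninf := [set w | tail 0 0 origin w = +oo%E].
have mN : measurable Ninf.
  rewrite (_ : Ninf = tail 0 0 origin @^-1` [set +oo%E]); last by [].
  by rewrite -[X in measurable X]setTI; exact: measurable_tail.
have PN : P Ninf = 0%E.
  apply/eqP; rewrite eq_le measure_ge0 andbT.
  apply/lee_addgt0Pr => e e0; rewrite add0e.
  pose a := (1 + tail_const) / e.
  have a0' : 0 < a by rewrite divr_gt0 // ltr_pwDl ?tail_const_ge0.
  have := markov_ge0 P (measurable_tail 0 0 origin) (tail_ge0 0 0 origin) (ltW a0').
  move/le_trans/(_ (integral_tail 0 0 origin)); rewrite expr0 mulr1 => H.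
  have {}H : (a%:E * P Ninf <= tail_const%:E)%E.
    apply: le_trans H; apply: lee_wpmul2l; first by rewrite lee_fin ltW.
    apply: le_measure; rewrite ?inE //.
      by rewrite -[X in measurable X]setTI; exact: (emeasurable_fun_c_infty measurableT (measurable_tail 0 0 origin) a%:E).
    by move=> w /= ->; rewrite leey.
  have pf : P Ninf \is a fin_num by rewrite fin_num_measure.
  move: H; rewrite -(fineK pf) -EFinM !lee_fin -ler_pdivlMl // => H.
  apply: (le_trans H); rewrite /a invf_div mulrAC ler_pdivrMr ?ltr_pwDl ?tail_const_ge0 //.
  by rewrite ler_wpM2l ?(ltW e0) // lerDr.
have sub : approx_hit mixture `<=` (\bigcup_(m : nat) (approx_hit mixture `&` (tame m%:R `*` setT))) `|` (Ninf `*` setT).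
  move=> [w w'] hw; have [nw|tw] := pselect (Ninf w); first by right.
  left; have tf : tail 0 0 origin w \is a fin_num.
    by rewrite ge0_fin_numE ?tail_ge0 // ltey; apply/eqP => /tw.
  pose y := fine (tail 0 0 origin w) + \sum_c `|X c x0 w|.
  have s0 : 0 <= \sum_c `|X c x0 w| by apply: sumr_ge0.
  have f0 : 0 <= fine (tail 0 0 origin w) by rewrite fine_ge0 // tail_ge0.
  have hy : y < (Num.truncn y).+1%:R by exact: truncnS_gt.
  exists (Num.truncn y).+1 => //; split => //; split => //; split.
    rewrite -(fineK tf) lee_fin; apply: (le_via (Num.truncn y).+1%:R).
      by apply: le_trans (ltW hy); rewrite lerDl.
    by rewrite -natrX ler_nat -[leqLHS]expn1 leq_pexp2l // muln_gt0 (cf_d cf).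
  move=> c; apply: le_trans (ltW hy); rewrite /y (bigD1 c) //= addrCA lerDl.
  by rewrite addr_ge0 // sumr_ge0.
have neg : (P \x P)%E.-negligible (approx_hit mixture).
  apply: negligibleS sub _; apply: negligibleU.
    apply: negligible_bigcup => m; apply/negligibleP; [exact: measurableI|exact: Tn].
  apply/negligibleP; first exact: measurableX.
  have Nn : (P \x P)%E (Ninf `*` setT) = 0%E.
    by transitivity (P Ninf * P [set: T])%E; [exact: product_measure1E|rewrite PN mul0e].
  exact: Nn.
by rewrite (measure_negligible mAH neg).
Qed.

End covering.
End field.

(** * Linear combinations, translations, reflections and densities *)

Section integral_combination.
Context d (T : measurableType d) (R : realType) (m : {measure set T -> \bar R}).

Lemma integrable_lin (a b : R) (f g : T -> R) :
  itg m f -> itg m g ->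
  itg m (fun x => a * f x + b * g x).
Proof.
move=> hf hg.
rewrite (_ : EFin \o _ = ((fun x => a%:E * (EFin \o f) x) \+ (fun x => b%:E * (EFin \o g) x))%E); last by [].
by apply: integrableD => //; exact: integrableZl.
Qed.

Lemma Rintegral_lin (a b : R) (f g : T -> R) :
  itg m f -> itg m g ->
  \int[m]_x (a * f x + b * g x) = a * \int[m]_x f x + b * \int[m]_x g x.
Proof.
move=> hf hg.
have ha (c : R) (h : T -> R) : itg m h -> itg m (fun x => c * h x).
  by move=> hh; exact: (integrableZl measurableT c hh).
rewrite (@RintegralD _ _ _ m setT (fun x => a * f x) (fun x => b * g x)) //; try exact: ha.
by rewrite !RintegralZl.
Qed.
End integral_combination.

Section lebesgue_shift.
Context {R : realType}.
Local Notation mu := (@lebesgue_measure R).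
Local Open Scope ereal_scope.

Definition shiftR (c : R) (x : Borel R) : Borel R := (x + c)%R.

Lemma measurable_shiftR c : mbl (shiftR c).
Proof. exact: measurable_funD. Qed.
HB.instance Definition _ c := isMeasurableFun.Build _ _ _ _ (shiftR c) (measurable_shiftR c).

Lemma pushforward_shift (c : R) (A : set (Borel R)) : measurable A ->
  pushforward mu (shiftR c) A = mu A.
Proof.
move=> mA; pose m0 := pushforward mu (shiftR c) : {measure set (Borel R) -> \bar R}.
pose m := m0 (measurable_shiftR c).
apply/esym; apply: (@lebesgue_measure_unique _ m) => // X [[a b] _ <-] /=.
rewrite /m /m0 /= /pushforward.
rewrite (_ : shiftR c @^-1` _ = `](a - c)%R, (b - c)%R]%classic); last first.
  by apply/seteqP; split => x /=; rewrite !in_itv /= /shiftR /= ltrBlDr lerBrDr.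
rewrite !lebesgue_measure_itv /= !lte_fin ltrD2r.
by case: ifP => // _; rewrite -!EFinD; congr _%:E; ring.
Qed.

Lemma ge0_integral_shift (c : R) (F : Borel R -> \bar R) :
  mbl F -> (forall x, 0 <= F x) ->
  \int[mu]_x F (x + c)%R = \int[mu]_x F x.
Proof.
move=> mF F0.
rewrite -[LHS](ge0_integral_pushforward (measurable_shiftR c) mu measurableT mF) //.
by apply: eq_measure_integral => A mA _; exact: pushforward_shift.
Qed.

Lemma ge0_integral_opp (F : Borel R -> \bar R) :
  mbl F -> (forall x, 0 <= F x) ->
  \int[mu]_x F (- x)%R = \int[mu]_x F x.
Proof.
move=> mF F0; pose o (x : Borel R) : Borel R := (- x)%R.
have mo : mbl o by exact: measurable_funN.
rewrite -[LHS](ge0_integral_pushforward mo mu measurableT mF) //.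
apply: eq_measure_integral => A mA _.
pose m0 := pushforward mu o : {measure set (Borel R) -> \bar R}.
pose m := m0 mo.
apply/esym; apply: (@lebesgue_measure_unique _ m) => // X [[a b] _ <-] /=.
rewrite /m /m0 /= /pushforward.
rewrite (_ : o @^-1` _ = `[(- b)%R, (- a)%R[%classic); last first.
  by apply/seteqP; split => x /=; rewrite !in_itv /= /o ltrNr lerNl andbC.
rewrite !lebesgue_measure_itv /= !lte_fin ltrN2.
by case: ifP => // _; rewrite -!EFinD; congr _%:E; ring.
Qed.

(* By the layer-cake formula [f x = \int 1_(0 <= t < f x) dt]. *)
Lemma ge0_integral_density d (T : measurableType d)
    (m : {sigma_finite_measure set T -> \bar R}) (nu : {sigma_finite_measure set T -> \bar R})
    (h f : T -> R) :
  (forall A, measurable A -> nu A = \int[m]_(x in A) (h x)%:E) ->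
  mbl h -> (forall x, (0 <= h x)%R) ->
  mbl f -> (forall x, (0 <= f x)%R) ->
  \int[nu]_x (f x)%:E = \int[m]_x (f x * h x)%:E.
Proof.
move=> nuh mh h0 mf f0.
pose L (z : T * Borel R) : R := (if (0 <= z.2) && (z.2 < f z.1) then 1 else 0)%R.
have mL : mbl L.
  have m1 : mbl (fun z : T * Borel R => f z.1).
    by mauto.
  have m2 : mbl (fun z : T * Borel R => z.2 : R) by mauto.
  apply: measurable_fun_if => //; apply: measurable_and.
    exact: measurable_fun_ler.
  exact: measurable_fun_ltr.
have L0 z : (0 <= L z)%R by rewrite /L; case: ifP.
have fE x : (f x)%:E = \int[mu]_t (L (x, t))%:E.
  rewrite (_ : (fun t => _) = fun t => (\1_(`[0%R, f x[%classic) t)%:E); last first.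
    by apply/funext => t; rewrite /L /= indicE mem_setE in_itv /=; case: ifP.
  rewrite integral_indic //= setIT lebesgue_measure_itv /= lte_fin sube0.
  by case: ltP => // f1; congr _%:E; apply/eqP; rewrite eq_le f1 f0.
have mLf t : measurable [set x | (0 <= t)%R && (t < f x)%R].
  rewrite -[X in measurable X]setTI; apply: (measurable_and (measurable_cst _)) => //.
  by apply: measurable_fun_ltr.
under eq_integral do rewrite fE.
rewrite (@fubini_tonelli _ _ _ _ _ nu mu (fun z => (L z)%:E)) //; last by apply/measurable_EFinP.
transitivity (\int[mu]_t \int[m]_x (L (x, t) * h x)%:E).
  apply: eq_integral => t _.
  rewrite (_ : (fun x => _) = fun x => (\1_[set x | (0 <= t)%R && (t < f x)%R] x)%:E); last first.
    apply/funext => x; rewrite /L /= indicE; case: ifPn => hx; first by rewrite mem_set.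
    by rewrite memNset //= => hx'; rewrite hx' in hx.
  rewrite integral_indic // setIT.
  transitivity (\int[m]_(x in [set x | (0 <= t)%R && (t < f x)%R]) (h x)%:E); first exact: (nuh _ (mLf t)).
  rewrite integral_mkcond; apply: eq_integral => x _.
  rewrite patchE /L /=; case: ifPn => [/set_mem /= -> |hx]; first by rewrite mul1r.
  by rewrite ifF ?mul0r //; apply/negbTE; apply: contraNN hx => hx; rewrite mem_set.
rewrite -(@fubini_tonelli _ _ _ _ _ m mu (fun z => (L z * h z.1)%:E)); last 2 first.
- by mauto.
- by move=> z; rewrite lee_fin mulr_ge0.
apply: eq_integral => x _.
under eq_integral do rewrite EFinM /=.
rewrite ge0_integralZr ?lee_fin //; last by move=> t _; rewrite lee_fin.
- by rewrite -fE EFinM.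
by mauto.
Qed.
End lebesgue_shift.

(** * Fourier transform of the Gaussian function on the line *)

Section gaussian_fourier.
Context {R : realType}.
Local Notation mu := (@lebesgue_measure R).
Local Notation gam := (@gauss_fun R).

(** For |x| > 1, y^(m+1) <= (m+1)! exp(y) at y = x^2 leaves two spare powers of x. *)
Lemma gauss_moment_bound m (x : R) : x ^+ (2 * m) * gam x <= m.+1`!%:R * decay (- 2) x.
Proof.
have f0 : 0 < m.+1`!%:R :> R by rewrite ltr0n fact_gt0.
have f1 : 1 <= m.+1`!%:R :> R by rewrite ler1n fact_gt0.
have xx : 0 <= x ^+ 2 by exact: sqr_ge0.
have h := expR_ge1Dxn m xx.
have g : gam x * expR (x ^+ 2) = 1 by rewrite /gauss_fun expRN mulVf // gt_eqF ?expR_gt0.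
rewrite /decay; case: ifPn => x1.
  rewrite mulr1 (le_trans _ f1) // mulr_ile1 ?gauss_fun_ge0 ?gauss_fun_le1 //.
    by rewrite exprn_even_ge0 // mul2n odd_double.
  by rewrite exprM exprn_ile1 // -real_normK ?num_real // exprn_ile1.
rewrite -ltNge in x1; rewrite powR_invn // real_normK ?num_real //.
have x0 : 0 < x ^+ 2 by rewrite -real_normK ?num_real // exprn_gt0 // (lt_trans ltr01).
have h' : x ^+ (2 * m) * x ^+ 2 <= m.+1`!%:R * expR (x ^+ 2).
  rewrite exprM -exprSr -ler_pdivrMl // mulrC; apply: le_trans h.
  by rewrite lerDr.
rewrite ler_pdivlMr // mulrAC; apply: (le_trans (ler_wpM2r (gauss_fun_ge0 x) h')).
by rewrite -mulrA [_ * gam x]mulrC g mulr1.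
Qed.

Lemma integrable_gauss_moment m : mu.-integrable setT (fun x => (x ^+ (2 * m) * gam x)%:E).
Proof.
have i2 : itg mu (decay (- 2)) by apply: integrable_decay; lra.
apply: (@le_integrable _ _ _ mu setT measurableT _ (fun x => (m.+1`!%:R * decay (- 2) x)%:E)).
- apply/measurable_EFinP; apply: measurable_funM; last exact: measurable_gauss_fun.
  by mauto.
- move=> x _; rewrite !abse_EFin lee_fin ger0_norm.
    by rewrite (le_trans (gauss_moment_bound m x)) // ler_norm.
  by rewrite mulr_ge0 ?gauss_fun_ge0 // exprn_even_ge0 // mul2n odd_double.
exact: (integrableZl measurableT m.+1`!%:R i2).
Qed.

Definition gauss_moment m : R := \int[mu]_x (x ^+ (2 * m) * gam x).

Lemma gauss_momentE m : (\int[mu]_x (x ^+ (2 * m) * gam x)%:E = (gauss_moment m)%:E)%E.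
Proof. by rewrite /gauss_moment /Rintegral fineK // integrable_fin_num //; exact: integrable_gauss_moment. Qed.

Lemma gauss_moment_ge0 m : 0 <= gauss_moment m.
Proof.
apply: Rintegral_ge0 => x _; rewrite mulr_ge0 ?gauss_fun_ge0 //.
by rewrite exprn_even_ge0 // mul2n odd_double.
Qed.

Lemma gauss_moment0 : gauss_moment 0 = Num.sqrt pi.
Proof.
apply: EFin_inj; rewrite -gauss_momentE -integralT_gauss; apply: eq_integral_leb => x.
by rewrite muln0 expr0 mul1r.
Qed.

Lemma gauss_moment0_gt0 : 0 < gauss_moment 0.
Proof. by rewrite gauss_moment0 sqrtr_gt0 pi_gt0. Qed.

Definition gauss_hat t : R := \int[mu]_x (cos (t * x) * gam x).

Lemma integrable_gauss_bounded (u : R -> R) (M : R) : mbl u -> (forall x, `|u x| <= M) ->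
  mu.-integrable setT (fun x => (u x * gam x)%:E).
Proof.
move=> mu' uM.
apply: (@le_integrable _ _ _ mu setT measurableT _ (fun x => (M%:E * (gam x)%:E)%E)).
- by apply/measurable_EFinP; apply: measurable_funM => //; exact: measurable_gauss_fun.
- by move=> x _; rewrite -EFinM !abse_EFin lee_fin !normrM ler_wpM2r // (le_trans (uM x)) // ler_norm.
- apply: integrableZl => //; exact: integrableT_gauss.
Qed.

Lemma gauss_hatE t : (\int[mu]_x (cos (t * x) * gam x)%:E = (gauss_hat t)%:E)%E.
Proof.
rewrite /gauss_hat /Rintegral fineK // integrable_fin_num //.
by apply: (@integrable_gauss_bounded _ 1) => [|x]; [mauto|exact: cos_max].
Qed.

(** Oddness, obtained by applying the reflection to the nonnegative integrands 1 + sin and 1 -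
    sin. *)
Lemma gauss_sin t : (\int[mu]_x (sin (t * x) * gam x)%:E = 0)%E.
Proof.
have i1 : mu.-integrable setT (fun x => (sin (t * x) * gam x)%:E).
  by apply: (@integrable_gauss_bounded _ 1) => [|x]; [mauto|exact: sin_max].
have i0 := integrableT_gauss.
have fin := integrable_fin_num measurableT i1.
have mg : mbl (fun x : Borel R => ((1 + sin (t * x)) * gam x)%:E).
  by apply/measurable_EFinP; have := @measurable_gauss_fun R => ?; mauto.
have g0 (x : Borel R) : (0 <= ((1 + sin (t * x)) * gam x)%:E)%E.
  rewrite lee_fin mulr_ge0 ?gauss_fun_ge0 //.
have := ge0_integral_opp mg g0.
have E1 (b : R) : (\int[mu]_x ((1 + b * sin (t * x)) * gam x)%:E =
    \int[mu]_x (gam x)%:E + b%:E * \int[mu]_x (sin (t * x) * gam x)%:E)%E.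
  rewrite -integralZl // -integralD //; last exact: integrableZl.
  by apply: eq_integral_leb => x; rewrite -EFinM -EFinD; congr _%:E; ring.
rewrite (@eq_integral_leb _ _ (fun x => ((1 + (- 1) * sin (t * x)) * gam x)%:E)); last first.
  by move=> x; rewrite mulrN sinN /gauss_fun sqrrN mulN1r.
rewrite [X in _ = X](@eq_integral_leb _ _ (fun x => ((1 + 1 * sin (t * x)) * gam x)%:E)); last first.
  by move=> x; rewrite mul1r.
rewrite !E1 -(fineK fin) integralT_gauss -!EFinM -!EFinD => -[h].
by congr _%:E; lra.
Qed.

(* Rotation by 45 degrees, done by the shifts [y := y - x] and [x := x + y / 2]. *)
Lemma gauss_hat_double t : gauss_hat t ^+ 2 = gauss_hat (Num.sqrt 2 * t) * gauss_moment 0.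
Proof.
pose F (z : Borel R * Borel R) : R := (1 + cos (t * (z.1 + z.2))) * (gam z.1 * gam z.2).
have mgam := @measurable_gauss_fun R.
have mg1 : mbl (fun z : Borel R * Borel R => gam z.1).
  by mauto.
have mg2 : mbl (fun z : Borel R * Borel R => gam z.2).
  by mauto.
have c0 (y : R) : 0 <= 1 + cos y by have := cos_max y; rewrite ler_norml => /andP[+ _]; lra.
have g0 := @gauss_fun_ge0 R.
have m1 : mbl (fun z : Borel R * Borel R => z.1 : R) by mauto.
have m2 : mbl (fun z : Borel R * Borel R => z.2 : R) by mauto.
have I0 : (\int[mu]_x (gam x)%:E = (gauss_moment 0)%:E)%E by rewrite integralT_gauss gauss_moment0.
have Ic c x : (\int[mu]_y ((1 + cos (t * (x + y))) * (c * gam y))%:E =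
    (c * (gauss_moment 0 + cos (t * x) * gauss_hat t))%:E)%E.
  rewrite (@eq_integral_leb _ _ (fun y => (c%:E * (gam y)%:E + ((c * cos (t * x))%:E * (cos (t * y) * gam y)%:E +
     (- (c * sin (t * x)))%:E * (sin (t * y) * gam y)%:E)))%E); last first.
    by move=> y; rewrite -!EFinM -!EFinD; congr _%:E; rewrite mulrDr cosD; ring.
  have ic : mu.-integrable setT (fun x => (cos (t * x) * gam x)%:E).
    by apply: (@integrable_gauss_bounded _ 1) => [|y]; [mauto|exact: cos_max].
  have is_ : mu.-integrable setT (fun x => (sin (t * x) * gam x)%:E).
    by apply: (@integrable_gauss_bounded _ 1) => [|y]; [mauto|exact: sin_max].
  have i0 := @integrableT_gauss R.
  rewrite integralD //; [|exact: integrableZl|by apply: integrableD => //; exact: integrableZl].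
  rewrite integralD //; [|exact: integrableZl|exact: integrableZl].
  rewrite !integralZl // I0 gauss_hatE gauss_sin mule0 adde0 -!EFinM -EFinD.
  by congr _%:E; ring.
have LHS1 : (\int[mu]_x \int[mu]_y (F (x, y))%:E = (gauss_moment 0 ^+ 2 + gauss_hat t ^+ 2)%:E)%E.
  rewrite (@eq_integral_leb _ _ (fun x => (gauss_moment 0)%:E * (gam x)%:E + (gauss_hat t)%:E * (cos (t * x) * gam x)%:E)%E); last first.
    move=> x; rewrite /F /= (Ic (gam x) x) -!EFinM -EFinD; congr _%:E; ring.
  have ic : mu.-integrable setT (fun x => (cos (t * x) * gam x)%:E).
    by apply: (@integrable_gauss_bounded _ 1) => [|y]; [mauto|exact: cos_max].
  have i0 := @integrableT_gauss R.
  rewrite integralD //; [|exact: integrableZl|exact: integrableZl].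
  by rewrite !integralZl // I0 gauss_hatE -!EFinM -EFinD !expr2.
have s2 : 0 < Num.sqrt (2 : R) by rewrite sqrtr_gt0.
have ss : Num.sqrt 2 * Num.sqrt 2 = 2 :> R by rewrite -expr2 sqr_sqrtr.
pose G (y : R) : R := (1 + cos (t * y)) * expR (- (y ^+ 2 / 2)).
have RHS1 : (\int[mu]_x \int[mu]_y (F (x, y))%:E =
    (gauss_moment 0 * (gauss_moment 0 + gauss_hat (Num.sqrt 2 * t)))%:E)%E.
  have mF : mbl F.
    by rewrite /F; mauto.
  transitivity (\int[mu]_x \int[mu]_y (F (x, y - x)%R)%:E)%E.
    apply: eq_integral_leb => x.
    have mFx : mbl (fun y : Borel R => (F (x, y))%:E).
      by mauto.
    rewrite -(@ge0_integral_shift R (- x) _ mFx) // => y.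
    by rewrite lee_fin mulr_ge0 // mulr_ge0.
  have mF2 : mbl (fun z : Borel R * Borel R => (F (z.1, z.2 - z.1)%R)%:E).
    by mauto.
  rewrite (@fubini_tonelli _ _ _ _ _ mu mu (fun z => (F (z.1, z.2 - z.1)%R)%:E)) //; last first.
    by move=> z; rewrite lee_fin mulr_ge0 // mulr_ge0.
  transitivity (\int[mu]_y ((G y)%:E * \int[mu]_x (gam (Num.sqrt 2 * x))%:E))%E.
    apply: eq_integral_leb => y.
    have msx : mbl (fun x : Borel R => (gam (Num.sqrt 2 * x))%:E).
      by mauto.
    rewrite -(@ge0_integral_shift R (- (y / 2)) _ msx); last by move=> x; rewrite lee_fin.
    rewrite -ge0_integralZl_EFin //; last 3 first.
    - by move=> x _; rewrite lee_fin.
    - by mauto.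
    - by rewrite mulr_ge0 // expR_ge0.
    apply: eq_integral_leb => x; rewrite -EFinM; congr _%:E.
    rewrite /F /G /gauss_fun /= (_ : x + (y - x) = y) -?expRD; last by ring.
    rewrite -mulrA; congr (_ * _); rewrite -!expRD; congr expR.
    by rewrite exprMn [Num.sqrt 2 ^+ 2]expr2 ss; field.
  have sc : (\int[mu]_x (gam (Num.sqrt 2 * x))%:E = ((Num.sqrt 2)^-1 * gauss_moment 0)%:E)%E.
    rewrite EFinM -I0; apply: (@ge0_integral_scale1 R (Num.sqrt 2) (fun x => (gam x)%:E) s2).
      by mauto.
    by move=> x; rewrite lee_fin.
  rewrite (@eq_integral_leb _ _ (fun y => (G y)%:E * ((Num.sqrt 2)^-1 * gauss_moment 0)%:E)%E); last first.
    by move=> y; congr (_ * _)%E; exact: sc.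
  rewrite ge0_integralZr //; last 3 first.
  - by apply/measurable_EFinP; rewrite /G; mauto.
  - by move=> y _; rewrite lee_fin mulr_ge0 // expR_ge0.
  - by rewrite lee_fin mulr_ge0 ?invr_ge0 ?gauss_moment_ge0 // ltW.
  have mGs : mbl (fun y : Borel R => (G y)%:E) by apply/measurable_EFinP; rewrite /G; mauto.
  have GE : (\int[mu]_y (G y)%:E = (Num.sqrt 2)%:E * (gauss_moment 0 + gauss_hat (Num.sqrt 2 * t))%:E)%E.
    have G0 y : (0 <= (G y)%:E)%E by rewrite lee_fin mulr_ge0 // expR_ge0.
    have H := @ge0_integral_scale1 R (Num.sqrt 2) _ s2 mGs G0.
    rewrite (@eq_integral_leb _ (fun x => (G (Num.sqrt 2 * x))%:E)
      (fun x => (gam x)%:E + (cos ((Num.sqrt 2 * t) * x) * gam x)%:E)%E) in H; last first.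
      move=> x; rewrite -EFinD; congr _%:E; rewrite /G /gauss_fun exprMn [Num.sqrt 2 ^+ 2]expr2 ss.
      rewrite (_ : t * _ = Num.sqrt 2 * t * x); last by ring.
      rewrite (_ : 2 * x ^+ 2 / 2 = x ^+ 2); last by field.
      by ring.
    have i0 := @integrableT_gauss R.
    have ic : mu.-integrable setT (fun x => (cos (Num.sqrt 2 * t * x) * gam x)%:E).
      by apply: (@integrable_gauss_bounded _ 1) => [|y]; [mauto|exact: cos_max].
    rewrite integralD // I0 gauss_hatE -EFinD in H.
    by rewrite H muleA -EFinM mulfV ?mul1e // gt_eqF.
  rewrite GE -!EFinM; congr _%:E.
  by field; rewrite gt_eqF.
have := LHS1; rewrite RHS1 => -[]; lra.
Qed.

(** The variance of the law with density proportional to exp(- x^2), classically 1/2. *)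
Definition gauss_var : R := gauss_moment 1 / gauss_moment 0.

Lemma sin_cubic (y : R) : `|y - sin y| <= `|y| ^+ 3 / 2.
Proof.
wlog y0 : y / 0 <= y => [h|].
  by have [/h //|/ltW y0] := leP 0 y; have := h (- y); rewrite sinN opprK oppr_ge0 !normrN addrC -opprB normrN addrC => /(_ y0).
have [->|yN0] := eqVneq y 0; first by rewrite sin0 subrr normr0 expr0n mul0r.
have yp : 0 < y by rewrite lt_def yN0.
have [c hc ->] : exists2 c, c \in `]0, y[ & (y - sin y) = (1 - cos c) * y.
  have [|c hc] := @MVT R (fun x => x - sin x) (fun x => 1 - cos x) 0 y yp.
    by apply: derivable_within_continuous => x _; apply: derivableB.
  by rewrite sin0 !subr0 => e; exists c.
move: hc; rewrite in_itv /= => /andP[c0 cy].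
have h1 := onem_cos_le c; have h2 : 0 <= 1 - cos c by rewrite subr_ge0 cos_le1.
rewrite ger0_norm ?mulr_ge0 // (ger0_norm y0) exprSr mulrAC ler_wpM2r //.
apply: (le_trans h1); rewrite ler_pM2r ?invr_gt0 //.
by apply: lerXn2r; rewrite ?nnegrE ?(ltW c0) // ltW.
Qed.

Lemma cos_quartic (x : R) : `|cos x - 1 + x ^+ 2 / 2| <= x ^+ 4.
Proof.
have -> : cos x = 1 - 2 * sin (x / 2) ^+ 2.
  have := cosB_cosD (x / 2) (x / 2); rewrite subrr cos0 (_ : x / 2 + x / 2 = x); last by field.
  by rewrite expr2; lra.
set y := x / 2; have -> : x = 2 * y by rewrite /y; field.
rewrite (_ : _ + _ = 2 * ((y - sin y) * (y + sin y))); last by field.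
have h1 := sin_cubic y; have h2 : `|y + sin y| <= 2 * `|y|.
  by apply: (le_trans (ler_normD _ _)); rewrite mulrDl mul1r lerD2l sin_le_norm.
rewrite normrM normrM (ger0_norm (ler0n _ 2)).
have h3 : `|y - sin y| * `|y + sin y| <= `|y| ^+ 3 / 2 * (2 * `|y|) by apply: ler_pM.
have -> : (2 * y) ^+ 4 = 16 * `|y| ^+ 4.
  by rewrite exprMn (_ : `|y| ^+ 4 = y ^+ 4); [ring|rewrite -normrX ger0_norm // exprn_even_ge0].
have y4 : 0 <= `|y| ^+ 4 by rewrite exprn_ge0.
have e : `|y| ^+ 3 / 2 * (2 * `|y|) = `|y| ^+ 4 by field.
by rewrite e in h3; lra.
Qed.

Lemma gauss_hat_small t : `|gauss_hat t / gauss_moment 0 - 1 + gauss_var * t ^+ 2 / 2| <=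
  gauss_moment 2 / gauss_moment 0 * t ^+ 4.
Proof.
have m0 := gauss_moment0_gt0.
have i m : itg mu (fun x => x ^+ (2 * m) * gam x) := @integrable_gauss_moment m.
have ic : itg mu (fun x => cos (t * x) * gam x).
  by apply: (@integrable_gauss_bounded _ 1) => [|x]; [mauto|exact: cos_max].
have i1 := integrable_lin 1 (- 1) ic (i 0%N).
have i2 := integrable_lin 1 (t ^+ 2 / 2) i1 (i 1%N).
have -> : gauss_hat t / gauss_moment 0 - 1 + gauss_var * t ^+ 2 / 2 =
    (gauss_moment 0)^-1 * \int[mu]_x (1 * (1 * (cos (t * x) * gam x) + - 1 * (x ^+ (2 * 0) * gam x)) +
      t ^+ 2 / 2 * (x ^+ (2 * 1) * gam x)).
  rewrite (Rintegral_lin 1 (t ^+ 2 / 2) i1 (i 1%N)) (Rintegral_lin 1 (- 1) ic (i 0%N)).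
  rewrite -/(gauss_hat t) -/(gauss_moment 0) -/(gauss_moment 1) /gauss_var; field.
  by rewrite gt_eqF.
rewrite normrM (@ger0_norm _ (gauss_moment 0)^-1) ?invr_ge0 ?(ltW m0) //.
rewrite (_ : gauss_moment 2 / gauss_moment 0 * t ^+ 4 = (gauss_moment 0)^-1 * (t ^+ 4 * gauss_moment 2)); last by ring.
rewrite ler_wpM2l ?invr_ge0 ?(ltW m0) //.
apply: (le_trans (le_normr_Rintegral measurableT i2)).
have i4 : itg mu (fun x => t ^+ 4 * (x ^+ (2 * 2) * gam x)).
  exact: (integrableZl measurableT (t ^+ 4) (i 2%N)).
have -> : t ^+ 4 * gauss_moment 2 = \int[mu]_x (t ^+ 4 * (x ^+ (2 * 2) * gam x)) by rewrite RintegralZl.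
apply: le_Rintegral => // [|x _].
  exact: (integrable_norm i2).
rewrite muln0 expr0 muln1 (_ : _ + _ = (cos (t * x) - 1 + (t * x) ^+ 2 / 2) * gam x); last by ring.
rewrite normrM [`|gam x|]ger0_norm ?gauss_fun_ge0 // mulrA ler_wpM2r ?gauss_fun_ge0 //.
by rewrite -exprMn; exact: cos_quartic.
Qed.

(** For the normalised transform phi, [gauss_hat_double] reads phi(sqrt 2 t) = phi(t)^2; this is
    iterated 2m times. *)
Lemma gauss_hat_scale t m : gauss_hat t / gauss_moment 0 = (gauss_hat (t / 2 ^+ m) / gauss_moment 0) ^+ (4 ^ m).
Proof.
have m0 := gauss_moment0_gt0.
have s2 : 0 < Num.sqrt (2 : R) by rewrite sqrtr_gt0.
have ss : Num.sqrt 2 * Num.sqrt 2 = 2 :> R by rewrite -expr2 sqr_sqrtr.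
have step y : gauss_hat (Num.sqrt 2 * y) / gauss_moment 0 = (gauss_hat y / gauss_moment 0) ^+ 2.
  by rewrite expr_div_n gauss_hat_double expr2; field; rewrite gt_eqF.
elim: m t => [|m IH] t; first by rewrite expr0 divr1 expr1.
rewrite IH expnS exprM; congr (_ ^+ _).
have -> : t / 2 ^+ m = Num.sqrt 2 * (Num.sqrt 2 * (t / 2 ^+ m.+1)).
  by rewrite mulrA ss exprS; field; rewrite expf_neq0.
by rewrite (step (Num.sqrt 2 * (t / 2 ^+ m.+1))) (step (t / 2 ^+ m.+1)) -exprM.
Qed.

Lemma exprB_le (a b : R) n : `|a| <= 1 -> `|b| <= 1 -> `|a ^+ n - b ^+ n| <= n%:R * `|a - b|.
Proof.
move=> a1 b1; elim: n => [|n IH]; first by rewrite !expr0 subrr normr0 mul0r.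
rewrite !exprS (_ : _ - _ = a * (a ^+ n - b ^+ n) + (a - b) * b ^+ n); last by ring.
apply: (le_trans (ler_normD _ _)); rewrite !normrM -natr1 mulrDl mul1r; apply: lerD.
  by apply: le_trans IH; rewrite ler_piMl.
by rewrite ler_piMr // normrX exprn_ile1.
Qed.

(** The argument of the central limit theorem: phi(t) is the 4^J-th power of phi(t / 2^J). There phi
    and the exponential agree up to D / 16^J, so their 4^J-th powers differ by at most D / 4^J. *)
Lemma gauss_hat_formula t : gauss_hat t = gauss_moment 0 * expR (- (gauss_var * t ^+ 2 / 2)).
Proof.
have m0 := gauss_moment0_gt0.
have v0 : 0 <= gauss_var by rewrite divr_ge0 ?gauss_moment_ge0.
suff h : gauss_hat t / gauss_moment 0 = expR (- (gauss_var * t ^+ 2 / 2)).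
  by rewrite -h mulrC divfK // gt_eqF.
set u := gauss_var * t ^+ 2 / 2.
have u0 : 0 <= u by rewrite divr_ge0 // mulr_ge0 // sqr_ge0.
apply/eqP; rewrite -subr_eq0 -normr_le0; apply/ler_addgt0Pr => e e0; rewrite add0r.
pose D := gauss_moment 2 / gauss_moment 0 * t ^+ 4 + u ^+ 2.
have D0 : 0 <= D by rewrite addr_ge0 ?sqr_ge0 // mulr_ge0 ?divr_ge0 ?gauss_moment_ge0 // exprn_even_ge0.
have [J hJ] : exists J, forall j, (J <= j)%N -> (4^-1) ^+ j <= e / (1 + D).
  by apply: expr_small; [apply/andP; split; lra|rewrite divr_gt0 // ltr_pwDl].
have {hJ}hJ := hJ J (leqnn J).
pose N : R := 4 ^+ J; have N0 : 0 < N by rewrite exprn_gt0.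
rewrite (gauss_hat_scale t J).
have -> : expR (- u) = expR (- (u / N)) ^+ (4 ^ J).
  by rewrite -expRM_natl; congr expR; rewrite /N natrX; field; rewrite gt_eqF.
have b1 y : `|gauss_hat y / gauss_moment 0| <= 1.
  rewrite normrM normfV (gtr0_norm m0) ler_pdivrMr // mul1r.
  apply: (le_trans (le_normr_Rintegral measurableT _)).
    by apply: (@integrable_gauss_bounded _ 1) => [|x]; [mauto|exact: cos_max].
  apply: le_Rintegral => //.
  - apply: integrable_norm; by apply: (@integrable_gauss_bounded _ 1) => [|x]; [mauto|exact: cos_max].
  - exact: (@integrable_gauss_moment 0).
  by move=> x _; rewrite muln0 expr0 normrM (@ger0_norm _ (gam x)) ?gauss_fun_ge0 // ler_wpM2r ?gauss_fun_ge0 // cos_max.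
have b2 : `|expR (- (u / N))| <= 1.
  by rewrite ger0_norm ?expR_ge0 // -expR0 ler_expR oppr_le0 divr_ge0 // ltW.
apply: (le_trans (exprB_le _ (b1 _) b2)).
have h1 := gauss_hat_small (t / 2 ^+ J).
have NN : (2 ^+ J) ^+ 2 = N by rewrite -exprM mulnC exprM /N; congr (_ ^+ J); ring.
have e1 : gauss_var * (t / 2 ^+ J) ^+ 2 / 2 = u / N.
  by rewrite expr_div_n NN /u; field; rewrite gt_eqF.
have e2 : (t / 2 ^+ J) ^+ 4 = t ^+ 4 / N ^+ 2.
  by rewrite expr_div_n -NN -exprM.
rewrite e1 e2 in h1.
have h2 : `|expR (- (u / N)) - 1 + u / N| <= (u / N) ^+ 2.
  have y0 : 0 <= u / N by rewrite divr_ge0 // ltW.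
  set y := u / N in y0 *.
  have l1 : 1 - y <= expR (- y) by have := expR_ge1Dx (- y); lra.
  have l2 : expR (- y) * (1 + y) <= 1.
    have := expR_ge1Dx y; have := expR_ge0 (- y) => p q.
    by rewrite -[leRHS](expRxMexpNx_1 y) [leRHS]mulrC ler_wpM2l.
  have p := expR_ge0 (- y).
  rewrite ger0_norm; last by lra.
  have : expR (- y) <= 1 - y + y ^+ 2.
    rewrite -(@ler_pM2r _ (1 + y)); last by lra.
    apply: (le_trans l2); rewrite expr2; have := mulr_ge0 y0 (mulr_ge0 y0 y0); nra.
  lra.
have h3 : `|gauss_hat (t / 2 ^+ J) / gauss_moment 0 - expR (- (u / N))| <= D / N ^+ 2.
  rewrite (_ : _ - _ = (gauss_hat (t / 2 ^+ J) / gauss_moment 0 - 1 + u / N) - (expR (- (u / N)) - 1 + u / N)); last by ring.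
  apply: (le_trans (ler_normB _ _)); apply: (le_trans (lerD h1 h2)).
  by rewrite [(u / N) ^+ 2]expr_div_n /D mulrDl mulrA.
rewrite natrX -/N; apply: (le_via (N * (D / N ^+ 2))); first by rewrite ler_wpM2l // ltW.
have -> : N * (D / N ^+ 2) = D * (4^-1) ^+ J.
  by rewrite exprVn -/N; field; rewrite gt_eqF.
apply: (le_via (D * (e / (1 + D)))); first by rewrite ler_wpM2l.
rewrite mulrA ler_pdivrMr ?ltr_pwDl // mulrC ler_wpM2l ?(ltW e0) //.
by rewrite lerDr.
Qed.
End gaussian_fourier.

(** * Centred Gaussian variables: moments, characteristic functions, L2 limits *)

Section centered_gaussian_law.
Context {R : realType}.
Local Notation mu := (@lebesgue_measure R).
Local Notation gam := (@gauss_fun R).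

Lemma gauss_var_gt0 : 0 < @gauss_var R.
Proof.
rewrite divr_gt0 ?gauss_moment0_gt0 //.
suff : (0 < (gauss_moment 1 : R)%:E)%E by rewrite lte_fin.
rewrite -gauss_momentE.
have H : (0 < \int[mu]_x ((expR (- 4))%:E * (\1_`[1%R, 2%R] x)%:E))%E.
  rewrite ge0_integralZl_EFin ?expR_ge0 //; last first.
    by mauto.
  rewrite integral_indic //= setIT lebesgue_measure_itv /= lte_fin ltr1n -EFinD -EFinM lte_fin.
  by rewrite mulr_gt0 ?expR_gt0 //; lra.
apply: (lt_le_trans H); apply: ge0_le_integral => //.
- by mauto.
- apply/measurable_EFinP; apply: measurable_funM; last exact: measurable_gauss_fun.
  by mauto.
move=> x _; rewrite -EFinM lee_fin muln1 indicE; case: (boolP (x \in _)); last first.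
  by move=> _; rewrite mulr0 mulr_ge0 ?gauss_fun_ge0 // sqr_ge0.
rewrite inE /= in_itv /= mulr1 => /andP[x1 x2].
apply: (le_via (gam x)); first by rewrite /gauss_fun ler_expR lerN2 expr2; nra.
by rewrite ler_peMl ?gauss_fun_ge0 // expr2; nra.
Qed.

Context d (T : measurableType d) (P : probability T R).

(** The moment of order 2m of the standard normal law. *)
Definition moment_const m : R := gauss_moment m / gauss_moment 0 / gauss_var ^+ m.

Lemma moment_const_ge0 m : 0 <= moment_const m.
Proof. by rewrite !divr_ge0 ?gauss_moment_ge0 // exprn_ge0 // ltW // gauss_var_gt0. Qed.

(** What later sections use of a centred Gaussian law, in a form that survives L2 limits. The higher
    moments appear as upper bounds, which is what a truncation and limit argument yields. *)
Record gauss_like (X : T -> R) (v : R) : Prop := GaussLike {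
  gl_measurable : mbl X ;
  gl_var : (\int[P]_w (X w ^+ 2)%:E = v%:E)%E ;
  gl_chf : forall c, \int[P]_w cos (X w + c) = cos c * expR (- v / 2) ;
  gl_moment : forall m, (\int[P]_w (X w ^+ (2 * m))%:E <= (moment_const m * v ^+ m)%:E)%E }.

Lemma gl_ge0 X v : gauss_like X v -> 0 <= v.
Proof.
case=> _ h _ _; rewrite -lee_fin -h; apply: integral_ge0 => w _.
by rewrite lee_fin sqr_ge0.
Qed.

Lemma centered_gaussian_integral (X : T -> R) (s : R) (f : R -> R) : mbl X -> 0 < s ->
  (forall A, measurable A -> P (X @^-1` A) = normal_prob 0 s A) ->
  mbl f -> (forall x, 0 <= f x) ->
  (\int[P]_w (f (X w))%:E = \int[mu]_x (f (Num.sqrt 2 * s * x) * gam x / gauss_moment 0)%:E)%E.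
Proof.
move=> mX s0 hX mf f0.
have sN0 : s != 0 by rewrite gt_eqF.
have mfE : mbl (fun x : Borel R => (f x)%:E) by mauto.
pose X' : T -> Borel R := X.
have mX' : mbl X' by mauto.
rewrite -[LHS](@ge0_integral_pushforward _ _ _ _ R X' mX' P setT _ measurableT mfE); last first.
  by move=> x _; rewrite lee_fin.
transitivity (\int[normal_prob 0 s]_y (f y)%:E)%E.
  by apply: eq_measure_integral => A mA _; exact: (hX A mA).
rewrite (@ge0_integral_density R _ _ mu (normal_prob 0 s) (normal_pdf 0 s) f) //; last 2 first.
- exact: measurable_normal_pdf.
- by move=> x; exact: normal_pdf_ge0.
have c0 : 0 < Num.sqrt 2 * s by rewrite mulr_gt0 // sqrtr_gt0.
have mF : mbl (fun x : Borel R => (f x * normal_pdf 0 s x)%:E).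
  by apply/measurable_EFinP; apply: measurable_funM => //; exact: measurable_normal_pdf.
have F0 (x : Borel R) : (0 <= (f x * normal_pdf 0 s x)%:E)%E.
  by rewrite lee_fin mulr_ge0 // normal_pdf_ge0.
have H := @ge0_integral_scale1 R (Num.sqrt 2 * s) _ c0 mF F0.
have -> : (\int[mu]_x (f x * normal_pdf 0 s x)%:E =
    (Num.sqrt 2 * s)%:E * \int[mu]_x (f (Num.sqrt 2 * s * x) * normal_pdf 0 s (Num.sqrt 2 * s * x))%:E)%E.
  by rewrite H muleA -EFinM mulfV ?mul1e // gt_eqF.
rewrite -ge0_integralZl_EFin //; last 2 first.
- apply: (measurableT_comp mF); exact: measurable_funM.
- exact: ltW.
apply: eq_integral_leb => x; rewrite -EFinM; congr _%:E.
rewrite normal_pdfE // /normal_fun subr0.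
have s22 : Num.sqrt 2 ^+ 2 = 2 :> R by rewrite sqr_sqrtr.
have -> : - (Num.sqrt 2 * s * x) ^+ 2 / (s ^+ 2 *+ 2) = - x ^+ 2.
  by rewrite 2!exprMn s22; field.
rewrite -/(gam x) gauss_moment0 /normal_peak.
have -> : Num.sqrt (s ^+ 2 * pi *+ 2) = Num.sqrt 2 * s * Num.sqrt pi.
  have -> : s ^+ 2 * pi *+ 2 = 2 * s ^+ 2 * pi by rewrite -[LHS]mulr_natl mulrA.
  have s20 : 0 <= 2 * s ^+ 2 by rewrite mulr_ge0 ?sqr_ge0.
  by rewrite (sqrtrM pi s20) sqrtrM // sqrtr_sqr ger0_norm // ltW.
have sp : Num.sqrt (pi : R) != 0 by rewrite gt_eqF // sqrtr_gt0 pi_gt0.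
by field; rewrite sp gt_eqF // gt_eqF // sqrtr_gt0.
Qed.

Lemma centered_gaussian_like (X : T -> R) : mbl X -> centered_gaussian P X ->
  exists v, gauss_like X v.
Proof.
move=> mX [s s0 hX]; have m0 := @gauss_moment0_gt0 R.
have mE m : mbl (fun x : R => x ^+ m) by mauto.
have ev (x : R) m : 0 <= x ^+ (2 * m) by rewrite exprn_even_ge0 // mul2n odd_double.
have c1 (x : R) : 0 <= 1 + cos x by have := cos_max x; rewrite ler_norml => /andP[+ _]; lra.
have ic c : itg P (fun w => cos (X w + c)).
  by apply: (integrable_by 1) => [|w]; [mauto|exact: cos_max].
(* The change of variables is stated for nonnegative integrands, hence the shift of the cosine by
   1. *)
have chfE c : (\int[P]_w (1 + cos (X w + c))%:E = (1 + \int[P]_w cos (X w + c))%:E)%E.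
  have i1 : itg P (cst (1 : R)).
    by apply: (integrable_by 1) => // w; rewrite normr1.
  have := integrable_lin 1 1 i1 (ic c) => i2.
  transitivity ((\int[P]_w (1 * cst 1 w + 1 * cos (X w + c)))%:E)%E.
    rewrite -integral_Rintegral //; apply: eq_integral => w _ /=; congr _%:E; by rewrite !mul1r.
  rewrite (Rintegral_lin 1 1 i1 (ic c)) Rintegral_cst //= probability_setT /=; congr _%:E; ring.
have [s_eq0|sN0] := eqVneq s 0.
  exists 0; have hD (f : R -> R) : mbl f -> (forall x, 0 <= f x) ->
      (\int[P]_w (f (X w))%:E = (f 0)%:E)%E.
    move=> mf f0; have mfE : mbl (fun x : Borel R => (f x)%:E) by apply/measurable_EFinP.
    rewrite -[LHS](@ge0_integral_pushforward _ _ _ _ R X mX P setT _ measurableT mfE); last first.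
      by move=> x _; rewrite lee_fin.
    rewrite (eq_measure_integral (dirac (0 : R))); last first.
      by move=> A mA _; have := hX A mA; rewrite s_eq0 eqxx.
    by rewrite integral_dirac // diracT mul1e.
  split => //.
  - by rewrite (hD (fun x => x ^+ 2)) ?expr0n // => x; exact: sqr_ge0.
  - move=> c; rewrite mulNr mul0r oppr0 expR0 mulr1.
    have := chfE c; rewrite (hD (fun x => 1 + cos (x + c))) ?add0r //; last by mauto.
    by move=> -[]; lra.
  - move=> m; rewrite (hD (fun x => x ^+ (2 * m))) // lee_fin; case: m => [|m]; last first.
      by rewrite expr0n muln_eq0 /= expr0n mulr0.
    by rewrite muln0 !expr0 mulr1 /moment_const expr0 divr1 divff // gt_eqF.
have sp : 0 < s by rewrite lt_def sN0.
have hX' A : measurable A -> P (X @^-1` A) = normal_prob 0 s A.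
  by move=> mA; rewrite hX // (negbTE sN0).
(* The variable is sqrt 2 * s times one with variance [gauss_var]. *)
pose v := 2 * s ^+ 2 * @gauss_var R.
have mom m : (\int[P]_w (X w ^+ (2 * m))%:E = (moment_const m * v ^+ m)%:E)%E.
  rewrite (centered_gaussian_integral mX sp hX' (mE (2 * m)%N)) //.
  rewrite (@eq_integral_leb _ _ (fun x => ((2 * s ^+ 2) ^+ m / gauss_moment 0)%:E * (x ^+ (2 * m) * gam x)%:E)%E); last first.
    move=> x; rewrite -EFinM; congr _%:E; rewrite exprM (_ : (Num.sqrt 2 * s * x) ^+ 2 = 2 * s ^+ 2 * x ^+ 2).
      by rewrite exprMn -exprM; ring.
    by rewrite 2!exprMn sqr_sqrtr.
  rewrite integralZl //; last exact: integrable_gauss_moment.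
  rewrite gauss_momentE -EFinM; congr _%:E; rewrite /moment_const /v [(2 * _ * gauss_var) ^+ m]exprMn.
  field; rewrite (gt_eqF m0) /=.
  by rewrite expf_neq0 // gt_eqF // gauss_var_gt0.
exists v; split => //.
- have := mom 1%N; rewrite muln1 => ->; congr _%:E; rewrite /moment_const !expr1 /gauss_var.
  have m1 : gauss_moment 1 != 0 :> R.
    by have := gauss_var_gt0; rewrite /gauss_var pmulr_lgt0 ?invr_gt0 // => /gt_eqF ->.
  by field; rewrite m1 gt_eqF.
- move=> c; have := chfE c.
  rewrite (centered_gaussian_integral mX sp hX' (f := fun x => 1 + cos (x + c))) //; last by mauto.
  rewrite (@eq_integral_leb _ _ (fun x => ((gauss_moment 0)^-1)%:E * (x ^+ (2 * 0) * gam x)%:E +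
    ((cos c / gauss_moment 0)%:E * (cos (Num.sqrt 2 * s * x) * gam x)%:E +
     (- sin c / gauss_moment 0)%:E * (sin (Num.sqrt 2 * s * x) * gam x)%:E))%E); last first.
    by move=> x; rewrite -!EFinM -!EFinD; congr _%:E; rewrite cosD muln0 expr0; ring.
  have i0 := @integrable_gauss_moment R 0.
  have i1 : mu.-integrable setT (fun x => (cos (Num.sqrt 2 * s * x) * gam x)%:E).
    by apply: (@integrable_gauss_bounded _ _ 1) => [|y]; [mauto|exact: cos_max].
  have i2 : mu.-integrable setT (fun x => (sin (Num.sqrt 2 * s * x) * gam x)%:E).
    by apply: (@integrable_gauss_bounded _ _ 1) => [|y]; [mauto|exact: sin_max].
  rewrite integralD //; [|exact: integrableZl|by apply: integrableD => //; exact: integrableZl].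
  rewrite integralD //; [|exact: integrableZl|exact: integrableZl].
  rewrite !integralZl // gauss_momentE gauss_hatE gauss_sin mule0 adde0 -!EFinM -EFinD => -[].
  rewrite gauss_hat_formula mulVf ?gt_eqF // => /addrI <-.
  rewrite mulrA divfK ?gt_eqF //; congr (_ * expR _).
  rewrite !exprMn sqr_sqrtr // /v; by field.
- by move=> m; rewrite mom.
Qed.

Lemma exprB_le_bound (a b V : R) n : 1 <= V -> `|a| <= V -> `|b| <= V ->
  `|a ^+ n - b ^+ n| <= n%:R * V ^+ n * `|a - b|.
Proof.
move=> V1 aV bV; have V0 : 0 <= V by exact: le_trans V1.
elim: n => [|n IH]; first by rewrite !expr0 subrr normr0 !mul0r.
rewrite !exprS (_ : _ - _ = a * (a ^+ n - b ^+ n) + (a - b) * b ^+ n); last by ring.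
apply: (le_trans (ler_normD _ _)); rewrite !normrM.
rewrite -natr1 (_ : _ * _ * _ = V * (n%:R * V ^+ n * `|a - b|) + V * V ^+ n * `|a - b|); last by ring.
apply: lerD; first by apply: ler_pM.
rewrite mulrC ler_wpM2r // normrX -[leLHS]mul1r; apply: ler_pM => //.
by apply: lerXn2r; rewrite ?nnegrE.
Qed.

(** Pointwise |y| <= e + y^2 / e. *)
Lemma l1_le_l2 (X Y : T -> R) (e : R) : mbl X -> mbl Y -> 0 < e ->
  (\int[P]_w ((X w - Y w) ^+ 2)%:E <= (e ^+ 2)%:E)%E -> (\int[P]_w `|X w - Y w|%:E <= (2 * e)%:E)%E.
Proof.
move=> mX mY e0 h.
apply: (le_via (\int[P]_w (e%:E + e^-1%:E * ((X w - Y w) ^+ 2)%:E))%E).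
  apply: ge0_le_integral => //.
  - by mauto.
  - apply/measurable_EFinP; apply: measurable_funD => //; apply: measurable_funM => //.
    by mauto.
  move=> w _; rewrite -EFinM -EFinD lee_fin -(real_normK (num_real (X w - Y w))).
  set y := `|_|; have y0 : 0 <= y by exact: normr_ge0.
  rewrite -(ler_pM2l e0) mulrDr mulrA mulfV ?gt_eqF // mul1r.
  by have := sqr_ge0 (e - y); have := mulr_ge0 (ltW e0) y0; rewrite !expr2; nra.
rewrite ge0_integralD //; last 3 first.
- by move=> w _; rewrite lee_fin ltW.
- by move=> w _; rewrite -EFinM lee_fin mulr_ge0 ?sqr_ge0 // invr_ge0 ltW.
- by mauto.
rewrite integral_cst //= probability_setT mule1 ge0_integralZl_EFin //; last 3 first.
- by move=> w _; rewrite lee_fin sqr_ge0.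
- by mauto.
- by rewrite invr_ge0 ltW.
apply: (le_via (e%:E + e^-1%:E * (e ^+ 2)%:E)%E).
  by rewrite leeD2l //; apply: lee_wpmul2l => //; rewrite lee_fin invr_ge0 ltW.
by rewrite -EFinM -EFinD lee_fin expr2 mulKf ?gt_eqF //; lra.
Qed.

(** Pointwise x^2 <= (1 + e) y^2 + (1 + 1/e) (x - y)^2, and (1 + 1/e) e^2 = e^2 + e. Finiteness of
    the second moment of X is a conclusion. *)
Lemma sqr_perturb (X Y : T -> R) (e a : R) : mbl X -> mbl Y -> 0 < e ->
  (\int[P]_w ((X w - Y w) ^+ 2)%:E <= (e ^+ 2)%:E)%E -> (\int[P]_w (Y w ^+ 2)%:E <= a%:E)%E ->
  (\int[P]_w (X w ^+ 2)%:E <= ((1 + e) * a + e ^+ 2 + e)%:E)%E.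
Proof.
move=> mX mY e0 h hY.
have mD : mbl (fun w => ((X w - Y w) ^+ 2)%:E).
  by mauto.
have mY2 : mbl (fun w => (Y w ^+ 2)%:E) by mauto.
have p1 : 0 <= 1 + e by lra.
have p2 : 0 <= 1 + e^-1 by rewrite addr_ge0 // invr_ge0 ltW.
apply: (le_via (\int[P]_w ((1 + e)%:E * (Y w ^+ 2)%:E + (1 + e^-1)%:E * ((X w - Y w) ^+ 2)%:E))%E).
  apply: ge0_le_integral => //.
  - by move=> w _; rewrite lee_fin sqr_ge0.
  - by mauto.
  - by apply: emeasurable_funD; exact: measurable_funeM.
  move=> w _; rewrite -!EFinM -EFinD lee_fin; set x := X w; set y := Y w.
  rewrite -subr_ge0 (_ : _ - _ = e^-1 * (e * y - (x - y)) ^+ 2); last by field; rewrite gt_eqF.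
  by rewrite mulr_ge0 ?sqr_ge0 // invr_ge0 ltW.
rewrite ge0_integralD //; last 4 first.
- by move=> w _; rewrite -EFinM lee_fin mulr_ge0 // sqr_ge0.
- by mauto.
- by move=> w _; rewrite -EFinM lee_fin mulr_ge0 // sqr_ge0.
- by mauto.
rewrite !ge0_integralZl_EFin //; last 2 first.
- by move=> w _; rewrite lee_fin sqr_ge0.
- by move=> w _; rewrite lee_fin sqr_ge0.
apply: (le_via ((1 + e)%:E * a%:E + (1 + e^-1)%:E * (e ^+ 2)%:E)%E).
  by apply: leeD; apply: lee_wpmul2l.
rewrite -!EFinM -EFinD lee_fin; apply: le_of_eq; field.
by rewrite gt_eqF.
Qed.
End centered_gaussian_law.

Section gaussian_limits.
Context {R : realType} d (T : measurableType d) (P : probability T R).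

Lemma norm_min_sub (x y B : R) : `|Num.min `|x| B - Num.min `|y| B| <= `|x - y|.
Proof.
have h : `| `|x| - `|y| | <= `|x - y| by exact: ler_dist_dist.
apply: le_trans h; rewrite /Num.min.
case: ltP => h1; case: ltP => h2 //.
- by rewrite ler_norml; apply/andP; split; have := ler_norm (`|y| - `|x|); rewrite distrC; lra.
- by rewrite ler_norml; apply/andP; split; have := ler_norm (`|x| - `|y|); lra.
- by rewrite subrr normr0.
Qed.

(** Variances converge by [sqr_perturb], characteristic functions because the cosine is Lipschitz
    and L2 controls L1. For the moments, the truncation min(|x|, B)^(2m) is Lipschitz, so the bound
    passes to the limit at fixed B; then B tends to infinity. *)
Lemma gauss_like_limit (Z : T -> R) : mbl Z ->
  (forall e, 0 < e -> exists (Y : T -> R) (v : R), gauss_like P Y v /\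
    (\int[P]_w ((Y w - Z w) ^+ 2)%:E <= (e ^+ 2)%:E)%E) ->
  exists v, gauss_like P Z v.
Proof.
move=> mZ hZ.
have sw (Y : T -> R) (e : R) : (\int[P]_w ((Y w - Z w) ^+ 2)%:E <= (e ^+ 2)%:E)%E ->
    (\int[P]_w ((Z w - Y w) ^+ 2)%:E <= (e ^+ 2)%:E)%E.
  by under eq_integral do rewrite -sqrrN opprB.
have [Y1 [v1 [g1 h1]]] := hZ 1 ltr01.
have fin : (\int[P]_w (Z w ^+ 2)%:E < +oo)%E.
  have l1 : (\int[P]_w (Y1 w ^+ 2)%:E <= v1%:E)%E by rewrite (gl_var g1).
  have l2 := sqr_perturb mZ (gl_measurable g1) ltr01 (sw _ _ h1) l1.
  by apply: le_lt_trans l2 _; rewrite ltry.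
have Z20 : (0 <= \int[P]_w (Z w ^+ 2)%:E)%E by apply: integral_ge0 => w _; rewrite lee_fin sqr_ge0.
pose v := fine (\int[P]_w (Z w ^+ 2)%:E).
have vE : (\int[P]_w (Z w ^+ 2)%:E = v%:E)%E by rewrite /v fineK // ge0_fin_numE.
have v0 : 0 <= v by rewrite -lee_fin -vE.
have close e : 0 < e <= 1 -> exists (Y : T -> R) (vY : R), [/\ gauss_like P Y vY,
    (\int[P]_w `|Y w - Z w|%:E <= (2 * e)%:E)%E & `|vY - v| <= e * (2 * v + 4)].
  move=> /andP[e0 e1]; have [Y [vY [gY hY]]] := hZ e e0.
  exists Y, vY; split => //; first exact: l1_le_l2 (gl_measurable gY) mZ e0 hY.
  have vY0 := gl_ge0 gY.
  have := sqr_perturb (gl_measurable gY) mZ e0 hY; rewrite (gl_var gY) vE => /(_ v (lexx _)).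
  rewrite lee_fin => a1.
  have := sqr_perturb mZ (gl_measurable gY) e0 (sw _ _ hY); rewrite (gl_var gY) vE => /(_ vY (lexx _)).
  rewrite lee_fin => a2.
  have ee : e ^+ 2 <= e by rewrite expr2 ler_piMl // ltW.
  have b1 : vY <= 2 * v + 2.
    apply: (le_trans a1); have := ler_wpM2r v0 e1; rewrite mul1r mulrDl mul1r; lra.
  have c1 : e * vY <= e * (2 * v + 2) by rewrite ler_wpM2l // ltW.
  rewrite ler_norml; apply/andP; split.
    rewrite mulrDl mul1r in a2; rewrite mulrDr in c1 *; lra.
  rewrite mulrDl mul1r in a1; rewrite mulrDr.
  by have := mulr_ge0 (ltW e0) v0; rewrite mulrCA; lra.
exists v; split => //.
- move=> c; apply/eqP; rewrite -subr_eq0 -normr_le0; apply/ler_addgt0Pr => eps eps0; rewrite add0r.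
  pose e := Num.min 1 (Num.min (eps / 4) ((eps / 2) ^+ 2 / (v + 2))).
  have v2 : 0 < v + 2 by lra.
  have e0 : 0 < e by rewrite !lt_min ltr01 !divr_gt0 ?exprn_gt0 // divr_gt0.
  have [|Y [vY [gY hY hv]]] := close e; first by rewrite e0 ge_min lexx.
  have e1 : e <= eps / 4 by rewrite !ge_min lexx !orbT.
  have e2 : e * (v + 2) <= (eps / 2) ^+ 2.
    by rewrite -ler_pdivlMr // !ge_min lexx !orbT.
  have mY := gl_measurable gY.
  have iZ : itg P (fun w => cos (Z w + c)).
    by apply: (integrable_by 1) => [|w]; [mauto|exact: cos_max].
  have iY : itg P (fun w => cos (Y w + c)).
    by apply: (integrable_by 1) => [|w]; [mauto|exact: cos_max].
  have A1 : `|\int[P]_w cos (Z w + c) - \int[P]_w cos (Y w + c)| <= 2 * e.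
    rewrite -RintegralB // -lee_fin.
    have iD : itg P (fun w => cos (Z w + c) - cos (Y w + c)).
      by have := integrable_lin 1 (- 1) iZ iY; under eq_fun do rewrite mul1r mulN1r.
    apply: (le_via (\int[P]_w `|cos (Z w + c) - cos (Y w + c)|%:E)%E).
      have := le_abse_integral P measurableT (measurable_int _ iD).
      by rewrite integral_Rintegral.
    apply: le_trans hY; apply: ge0_le_integral => //.
    + by mauto.
    + by mauto.
    move=> w _; rewrite lee_fin; apply: (le_trans (cos_lipschitz _ _)).
    by rewrite distrC opprD addrACA subrr addr0.
  have A2 : `|expR (- vY / 2) - expR (- v / 2)| <= eps / 2.
    rewrite !mulNr; apply: (le_trans (expRN_sqrt_lipschitz _ _)); rewrite ?divr_ge0 // ?(gl_ge0 gY) //.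
    rewrite -(@ger0_norm _ (eps / 2)); last by rewrite divr_ge0 // ltW.
    rewrite -[leRHS]sqrtr_sqr ler_wsqrtr // -mulrBl normrM (@ger0_norm _ 2^-1) ?invr_ge0 //.
    apply: le_trans e2; rewrite ler_pdivrMr //; apply: (le_trans hv).
    by rewrite -mulrA ler_wpM2l ?(ltW e0) //; lra.
  rewrite (_ : _ - _ = (\int[P]_w cos (Z w + c) - \int[P]_w cos (Y w + c)) +
    cos c * (expR (- vY / 2) - expR (- v / 2))); last by rewrite (gl_chf gY); ring.
  apply: (le_trans (ler_normD _ _)); rewrite normrM.
  have := ler_pM (normr_ge0 (cos c)) (normr_ge0 _) (cos_max c) A2; rewrite mul1r.
  by lra.
- move=> m; pose F (B : nat) w := ((Num.min `|Z w| B%:R) ^+ (2 * m))%:E.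
  have nn (x : R) (B : nat) : 0 <= Num.min `|x| B%:R by rewrite le_min normr_ge0 ler0n.
  have F0 B w : (0 <= F B w)%E by rewrite lee_fin exprn_ge0.
  have mmin (Y : T -> R) (B : nat) : mbl Y -> mbl (fun w => Num.min `|Y w| B%:R).
    move=> mY; apply: measurable_minr => //; by mauto.
  have mF B : mbl (F B).
    by apply/measurable_EFinP; apply: measurable_funX; exact: mmin.
  apply: (ge0_integral_le_of_cvg mF F0) => [w|B].
    apply: cvg_near_cst; exists (Num.truncn `|Z w|).+1 => // B /= hB.
    rewrite /F; congr _%:E.
    have hz : `|Z w| <= B%:R by apply: (le_trans (ltW (truncnS_gt _))); rewrite ler_nat.
    have -> : Num.min `|Z w| B%:R = `|Z w| by rewrite min_l.
    by rewrite -normrX ger0_norm // exprn_even_ge0 // mul2n odd_double.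
  apply/lee_addgt0Pr => eps eps0; rewrite -EFinD.
  pose V := 1 + B%:R : R; have V1 : 1 <= V by rewrite lerDl.
  pose V' := 3 * v + 5; have V1' : 1 <= V' by rewrite /V'; lra.
  pose Lc := (2 * m)%:R * V ^+ (2 * m) * 2 + moment_const m * (m%:R * V' ^+ m * (2 * v + 4)).
  have mc0 := @moment_const_ge0 R m.
  have L0 : 0 <= Lc.
    have V0 : 0 <= V by exact: le_trans V1.
    have V0' : 0 <= V' by exact: le_trans V1'.
    have v4 : 0 <= 2 * v + 4 by lra.
    exact: addr_ge0 (mulr_ge0 (mulr_ge0 (ler0n _ _) (exprn_ge0 _ V0)) _) (mulr_ge0 mc0 (mulr_ge0 (mulr_ge0 (ler0n _ _) (exprn_ge0 _ V0')) v4)).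
  pose e := Num.min 1 (eps / (1 + Lc)).
  have e0 : 0 < e by rewrite lt_min ltr01 divr_gt0 // ltr_pwDl.
  have e1 : e <= 1 by rewrite ge_min lexx.
  have e2 : Lc * e <= eps.
    have h : e <= eps / (1 + Lc) by rewrite ge_min lexx orbT.
    apply: (le_trans (ler_wpM2l L0 h)); rewrite mulrCA ler_piMr ?(ltW eps0) //.
    by rewrite ler_pdivrMr ?ltr_pwDl // mul1r lerDr.
  have [|Y [vY [gY hY hv]]] := close e; first by rewrite e0.
  have mY := gl_measurable gY; have vY0 := gl_ge0 gY.
  apply: (le_via (\int[P]_w ((Y w ^+ (2 * m))%:E + ((2 * m)%:R * V ^+ (2 * m))%:E * `|Y w - Z w|%:E))%E).
    apply: ge0_le_integral => //.
    + apply: emeasurable_funD; first by apply/measurable_EFinP; exact: measurable_funX.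
      by mauto.
    move=> w _; rewrite -EFinM -EFinD lee_fin.
    have l1 (x : R) : `|Num.min `|x| B%:R| <= V.
      by rewrite ger0_norm // (le_via B%:R) ?ge_min ?lexx ?orbT // lerDr.
    have := exprB_le_bound (2 * m) V1 (l1 (Z w)) (l1 (Y w)) => hh.
    have hh' : Num.min `|Y w| B%:R ^+ (2 * m) <= Y w ^+ (2 * m).
      have -> : Y w ^+ (2 * m) = `|Y w| ^+ (2 * m).
        by rewrite -normrX ger0_norm // exprn_even_ge0 // mul2n odd_double.
      by apply: lerXn2r; rewrite ?nnegrE // ge_min lexx.
    have := ler_norm (Num.min `|Z w| B%:R ^+ (2 * m) - Num.min `|Y w| B%:R ^+ (2 * m)).
    have hm : (2 * m)%:R * V ^+ (2 * m) * `|Num.min `|Z w| B%:R - Num.min `|Y w| B%:R| <=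
      (2 * m)%:R * V ^+ (2 * m) * `|Y w - Z w|.
      apply: ler_wpM2l; first by rewrite mulr_ge0 // exprn_ge0 // (le_trans _ V1).
      by rewrite [leRHS]distrC; exact: norm_min_sub.
    lra.
  rewrite ge0_integralD //; last 4 first.
  + by move=> w _; rewrite lee_fin exprn_even_ge0 // mul2n odd_double.
  + by mauto.
  + by move=> w _; rewrite -EFinM lee_fin !mulr_ge0 // exprn_ge0 // (le_trans _ V1).
  + by mauto.
  rewrite ge0_integralZl_EFin //; last 2 first.
  + by mauto.
  + by rewrite !mulr_ge0 // exprn_ge0 // (le_trans _ V1).
  apply: (le_via ((moment_const m * vY ^+ m)%:E + ((2 * m)%:R * V ^+ (2 * m))%:E * (2 * e)%:E)%E).
    apply: leeD; first exact: (gl_moment gY).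
    by apply: lee_wpmul2l => //; rewrite lee_fin mulr_ge0 // exprn_ge0 // (le_trans _ V1).
  rewrite -EFinM -EFinD lee_fin.
  have hw : e * (2 * v + 4) <= 2 * v + 4 by rewrite ler_piMl //; lra.
  have hb : vY ^+ m <= v ^+ m + m%:R * V' ^+ m * (e * (2 * v + 4)).
    have bY : `|vY| <= V'.
      by rewrite ger0_norm //; move: hv; rewrite ler_norml /V' => /andP[_]; lra.
    have bv : `|v| <= V' by rewrite ger0_norm // /V'; lra.
    have := exprB_le_bound m V1' bY bv => q1.
    have := ler_norm (vY ^+ m - v ^+ m).
    have q2 : m%:R * V' ^+ m * `|vY - v| <= m%:R * V' ^+ m * (e * (2 * v + 4)).
      by apply: ler_wpM2l => //; rewrite mulr_ge0 // exprn_ge0 // (le_trans _ V1').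
    lra.
  have := ler_wpM2l mc0 hb; rewrite mulrDr => q.
  apply: (le_via (moment_const m * v ^+ m + Lc * e)); last by rewrite lerD2l.
  rewrite /Lc; move: q.
  set q1 := moment_const m * vY ^+ m; set q2 := moment_const m * v ^+ m.
  rewrite (_ : (2 * m)%:R * V ^+ (2 * m) * (2 * e) = (2 * m)%:R * V ^+ (2 * m) * 2 * e); last by ring.
  rewrite (_ : moment_const m * (m%:R * V' ^+ m * (e * (2 * v + 4))) = moment_const m * (m%:R * V' ^+ m * (2 * v + 4)) * e); last by ring.
  by rewrite [(_ + _) * e]mulrDl; lra.
Qed.

Lemma gauss_like_second_moment (I : Type) (Z : I -> T -> R) (L0 : seq (R * I)) :
  (forall L, exists v, gauss_like P (lin Z L) v) ->
  \int[P]_w (lin Z L0 w ^+ 2) = bil (fun i j => \int[P]_w (Z i w * Z j w)) L0 L0.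
Proof.
move=> hL.
have linE i w : lin Z [:: (1, i)] w = Z i w by rewrite /lin big_seq1 mul1r.
have mZ i : mbl (Z i).
  have [v g] := hL [:: (1, i)]; have := gl_measurable g.
  by rewrite (_ : lin Z _ = Z i) //; apply/funext => w; rewrite linE.
have i2 i : itg P (fun w => Z i w ^+ 2).
  have [v g] := hL [:: (1, i)]; apply/integrableP; split.
    by mauto.
  rewrite (eq_integral (fun w => (lin Z [:: (1, i)] w ^+ 2)%:E)) ?(gl_var g) ?ltry // => w _.
  by rewrite /= linE ger0_norm // sqr_ge0.
have iZZ i j : itg P (fun w => Z i w * Z j w).
  have ih := integrable_lin 1 1 (i2 i) (i2 j).
  apply: (le_integrable measurableT _ _ ih).
    by mauto.
  move=> w _; rewrite /= lee_fin !mul1r normrM [leRHS]ger0_norm ?addr_ge0 ?sqr_ge0 //.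
  rewrite -(real_normK (num_real (Z i w))) -(real_normK (num_real (Z j w))).
  have := sqr_ge0 (`|Z i w| - `|Z j w|); have := mulr_ge0 (normr_ge0 (Z i w)) (normr_ge0 (Z j w)).
  by rewrite !expr2; lra.
have Rl i L : itg P (fun w => \sum_(p <- L) p.1 * (Z i w * Z p.2 w)) /\
    \int[P]_w (\sum_(p <- L) p.1 * (Z i w * Z p.2 w)) = \sum_(p <- L) p.1 * \int[P]_w (Z i w * Z p.2 w).
  elim: L => [|p L [h1 h2]].
    split; last by rewrite big_nil; under eq_Rintegral do rewrite big_nil; rewrite Rintegral_cst // mul0r.
    rewrite (_ : _ \o _ = EFin \o cst 0); last by apply/funext => w /=; rewrite big_nil.
    by apply: (integrable_by 0) => // w; rewrite normr0.
  have E : (fun w => \sum_(p0 <- p :: L) p0.1 * (Z i w * Z p0.2 w)) =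
      (fun w => p.1 * (Z i w * Z p.2 w) + 1 * \sum_(p0 <- L) p0.1 * (Z i w * Z p0.2 w)).
    by apply/funext => w; rewrite big_cons mul1r.
  rewrite E big_cons; split; first exact: integrable_lin.
  by rewrite Rintegral_lin // mul1r h2.
have Rll L L' : itg P (fun w => \sum_(p <- L) p.1 * \sum_(q <- L') q.1 * (Z p.2 w * Z q.2 w)) /\
    \int[P]_w (\sum_(p <- L) p.1 * \sum_(q <- L') q.1 * (Z p.2 w * Z q.2 w)) =
    \sum_(p <- L) p.1 * \sum_(q <- L') q.1 * \int[P]_w (Z p.2 w * Z q.2 w).
  elim: L => [|p L [h1 h2]].
    split; last by rewrite big_nil; under eq_Rintegral do rewrite big_nil; rewrite Rintegral_cst // mul0r.
    rewrite (_ : _ \o _ = EFin \o cst 0); last by apply/funext => w /=; rewrite big_nil.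
    by apply: (integrable_by 0) => // w; rewrite normr0.
  have [k1 k2] := Rl p.2 L'.
  have E : (fun w => \sum_(p0 <- p :: L) p0.1 * \sum_(q <- L') q.1 * (Z p0.2 w * Z q.2 w)) =
      (fun w => p.1 * (\sum_(q <- L') q.1 * (Z p.2 w * Z q.2 w)) + 1 * \sum_(p0 <- L) p0.1 * \sum_(q <- L') q.1 * (Z p0.2 w * Z q.2 w)).
    by apply/funext => w; rewrite big_cons mul1r.
  rewrite E big_cons; split; first exact: integrable_lin.
  by rewrite Rintegral_lin // mul1r h2 k2.
transitivity (\int[P]_w (\sum_(p <- L0) p.1 * \sum_(q <- L0) q.1 * (Z p.2 w * Z q.2 w))).
  apply: eq_Rintegral => w _; rewrite expr2 /lin mulr_suml; apply: eq_bigr => p _.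
  by rewrite -mulrA; congr (_ * _); rewrite mulr_sumr; apply: eq_bigr => q _; ring.
rewrite (Rll L0 L0).2 /bil; apply: eq_bigr => p _; rewrite mulr_sumr; apply: eq_bigr => q _.
by rewrite mulrA.
Qed.

(** The variance of a combination expands into second moments, so one-dimensional laws of all
    combinations determine the joint characteristic functions. *)
Lemma gauss_like_family (I : Type) (Z : I -> T -> R) :
  (forall L, exists v, gauss_like P (lin Z L) v) ->
  gaussian P Z (fun i j => \int[P]_w (Z i w * Z j w)).
Proof.
move=> hL; split=> [i|L c].
  have [v g] := hL [:: (1, i)]; have := gl_measurable g.
  by rewrite (_ : lin Z _ = Z i) //; apply/funext => w; rewrite /lin big_seq1 mul1r.
have [v g] := hL L; rewrite (gl_chf g); congr (_ * expR (- _ / 2)).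
by rewrite -gauss_like_second_moment // /Rintegral (gl_var g).
Qed.

End gaussian_limits.

(** * Integrals of products over product spaces *)

Section product_integrals.
Context d1 d2 (T1 : measurableType d1) (T2 : measurableType d2) (R : realType).
Variable m1 : {sigma_finite_measure set T1 -> \bar R}.
Variable m2 : {sigma_finite_measure set T2 -> \bar R}.

Lemma integral_EFin_Rintegral d (T : measurableType d) (m : {measure set T -> \bar R}) (f : T -> R) :
  itg m f -> (\int[m]_x (f x)%:E = (\int[m]_x f x)%:E)%E.
Proof. by move=> h; rewrite /Rintegral fineK //; apply: integrable_fin_num. Qed.

Lemma integrable_dominated d (T : measurableType d) (m : {measure set T -> \bar R}) (f g : T -> R) :
  mbl f -> (forall x, `|f x| <= g x) -> itg m g ->
  itg m f.
Proof.
move=> mf fg ig; apply: (le_integrable measurableT _ _ ig); first exact/measurable_EFinP.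
by move=> x _; rewrite /= lee_fin (le_trans (fg x)) // ler_norm.
Qed.

Lemma integrable_normM (c : R) d (T : measurableType d) (m : {measure set T -> \bar R}) (f : T -> R) :
  itg m f -> itg m (fun x => c * f x).
Proof. by move=> h; have := integrableZl measurableT c h; apply: eq_integrable. Qed.

Lemma integrable_prod_dom (F : T1 * T2 -> R) (a : T1 -> R) (b : T2 -> R) :
  mbl F -> itg m1 a -> itg m2 b ->
  (forall x y, `|F (x, y)| <= `|a x| * `|b y|) -> itg (m1 \x m2)%E F.
Proof.
move=> mF ia ib h.
have ma : mbl a by apply/measurable_EFinP; exact: measurable_int ia.
have mb : mbl b by apply/measurable_EFinP; exact: measurable_int ib.
have mEF : mbl (EFin \o F) by mauto.
apply/integrable12ltyP => //.
have [/integrableP[_ fa] /integrableP[_ fb]] := (ia, ib).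
have fb0 : (0 <= \int[m2]_y `|(b y)%:E|)%E by exact: integral_ge0.
apply: (@le_lt_trans _ _ (\int[m1]_x (`|(a x)%:E| * \int[m2]_y `|(b y)%:E|))%E); last first.
  have -> : (\int[m2]_y `|(b y)%:E| = (fine (\int[m2]_y `|(b y)%:E|))%:E)%E.
    by rewrite fineK // ge0_fin_numE.
  rewrite ge0_integralZr //.
  - have fa0 : (0 <= \int[m1]_x `|(a x)%:E|)%E by exact: integral_ge0.
    have -> : (\int[m1]_x `|(a x)%:E| = (fine (\int[m1]_x `|(a x)%:E|))%:E)%E.
      by rewrite fineK // ge0_fin_numE.
    by rewrite -EFinM ltry.
  - by mauto.
  - by rewrite lee_fin fine_ge0.
apply: ge0_le_integral => //.
- by move=> x _; exact: integral_ge0.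
- apply: (@measurable_fun_fubini_tonelli_F _ _ _ _ _ m2 (fun z => `|(F z)%:E|%E)) => //.
  by mauto.
- by mauto.
move=> x _; rewrite -ge0_integralZl //; last by apply/measurable_EFinP; mauto.
apply: ge0_le_integral => //.
- by mauto.
- by mauto.
by move=> y _ /=; rewrite -EFinM lee_fin.
Qed.

Lemma integrable_prodM (a : T1 -> R) (b : T2 -> R) :
  itg m1 a -> itg m2 b ->
  itg (m1 \x m2)%E (fun z => a z.1 * b z.2).
Proof.
move=> ia ib; apply: (integrable_prod_dom _ ia ib) => [|x y]; last by rewrite normrM.
apply: measurable_funM.
  apply: (measurableT_comp (f := a)) => //; apply/measurable_EFinP; exact: measurable_int ia.
apply: (measurableT_comp (f := b)) => //; apply/measurable_EFinP; exact: measurable_int ib.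
Qed.

Lemma integral_prodM (a : T1 -> R) (b : T2 -> R) :
  itg m1 a -> itg m2 b ->
  (\int[(m1 \x m2)%E]_z (a z.1 * b z.2)%:E = ((\int[m1]_x a x) * \int[m2]_y b y)%:E)%E.
Proof.
move=> ia ib; rewrite -(integral12_prod_meas1 (integrable_prodM ia ib)) /fubini_F /=.
under eq_integral => x _.
  under eq_integral do rewrite EFinM.
  rewrite integralZl // (integral_EFin_Rintegral ib) muleC; over.
rewrite integralZl // (integral_EFin_Rintegral ia) -EFinM; congr _%:E; exact: mulrC.
Qed.

End product_integrals.

(** * Reflected translations of tuples and the null diagonal *)

Section tuple_translation.
Context {R : realType}.
Local Notation mu := (@lebesgue_measure R).
Local Notation TR n := (n.-tuple (Borel R)).

Definition subt n (u v : TR n) : TR n := [tuple tnth u i - tnth v i | i < n].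

Lemma to_row_subt n (u v : TR n) : to_row (subt u v) = to_row u - to_row v.
Proof. by apply/rowP => i; rewrite !mxE tnth_mktuple. Qed.

Lemma measurable_subt_pair n : mbl (fun p : TR n * TR n => subt p.1 p.2).
Proof.
apply/measurable_fun_tnthP => i.
rewrite (_ : _ \o _ = fun p : TR n * TR n => tnth p.1 i - tnth p.2 i); last first.
  by apply/funext => p /=; rewrite tnth_mktuple.
apply: measurable_funB.
  by apply: (measurableT_comp (f := fun u : TR n => tnth u i)) => //; exact: measurable_tnth.
by apply: (measurableT_comp (f := fun u : TR n => tnth u i)) => //; exact: measurable_tnth.
Qed.

Lemma measurable_subt n (u : TR n) : mbl (subt u).
Proof. exact: (measurable_fun_pair2 u (@measurable_subt_pair n)). Qed.

Lemma subt_cons n x y (u v : TR n) :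
  subt (cons_pair (x, u)) (cons_pair (y, v)) = cons_pair (x - y, subt u v).
Proof.
apply: eq_from_tnth => i; rewrite tnth_mktuple.
case: (unliftP ord0 i) => [j|] ->; last by rewrite !tnth0.
by rewrite !tnthS tnth_mktuple.
Qed.

Lemma tupleP_cons n (u : TR n.+1) : exists x u', u = cons_pair (x, u').
Proof.
exists (thead u), [tuple of behead u]; apply: eq_from_tnth => i; rewrite {1}[u]tuple_eta.
by [].
Qed.

Lemma ge0_integral_subt n (u : TR n) (F : TR n -> \bar R) :
  mbl F -> (forall x, 0 <= F x)%E ->
  (\int[leb (n:=n)]_v F (subt u v) = \int[leb (n:=n)]_v F v)%E.
Proof.
elim: n u F => [|n IH] u F mF F0.
  by rewrite !integral_leb0; congr F; apply: eq_from_tnth => -[].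
have [x [u' ->]] := tupleP_cons u.
rewrite !integral_lebS //; last by apply: (measurableT_comp mF); exact: measurable_subt.
pose G v' := (\int[mu]_y F (cons_pair (y, v')))%E.
have mG : mbl G.
  apply: (@measurable_fun_fubini_tonelli_G _ _ _ _ _ mu (fun p => F (cons_pair p))) => //.
  by mauto.
have G0 v' : (0 <= G v')%E by exact: integral_ge0.
rewrite -[RHS](IH u' G mG G0); apply: eq_integral => v' _; rewrite /G.
pose H y := F (cons_pair (y, subt u' v')).
have mH : mbl H.
  apply: (measurable_fun_pair1 (f := fun p : Borel R * TR n => F (cons_pair p)) (subt u' v')).
  by mauto.
have H0 y : (0 <= H y)%E by exact: F0.
transitivity (\int[mu]_y H (- y + x)%R)%E.
  by apply: eq_integral_leb => y; rewrite subt_cons addrC.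
have mH' : mbl (fun y : Borel R => H (y + x)%R).
  by mauto.
rewrite (@ge0_integral_opp R (fun y : Borel R => H (y + x)) mH' (fun y => H0 _)).
exact: (@ge0_integral_shift R x H mH H0).
Qed.

Lemma tn_subt n (u v : TR n) : tn (subt u v) = enorm (to_row u - to_row v).
Proof. by rewrite /tn to_row_subt. Qed.

Lemma tn_ge0 n (u : TR n) : 0 <= tn u. Proof. exact: enorm_ge0. Qed.

(** By Tonelli: for fixed u, the set of v at distance 0 from u is the image of the null set
    [tn v = 0] under v |-> u - v. *)
Lemma null_diag n : (0 < n)%N ->
  (leb (n:=n) \x leb (n:=n))%E [set p | tn (subt p.1 p.2) = 0] = 0%E.
Proof.
move=> n0; set D := [set p | _].
have mD : measurable D.
  rewrite -[X in measurable X]setTI.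
  have mt : mbl (fun p : TR n * TR n => tn (subt p.1 p.2)).
    by apply: (measurableT_comp (@measurable_tn R n)); exact: measurable_subt_pair.
  exact: (mt measurableT _ (measurable_set1 0%R)).
rewrite -(setIT D) -integral_indic // fubini_tonelli1 //; last first.
  by mauto.
rewrite /fubini_F (eq_integral (cst 0%E)) ?integral0 // => u _ /=.
pose F (v : TR n) : \bar R := (\1_[set v | tn v = 0] v)%:E.
have mZ : measurable [set v : TR n | tn v = 0].
  rewrite -[X in measurable X]setTI.
  exact: (@measurable_tn R n measurableT _ (measurable_set1 0%R)).
have mF : mbl F by apply/measurable_EFinP; exact: measurable_indic.
have F0 v : (0 <= F v)%E by rewrite lee_fin.
have FE : (\int[leb (n:=n)]_v F v = 0)%E.
  by rewrite /F (@integral_indic _ _ _ (leb (n:=n)) _ measurableT _ mZ) setIT; exact: leb_tn0.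
rewrite -FE -(ge0_integral_subt u mF F0); apply: eq_integral => v _; rewrite !indicE; congr ((_ : bool)%:R)%:E.
Qed.

End tuple_translation.

(** * The Gaussian function in several variables *)

Section gaussian_fourier_tuple.
Context {R : realType}.
Local Notation mu := (@lebesgue_measure R).
Local Notation gam := (@gauss_fun R).
Local Notation TR n := (n.-tuple (Borel R)).

Definition dott n (u v : TR n) : R := \sum_(i < n) tnth u i * tnth v i.

Lemma dott_cons n x y (u v : TR n) : dott (cons_pair (x, u)) (cons_pair (y, v)) = x * y + dott u v.
Proof.
by rewrite /dott big_ord_recl !tnth0; congr (_ + _); apply: eq_bigr => i _; rewrite !tnthS.
Qed.

Lemma dottB n (u v w : TR n) : dott (subt u v) w = dott u w - dott v w.
Proof. by rewrite /dott -sumrB; apply: eq_bigr => i _; rewrite tnth_mktuple mulrBl. Qed.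

Lemma sqr_tn n (u : TR n) : tn u ^+ 2 = dott u u.
Proof. by rewrite /tn sqr_enorm dotp_to_row. Qed.

Lemma measurable_dott_pair n : mbl (fun p : TR n * TR n => dott p.1 p.2).
Proof.
apply: measurable_sum => i; apply: measurable_funM.
  by apply: (measurableT_comp (f := fun u : TR n => tnth u i)) => //; exact: measurable_tnth.
by apply: (measurableT_comp (f := fun u : TR n => tnth u i)) => //; exact: measurable_tnth.
Qed.

Lemma measurable_dott n (u : TR n) : mbl (dott u).
Proof. exact: (measurable_fun_pair2 u (@measurable_dott_pair n)). Qed.

Definition gk n (u : TR n) : R := expR (- tn u ^+ 2).

Lemma gk_ge0 n (u : TR n) : 0 <= gk u. Proof. exact: expR_ge0. Qed.

Lemma gk_cons n x (u : TR n) : gk (cons_pair (x, u)) = gam x * gk u.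
Proof. by rewrite /gk !sqr_tn dott_cons opprD expRD /gauss_fun expr2. Qed.

Lemma measurable_gk n : mbl (@gk n).
Proof. by have := @measurable_tn R n => ?; rewrite /gk; mauto. Qed.

Lemma integrable_gk n : (leb (n:=n)).-integrable setT (EFin \o @gk n).
Proof.
have mE m : mbl (EFin \o @gk m) by apply/measurable_EFinP; exact: measurable_gk.
apply/integrableP; split; first exact: mE.
rewrite (eq_integral (EFin \o @gk n)); last by move=> u _ /=; rewrite ger0_norm // gk_ge0.
elim: n => [|n IH]; first by rewrite integral_leb0 ltry.
rewrite integral_lebS //; last by move=> u; rewrite lee_fin gk_ge0.
rewrite (eq_integral (fun u => (gauss_moment 0)%:E * (EFin \o @gk n) u)%E); last first.
  move=> u _ /=; under eq_integral_leb do rewrite gk_cons EFinM.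
  under eq_integral do rewrite muleC.
  rewrite ge0_integralZl_EFin ?gk_ge0 //; last 2 first.
  - by move=> x _; rewrite lee_fin gauss_fun_ge0.
  - by apply/measurable_EFinP; exact: measurable_gauss_fun.
  rewrite muleC -gauss_momentE; congr (_ * _)%E; apply: eq_integral_leb => x.
  by rewrite muln0 expr0 mul1r.
rewrite ge0_integralZl_EFin //; last 3 first.
- by move=> u _; rewrite lee_fin gk_ge0.
- exact: mE.
- exact: gauss_moment_ge0.
by rewrite lte_mul_pinfty // lee_fin gauss_moment_ge0.
Qed.

Lemma integrable_gk_bounded n (h : TR n -> R) : mbl h -> (forall u, `|h u| <= 1) ->
  (leb (n:=n)).-integrable setT (EFin \o (fun u => h u * gk u)).
Proof.
move=> mh h1; apply: (integrable_dominated _ _ (integrable_gk n)).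
  by apply: measurable_funM => //; exact: measurable_gk.
by move=> u; rewrite normrM (ger0_norm (gk_ge0 _)) ler_piMl // gk_ge0.
Qed.

(** One coordinate at a time. The phase [c] is what the induction needs: it absorbs the remaining
    coordinates, and the sine terms vanish by oddness. *)
Lemma gk_hat n (y : TR n) (c : R) :
  (\int[leb (n:=n)]_u (cos (dott y u + c) * gk u)%:E =
   (cos c * gauss_moment 0 ^+ n * expR (- (gauss_var * tn y ^+ 2 / 2)))%:E)%E.
Proof.
elim: n y c => [|n IH] y c.
  rewrite integral_leb0 /gk !sqr_tn /dott !big_ord0 add0r oppr0 expR0 expr0 !mulr0.
  by rewrite mul0r oppr0 expR0 !mulr1.
have [x [y' ->]] := tupleP_cons y.
rewrite integral_lebS_int; last first.
  apply: (integrable_gk_bounded (h := fun u => cos (dott (cons_pair (x, y')) u + c))).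
    by have := measurable_dott (cons_pair (x, y')) => ?; mauto.
  by move=> u; exact: cos_max.
rewrite (eq_integral (fun u => (gauss_hat x)%:E * (cos (dott y' u + c) * gk u)%:E)%E); last first.
  move=> u _.
  rewrite (@eq_integral_leb _ _ (fun z => (cos (dott y' u + c) * gk u)%:E * (cos (x * z) * gam z)%:E +
     (- sin (dott y' u + c) * gk u)%:E * (sin (x * z) * gam z)%:E)%E); last first.
    move=> z; rewrite -!EFinM -EFinD; congr _%:E.
    rewrite gk_cons (_ : dott (cons_pair (x, y')) (cons_pair (z, u)) + c = (x * z : R) + (dott y' u + c)); last first.
      by rewrite dott_cons addrA.
    by rewrite (cosD (x * z : R)); ring.
  have i1 : mu.-integrable setT (fun z => (cos (x * z) * gam z)%:E).
    by apply: (@integrable_gauss_bounded _ _ 1) => [|z]; [mauto|exact: cos_max].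
  have i2 : mu.-integrable setT (fun z => (sin (x * z) * gam z)%:E).
    by apply: (@integrable_gauss_bounded _ _ 1) => [|z]; [mauto|exact: sin_max].
  rewrite integralD //; [|exact: integrableZl|exact: integrableZl].
  by rewrite !integralZl // gauss_hatE gauss_sin mule0 adde0 muleC.
rewrite integralZl //; last first.
  apply: (integrable_gk_bounded (h := fun u => cos (dott y' u + c))).
    by have := measurable_dott y' => ?; mauto.
  by move=> u; exact: cos_max.
rewrite IH -EFinM gauss_hat_formula; congr _%:E.
have -> : tn (cons_pair (x, y')) ^+ 2 = x ^+ 2 + tn y' ^+ 2 by rewrite !sqr_tn dott_cons expr2.
have key (g m a b e : R) : m * expR (- (g * a / 2)) * (cos c * e * expR (- (g * b / 2))) =
    cos c * (m * e) * expR (- (g * (a + b) / 2)).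
  rewrite (_ : - (g * (a + b) / 2) = - (g * a / 2) + - (g * b / 2)) ?expRD; last by ring.
  by ring.
by rewrite [gauss_moment 0 ^+ n.+1]exprS; exact: key.
Qed.
End gaussian_fourier_tuple.

Ltac tuple_leaf := first [ exact: measurable_tn | exact: measurable_scale_tuple | exact: measurable_gk
  | exact: measurable_subt_pair | exact: measurable_subt | exact: measurable_dott_pair
  | exact: measurable_dott ].
Ltac mleaf ::= tuple_leaf.

Section double_lebesgue.
Context {R : realType}.
Local Notation TR n := (n.-tuple (Borel R)).

(** A named product measure with its own sigma-finite structure, so that it can be a factor in a
    further application of Fubini. *)
Definition leb2 n : set (TR n * TR n) -> \bar R := (leb (n:=n) \x leb (n:=n))%E.
HB.instance Definition _ n := Measure.on (@leb2 n).

Lemma leb2_sigma_finite n : sigma_finite setT (@leb2 n).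
Proof.
exists (fun N => @box R n N%:R `*` @box R n N%:R); last first.
  move=> N; split; first by apply: measurableX; exact: measurable_box.
  rewrite /leb2 product_measure1E //; [|exact: measurable_box|exact: measurable_box].
  have b : leb (@box R n N%:R) \is a fin_num by rewrite ge0_fin_numE // leb_box.
  by apply: lte_mul_pinfty => //; exact: leb_box.
apply/esym; rewrite -subTset => -[u v] _.
exists (Num.truncn (\sum_(i < n) `|tnth u i| + \sum_(i < n) `|tnth v i|)%R).+1 => //.
have h (w : TR n) i : (`|tnth w i| <= \sum_(i < n) `|tnth w i|)%R.
  by rewrite (bigD1 i) //= lerDl sumr_ge0.
have h0 (w : TR n) : (0 <= \sum_(i < n) `|tnth w i|)%R by rewrite sumr_ge0.
split=> i /=; apply/ltW/(le_lt_trans _ (truncnS_gt _)); apply: (le_trans (h _ i)).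
  by rewrite lerDl.
by rewrite lerDr.
Qed.
HB.instance Definition _ n := Measure_isSigmaFinite.Build _ _ _ (@leb2 n) (leb2_sigma_finite n).
End double_lebesgue.

(** * Fourier transforms of integrable functions and Gaussian energies *)

Section fourier_tuple.
Context {R : realType} (k : nat).
Local Notation mu := (@lebesgue_measure R).
Local Notation TR n := (n.-tuple (Borel R)).
Local Notation lb := (leb (R:=R) (n:=k)).
Implicit Types f g : TR k -> R.

Definition fc f (x : TR k) : R := \int[lb]_u (cos (dott x u) * f u).
Definition fs f (x : TR k) : R := \int[lb]_u (sin (dott x u) * f u).
Definition nfour2 f x : R := fc f x ^+ 2 + fs f x ^+ 2.

Lemma nfour2_ge0 f x : 0 <= nfour2 f x.
Proof. by rewrite addr_ge0 // sqr_ge0. Qed.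

Lemma dottZ c (u v : TR k) : dott (scale_tuple c u) v = c * dott u v.
Proof. by rewrite /dott mulr_sumr; apply: eq_bigr => i _; rewrite tnth_mktuple mulrA. Qed.

Lemma dottC (u v : TR k) : dott u v = dott v u.
Proof. by apply: eq_bigr => i _; exact: mulrC. Qed.

Lemma integrable_measurable d (T : measurableType d) (m : {measure set T -> \bar R}) (f : T -> R) :
  itg m f -> mbl f.
Proof. by move=> h; apply/measurable_EFinP; exact: measurable_int h. Qed.

Lemma integrable_bounded_mul (h f : TR k -> R) : mbl h -> (forall u, `|h u| <= 1) ->
  itg lb f -> itg lb (fun u => h u * f u).
Proof.
move=> mh h1 i; have mf := integrable_measurable i.
apply: (integrable_dominated (g := fun u => `|f u|)); first exact: measurable_funM.
  by move=> u; rewrite normrM ler_piMl.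
by have := integrable_norm i; apply: eq_integrable.
Qed.

Lemma integrable_fc f x : itg lb f ->
  itg lb (fun u => cos (dott x u) * f u).
Proof.
move=> i; apply: integrable_bounded_mul => // [|u]; last exact: cos_max.
by mauto.
Qed.

Lemma integrable_fs f x : itg lb f ->
  itg lb (fun u => sin (dott x u) * f u).
Proof.
move=> i; apply: integrable_bounded_mul => // [|u]; last exact: sin_max.
by mauto.
Qed.

(* Weighting by [gk] makes the integrand of the Fourier transform integrable on the product. *)
Lemma measurable_trig_transform (w : R -> R) f : mbl w -> (forall x, `|w x| <= 1) ->
  itg lb f ->
  mbl (fun x : TR k => \int[lb]_u (w (dott x u) * f u)).
Proof.
move=> mw w1 i; have mf := integrable_measurable i.
pose F (z : TR k * TR k) : R := gk z.1 * (w (dott z.1 z.2) * f z.2).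
have mF : mbl F.
  apply: measurable_funM; first by apply: (measurableT_comp (@measurable_gk R k)).
  by mauto.
have iF : itg (lb \x lb)%E F.
  apply: (integrable_prod_dom mF (@integrable_gk R k) i) => x y.
  by rewrite !normrM ler_wpM2l // ler_piMl.
have iw x : itg lb (fun u => w (dott x u) * f u).
  apply: integrable_bounded_mul => //; apply: (measurableT_comp mw); exact: measurable_dott.
have mG := measurable_fubini_F iF.
have : mbl (fun x => gk x * \int[lb]_u (w (dott x u) * f u)).
  apply/measurable_EFinP; move: mG; apply: eq_measurable_fun => x _ /=.
  rewrite /fubini_F /F /=; under eq_integral do rewrite EFinM.
  rewrite EFinM -(integral_EFin_Rintegral (iw x)).
  by have := integralZl measurableT (iw x) (gk x).
move=> mH; have mg := measurable_funV (@measurable_gk R k).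
have := measurable_funM mg mH; apply: eq_measurable_fun => x _ /=.
by rewrite mulKf // gt_eqF // expR_gt0.
Qed.

Lemma measurable_fc f : itg lb f -> mbl (fc f).
Proof. by apply: (@measurable_trig_transform cos) => [|x]; [exact: measurable_fun_cos|exact: cos_max]. Qed.

Lemma measurable_fs f : itg lb f -> mbl (fs f).
Proof. by apply: (@measurable_trig_transform sin) => [|x]; [exact: measurable_fun_sin|exact: sin_max]. Qed.

Lemma measurable_nfour2 f : itg lb f -> mbl (nfour2 f).
Proof.
by move=> i; apply: measurable_funD; apply: measurable_funX; [exact: measurable_fc|exact: measurable_fs].
Qed.

(** The Gaussian kernel is itself the transform of [gk]. After exchanging the integrals, the cosine
    of a difference splits into cosine and sine products, which give the squared modulus of the
    transform of [f]. *)
Lemma gaussian_energy f s : itg lb f ->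
  (\int[leb2 (n:=k)]_p (f p.1 * f p.2 *
      (gauss_moment 0 ^+ k * expR (- (gauss_var * (s * tn (subt p.1 p.2)) ^+ 2 / 2))))%:E =
   \int[lb]_y (gk y * nfour2 f (scale_tuple s y))%:E)%E.
Proof.
move=> i; have mf := integrable_measurable i.
pose F (z : (TR k * TR k) * TR k) : R :=
  (f z.1.1 * f z.1.2) * (cos (s * dott (subt z.1.1 z.1.2) z.2) * gk z.2).
have iff : (leb2 (R:=R) (n:=k)).-integrable setT (EFin \o (fun p : TR k * TR k => f p.1 * f p.2)).
  exact: integrable_prodM.
have mF : mbl F.
  apply: measurable_funM.
    apply: (measurableT_comp (f := fun p : TR k * TR k => f p.1 * f p.2)) => //.
    by mauto.
  apply: measurable_funM; last by apply: (measurableT_comp (@measurable_gk R k)).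
  apply: measurable_fun_cos; apply: measurable_funM => //.
  apply: (measurableT_comp (f := fun p : TR k * TR k => dott p.1 p.2)
    (g := fun z : (TR k * TR k) * TR k => (subt z.1.1 z.1.2, z.2))).
    by mauto.
  apply: measurable_fun_pair => //.
  exact: (measurableT_comp (@measurable_subt_pair R k)).
have iF : (leb2 (R:=R) (n:=k) \x lb)%E.-integrable setT (EFin \o F).
  apply: (integrable_prod_dom mF iff (@integrable_gk R k)) => x y.
  by rewrite !normrM ler_wpM2l // ler_piMl // cos_max.
have := Fubini iF; rewrite /= => E.
transitivity (\int[leb2 (n:=k)]_p \int[lb]_y (F (p, y))%:E)%E.
  apply: eq_integral => -[u v] _; rewrite /F /=.
  have h := gk_hat (scale_tuple s (subt u v)) 0.
  have hi : itg lb (fun y => cos (s * dott (subt u v) y) * gk y).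
    apply: integrable_gk_bounded => [|y]; last exact: cos_max.
    by mauto.
  under [RHS]eq_integral do rewrite EFinM.
  rewrite integralZl // EFinM; congr (_ * _)%E.
  have -> : (s * tn (subt u v)) ^+ 2 = tn (scale_tuple s (subt u v)) ^+ 2.
    by rewrite exprMn !sqr_tn dottZ dottC dottZ mulrA expr2.
  move: h; rewrite cos0 mul1r => <-.
  by apply: eq_integral => y _; rewrite -dottZ addr0.
rewrite E; apply: eq_integral => y _; rewrite /F /=.
have ic := integrable_fc (scale_tuple s y) i; have is_ := integrable_fs (scale_tuple s y) i.
have icc := integrable_prodM ic ic; have iss := integrable_prodM is_ is_.
rewrite (eq_integral (fun p : TR k * TR k => (gk y)%:E * (((cos (dott (scale_tuple s y) p.1) * f p.1) * (cos (dott (scale_tuple s y) p.2) * f p.2))%:E +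
  ((sin (dott (scale_tuple s y) p.1) * f p.1) * (sin (dott (scale_tuple s y) p.2) * f p.2))%:E))%E); last first.
  move=> [u v] _ /=; rewrite -EFinD -EFinM; congr _%:E.
  by rewrite dottB mulrBr cosB !dottZ ![dott y _]dottC; ring.
rewrite integralZl //; last exact: integrableD.
rewrite integralD // EFinM; congr (_ * _)%E.
rewrite /nfour2 !expr2 EFinD; congr (_ + _)%E; exact: integral_prodM.
Qed.
End fourier_tuple.

Ltac mleaf ::= first [ tuple_leaf | (apply: measurable_fc; done) | (apply: measurable_fs; done)
  | (apply: measurable_nfour2; done) ].

(** * One-dimensional integrals of powers against Gaussians *)

Section power_integrals.
Context {R : realType}.
Local Notation mu := (@lebesgue_measure R).

Lemma ge0_integral_abs_powR_scale (a : R) (Phi : R -> R) (c : R) : 0 < c ->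
  mbl Phi -> (forall s, 0 <= Phi s) ->
  (\int[mu]_s (`|s| `^ a * Phi (c * s))%:E = (c `^ (- a - 1))%:E * \int[mu]_s (`|s| `^ a * Phi s)%:E)%E.
Proof.
move=> c0 mPhi Phi0.
have mE : mbl (fun s : Borel R => (`|s| `^ a * Phi s)%:E).
  by mauto.
have E0 (s : Borel R) : (0 <= (`|s| `^ a * Phi s)%:E)%E by rewrite lee_fin mulr_ge0 // powR_ge0.
have := @ge0_integral_scale1 R c _ c0 mE E0.
have -> : (\int[mu]_s (`|s| `^ a * Phi (c * s))%:E =
    (c `^ (- a))%:E * \int[mu]_s (`|c * s| `^ a * Phi (c * s))%:E)%E.
  rewrite -ge0_integralZl_EFin ?powR_ge0 //; last first.
  - by mauto.
  apply: eq_integral_leb => s; rewrite -EFinM; congr _%:E.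
  have -> : `|s| `^ a = c `^ (- a) * `|c * s| `^ a; last by rewrite mulrA.
  by rewrite normrM powRM // mulrA gtr0_norm // -powRD ?addNr ?powRr0 ?mul1r // (gt_eqF c0) implybT.
move=> ->; rewrite muleA -EFinM powRD ?(gt_eqF c0) ?implybT // powR_inv1 ?ltW //.
Qed.

Lemma integral_lower_bound (f : R -> R) (c : R) : mbl f -> (forall s, 0 <= f s) ->
  0 <= c -> (forall s, 1 <= s <= 2 -> c <= f s) -> (c%:E <= \int[mu]_s (f s)%:E)%E.
Proof.
move=> mf f0 c0 h.
apply: (le_via (\int[mu]_x (c%:E * (\1_`[1%R, 2%R] x)%:E))%E).
  rewrite ge0_integralZl_EFin //; last by apply/measurable_EFinP; exact: measurable_indic.
  rewrite integral_indic //= setIT lebesgue_measure_itv /= lte_fin ltr1n -EFinD -EFinM lee_fin.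
  by rewrite (_ : 2 - 1 = 1) ?mulr1 //; lra.
apply: ge0_le_integral => //.
- by move=> s _; rewrite -EFinM lee_fin mulr_ge0.
- by mauto.
- by mauto.
move=> s _; rewrite -EFinM lee_fin indicE; case: (boolP (s \in _)); last by rewrite mulr0.
by rewrite inE /= in_itv /= mulr1; exact: h.
Qed.

Lemma integrable_decay_bound (f : R -> R) (b C : R) : b < - 1 -> mbl f ->
  (forall s, 0 <= f s <= C * decay b s) -> itg mu f.
Proof.
move=> b1 mf h.
have mf' : mbl (f : Borel R -> R) by mauto.
apply: (integrable_dominated mf' _ (integrable_normM C (integrable_decay b1))) => s.
by have /andP[f0 fC] := h s; rewrite ger0_norm.
Qed.

Lemma expR_ge_pow (x : R) n : 0 <= x -> x ^+ n.+1 <= n.+1`!%:R * expR x.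
Proof.
move=> x0; rewrite mulrC -ler_pdivrMr ?ltr0n ?fact_gt0 //.
by apply: le_trans (expR_ge1Dxn n x0); rewrite lerDr.
Qed.

Definition gauss_power (b s : R) : R := `|s| `^ (b - 1) * expR (- (gauss_var * s ^+ 2 / 2)).
Definition gauss_inv_power (a s : R) : R := `|s| `^ a * expR (- s ^- 2).

Lemma measurable_gauss_power b : mbl (gauss_power b).
Proof. by rewrite /gauss_power; mauto. Qed.

Lemma measurable_gauss_inv_power a : mbl (gauss_inv_power a).
Proof.
rewrite /gauss_inv_power; apply: measurable_funM; first by mauto.
by mauto.
Qed.

Lemma gauss_power_ge0 b s : 0 <= gauss_power b s.
Proof. by rewrite mulr_ge0 ?powR_ge0 ?expR_ge0. Qed.

Lemma gauss_inv_power_ge0 a s : 0 <= gauss_inv_power a s.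
Proof. by rewrite mulr_ge0 ?powR_ge0 ?expR_ge0. Qed.

Lemma integrable_gauss_power b : 1 < b < 2 -> itg mu (gauss_power b).
Proof.
move=> /andP[b1 b2]; have gv := @gauss_var_gt0 R.
pose C : R := 1 + 8 / gauss_var ^+ 2.
have C8 : 0 <= 8 / gauss_var ^+ 2 :> R by rewrite divr_ge0 // exprn_ge0 // ltW.
apply: (@integrable_decay_bound _ (- 2) C) => [||s]; [lra|exact: measurable_gauss_power|].
rewrite gauss_power_ge0 /=; have y0 : 0 <= gauss_var * s ^+ 2 / 2.
  by rewrite divr_ge0 // mulr_ge0 ?sqr_ge0 // ltW.
rewrite /decay; case: ifPn => [s1|].
  rewrite mulr1 (le_via 1) //; last by rewrite lerDl.
  rewrite /gauss_power; apply: mulr_ile1; [exact: powR_ge0|exact: expR_ge0| |by rewrite -[leRHS]expR0 ler_expR oppr_le0].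
  have [->|sN0] := eqVneq s 0; first by rewrite normr0 powR0 //; lra.
  rewrite -[leRHS](powRr0 `|s|); apply: ger_powR; first by rewrite normr_gt0 sN0.
  by lra.
rewrite -ltNge => s1; have s0 : 0 < `|s| by exact: lt_trans s1.
have h1 : `|s| `^ (b - 1) <= `|s| `^ 2 by apply: ler_powR; [exact: ltW|lra].
have h2 : expR (- (gauss_var * s ^+ 2 / 2)) <= 8 / gauss_var ^+ 2 * `|s| `^ (- 4).
  have := expR_ge_pow 1 y0; rewrite expRN (_ : 2`!%:R = 2) // => hh.
  have g2 : 0 < gauss_var ^+ 2 :> R by rewrite exprn_gt0.
  have s4 : 0 < `|s| ^+ 4 by rewrite exprn_gt0.
  rewrite powRN powR_mulrn //.
  have -> : 8 / gauss_var ^+ 2 * (`|s| ^+ 4)^-1 = (gauss_var ^+ 2 * `|s| ^+ 4 / 8)^-1.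
    by field; rewrite !gt_eqF.
  have P1 : 0 < gauss_var ^+ 2 * `|s| ^+ 4 / 8 by rewrite divr_gt0 // mulr_gt0.
  rewrite lef_pV2 ?posrE ?expR_gt0 //.
  have E4 : `|s| ^+ 4 = s ^+ 4 by rewrite (exprM _ 2 2) real_normK ?num_real // -exprM.
  rewrite E4; have E5 : (gauss_var * s ^+ 2 / 2) ^+ 2 = gauss_var ^+ 2 * s ^+ 4 / 4 by field.
  by move: hh; rewrite E5; set y := expR _; lra.
apply: (le_via (8 / gauss_var ^+ 2 * `|s| `^ (- 2))); last by rewrite ler_wpM2r ?powR_ge0 // lerDr.
apply: (le_trans (ler_pM (powR_ge0 _ _) (expR_ge0 _) h1 h2)).
rewrite mulrCA -powRD; last by rewrite (gt_eqF s0) implybT.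
by rewrite (_ : 2 + - 4 = - 2 :> R) //; lra.
Qed.

Lemma integrable_gauss_inv_power a : a < - 1 -> itg mu (gauss_inv_power a).
Proof.
move=> a1; pose m := (Num.truncn (- a)).
pose C : R := 1 + m.+1`!%:R.
have aN0 : a != 0 by rewrite lt_eqF //; lra.
apply: (@integrable_decay_bound _ a C) => //; first exact: measurable_gauss_inv_power.
move=> s; rewrite gauss_inv_power_ge0 /= /decay; case: ifPn => [s1|].
  rewrite mulr1 (le_via m.+1`!%:R) //; last by rewrite lerDr.
  have [->|sN0] := eqVneq s 0; first by rewrite /gauss_inv_power normr0 powR0 // mul0r.
  have s0 : 0 < `|s| by rewrite normr_gt0.
  have s2 : 0 <= s ^- 2 by rewrite invr_ge0 sqr_ge0.
  have := expR_ge_pow m s2 => h.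
  have h1 : `|s| `^ a <= (s ^- 2) ^+ m.+1.
    have -> : (s ^- 2) ^+ m.+1 = `|s| `^ (- (2 * m.+1)%:R).
      by rewrite powRN powR_mulrn // exprM real_normK ?num_real // exprVn.
    apply: ger_powR; first by rewrite s0.
    have := truncnS_gt (- a); rewrite -/m => ha; rewrite natrM; have := ler0n R m.+1; lra.
  rewrite /gauss_inv_power expRN ler_pdivrMr ?expR_gt0 //; exact: le_trans h1 h.
rewrite -ltNge => s1; rewrite /gauss_inv_power mulrC; apply: ler_wpM2r; first exact: powR_ge0.
by rewrite (le_via 1) // ?lerDl // -expR0 ler_expR oppr_le0 invr_ge0 sqr_ge0.
Qed.

(** Like [riesz_B] below, a Gamma value up to elementary factors; positivity of both makes [riesz_c]
    a positive real. *)
Definition riesz_A (b : R) : R := \int[mu]_s gauss_power b s.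
Definition riesz_B (a : R) : R := \int[mu]_s gauss_inv_power a s.

Lemma riesz_A_gt0 b : 1 < b < 2 -> 0 < riesz_A b.
Proof.
move=> b12; have gv := @gauss_var_gt0 R.
have H : 0 < expR (- (gauss_var * 2)) :> R by exact: expR_gt0.
apply: (lt_le_trans H); rewrite -lee_fin -(integral_EFin_Rintegral (integrable_gauss_power b12)).
apply: integral_lower_bound; [exact: measurable_gauss_power|exact: gauss_power_ge0|exact: ltW|].
move=> s /andP[s1 s2]; have s0 : 0 <= s by lra.
rewrite /gauss_power ger0_norm // -[leLHS]mul1r; apply: ler_pM; [exact: ler01|exact: expR_ge0| |].
  by rewrite -[leLHS](powRr0 s); apply: ler_powR => //; have /andP[] := b12; lra.
by rewrite ler_expR lerN2 -mulrA ler_wpM2l ?(ltW gv) // expr2; nra.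
Qed.

Lemma riesz_B_gt0 a : a < - 1 -> 0 < riesz_B a.
Proof.
move=> a1.
have H : 0 < 2 `^ a * expR (- 1) :> R by rewrite mulr_gt0 ?expR_gt0 // powR_gt0.
apply: (lt_le_trans H); rewrite -lee_fin -(integral_EFin_Rintegral (integrable_gauss_inv_power a1)).
apply: integral_lower_bound; [exact: measurable_gauss_inv_power|exact: gauss_inv_power_ge0|exact: ltW|].
move=> s /andP[s1 s2]; have s0 : 0 < s by lra.
rewrite /gauss_inv_power gtr0_norm //; apply: ler_pM; rewrite ?powR_ge0 ?expR_ge0 //.
  have h : s `^ (- a) <= 2 `^ (- a) by apply: ge0_ler_powR; rewrite ?nnegrE //; lra.
  by move: h; rewrite !powRN lef_pV2 ?posrE ?powR_gt0.
by rewrite ler_expR lerN2 invf_le1 ?exprn_gt0 // expr2; nra.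
Qed.

Lemma riesz_subordination b c : 1 < b < 2 -> 0 < c ->
  (\int[mu]_s (`|s| `^ (b - 1) * expR (- (gauss_var * (s * c) ^+ 2 / 2)))%:E =
   (riesz_A b * c `^ (- b))%:E)%E.
Proof.
move=> b12 c0.
have mP : mbl (fun s : R => expR (- (gauss_var * s ^+ 2 / 2))) by mauto.
have := @ge0_integral_abs_powR_scale (b - 1) _ c c0 mP (fun s => expR_ge0 _).
rewrite (integral_EFin_Rintegral (integrable_gauss_power b12)) -EFinM => E.
rewrite -/(riesz_A b) in E.
under eq_integral_leb do rewrite [_ * c]mulrC.
by rewrite E mulrC (_ : - (b - 1) - 1 = - b) //; ring.
Qed.

(** The companion of [riesz_subordination] on the Fourier side: integrating over the Gaussian scale
    turns exp(- (c / s)^2) back into a power of c. *)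
Lemma riesz_inversion a c : a < - 1 -> 0 < c ->
  (\int[mu]_s (`|s| `^ a * expR (- (c / s) ^+ 2))%:E = (riesz_B a * c `^ (a + 1))%:E)%E.
Proof.
move=> a1 c0.
have mP : mbl (fun s : R => expR (- s ^- 2)).
  by mauto.
have c1 : 0 < c^-1 by rewrite invr_gt0.
have := @ge0_integral_abs_powR_scale a _ c^-1 c1 mP (fun s => expR_ge0 _).
rewrite (integral_EFin_Rintegral (integrable_gauss_inv_power a1)) -EFinM => E.
rewrite -/(riesz_B a) in E.
rewrite (@eq_integral_leb _ _ (fun s => (`|s| `^ a * expR (- (c^-1 * s) ^- 2))%:E)); last first.
  by move=> s; rewrite -exprVn invfM invrK.
rewrite E mulrC -powR_inv1 ?ltW // -powRrM; congr (_ * _ `^ _)%:E; by ring.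
Qed.
End power_integrals.

(** * Riesz energies in Fourier variables *)

Section riesz_energy.
Context {R : realType} (k : nat).
Local Notation mu := (@lebesgue_measure R).
Local Notation TR n := (n.-tuple (Borel R)).
Local Notation lb := (leb (R:=R) (n:=k)).
Local Notation lb2 := (leb2 (R:=R) (n:=k)).

(** A single constant bounds both the values and the support. *)
Definition boxed (M : R) (f : TR k -> R) : Prop :=
  mbl f /\ forall u, `|f u| <= M * \1_(@box R k M) u.

Lemma integrable_box M : itg lb (\1_(@box R k M)).
Proof.
have mb := @measurable_box R k M.
apply/integrableP; split; first by apply/measurable_EFinP; exact: measurable_indic.
rewrite (eq_integral (fun u => (\1_(@box R k M) u)%:E)); last first.
  by move=> u _ /=; rewrite ger0_norm.
by rewrite integral_indic // setIT; exact: leb_box.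
Qed.

Lemma integrable_boxed M f : boxed M f -> itg lb f.
Proof.
move=> [mf h]; apply: (integrable_dominated mf h); apply: integrable_normM; exact: integrable_box.
Qed.

Definition riesz (b : R) (p : TR k * TR k) : R := tn (subt p.1 p.2) `^ (- b).

Lemma measurable_tn_subt : mbl (fun p : TR k * TR k => tn (subt p.1 p.2)).
Proof. by mauto. Qed.

Lemma measurable_diag : measurable [set p : TR k * TR k | tn (subt p.1 p.2) = 0].
Proof.
have mt : mbl (fun p : TR k * TR k => tn (subt p.1 p.2)) by mauto.
rewrite -[X in measurable X]setTI; exact: (mt measurableT _ (measurable_set1 0%R)).
Qed.

Lemma measurable_tn0 : measurable [set u : TR k | tn u = 0].
Proof.
have mt : mbl (@tn R k) by mauto.
rewrite -[X in measurable X]setTI; exact: (mt measurableT _ (measurable_set1 0%R)).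
Qed.

Lemma measurable_riesz b : mbl (riesz b).
Proof. by apply: measurable_fun_powR; exact: measurable_tn_subt. Qed.

(** For |u - v| <= 1 the kernel is a translate of an integrable power, as b < k; for larger
    distances it is at most 1 and the box is bounded. *)
Lemma integrable_riesz_box b M : 0 < b < k%:R ->
  itg lb2 (fun p => \1_(@box R k M) p.1 * \1_(@box R k M) p.2 * riesz b p).
Proof.
move=> /andP[b0 bk].
have mb := @measurable_box R k M.
have mB : mbl (fun u : TR k => \1_(@box R k M) u : R) by mauto.
pose S (w : TR k) : R := if (0 < tn w) && (tn w <= 1) then tn w `^ (- b) else 0.
have S0 w : 0 <= S w by rewrite /S; case: ifP => // _; exact: powR_ge0.
have mS : mbl S by have := @measurable_tn R k => ?; rewrite /S; mauto.
have mES : mbl (EFin \o S) by mauto.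
have ES0 v : (0 <= (EFin \o S) v)%E by rewrite lee_fin.
have fS : (\int[lb]_w (S w)%:E < +oo)%E by apply: integral_tn_small; rewrite ltrN2.
pose G (p : TR k * TR k) : R := \1_(@box R k M) p.1 * (S (subt p.1 p.2) + \1_(@box R k M) p.2).
have mG : mbl G.
  apply: measurable_funM; first exact: (measurableT_comp mB).
  apply: measurable_funD; last exact: (measurableT_comp mB).
  exact: (measurableT_comp mS (@measurable_subt_pair R k)).
have G0 p : 0 <= G p by rewrite mulr_ge0 // addr_ge0.
have mH : mbl (fun p : TR k * TR k => \1_(@box R k M) p.1 * \1_(@box R k M) p.2 * riesz b p).
  apply: measurable_funM; last exact: measurable_riesz.
  by mauto.
apply: (@integrable_dominated _ _ _ lb2 _ G) => // [p|].
  have bi (q : TR k) : \1_(@box R k M) q <= 1 :> R by rewrite indicE; case: (_ \in _).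
  rewrite ger0_norm; last by rewrite !mulr_ge0 // powR_ge0.
  rewrite -mulrA ler_wpM2l // /riesz /S.
  have := tn_ge0 (subt p.1 p.2); set t := tn _ => t0.
  have [t1|t1] := leP t 1.
    rewrite andbT; case: ltP => t0'.
      by rewrite -[leLHS]addr0; apply: lerD => //; rewrite ler_piMl // powR_ge0.
    have -> : t = 0 by apply/le_anti; rewrite t0 t0'.
    by rewrite powR0 ?mulr0 ?add0r // oppr_eq0 gt_eqF.
  rewrite andbF add0r ler_piMr // powRN invf_le1 ?powR_gt0 //; last exact: lt_trans t1.
  by rewrite -[leLHS](powRr0 t); apply: ler_powR; [exact: ltW|exact: ltW].
apply/integrableP; split; first exact/measurable_EFinP.
rewrite (eq_integral (EFin \o G)); last by move=> p _ /=; rewrite ger0_norm.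
rewrite fubini_tonelli1; [|exact/measurable_EFinP|by move=> p; rewrite lee_fin].
have bfin : leb (@box R k M) \is a fin_num by rewrite ge0_fin_numE // leb_box.
have S0' : (0 <= \int[lb]_w (S w)%:E)%E by apply: integral_ge0 => w _; rewrite lee_fin.
have sfin : (\int[lb]_w (S w)%:E)%E \is a fin_num by rewrite ge0_fin_numE.
have Sb0 : (0 <= fine (\int[lb]_w (S w)%:E) + fine (leb (@box R k M)))%R by rewrite addr_ge0 ?fine_ge0.
rewrite /fubini_F (eq_integral (fun u => ((fine (\int[lb]_w (S w)%:E) + fine (leb (@box R k M)))%R%:E * (\1_(@box R k M) u)%:E)%E)); last first.
  move=> u _; rewrite /= /G /=; under eq_integral do rewrite EFinM.
  rewrite ge0_integralZl_EFin //; last 2 first.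
  - by move=> v _; rewrite lee_fin addr_ge0.
  - apply/measurable_EFinP; apply: measurable_funD; last exact: mB.
    exact: (measurableT_comp mS (measurable_subt u)).
  rewrite muleC; congr (_ * _)%E; under eq_integral do rewrite EFinD.
  have mSu : mbl (fun v => (S (subt u v))%:E).
    by apply/measurable_EFinP; exact: (measurableT_comp mS (measurable_subt u)).
  have mBE : mbl (fun v : TR k => ((\1_(@box R k M) v : R))%:E) by mauto.
  have Su0 v : setT v -> (0 <= (S (subt u v))%:E)%E by rewrite lee_fin.
  have B0 v : setT v -> (0 <= (\1_(@box R k M) v)%:E :> \bar R)%E by rewrite lee_fin.
  rewrite (ge0_integralD lb measurableT Su0 mSu B0 mBE).
  rewrite (@ge0_integral_subt R k u (EFin \o S) mES ES0).
  rewrite integral_indic // setIT EFinD (fineK sfin); congr (_ + _)%E; exact/esym/(fineK bfin).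
rewrite ge0_integralZl_EFin //; last exact/measurable_EFinP.
rewrite integral_indic // setIT; apply: lte_mul_pinfty; rewrite ?lee_fin //; exact: leb_box.
Qed.

Lemma integrable_riesz b M f g : 0 < b < k%:R -> boxed M f -> boxed M g ->
  itg lb2 (fun p => f p.1 * riesz b p * g p.2).
Proof.
move=> b0k [mf hf] [mg hg].
apply: (integrable_dominated _ _ (integrable_normM (M * M) (integrable_riesz_box M b0k))).
  apply: measurable_funM; last exact: (measurableT_comp mg).
  by apply: measurable_funM; [exact: (measurableT_comp mf)|exact: measurable_riesz].
move=> p; rewrite !normrM (ger0_norm (powR_ge0 _ _)).
rewrite (_ : M * M * _ = (M * \1_(@box R k M) p.1) * riesz b p * (M * \1_(@box R k M) p.2)); last by ring.
by apply: ler_pM => //; [rewrite mulr_ge0 // powR_ge0|apply: ler_wpM2r => //; exact: powR_ge0].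
Qed.

(** The constant c_{k,beta} of the spectral representation of the Riesz kernel. *)
Definition riesz_c b : R := riesz_B (b - 1 - k%:R) / (riesz_A b * gauss_moment 0 ^+ k).

Lemma riesz_c_gt0 b : 1 < b < 2 -> b < k%:R -> 0 < riesz_c b.
Proof.
move=> b12 bk; apply: divr_gt0; first by apply: riesz_B_gt0; lra.
by apply: mulr_gt0; [exact: riesz_A_gt0|rewrite exprn_gt0 // gauss_moment0_gt0].
Qed.

Lemma tn_scale_norm c (u : TR k) : tn (scale_tuple c u) ^+ 2 = (c * tn u) ^+ 2.
Proof. by rewrite exprMn !sqr_tn dottZ dottC dottZ mulrA expr2. Qed.

(** Subordinate the kernel to Gaussians of scale s, use [gaussian_energy] for each s, and substitute
    y = x / |s|. The power of |s| becomes a = b - 1 - k, and integrating over s by [riesz_inversion]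
    leaves |x|^(b - k). *)
Lemma riesz_energy b M f : (0 < k)%N -> 1 < b < 2 -> b < k%:R -> boxed M f ->
  (\int[lb2]_p (f p.1 * riesz b p * f p.2)%:E =
   (riesz_c b)%:E * \int[lb]_x (tn x `^ (b - k%:R) * nfour2 f x)%:E)%E.
Proof.
move=> k0 b12 bk tf; have fi := integrable_boxed tf.
have [mf hf] := tf; have [b1 b2] := andP b12.
have b0k : 0 < b < k%:R by rewrite (lt_trans ltr01 b1).
have A0 := riesz_A_gt0 b12.
have m0 : 0 < gauss_moment 0 ^+ k :> R by rewrite exprn_gt0 // gauss_moment0_gt0.
set a := b - 1 - k%:R; have a1 : a < - 1 by rewrite /a; lra.
have aN0 : a != 0 by rewrite lt_eqF //; lra.
have bN0 : b - 1 != 0 by rewrite gt_eqF // subr_gt0.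
have iff := integrable_riesz b0k tf tf.
have i2 : itg lb2 (fun p : TR k * TR k => f p.1 * f p.2) by exact: integrable_prodM.
pose e s (p : TR k * TR k) : R := expR (- (gauss_var * (s * tn (subt p.1 p.2)) ^+ 2 / 2)).
pose h (z : Borel R * (TR k * TR k)) : R :=
  (tn (subt z.2.1 z.2.2) != 0)%:R * (f z.2.1 * f z.2.2) * (`|z.1| `^ (b - 1) * e z.1 z.2).
have me : mbl (fun z : Borel R * (TR k * TR k) => e z.1 z.2).
  apply: measurable_fun_expR; apply: measurableT_comp => //; apply: measurable_funM => //.
  apply: measurable_funM => //; apply: measurable_funX; apply: measurable_funM => //.
  exact: (measurableT_comp measurable_tn_subt).
have mn : mbl (fun p : TR k * TR k => ((tn (subt p.1 p.2) != 0)%:R : R)).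
  rewrite (_ : (fun p => _) = \1_(~` [set p : TR k * TR k | tn (subt p.1 p.2) = 0])); last first.
    apply/funext => p; rewrite indicE; congr ((_ : bool)%:R); apply/idP/idP; rewrite in_setC.
      by move=> /eqP H; rewrite notin_setE.
    by rewrite notin_setE => /eqP.
  by apply: measurable_indic; apply: measurableC; exact: measurable_diag.
have mf2 : mbl (fun p : TR k * TR k => f p.1 * f p.2) by mauto.
have mab c : mbl (fun z : Borel R * (TR k * TR k) => `|z.1| `^ c).
  by mauto.
have mh : mbl h.
  apply: measurable_funM; last by apply: measurable_funM.
  by apply: measurable_funM; [exact: (measurableT_comp mn)|exact: (measurableT_comp mf2)].
have mEh : mbl (EFin \o h) by mauto.
have e0 s p : 0 <= `|s| `^ (b - 1) * e s p by rewrite mulr_ge0 ?powR_ge0 ?expR_ge0.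
have me' p : mbl (fun s : Borel R => (`|s| `^ (b - 1) * e s p)%:E).
  apply/measurable_EFinP; apply: measurable_funM.
    by mauto.
  exact: (measurable_fun_pair1 (f := fun z : Borel R * (TR k * TR k) => e z.1 z.2) p me).
have ie p : tn (subt p.1 p.2) != 0 ->
    (\int[mu]_s (`|s| `^ (b - 1) * e s p)%:E = (riesz_A b * riesz b p)%:E)%E.
  move=> tN0; have t0 : 0 < tn (subt p.1 p.2) by rewrite lt_def tN0 tn_ge0.
  by rewrite -riesz_subordination.
have ks p : (\int[mu]_s `|h (s, p)|%:E = (riesz_A b * `|f p.1 * riesz b p * f p.2|)%:E)%E.
  rewrite /h /=; case: eqVneq => [t0|tN0] /=.
    rewrite (@eq_integral_leb _ _ (cst 0%E)) ?integral0; last by move=> s; rewrite !mul0r normr0.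
    by rewrite /riesz t0 powR0 ?mulr0 ?mul0r ?normr0 ?mulr0 // oppr_eq0 gt_eqF // (lt_trans ltr01).
  rewrite (@eq_integral_leb _ _ (fun s => `|f p.1 * f p.2|%:E * (`|s| `^ (b - 1) * e s p)%:E)%E); last first.
    by move=> s; rewrite -EFinM mul1r [in LHS]normrM (ger0_norm (e0 _ _)).
  rewrite ge0_integralZl_EFin //; last by move=> s _; rewrite lee_fin.
  rewrite ie // -EFinM !normrM [`|riesz b p|]ger0_norm ?powR_ge0 //; congr _%:E; by ring.
have ks' p : (\int[mu]_s (h (s, p))%:E = (riesz_A b * (f p.1 * riesz b p * f p.2))%:E)%E.
  rewrite /h /=; case: eqVneq => [t0|tN0] /=.
    rewrite (@eq_integral_leb _ _ (cst 0%E)) ?integral0; last by move=> s; rewrite !mul0r.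
    by rewrite /riesz t0 powR0 ?mulr0 ?mul0r ?mulr0 // oppr_eq0 gt_eqF // (lt_trans ltr01).
  rewrite (@eq_integral_leb _ _ (fun s => (f p.1 * f p.2)%:E * (`|s| `^ (b - 1) * e s p)%:E)%E); last first.
    by move=> s; rewrite -EFinM mul1r.
  have is_ : mu.-integrable setT (fun s => (`|s| `^ (b - 1) * e s p)%:E).
    apply/integrableP; split; first exact: me'.
    rewrite (@eq_integral_leb _ _ (fun s => (`|s| `^ (b - 1) * e s p)%:E)); last first.
      by move=> s /=; rewrite ger0_norm.
    by rewrite ie // ltry.
  rewrite integralZl // ie // -EFinM; congr _%:E; by ring.
have ih : itg (mu \x lb2)%E h.
  apply/integrable21ltyP => //.
  rewrite (eq_integral (fun p => (riesz_A b)%:E * `|(f p.1 * riesz b p * f p.2)%:E|)%E); last first.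
    by move=> p _; rewrite -EFinM -ks.
  rewrite ge0_integralZl_EFin ?(ltW A0) //; last first.
    by apply/measurable_EFinP; apply: measurable_fun_norm; exact: integrable_measurable iff.
  by have /integrableP[_ hh] := iff; apply: lte_mul_pinfty; rewrite // lee_fin ltW.
have E := Fubini ih; rewrite /= in E.
pose H s x : R := `|s| `^ a * expR (- (tn x / s) ^+ 2) * nfour2 f x.
have E1 s : ((gauss_moment 0 ^+ k)%:E * \int[lb2]_p (h (s, p))%:E = \int[lb]_x (H s x)%:E)%E.
  have mc : mbl (fun p => e s p).
    exact: (measurable_fun_pair2 (f := fun z : Borel R * (TR k * TR k) => e z.1 z.2) s me).
  have mch : mbl (fun p => h (s, p)).
    exact: (measurable_fun_pair2 (f := h) s mh).
  have -> : (\int[lb2]_p (h (s, p))%:E =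
      \int[lb2]_p ((`|s| `^ (b - 1))%:E * (f p.1 * f p.2 * e s p)%:E))%E.
    (* The two integrands differ on the diagonal at most, which is null since k > 0. *)
    apply: ae_eq_integral => //; first exact/measurable_EFinP.
      by apply: measurable_funeM; apply/measurable_EFinP; exact: measurable_funM.
    exists [set p | tn (subt p.1 p.2) = 0]; split; [exact: measurable_diag|exact: null_diag|].
    move=> p; apply: contra_notP => tN0 _; rewrite -EFinM /h /=.
    have -> : tn (subt p.1 p.2) != 0 by exact/eqP.
    by rewrite mul1r mulrCA.
  have ife : itg lb2 (fun p => f p.1 * f p.2 * e s p).
    apply: (integrable_dominated (g := fun p => `|f p.1 * f p.2|)).
    - by mauto.
    - move=> p; rewrite normrM ler_piMr // ger0_norm ?expR_ge0 // -[leRHS]expR0 ler_expR oppr_le0.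
      by rewrite divr_ge0 // mulr_ge0 ?sqr_ge0 // ltW // gauss_var_gt0.
    - by have := integrable_norm i2; apply: eq_integrable.
  rewrite integralZl // muleCA -integralZl //.
  have -> : (\int[lb2]_p ((gauss_moment 0 ^+ k)%:E * (f p.1 * f p.2 * e s p)%:E) =
      \int[lb]_y (gk y * nfour2 f (scale_tuple `|s| y))%:E)%E.
    rewrite -(gaussian_energy `|s| fi); apply: eq_integral => p _; rewrite -EFinM; congr _%:E.
    by rewrite /e [in RHS]exprMn real_normK ?num_real // -exprMn; ring.
  have [->|sN0] := eqVneq s 0.
    rewrite normr0 powR0 // mul0e (eq_integral (cst 0%E)) ?integral0 // => x _.
    by rewrite /H normr0 powR0 // !mul0r.
  have s0 : 0 < `|s| by rewrite normr_gt0.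
  pose Gs x : \bar R := (gk (scale_tuple `|s|^-1 x) * nfour2 f x)%:E.
  have mGs : mbl Gs.
    apply/measurable_EFinP; apply: measurable_funM; last exact: measurable_nfour2.
    apply: (measurableT_comp (@measurable_gk R k)); exact: measurable_scale_tuple.
  have Gs0 x : (0 <= Gs x)%E by rewrite lee_fin mulr_ge0 ?gk_ge0 ?nfour2_ge0.
  have := ge0_integral_scale s0 mGs Gs0.
  rewrite (eq_integral (fun y => (gk y * nfour2 f (scale_tuple `|s| y))%:E)); last first.
    move=> y _; rewrite /Gs; congr (gk _ * _)%:E; apply: eq_from_tnth => i.
    by rewrite !tnth_mktuple mulKf // gt_eqF.
  move=> ->; rewrite muleA -EFinM -ge0_integralZl_EFin //.
  apply: eq_integral => x _; rewrite -EFinM; congr _%:E; rewrite /H mulrA; congr (_ * _ * _).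
    rewrite -powR_mulrn // -powRN -powRD; last by rewrite (gt_eqF s0) implybT.
    by congr (_ `^ _); rewrite /a.
  rewrite /gk tn_scale_norm; congr (expR (- _)).
  by rewrite [_^-1 * _]mulrC 2!exprMn exprVn real_normK ?num_real // exprVn.
have HE x s : (H s x = (`|s| `^ a * expR (- (tn x / s) ^+ 2)) * nfour2 f x) by [].
have mT := @measurable_tn R k.
have mN := measurable_nfour2 fi.
have mH : mbl (fun z : Borel R * TR k => (H z.1 z.2)%:E).
  apply/measurable_EFinP; apply: measurable_funM; last exact: (measurableT_comp mN).
  apply: measurable_funM.
    by mauto.
  apply: measurable_fun_expR; apply: measurableT_comp => //; apply: measurable_funX.
  by mauto.
have H0 (z : Borel R * TR k) : (0 <= (H z.1 z.2)%:E)%E.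
  by rewrite lee_fin !mulr_ge0 ?nfour2_ge0 ?expR_ge0 ?powR_ge0.
have Tn := @fubini_tonelli _ _ _ _ _ mu lb _ mH H0; rewrite /= in Tn.
have F1 : ((gauss_moment 0 ^+ k)%:E * ((riesz_A b)%:E * \int[lb2]_p (f p.1 * riesz b p * f p.2)%:E) =
    \int[lb]_x \int[mu]_s (H s x)%:E)%E.
  rewrite -Tn -integralZl // (eq_integral (fun p => \int[mu]_s (h (s, p))%:E)%E); last first.
    by move=> p _; rewrite ks' -EFinM.
  rewrite -E -integralZl //; last exact: (integrable_fubini_F ih).
  by apply: eq_integral_leb => s; rewrite E1.
have F2 : (\int[lb]_x \int[mu]_s (H s x)%:E =
    \int[lb]_x ((riesz_B a)%:E * (tn x `^ (b - k%:R) * nfour2 f x)%:E))%E.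
  apply: ae_eq_integral => //.
  - exact: (@measurable_fun_fubini_tonelli_G _ _ _ _ _ mu (fun z : Borel R * TR k => (H z.1 z.2)%:E)).
  - by mauto.
  exists [set x | tn x = 0]; split; [exact: measurable_tn0|exact: leb_tn0|].
  move=> x; apply: contra_notP => tN0 _.
  have t0 : 0 < tn x by rewrite lt_def tn_ge0 andbT; exact/eqP.
  rewrite (@eq_integral_leb _ _ (fun s => (nfour2 f x)%:E * (`|s| `^ a * expR (- (tn x / s) ^+ 2))%:E)%E); last first.
    by move=> s; rewrite -EFinM mulrC.
  rewrite ge0_integralZl_EFin ?nfour2_ge0 //; last first.
  - apply/measurable_EFinP; apply: measurable_funM.
      by mauto.
    apply: measurable_fun_expR; apply: measurableT_comp => //; apply: measurable_funX.
    by apply: measurable_funM => //; exact: measurable_funV.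
  rewrite riesz_inversion // -!EFinM; congr _%:E.
  have -> : a + 1 = b - k%:R by rewrite /a; ring.
  by ring.
move: F1; rewrite F2 ge0_integralZl_EFin; last 4 first.
- by [].
- by move=> x _; rewrite lee_fin mulr_ge0 ?powR_ge0 ?nfour2_ge0.
- apply/measurable_EFinP; apply: measurable_funM => //; exact: measurable_fun_powR.
- by rewrite ltW // riesz_B_gt0.
rewrite muleA -EFinM => F3.
have AM : gauss_moment 0 ^+ k * riesz_A b != 0 by rewrite gt_eqF // mulr_gt0.
have solve (c d : R) (x y : \bar R) : c != 0 -> (c%:E * x = d%:E * y)%E -> x = ((d / c)%:E * y)%E.
  move=> cN0 hxy; rewrite [d / c]mulrC EFinM -muleA -hxy muleA -EFinM mulVf // mul1e.
  by [].
by rewrite (solve _ _ _ _ AM F3) /riesz_c [riesz_A b * _]mulrC.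
Qed.
End riesz_energy.

(** * Plancherel's identity for bounded, compactly supported functions *)

Section plancherel.
Context {R : realType} (k : nat).
Local Notation mu := (@lebesgue_measure R).
Local Notation TR n := (n.-tuple (Borel R)).
Local Notation lb := (leb (R:=R) (n:=k)).
Local Notation lb2 := (leb2 (R:=R) (n:=k)).

Lemma integral_gk : (\int[lb]_u (gk u)%:E = (gauss_moment 0 ^+ k)%:E)%E.
Proof.
have z : tn ([tuple 0 | i < k] : TR k) = 0.
  rewrite /tn /enorm dotp_to_row big1 ?sqrtr0 // => i _; by rewrite !tnth_mktuple mul0r.
have d0 u : dott ([tuple 0 | i < k] : TR k) u = 0.
  by rewrite /dott big1 // => i _; rewrite tnth_mktuple mul0r.
have := gk_hat ([tuple 0 | i < k] : TR k) 0.
rewrite z expr0n /= mulr0 mul0r oppr0 expR0 mulr1 cos0 mul1r => <-.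
by apply: eq_integral => u _; rewrite d0 addr0 cos0 mul1r.
Qed.

Lemma subt_subt (u v : TR k) : subt u (subt u v) = v.
Proof. by apply: eq_from_tnth => i; rewrite !tnth_mktuple opprB addrC subrK. Qed.

Lemma scale_tupleK c (u : TR k) : c != 0 -> scale_tuple c^-1 (scale_tuple c u) = u.
Proof. by move=> c0; apply: eq_from_tnth => i; rewrite !tnth_mktuple mulKf. Qed.

(* Substitution [v = u - w / c] in a Gaussian average at scale [1 / c]. *)
Lemma gauss_average_substitution (c : R) (u : TR k) (h : TR k -> R) : 0 < c ->
  mbl h -> (forall v, 0 <= h v) ->
  (\int[lb]_v (h v * (c ^+ k * gk (scale_tuple c (subt u v))))%:E =
   \int[lb]_w (h (subt u (scale_tuple c^-1 w)) * gk w)%:E)%E.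
Proof.
move=> c0 mh h0; have cN0 : c != 0 by rewrite gt_eqF.
pose Th w : \bar R := (h (subt u (scale_tuple c^-1 w)) * gk w)%:E.
have mTh : mbl Th.
  apply/measurable_EFinP; apply: measurable_funM; last exact: measurable_gk.
  by mauto.
have Th0 w : (0 <= Th w)%E by rewrite lee_fin mulr_ge0 // gk_ge0.
pose G w : \bar R := ((c ^+ k)%:E * Th (scale_tuple c w))%E.
have mG : mbl G.
  by apply: measurable_funeM; apply: (measurableT_comp mTh); exact: measurable_scale_tuple.
have G0 w : (0 <= G w)%E by rewrite mule_ge0 // lee_fin exprn_ge0 // ltW.
transitivity (\int[lb]_v G (subt u v))%E.
  apply: eq_integral => v _; rewrite /G /Th -EFinM scale_tupleK // subt_subt; congr _%:E; by ring.
rewrite (ge0_integral_subt u mG G0) /G ge0_integralZl_EFin //; last 2 first.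
- by apply: (measurableT_comp mTh); exact: measurable_scale_tuple.
- by rewrite exprn_ge0 // ltW.
rewrite (ge0_integral_scale c0 mTh Th0) muleA -EFinM mulfV ?mul1e //.
by rewrite expf_neq0.
Qed.

(** The double integral of f(u) f(v) against the Gaussian approximate identity at scale 1/n is
    computed in two ways: by dominated convergence it tends to a multiple of the L2 norm, and by
    [gaussian_energy] it is an integral of the squared transform against a weight increasing to 1.
    Continuity enters only along the points u - w / (n + 1). *)
Lemma plancherel M f : boxed M f ->
  (forall u w : TR k, (fun n : nat => f (subt u (scale_tuple n.+1%:R^-1 w))) @ \oo --> f u) ->
  ((gauss_moment 0 ^+ k * gauss_moment 0 ^+ k)%:E * \int[lb]_u (f u ^+ 2)%:E =
   (Num.sqrt (gauss_var / 2) ^+ k)%:E * \int[lb]_x (nfour2 f x)%:E)%E.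
Proof.
move=> tf cf; have [mf hf] := tf; have fi := integrable_boxed tf.
have m0 : 0 < gauss_moment 0 ^+ k :> R by rewrite exprn_gt0 // gauss_moment0_gt0.
set m : R := gauss_moment 0 ^+ k in m0 *.
have g0 : 0 < gauss_var / 2 :> R by rewrite divr_gt0 // gauss_var_gt0.
(* Dividing the scale by [c0] turns the exponent gauss_var s^2 / 2 into n^2. *)
set c0 : R := Num.sqrt (gauss_var / 2); have c00 : 0 < c0 by rewrite sqrtr_gt0.
have c02 : c0 ^+ 2 = gauss_var / 2 by rewrite sqr_sqrtr // ltW.
have n0 n : 0 < n.+1%:R :> R by [].
have mS n : mbl (fun p : TR k * TR k => gk (scale_tuple (n.+1%:R : R) (subt p.1 p.2))).
  by mauto.
have fM : forall q, `|f q| <= `|M|.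
  move=> q; apply: (le_trans (hf q)); rewrite indicE; by case: (_ \in _); rewrite ?mulr1 ?mulr0 // ler_norm.
have mu1 : mbl (fun p : TR k * TR k => f p.1) by mauto.
have mu2 : mbl (fun p : TR k * TR k => f p.2) by mauto.
pose W n (p : TR k * TR k) : R := n.+1%:R ^+ k * gk (scale_tuple (n.+1%:R : R) (subt p.1 p.2)).
have W0 n p : 0 <= W n p by rewrite mulr_ge0 ?exprn_ge0 // gk_ge0.
have mW n : mbl (W n) by exact: measurable_funM.
have mW0 n p (a : R) : 0 <= a -> 0 <= m * a * W n p.
  by move=> a0; exact: mulr_ge0 (mulr_ge0 (ltW m0) a0) (W0 n p).
have mW1 n p (a b : R) : 0 <= a -> 0 <= b -> 0 <= m * a * b * W n p.
  by move=> a0 b0; exact: mulr_ge0 (mulr_ge0 (mulr_ge0 (ltW m0) a0) b0) (W0 n p).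

have mass (h : TR k -> R) n : mbl h -> (forall u, 0 <= h u) ->
    (\int[lb2]_p (m * h p.1 * W n p)%:E = (m * m)%:E * \int[lb]_u (h u)%:E)%E.
  move=> mh h0; have mh1 : mbl (fun p : TR k * TR k => h p.1) by exact: (measurableT_comp mh).
  rewrite [LHS]fubini_tonelli1; last 2 first.
  - by apply/measurable_EFinP; apply: measurable_funM => //; exact: measurable_funM.
  - by move=> p; rewrite lee_fin; exact: mW0.
  rewrite -ge0_integralZl_EFin ?mulr_ge0 ?(ltW m0) //; last 2 first.
  - by move=> x _; rewrite lee_fin.
  - by mauto.
  apply: eq_integral => x _; rewrite /fubini_F /W /=.
  have := @gauss_average_substitution n.+1%:R x (fun=> m * h x) (n0 n).
  move=> -> //; last by move=> _; rewrite mulr_ge0 // ltW.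
  under eq_integral do rewrite EFinM.
  rewrite ge0_integralZl_EFin //; last 3 first.
  - by move=> w _; rewrite lee_fin gk_ge0.
  - by mauto.
  - by rewrite mulr_ge0 // ltW.
  by rewrite integral_gk -/m -EFinM; congr _%:E; ring.
have f2i : itg lb (fun u => f u ^+ 2).
  apply: (integrable_dominated (g := fun u => `|M| * `|f u|)); first exact: measurable_funX.
    by move=> u; rewrite expr2 normrM ler_wpM2r // fM.
  by apply: integrable_normM; have := integrable_norm fi; apply: eq_integrable.
pose I := \int[lb]_u (f u ^+ 2).
have IE : (\int[lb]_u (f u ^+ 2)%:E = I%:E)%E by rewrite (integral_EFin_Rintegral f2i).
pose Q n (p : TR k * TR k) : R := m * f p.1 ^+ 2 * W n p.
pose Pn n (p : TR k * TR k) : R := f p.1 * f p.2 * (m * W n p).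
have mQ n : mbl (Q n).
  by apply: measurable_funM => //; apply: measurable_funM => //; exact: measurable_funX.
have mP n : mbl (Pn n).
  by apply: measurable_funM; [exact: measurable_funM|exact: measurable_funM].
have QE n : (\int[lb2]_p (Q n p)%:E = (m * m * I)%:E)%E.
  rewrite (mass (fun u => f u ^+ 2)) ?IE ?EFinM //; first exact: measurable_funX.
  by move=> u; exact: sqr_ge0.
have iQ n : itg lb2 (Q n).
  apply/integrableP; split; first exact/measurable_EFinP.
  rewrite (eq_integral (fun p => (Q n p)%:E)) ?QE ?ltry // => p _ /=.
  by rewrite ger0_norm //; apply: mW0; exact: sqr_ge0.
have ifM : (\int[lb]_u `|f u|%:E < +oo)%E by have /integrableP[] := fi.
have iP n : itg lb2 (Pn n).
  have i2 : itg lb2 (fun p : TR k * TR k => f p.1 * f p.2) by exact: integrable_prodM.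
  apply: (integrable_dominated _ _ (integrable_normM (m * n.+1%:R ^+ k)
    (f := fun p : TR k * TR k => `|f p.1 * f p.2|) _)).
  - exact: mP.
  - move=> p; have h1 : 0 <= m * W n p by exact: mulr_ge0 (ltW m0) (W0 n p).
    rewrite /Pn normrM [leLHS]mulrC ler_wpM2r // (ger0_norm h1).
    rewrite ler_wpM2l ?(ltW m0) // /W ler_piMr ?exprn_ge0 // -[leRHS]expR0 ler_expR oppr_le0.
    exact: sqr_ge0.
  - by have := integrable_norm i2; apply: eq_integrable.
pose g n (p : TR k * TR k) : R := m * `|f p.1| * `|f (subt p.1 (scale_tuple n.+1%:R^-1 p.2)) - f p.1| * gk p.2.
have mg n : mbl (g n).
  have ms : mbl (fun p : TR k * TR k => f (subt p.1 (scale_tuple n.+1%:R^-1 p.2))).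
    apply: (measurableT_comp mf).
    apply: (measurableT_comp (@measurable_subt_pair R k) (g := fun p : TR k * TR k => (p.1, scale_tuple n.+1%:R^-1 p.2))).
    by mauto.
  apply: measurable_funM; last exact: (measurableT_comp (@measurable_gk R k)).
  apply: measurable_funM; first by apply: measurable_funM => //; exact: measurable_fun_norm.
  by mauto.
have g0' n p : 0 <= g n p by rewrite !mulr_ge0 ?gk_ge0 // ltW.
have diff n : (`| \int[lb2]_p (Pn n p)%:E - (m * m * I)%:E | <= \int[lb2]_p (g n p)%:E)%E.
  rewrite -(QE n) -(integralB measurableT (iP n) (iQ n)).
  apply: le_trans (le_abse_integral lb2 measurableT _) _.
    by apply: emeasurable_funB; exact/measurable_EFinP.
  have -> : (\int[lb2]_p (g n p)%:E = \int[lb2]_p (m * `|f p.1| * `|f p.2 - f p.1| * W n p)%:E)%E.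
    rewrite [LHS]fubini_tonelli1; last 2 first.
    - by mauto.
    - by move=> p; rewrite lee_fin.
    have mx : mbl (fun p : TR k * TR k => m * `|f p.1| * `|f p.2 - f p.1|).
      apply: measurable_funM; first by apply: measurable_funM => //; exact: measurable_fun_norm.
      by mauto.
    rewrite [RHS]fubini_tonelli1; last 2 first.
    - by apply/measurable_EFinP; exact: measurable_funM.
    - by move=> p; rewrite lee_fin; exact: mW1.
    apply: eq_integral => u _; rewrite /fubini_F /W /=.
    have := @gauss_average_substitution n.+1%:R u (fun v => m * `|f u| * `|f v - f u|) (n0 n).
    move=> -> //.
    - exact: (measurable_fun_pair2 (f := fun p : TR k * TR k => m * `|f p.1| * `|f p.2 - f p.1|) u mx).
    - by move=> v; rewrite !mulr_ge0 // ltW.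
  apply: ge0_le_integral => //.
  - by apply: measurableT_comp => //; apply: emeasurable_funB; exact/measurable_EFinP.
  - apply/measurable_EFinP; apply: measurable_funM => //; apply: measurable_funM.
      by mauto.
    by mauto.
  move=> p _; rewrite -EFinB abse_EFin lee_fin /Pn /Q.
  rewrite (_ : _ - _ = m * f p.1 * (f p.2 - f p.1) * W n p); last by ring.
  by rewrite (normrM _ (W n p)) (ger0_norm (W0 n p)) (normrM (m * f p.1)) (normrM m) (gtr0_norm m0).
have lim0 : (fun n => \int[lb2]_p (g n p)%:E)%E @ \oo --> 0%E.
  pose D (p : TR k * TR k) : \bar R := (2 * m * `|M| * (`|f p.1| * gk p.2))%:E.
  have iD : lb2.-integrable setT D.
    apply: integrable_normM; apply: (integrable_prodM (a := fun u => `|f u|) (b := @gk R k)).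
      by have := integrable_norm fi; apply: eq_integrable.
    exact: integrable_gk.
  rewrite (_ : 0%E = \int[lb2]_p 0%:E)%E; last by rewrite integral0.
  apply: (@dominated_cvg _ _ _ lb2 setT measurableT (fun n p => (g n p)%:E) (cst 0%:E) D) => //.
  - by mauto.
  - move=> p _; apply: cvg_EFin; first by near=> n.
    have := cf p.1 p.2 => cp.
    have c1 : (fun n => `|f (subt p.1 (scale_tuple n.+1%:R^-1 p.2)) - f p.1|) @ \oo --> (0 : R).
      by have := cvg_norm (cvgB cp (cvg_cst (f p.1))); rewrite subrr normr0; apply.
    have := cvgM (cvgM (cvg_cst (m * `|f p.1|)) c1) (cvg_cst (gk p.2)); rewrite mulr0 mul0r; exact.
  - move=> n p _; rewrite /D abse_EFin lee_fin ger0_norm // /g mulrA ler_wpM2r ?gk_ge0 //.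
    rewrite (_ : 2 * m * `|M| * `|f p.1| = m * `|f p.1| * (`|M| + `|M|)); last by ring.
    by rewrite ler_wpM2l ?mulr_ge0 ?(ltW m0) // (le_trans (ler_normB _ _)) // lerD // fM.
have PE n : (\int[lb2]_p (Pn n p)%:E =
    (c0 ^+ k)%:E * \int[lb]_x (gk (scale_tuple (c0 / n.+1%:R) x) * nfour2 f x)%:E)%E.
  pose s := n.+1%:R / c0; have s0 : 0 < s by rewrite divr_gt0.
  have := gaussian_energy s fi => E.
  have -> : (\int[lb2]_p (Pn n p)%:E = (n.+1%:R ^+ k)%:E * \int[lb2]_p (f p.1 * f p.2 *
      (gauss_moment 0 ^+ k * expR (- (gauss_var * (s * tn (subt p.1 p.2)) ^+ 2 / 2))))%:E)%E.
    have nk0 : n.+1%:R ^+ k != 0 :> R by rewrite expf_neq0.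
    have eqf p : f p.1 * f p.2 * (gauss_moment 0 ^+ k * expR (- (gauss_var * (s * tn (subt p.1 p.2)) ^+ 2 / 2))) =
        (n.+1%:R ^+ k)^-1 * Pn n p.
      have -> : expR (- (gauss_var * (s * tn (subt p.1 p.2)) ^+ 2 / 2)) = (n.+1%:R ^+ k)^-1 * W n p.
        rewrite /W mulKf // /gk tn_scale_norm; congr (expR (- _)).
        rewrite !exprMn exprVn c02; field.
        by rewrite gt_eqF // gauss_var_gt0.
      by rewrite /Pn -/m; ring.
    under [in RHS]eq_integral do rewrite eqf EFinM.
    have /= -> := integralZl measurableT (iP n) (n.+1%:R ^- k).
    by rewrite muleA -EFinM mulfV // mul1e.
  pose Gs x : \bar R := (gk (scale_tuple (c0 / n.+1%:R) x) * nfour2 f x)%:E.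
  have mGs : mbl Gs.
    apply/measurable_EFinP; apply: measurable_funM; last exact: measurable_nfour2.
    apply: (measurableT_comp (@measurable_gk R k)); exact: measurable_scale_tuple.
  have Gs0 x : (0 <= Gs x)%E by rewrite lee_fin mulr_ge0 ?gk_ge0 ?nfour2_ge0.
  have := ge0_integral_scale s0 mGs Gs0.
  rewrite (eq_integral (fun y => (gk y * nfour2 f (scale_tuple s y))%:E)); last first.
    move=> y _; rewrite /Gs; congr (gk _ * _)%:E.
    by rewrite -[c0 / _]invf_div -/s scale_tupleK // gt_eqF.
  rewrite E => ->; rewrite muleA -EFinM; congr (_%:E * _)%E.
  by rewrite /s expr_div_n invf_div mulrCA mulfV ?mulr1 // expf_neq0.
have cvg1 : (fun n => \int[lb2]_p (Pn n p)%:E)%E @ \oo --> (m * m * I)%:E.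
  have PR n : (\int[lb2]_p (Pn n p)%:E = (\int[lb2]_p Pn n p)%:E)%E by exact: integral_EFin_Rintegral (iP n).
  pose e n := (\int[lb2]_p (g n p)%:E)%E.
  apply: (@squeeze_cvge _ _ _ _ (fun n => (m * m * I)%:E - e n)%E _ (fun n => (m * m * I)%:E + e n)%E).
  - apply: nearW => n; have := diff n; rewrite -/(e n) PR -EFinB abse_EFin => h.
    move: (e n) h => -[r| |]; [|by move=> _; rewrite /= leNye leey|by rewrite leeNy_eq].
    by rewrite lee_fin ler_norml => /andP[h1 h2]; rewrite -EFinD !lee_fin; apply/andP; split; lra.
  - by rewrite -[X in _ --> X]sube0; apply: cvgeB => //; exact: cvg_cst.
  - by rewrite -[X in _ --> X]adde0; apply: cvgeD => //; exact: cvg_cst.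
have cvg2 : (fun n => \int[lb2]_p (Pn n p)%:E)%E @ \oo -->
    ((c0 ^+ k)%:E * \int[lb]_x (nfour2 f x)%:E)%E.
  under eq_fun do rewrite PE.
  apply: cvgeZl => //.
  have mt n : mbl (fun x : TR k => (gk (scale_tuple (c0 / n.+1%:R) x) * nfour2 f x)%:E).
    apply/measurable_EFinP; apply: measurable_funM; last exact: measurable_nfour2.
    apply: (measurableT_comp (@measurable_gk R k)); exact: measurable_scale_tuple.
  have := @cvg_monotone_convergence _ _ _ lb setT measurableT
    (fun n (x : TR k) => (gk (scale_tuple (c0 / n.+1%:R) x) * nfour2 f x)%:E) mt.
  have -> : (fun x : TR k => lim ((gk (scale_tuple (c0 / n.+1%:R) x) * nfour2 f x)%:E @[n --> \oo])) =
      (fun x => (nfour2 f x)%:E).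
    apply/funext => x; apply/cvg_lim => //; apply: cvg_EFin; first by near=> n.
    have c1 : (fun n => gk (scale_tuple (c0 / n.+1%:R) x)) @ \oo --> (1 : R).
      have -> : (fun n => gk (scale_tuple (c0 / n.+1%:R) x)) =
          (fun n => expR (- (c0 * n.+1%:R^-1 * tn x * (c0 * n.+1%:R^-1 * tn x)))).
        by apply/funext => n; rewrite /gk tn_scale_norm expr2.
      have h : (fun n : nat => c0 * n.+1%:R^-1 * tn x) @ \oo --> (0 : R).
        have := cvgM (cvgM (cvg_cst c0) (@cvg_harmonic R)) (cvg_cst (tn x)).
        by rewrite mulr0 mul0r; apply.
      have h2 := cvgN (cvgM h h); rewrite mulr0 oppr0 in h2.
      have h3 := continuous_cvg _ (@continuous_expR R 0) (h2 _ _); rewrite expR0 in h3.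
      exact: h3.
    by have := cvgM c1 (cvg_cst (nfour2 f x)); rewrite mul1r; exact.
  apply.
  - by move=> n x _; rewrite lee_fin mulr_ge0 ?gk_ge0 ?nfour2_ge0.
  - move=> x _ i j ij; rewrite lee_fin ler_wpM2r ?nfour2_ge0 // ler_expR lerN2 !tn_scale_norm.
    have h : c0 / j.+1%:R * tn x <= c0 / i.+1%:R * tn x.
      by rewrite ler_wpM2r ?tn_ge0 // ler_wpM2l ?(ltW c00) // lef_pV2 ?posrE // ler_nat.
    by rewrite lerXn2r // nnegrE mulr_ge0 ?tn_ge0 // divr_ge0 // ltW.
have := cvg_unique _ cvg1 cvg2 => <- //; by rewrite IE -EFinM.
Unshelve. all: by end_near. Qed.
End plancherel.

(** * Test functions seen as functions of time and a tuple *)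

Section test_function_sections.
Context {R : realType} (k : nat).
Local Notation mu := (@lebesgue_measure R).
Local Notation TR n := (n.-tuple (Borel R)).
Local Notation lb := (leb (R:=R) (n:=k)).
Local Notation lb2 := (leb2 (R:=R) (n:=k)).
Local Notation MR := (Borel R).

Let dist_to_row (u v : TR k) (e : R) : 0 < e -> (forall i, `|tnth u i - tnth v i| < e) ->
  ball (to_row u) e (to_row v).
Proof. by move=> e0 h; split => // i j; rewrite /ball /= !mxE; exact: h. Qed.

(* An open set is the countable union of the rational boxes it contains. *)
Lemma measurable_continuous_row (phi : R * 'rV[R]_k -> R) : continuous phi ->
  mbl (fun p : MR * TR k => phi (p.1, to_row p.2)).
Proof.
move=> cphi; apply: (measurability _ (RGenOInfty.measurableE R)) => _ [_ [a ->]] <-.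
rewrite setTI; set O := _ @^-1` _.
pose cell (q : rat * k.-tuple rat * nat) : set (MR * TR k) :=
  [set p | `|p.1 - ratr q.1.1| < q.2.+1%:R^-1 /\ forall i, `|tnth p.2 i - ratr (tnth q.1.2 i)| < q.2.+1%:R^-1].
have mcell q : measurable (cell q).
  rewrite (_ : cell q = [set p | `|p.1 - ratr q.1.1| < q.2.+1%:R^-1] `&`
    \bigcap_(i in [set: 'I_k]) [set p | `|tnth p.2 i - ratr (tnth q.1.2 i)| < q.2.+1%:R^-1]); last first.
    by apply/seteqP; split => p [h1 h2]; split => // i *; exact: h2.
  have ml (f : MR * TR k -> R) (c : R) : mbl f -> measurable [set p | f p < c].
    move=> mf; rewrite -[X in measurable X]setTI.
    by apply: (measurable_fun_ltr mf (measurable_cst c)) => //; exact: measurable_set1.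
  apply: measurableI.
    by apply: ml; apply: measurable_fun_norm; exact: measurable_funB.
  apply: fin_bigcap_measurable => // i _; apply: ml; apply: measurable_fun_norm.
  apply: measurable_funB => //.
  by apply: (measurableT_comp (f := fun u : TR k => tnth u i)) => //; exact: measurable_tnth.
have -> : O = \bigcup_(q in [set q | cell q `<=` O]) cell q.
  apply/seteqP; split=> [p Op|p [q /= qO qp]]; last exact: qO.
  have : nbhs (p.1, to_row p.2) (phi @^-1` `]a, +oo[%classic).
    by apply: (cphi (p.1, to_row p.2)); apply: open_nbhs_nbhs; split => //; exact: interval_open.
  move=> /nbhs_ballP[e /= e0 he].
  pose m := Num.truncn (2 / e); have me : m.+1%:R^-1 < e / 2.
    by rewrite -[e / 2]invf_div ltf_pV2 ?posrE ?divr_gt0 // truncnS_gt.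
  have m0 : 0 < m.+1%:R^-1 :> R by rewrite invr_gt0.
  have tri (a' b' d : R) : `|a'| < d -> `|b'| < d -> d < e / 2 -> `|a' - b'| < e.
    by move=> ha hb hd; apply: (le_lt_trans (ler_normB _ _)); lra.
  have rat_near (x : R) : exists q : rat, `|x - ratr q| < m.+1%:R^-1.
    have xx : x - m.+1%:R^-1 < x + m.+1%:R^-1 by move: m0; set d := _^-1 => d0; lra.
    have [q] := rat_in_itvoo xx.
    rewrite in_itv /= => /andP[h1 h2]; exists q.
    by move: h1 h2; set d := _^-1; set y := ratr q => h1 h2; rewrite ltr_norml; apply/andP; split; lra.
  have [q1 hq1] := rat_near p.1.
  have /choice[q2 hq2] : forall i : 'I_k, exists q : rat, `|tnth p.2 i - ratr q| < m.+1%:R^-1.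
    by move=> i; exact: rat_near.
  exists (q1, [tuple q2 i | i < k], m); last first.
    by split => //= i; rewrite tnth_mktuple; exact: hq2.
  move=> p' [/= h1 h2]; rewrite /O /=; apply: he; split => /=.
    rewrite /ball /= (_ : _ - _ = (p.1 - ratr q1) - (p'.1 - ratr q1)); last by ring.
    exact: tri hq1 h1 me.
  apply: dist_to_row => // i; have := h2 i; rewrite tnth_mktuple => h3; have h4 := hq2 i.
  rewrite (_ : _ - _ = (tnth p.2 i - ratr (q2 i)) - (tnth p'.2 i - ratr (q2 i))); last by ring.
  exact: tri h4 h3 me.
rewrite bigcup_mkcond; apply: countable_bigcupT_measurable => [|q]; first exact: countableP.
by case: ifP => _; [exact: mcell|exact: measurable0].
Qed.

Lemma test_function_bounds (phi : test_function R k) : exists2 M, 0 <= M &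
  forall p, `|phi p| <= M /\ (phi p != 0 -> `|p.1| <= M /\ forall i, `|p.2 0 i| <= M).
Proof.
have [cphi _] := test_fun_smooth phi 0.
have cK := @test_fun_supp R k phi; rewrite /compactly_supported in cK.
pose K := closure [set p | phi p != 0].
have Kphi p : phi p != 0 -> K p by move=> h; apply: subset_closure.
have [M1 [M1r hM1]] := compact_bounded cK.
have cI : compact (phi @` K).
  by apply: continuous_compact => //; exact: continuous_subspaceT.
have [M2 [M2r hM2]] := compact_bounded cI.
pose M := 1 + `|M1| + `|M2|.
have h1 : M1 < M by have := ler_norm M1; have := normr_ge0 M2; rewrite /M; lra.
have h2 : M2 < M by have := ler_norm M2; have := normr_ge0 M1; rewrite /M; lra.
have M0 : 0 <= M by have := normr_ge0 M1; have := normr_ge0 M2; rewrite /M; lra.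
exists M => // p; split.
  have [->|/Kphi Kp] := eqVneq (phi p) 0; first by rewrite normr0.
  by apply: (hM2 M h2); exists p.
move=> /Kphi Kp; have := hM1 M h1 p Kp; rewrite /= prod_normE /= ge_max => /andP[q1 q2]; split => // i.
apply: le_trans q2; rewrite [leRHS]/Num.Def.normr /= mx_normrE.
by apply/bigmax_geP; right; exists (0, i).
Qed.

Definition window (M r : R) : R := \1_[set x : MR | `|x| <= M] r.

Lemma measurable_window M : measurable [set x : MR | `|x| <= M].
Proof.
rewrite -[X in measurable X]setTI.
have mx : mbl (fun x : MR => `|x| : R) by mauto.
by apply: (measurable_fun_ler mx (measurable_cst M)) => //; exact: measurable_set1.
Qed.

(** A class that contains the test functions cut at time 0 and their linear combinations. The cut
    destroys continuity in time, so continuity is recorded in space alone, along the sequences used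
    by [plancherel]. *)
Record slab (M : R) (F : MR * TR k -> R) : Prop := Slab {
  slab_measurable : mbl F ;
  slab_bound : forall r u, `|F (r, u)| <= M * window M r * \1_(@box R k M) u ;
  slab_cvg : forall r u w, (fun n : nat => F (r, subt u (scale_tuple n.+1%:R^-1 w))) @ \oo --> F (r, u) }.

Lemma indic_le (T : Type) (A B : set T) x : A `<=` B -> \1_A x <= \1_B x :> R.
Proof.
move=> AB; rewrite !indicE; case: (boolP (x \in A)) => // xA.
by have -> : x \in B by rewrite inE; apply: AB; rewrite inE in xA.
Qed.

Lemma indic_le1 (T : Type) (A : set T) x : \1_A x <= 1 :> R.
Proof. by rewrite indicE; case: (_ \in _). Qed.

Lemma indic_ge0 (T : Type) (A : set T) x : 0 <= \1_A x :> R.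
Proof. by rewrite indicE. Qed.

Lemma slab_le M N F : 0 <= M -> M <= N -> slab M F -> slab N F.
Proof.
move=> M0 MN [mF bF cF]; split => // r u; apply: (le_trans (bF r u)).
apply: ler_pM; rewrite ?mulr_ge0 ?indic_ge0 //.
  apply: ler_pM; rewrite ?indic_ge0 //; apply: indic_le => x /= h; exact: le_trans MN.
by apply: indic_le => x h i; exact: le_trans (h i) MN.
Qed.

Lemma slab_lin M N F G a b : 0 <= M -> 0 <= N -> slab M F -> slab N G ->
  slab ((1 + `|a| + `|b|) * (M + N)) (fun z => a * F z + b * G z).
Proof.
move=> M0 N0 sF sG; have a0 := normr_ge0 a; have b0 := normr_ge0 b.
have MN0 : 0 <= M + N by rewrite addr_ge0.
have MN : M + N <= (1 + `|a| + `|b|) * (M + N) by rewrite ler_peMl //; lra.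
have [mF bF cF] := sF; have [mG bG cG] := sG; split.
- by mauto.
- move=> r u; set L := (1 + _ + _) * _.
  have hF := bF r u; have hG := bG r u.
  have w1 : window M r * \1_(@box R k M) u <= window L r * \1_(@box R k L) u.
    apply: ler_pM; rewrite ?indic_ge0 //.
      by apply: indic_le => x /= h; apply: (le_trans h); rewrite /L; lra.
    by apply: indic_le => x h i; apply: (le_trans (h i)); rewrite /L; lra.
  have w2 : window N r * \1_(@box R k N) u <= window L r * \1_(@box R k L) u.
    apply: ler_pM; rewrite ?indic_ge0 //.
      by apply: indic_le => x /= h; apply: (le_trans h); rewrite /L; lra.
    by apply: indic_le => x h i; apply: (le_trans (h i)); rewrite /L; lra.
  apply: (le_trans (ler_normD _ _)); rewrite !normrM -mulrA.
  set W := window L r * _ in w1 w2 *.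
  have W0 : 0 <= W by rewrite mulr_ge0 // indic_ge0.
  rewrite -!mulrA in hF hG.
  have k1 : `|F (r, u)| <= M * W by apply: (le_trans hF); rewrite ler_wpM2l.
  have k2 : `|G (r, u)| <= N * W by apply: (le_trans hG); rewrite ler_wpM2l.
  apply: (le_via (`|a| * (M * W) + `|b| * (N * W))).
    by apply: lerD; rewrite ler_wpM2l.
  have e1 := mulr_ge0 M0 W0; have e2 := mulr_ge0 N0 W0.
  have e3 := mulr_ge0 a0 e2; have e4 := mulr_ge0 b0 e1.
  rewrite (_ : L * W = M * W + N * W + `|a| * (M * W) + `|a| * (N * W) + `|b| * (M * W) + `|b| * (N * W)).
    by lra.
  by rewrite /L; ring.
- move=> r u w; apply: cvgD; (apply: cvgM; first exact: cvg_cst); [exact: cF|exact: cG].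
Qed.

(** The noise integrates over times r >= 0; extension by 0 allows time integrals over the whole
    line. *)
Definition zero_extend (phi : R * 'rV[R]_k -> R) (z : MR * TR k) : R :=
  if 0 <= z.1 then phi (z.1, to_row z.2) else 0.

Lemma slab_test (phi : test_function R k) : exists2 M, 0 <= M & slab M (zero_extend phi).
Proof.
have [M M0 hM] := test_function_bounds phi; have [cphi _] := test_fun_smooth phi 0.
have mphi := measurable_continuous_row cphi.
exists M => //; split.
- have m1 : mbl (fun z : MR * TR k => z.1 : R) by mauto.
  by rewrite /zero_extend; apply: measurable_fun_ifT => //; apply: measurable_fun_ler.
- move=> r u; rewrite /zero_extend /=; have [h1 h2] := hM (r, to_row u).
  case: ifP => _; last by rewrite normr0 !mulr_ge0 ?indic_ge0.
  have [->|pN0] := eqVneq (phi (r, to_row u)) 0; first by rewrite normr0 !mulr_ge0 ?indic_ge0.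
  have [h3 h4] := h2 pN0; rewrite /window !indicE mem_set //= mem_set ?mulr1 // => i.
  by have := h4 i; rewrite mxE.
- move=> r u w; rewrite /zero_extend /=; case: ifP => _; last exact: cvg_cst.
  apply: (@cvg_comp _ _ _ (fun n : nat => ((r : R), to_row (subt u (scale_tuple n.+1%:R^-1 w)))) phi _
    (nbhs ((r : R), to_row u))); last exact: cphi.
  have c1 : (fun _ : nat => (r : R)) @ \oo --> (r : R) by exact: cvg_cst.
  suff c2 : (fun n : nat => to_row (subt u (scale_tuple n.+1%:R^-1 w))) @ \oo --> to_row u.
    exact: (cvg_pair c1 c2).
  have -> : (fun n : nat => to_row (subt u (scale_tuple n.+1%:R^-1 w))) =
      (fun n : nat => to_row u - n.+1%:R^-1 *: to_row w).
    by apply/funext => n; apply/rowP => i; rewrite !mxE !tnth_mktuple.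
  rewrite -[X in _ --> X]subr0; apply: cvgB; first exact: cvg_cst.
  rewrite -[X in _ --> X](scale0r (to_row w)); apply: cvgZl; exact: cvg_harmonic.
Qed.

Lemma integrable_window M : itg mu (fun r => window M r : R).
Proof.
have mb := measurable_window M; apply/integrableP; split; first by apply/measurable_EFinP; exact: measurable_indic.
rewrite (eq_integral (fun u : MR => (window M u)%:E)); last first.
  by move=> u _ /=; rewrite ger0_norm // indic_ge0.
rewrite /window integral_indic // setIT.
apply: (@le_lt_trans _ _ (mu `[- M, M]%classic)).
  by apply: le_measure; rewrite ?inE //; move=> x /=; rewrite in_itv /= ler_norml.
by rewrite lebesgue_measure_itv /=; case: ifP => _; rewrite ?ltry // -EFinB ltry.
Qed.

Lemma slab_boxed M F r : 0 <= M -> slab M F -> boxed M (fun u => F (r, u)).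
Proof.
move=> M0 [mF bF _]; split; first exact: measurable_fun_pair2.
move=> u; apply: (le_trans (bF r u)); rewrite ler_wpM2r ?indic_ge0 //.
by rewrite ler_piMr // indic_le1.
Qed.
End test_function_sections.

(** * Spectral isometry of the Riesz and white noises *)

Section spectral_isometry.
Context {R : realType} (k : nat).
Local Notation mu := (@lebesgue_measure R).
Local Notation TR n := (n.-tuple (Borel R)).
Local Notation lb := (leb (R:=R) (n:=k)).
Local Notation lb2 := (leb2 (R:=R) (n:=k)).
Local Notation MR := (Borel R).
Local Notation slabT := (MR * TR k -> R).

Definition spectral_norm2 (b : R) (F : slabT) : \bar R :=
  (\int[mu]_r \int[lb]_x (tn x `^ (b - k%:R) * nfour2 (fun u => F (r, u)) x)%:E)%E.

(** The common interface of the two noises. The bilinear form [C] extends the covariance from test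
    functions to slabs, so that linear combinations can be handled as plain functions without being
    packed into [test_function]. *)
Definition spectral_isometry (b c : R) (cov : test_function R k -> test_function R k -> \bar R) : Prop :=
  exists C : slabT -> slabT -> R,
  [/\ forall phi psi, cov phi psi = (C (zero_extend phi) (zero_extend psi))%:E,
      forall M F G H a e, 0 <= M -> slab M F -> slab M G -> slab M H ->
        C H (fun z => a * F z + e * G z) = a * C H F + e * C H G,
      forall M F G H a e, 0 <= M -> slab M F -> slab M G -> slab M H ->
        C (fun z => a * F z + e * G z) H = a * C F H + e * C G H
    & forall M F, 0 <= M -> slab M F -> (C F F)%:E = (c%:E * spectral_norm2 b F)%E].

Lemma integral_half_line (f : R -> \bar R) :
  (\int[mu]_(r in `[0%R, +oo[) f r = \int[mu]_r (if (0 <= r)%R then f r else 0))%E.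
Proof.
rewrite integral_mkcond; apply: eq_integral_leb => r; rewrite patchE.
by congr (if _ then _ else _); apply/idP/idP; rewrite in_setE /= in_itv /= andbT.
Qed.

(* Constants factor out of an integral that is known to be a real multiple of a measurable one. *)
Lemma integral_factor (f g : MR -> \bar R) (c : R) : 0 < c -> mbl f ->
  (forall r, 0 <= g r)%E -> (forall r, f r = c%:E * g r)%E ->
  (\int[mu]_r f r = c%:E * \int[mu]_r g r)%E.
Proof.
move=> c0 mf g0 fg; have gf : g = (fun r => (c^-1)%:E * f r)%E.
  by apply/funext => r; rewrite fg muleA -EFinM mulVf ?mul1e // gt_eqF.
rewrite -ge0_integralZl_EFin //; last 2 first.
- by rewrite gf; exact: measurable_funeM.
- exact: ltW.
by apply: eq_integral_leb => r; rewrite fg.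
Qed.

Lemma riesz_isometry (b : R) : (0 < k)%N -> 1 < b < 2 -> b < k%:R ->
  spectral_isometry b (riesz_c k b) (@riesz_cov R k b).
Proof.
move=> k0 b12 bk; have [b1 b2] := andP b12; have b0k : 0 < b < k%:R by rewrite (lt_trans ltr01 b1).
pose h (F G : slabT) (z : MR * (TR k * TR k)) : R := F (z.1, z.2.1) * riesz b z.2 * G (z.1, z.2.2).
have mh F G : mbl F -> mbl G -> mbl (h F G).
  move=> mF mG; apply: measurable_funM; last first.
    by mauto.
  apply: measurable_funM; last exact: (measurableT_comp (@measurable_riesz R k b)).
  by mauto.
have ih M F G : 0 <= M -> slab M F -> slab M G -> itg (mu \x lb2)%E (h F G).
  move=> M0 sF sG; have [mF bF _] := sF; have [mG bG _] := sG.
  apply: (integrable_prod_dom (mh _ _ mF mG) (integrable_normM (M * M) (integrable_window M))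
    (integrable_riesz_box M b0k)) => r p; rewrite /h /= !normrM.
  have p0 : 0 <= riesz b p by exact: powR_ge0.
  have w0 : 0 <= window M r := indic_ge0 _ _; have w1 : window M r <= 1 := indic_le1 _ _.
  rewrite (ger0_norm p0) (ger0_norm M0) (ger0_norm w0) !(ger0_norm (indic_ge0 _ _)).
  rewrite (_ : M * M * _ * _ = (M * window M r * \1_(@box R k M) p.1) * riesz b p * (M * \1_(@box R k M) p.2)); last by ring.
  apply: ler_pM; rewrite ?mulr_ge0 //; first by apply: ler_wpM2r.
  apply: (le_trans (bG r p.2)); rewrite ler_wpM2r ?indic_ge0 // ler_piMr //.
exists (fun F G => \int[(mu \x lb2)%E]_z h F G z); split.
- move=> phi psi; have [M1 M10 s1] := slab_test phi; have [M2 M20 s2] := slab_test psi.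
  set M := M1 + M2; have M0 : 0 <= M by rewrite addr_ge0.
  have s1' : slab M (zero_extend phi) by apply: slab_le s1; rewrite // lerDl.
  have s2' : slab M (zero_extend psi) by apply: slab_le s2; rewrite // lerDr.
  have i12 := ih _ _ _ M0 s1' s2'.
  rewrite -(integral_EFin_Rintegral i12) -(integral12_prod_meas1 i12) /riesz_cov integral_half_line.
  apply: eq_integral_leb => r; rewrite /fubini_F /h /=.
  have ii := integrable_riesz b0k (slab_boxed r M0 s1') (slab_boxed r M0 s2').
  rewrite -(integral12_prod_meas1 ii) /fubini_F /=.
  case: ifPn => r0; last first.
    rewrite (eq_integral (cst 0%E)) ?integral0 // => u _.
    rewrite (eq_integral (cst 0%E)) ?integral0 // => v _.
    by rewrite /zero_extend /= (negbTE r0) !mul0r.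
  apply: eq_integral => u _; apply: eq_integral => v _.
  by rewrite /zero_extend /= r0 /riesz tn_subt.
- move=> M F G H a e M0 sF sG sH.
  rewrite -(Rintegral_lin a e (ih _ _ _ M0 sH sF) (ih _ _ _ M0 sH sG)).
  by apply: eq_Rintegral => z _; rewrite /h; ring.
- move=> M F G H a e M0 sF sG sH.
  rewrite -(Rintegral_lin a e (ih _ _ _ M0 sF sH) (ih _ _ _ M0 sG sH)).
  by apply: eq_Rintegral => z _; rewrite /h; ring.
- move=> M F M0 sF; have iF := ih _ _ _ M0 sF sF.
  rewrite -(integral_EFin_Rintegral iF) -(integral12_prod_meas1 iF).
  apply: integral_factor.
  + exact: riesz_c_gt0.
  + exact: (measurable_fubini_F iF).
  + by move=> r; apply: integral_ge0 => x _; rewrite lee_fin mulr_ge0 ?powR_ge0 // nfour2_ge0.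
  + move=> r; exact: (riesz_energy k0 b12 bk (slab_boxed r M0 sF)).
Qed.

(** Classically (2 pi)^-k, since [gauss_var] is 1/2 and [gauss_moment 0] is the square root of
    pi. *)
Definition white_c : R :=
  Num.sqrt (gauss_var / 2) ^+ k / (gauss_moment 0 ^+ k * gauss_moment 0 ^+ k).

Lemma white_c_gt0 : 0 < white_c.
Proof.
have gv := @gauss_var_gt0 R; have h2 : 0 < gauss_var / 2 :> R by lra.
have v0 : 0 < Num.sqrt (gauss_var / 2) :> R by rewrite sqrtr_gt0.
have g0 := @gauss_moment0_gt0 R.
exact: divr_gt0 (exprn_gt0 _ v0) (mulr_gt0 (exprn_gt0 _ g0) (exprn_gt0 _ g0)).
Qed.

Lemma white_isometry : k = 1%N -> spectral_isometry 1 white_c (@white_cov R k).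
Proof.
move=> k1.
pose h (F G : slabT) (z : MR * TR k) : R := F z * G z.
have ih M F G : 0 <= M -> slab M F -> slab M G -> itg (mu \x lb)%E (h F G).
  move=> M0 sF sG; have [mF bF _] := sF; have [mG bG _] := sG.
  apply: (integrable_prod_dom (measurable_funM mF mG) (integrable_normM (M * M) (integrable_window M))
    (@integrable_box R k M)) => r u; rewrite /h /= !normrM.
  have w0 : 0 <= window M r := indic_ge0 _ _; have w1 : window M r <= 1 := indic_le1 _ _.
  have i0 : 0 <= \1_(@box R k M) u :> R := indic_ge0 _ _; have i1 : \1_(@box R k M) u <= 1 :> R := indic_le1 _ _.
  rewrite (ger0_norm M0) (ger0_norm w0) (ger0_norm i0).
  rewrite (_ : M * M * _ * _ = (M * window M r * \1_(@box R k M) u) * M); last by ring.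
  apply: ler_pM => //; apply: (le_trans (bG r u)).
  by rewrite -mulrA ler_piMr // mulr_ile1.
have m0 : gauss_moment 0 ^+ k != 0 :> R by rewrite expf_neq0 // gt_eqF // gauss_moment0_gt0.
exists (fun F G => \int[(mu \x lb)%E]_z h F G z); split.
- move=> phi psi; have [M1 M10 s1] := slab_test phi; have [M2 M20 s2] := slab_test psi.
  set M := M1 + M2; have M0 : 0 <= M by rewrite addr_ge0.
  have s1' : slab M (zero_extend phi) by apply: slab_le s1; rewrite // lerDl.
  have s2' : slab M (zero_extend psi) by apply: slab_le s2; rewrite // lerDr.
  have i12 := ih _ _ _ M0 s1' s2'.
  rewrite -(integral_EFin_Rintegral i12) -(integral12_prod_meas1 i12) /white_cov integral_half_line.
  apply: eq_integral_leb => r; rewrite /fubini_F /h /=.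
  case: ifPn => r0; last first.
    rewrite (eq_integral (cst 0%E)) ?integral0 // => u _.
    by rewrite /zero_extend /= (negbTE r0) !mul0r.
  by apply: eq_integral => u _; rewrite /zero_extend /= r0.
- move=> M F G H a e M0 sF sG sH.
  rewrite -(Rintegral_lin a e (ih _ _ _ M0 sH sF) (ih _ _ _ M0 sH sG)).
  by apply: eq_Rintegral => z _; rewrite /h; ring.
- move=> M F G H a e M0 sF sG sH.
  rewrite -(Rintegral_lin a e (ih _ _ _ M0 sF sH) (ih _ _ _ M0 sG sH)).
  by apply: eq_Rintegral => z _; rewrite /h; ring.
- move=> M F M0 sF; have iF := ih _ _ _ M0 sF sF.
  rewrite -(integral_EFin_Rintegral iF) -(integral12_prod_meas1 iF).
  apply: integral_factor.
  + exact: white_c_gt0.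
  + exact: (measurable_fubini_F iF).
  + by move=> r; apply: integral_ge0 => x _; rewrite lee_fin mulr_ge0 ?powR_ge0 // nfour2_ge0.
  + move=> r; rewrite /fubini_F /h /=.
    have [_ _ cF] := sF.
    have := plancherel (slab_boxed r M0 sF) (cF r).
    set m := gauss_moment 0 ^+ k in m0 *; set c0 := Num.sqrt _ ^+ k => E.
    have mm : m * m != 0 by rewrite mulf_neq0.
    rewrite /white_c -/m -/c0 mulrC EFinM -muleA; apply: (canRL (f := fun x => (m * m)%:E * x)%E).
      by move=> x; rewrite muleA -EFinM mulVf // mul1e.
    transitivity ((m * m)%:E * \int[lb]_u (F (r, u) ^+ 2)%:E)%E.
      by congr (_ * _)%E; apply: eq_integral => u _; rewrite expr2.
    rewrite E; congr (_ * _)%E; apply: eq_integral => x _.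
    (* For k = 1 the spectral weight has exponent 0 and is 1 everywhere, including at frequency
       0. *)
    have -> : (1 - k%:R = 0 :> R)%R by rewrite k1 subrr.
    by rewrite powRr0 mul1r.
Qed.
End spectral_isometry.

(** * The spectral L2 space *)

Section spectral_space.
Context {R : realType} (k : nat) (b : R).
Local Notation mu := (@lebesgue_measure R).
Local Notation TR n := (n.-tuple (Borel R)).
Local Notation lb := (leb (R:=R) (n:=k)).
Local Notation MR := (Borel R).
Local Notation slabT := (MR * TR k -> R).
Implicit Types A B : slabT.

(** The integral is [fine] of the difference of the integrals of the positive and negative parts,
    each measurable by Tonelli. This gives joint measurability of Fourier transforms in time and
    frequency. *)
Lemma measurable_parametric d1 d2 (T1 : measurableType d1) (T2 : measurableType d2)
    (m : {sigma_finite_measure set T2 -> \bar R}) (H : T1 * T2 -> R) :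
  mbl H -> mbl (fun x => \int[m]_y H (x, y)).
Proof.
move=> mH; have mE : mbl (EFin \o H) by exact/measurable_EFinP.
apply: (measurableT_comp (f := fine) (g := fun x => \int[m]_y (H (x, y))%:E)%E).
  by mauto.
rewrite (_ : (fun x => _) = (fun x => \int[m]_y ((EFin \o H)^\+ (x, y)) - \int[m]_y ((EFin \o H)^\- (x, y)))%E); last first.
  by apply/funext => x; rewrite [LHS]integralE; congr (_ - _)%E; apply: eq_integral => y _; rewrite ?funeposE ?funenegE.
apply: emeasurable_funB.
  apply: (@measurable_fun_fubini_tonelli_F _ _ _ _ _ m (fun z => (EFin \o H)^\+ z)%E) => //.
  exact: measurable_funepos.
apply: (@measurable_fun_fubini_tonelli_F _ _ _ _ _ m (fun z => (EFin \o H)^\- z)%E) => //.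
exact: measurable_funeneg.
Qed.

(** Squared spectral norm of a complex integrand with real part [A] and imaginary part [- B],
    possibly infinite. *)
Definition N2 A B : \bar R :=
  (\int[mu]_r \int[lb]_x (tn x `^ (b - k%:R) * (A (r, x) ^+ 2 + B (r, x) ^+ 2))%:E)%E.

Definition FC (F : slabT) : slabT := fun z => fc (fun u => F (z.1, u)) z.2.
Definition FS (F : slabT) : slabT := fun z => fs (fun u => F (z.1, u)) z.2.

Lemma measurable_trig_slab (w : R -> R) (F : slabT) : mbl w -> mbl F ->
  mbl (fun z : MR * TR k => \int[lb]_u (w (dott z.2 u) * F (z.1, u))).
Proof.
move=> mw mF.
apply: (@measurable_parametric _ _ _ _ lb (fun q : (MR * TR k) * TR k => w (dott q.1.2 q.2) * F (q.1.1, q.2))).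
apply: measurable_funM.
  apply: (measurableT_comp mw).
  apply: (measurableT_comp (@measurable_dott_pair R k) (g := fun q : (MR * TR k) * TR k => (q.1.2, q.2))).
  by mauto.
by mauto.
Qed.

Lemma measurable_FC F : mbl F -> mbl (FC F).
Proof. by move=> mF; apply: (@measurable_trig_slab cos) => //; exact: measurable_fun_cos. Qed.

Lemma measurable_FS F : mbl F -> mbl (FS F).
Proof. by move=> mF; apply: (@measurable_trig_slab sin) => //; exact: measurable_fun_sin. Qed.

Lemma measurable_spectral_weight : mbl (fun z : MR * TR k => tn z.2 `^ (b - k%:R)).
Proof. by mauto. Qed.

Lemma measurable_N2_integrand A B : mbl A -> mbl B ->
  mbl (fun z : MR * TR k => (tn z.2 `^ (b - k%:R) * (A z ^+ 2 + B z ^+ 2))%:E).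
Proof.
move=> mA mB; apply/measurable_EFinP; apply: measurable_funM; first exact: measurable_spectral_weight.
by mauto.
Qed.

Lemma N2_integrand_ge0 A B (z : MR * TR k) : (0 <= (tn z.2 `^ (b - k%:R) * (A z ^+ 2 + B z ^+ 2))%:E)%E.
Proof. by rewrite lee_fin mulr_ge0 ?powR_ge0 // addr_ge0 // sqr_ge0. Qed.

Lemma N2_prod A B : mbl A -> mbl B ->
  N2 A B = (\int[(mu \x lb)%E]_z (tn z.2 `^ (b - k%:R) * (A z ^+ 2 + B z ^+ 2))%:E)%E.
Proof.
move=> mA mB; rewrite fubini_tonelli1 //; last exact: N2_integrand_ge0.
exact: measurable_N2_integrand.
Qed.

Lemma N2_ge0 A B : (0 <= N2 A B)%E.
Proof.
apply: integral_ge0 => r _; apply: integral_ge0 => x _; exact: (N2_integrand_ge0 A B (r, x)).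
Qed.

Lemma N2_le (A B A' B' A'' B'' : slabT) (p q : R) : 0 <= p -> 0 <= q ->
  mbl A -> mbl B -> mbl A' -> mbl B' ->
  mbl A'' -> mbl B'' ->
  (forall z, A z ^+ 2 <= p * A' z ^+ 2 + q * A'' z ^+ 2) ->
  (forall z, B z ^+ 2 <= p * B' z ^+ 2 + q * B'' z ^+ 2) ->
  (N2 A B <= p%:E * N2 A' B' + q%:E * N2 A'' B'')%E.
Proof.
move=> p0 q0 mA mB mA' mB' mA'' mB'' hA hB; rewrite !N2_prod //.
have m0 := measurable_N2_integrand mA mB; have m1 := measurable_N2_integrand mA' mB'.
have m2 := measurable_N2_integrand mA'' mB''.
rewrite -!ge0_integralZl_EFin //; last 2 first.
- by move=> z _; exact: N2_integrand_ge0.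
- by move=> z _; exact: N2_integrand_ge0.
rewrite -ge0_integralD //; last 4 first.
- by move=> z _; rewrite mule_ge0 // ?lee_fin //; exact: N2_integrand_ge0.
- by mauto.
- by move=> z _; rewrite mule_ge0 // ?lee_fin //; exact: N2_integrand_ge0.
- by mauto.
apply: ge0_le_integral => //.
- by move=> z _; exact: N2_integrand_ge0.
- by apply: emeasurable_funD; exact: measurable_funeM.
move=> z _; rewrite -!EFinM -EFinD lee_fin.
rewrite (_ : p * _ + q * _ = tn z.2 `^ (b - k%:R) * (p * A' z ^+ 2 + q * A'' z ^+ 2 + (p * B' z ^+ 2 + q * B'' z ^+ 2))); last by ring.
by rewrite ler_wpM2l ?powR_ge0 // lerD.
Qed.

Lemma eq_N2_sqr A B A' B' : (forall z, A z ^+ 2 = A' z ^+ 2) -> (forall z, B z ^+ 2 = B' z ^+ 2) ->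
  (N2 A B <= N2 A' B')%E.
Proof.
move=> hA hB; rewrite le_eqVlt; apply/orP; left; apply/eqP.
by apply: eq_integral_leb => r; apply: eq_integral => x _; rewrite hA hB.
Qed.

Lemma sqr_split (x y e : R) : 0 < e -> x ^+ 2 <= (1 + e) * y ^+ 2 + (1 + e^-1) * (x - y) ^+ 2.
Proof.
move=> e0; rewrite -subr_ge0 (_ : _ - _ = e^-1 * (e * y - (x - y)) ^+ 2); last by field; rewrite gt_eqF.
by rewrite mulr_ge0 ?sqr_ge0 // invr_ge0 ltW.
Qed.

Lemma N2_perturb A B A' B' (e a : R) : 0 < e ->
  mbl A -> mbl B -> mbl A' -> mbl B' ->
  (N2 (fun z => A z - A' z)%R (fun z => B z - B' z)%R <= (e ^+ 2)%:E)%E -> (N2 A' B' <= a%:E)%E ->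
  (N2 A B <= ((1 + e) * a + e ^+ 2 + e)%:E)%E.
Proof.
move=> e0 mA mB mA' mB' h1 h2; have ei : 0 < e^-1 by rewrite invr_gt0.
have mAA : mbl (fun z => A z - A' z) by mauto.
have mBB : mbl (fun z => B z - B' z) by mauto.
apply: (le_via ((1 + e)%:E * N2 A' B' + (1 + e^-1)%:E * N2 (fun z => A z - A' z)%R (fun z => B z - B' z)%R)%E).
  by apply: N2_le => //; [lra|lra|move=> z; exact: sqr_split|move=> z; exact: sqr_split].
apply: (le_via ((1 + e)%:E * a%:E + (1 + e^-1)%:E * (e ^+ 2)%:E)%E).
  by apply: leeD; apply: lee_wpmul2l; rewrite // lee_fin; lra.
rewrite -!EFinM -EFinD lee_fin; apply: le_of_eq; field.
by rewrite gt_eqF.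
Qed.

Lemma N2_step (a : R) A B A' B' :
  mbl A -> mbl B -> mbl A' -> mbl B' ->
  (N2 (fun z => a * A z + A' z)%R (fun z => a * B z + B' z)%R <=
   (2 * a ^+ 2)%:E * N2 A B + 2%:E * N2 A' B')%E.
Proof.
move=> mA mB mA' mB'; have a2 : 0 <= 2 * a ^+ 2 by rewrite mulr_ge0 // sqr_ge0.
apply: N2_le => //.
- by mauto.
- by mauto.
- by move=> z; have := sqr_ge0 (a * A z - A' z); rewrite !expr2; lra.
- by move=> z; have := sqr_ge0 (a * B z - B' z); rewrite !expr2; lra.
Qed.

Lemma spectral_norm2E F : spectral_norm2 b F = N2 (FC F) (FS F).
Proof. by []. Qed.

Lemma FC_lin M F G a c : 0 <= M -> slab M F -> slab M G ->
  FC (fun z => a * F z + c * G z) = (fun z => a * FC F z + c * FC G z).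
Proof.
move=> M0 sF sG; apply/funext => -[r x]; rewrite /FC /=.
have iF := integrable_fc x (integrable_boxed (slab_boxed r M0 sF)).
have iG := integrable_fc x (integrable_boxed (slab_boxed r M0 sG)).
rewrite /fc -(Rintegral_lin a c iF iG); apply: eq_Rintegral => u _; by ring.
Qed.

Lemma FS_lin M F G a c : 0 <= M -> slab M F -> slab M G ->
  FS (fun z => a * F z + c * G z) = (fun z => a * FS F z + c * FS G z).
Proof.
move=> M0 sF sG; apply/funext => -[r x]; rewrite /FS /=.
have iF := integrable_fs x (integrable_boxed (slab_boxed r M0 sF)).
have iG := integrable_fs x (integrable_boxed (slab_boxed r M0 sG)).
rewrite /fs -(Rintegral_lin a c iF iG); apply: eq_Rintegral => u _; by ring.
Qed.

Local Open Scope complex_scope.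

Definition re_part (G : R -> 'rV[R]_k -> R[i]) : slabT :=
  fun z => if 0 <= z.1 then complex.Re (G z.1 (to_row z.2)) else 0.
(** The sign matches [FS]: with the convention exp(- i xi.x), the imaginary part of a transform is
    minus its sine part. *)
Definition im_part (G : R -> 'rV[R]_k -> R[i]) : slabT :=
  fun z => if 0 <= z.1 then - complex.Im (G z.1 (to_row z.2)) else 0.

Lemma spectral_dist2E (phi : test_function R k) G :
  spectral_dist2 b phi G =
  N2 (fun z => FC (zero_extend phi) z - re_part G z)%R (fun z => FS (zero_extend phi) z - im_part G z)%R.
Proof.
rewrite /spectral_dist2 integral_half_line; apply: eq_integral_leb => r.
rewrite /re_part /im_part /=; case: ifPn => r0; last first.
  rewrite (eq_integral (cst 0%E)) ?integral0 // => x _.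
  have z0 (w : R -> R) : \int[lb]_u (w (dott x u) * 0) = 0.
    by under eq_Rintegral do rewrite mulr0; rewrite Rintegral_cst // mul0r.
  have h w : \int[lb]_u (w (dott x u) * zero_extend phi (r, u)) = 0.
    by rewrite -[RHS](z0 w); apply: eq_Rintegral => u _; rewrite /zero_extend /= (negbTE r0).
  by rewrite /FC /FS /fc /fs /= !h subrr expr0n /= addr0 mulr0.
apply: eq_integral => x _; congr (_ * _)%:E.
have -> : FC (zero_extend phi) (r, x) =
    fine (integral_Rk (fun y => (cos (dotp (to_row x) y) * phi (r, y))%:E)).
  by rewrite /FC /fc /Rintegral; congr fine; apply: eq_integral => u _; rewrite /zero_extend /= r0 dotp_to_row.
have -> : FS (zero_extend phi) (r, x) =
    fine (integral_Rk (fun y => (sin (dotp (to_row x) y) * phi (r, y))%:E)).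
  by rewrite /FS /fs /Rintegral; congr fine; apply: eq_integral => u _; rewrite /zero_extend /= r0 dotp_to_row.
rewrite /fourier; case: (G r (to_row x)) => g1 g2 /=.
set p := fine _; set q := fine _.
rewrite sqr_sqrtr; last by rewrite addr_ge0 // sqr_ge0.
by rewrite -(sqrrN (- q - g2)) opprD !opprK.
Qed.
End spectral_space.

Lemma le_of_small_excess (R : realType) (a b K : R) : 0 <= K ->
  (forall e, 0 < e <= 1 -> a <= b + e * K) -> a <= b.
Proof.
move=> K0 h; apply/ler_addgt0Pr => eps eps0.
pose e := Num.min 1 (eps / (1 + K)).
have K1 : 0 < 1 + K by lra.
have e0 : 0 < e by rewrite lt_min ltr01 divr_gt0.
apply: (le_trans (h e _)); first by rewrite e0 ge_min lexx.
rewrite lerD2l; have h1 : e <= eps / (1 + K) by rewrite ge_min lexx orbT.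
apply: (le_trans (ler_wpM2r K0 h1)); rewrite mulrAC ler_pdivrMr //.
by rewrite ler_wpM2l ?(ltW eps0) //; lra.
Qed.

Lemma eq_N2_le (R : realType) k (b : R) (A A' B B' : Borel R * k.-tuple (Borel R) -> R) x :
  (forall z, A z = A' z) -> (forall z, B z = B' z) -> (N2 b A B <= x)%E -> (N2 b A' B' <= x)%E.
Proof. by move=> /funext -> /funext ->. Qed.

Ltac mleaf ::= first [ tuple_leaf | (apply: measurable_FC; done) | (apply: measurable_FS; done)
  | exact: measurable_spectral_weight ].

Lemma eq_sum_In (R : realType) (S : Type) (L : seq S) (f g : S -> R) :
  (forall p, List.In p L -> f p = g p) -> \sum_(p <- L) f p = \sum_(p <- L) g p.
Proof.
elim: L => [|p L IH] h; first by rewrite !big_nil.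
by rewrite !big_cons h; [rewrite IH // => q hq; apply: h; right|left].
Qed.

(** * The Gaussian family of stochastic integrals and its isometry *)

Section stochastic_integrals.
Context {R : realType} (k d : nat) {disp : measure_display} {T : measurableType disp}.
Variable P : probability T R.
Variables (b c : R) (cov : test_function R k -> test_function R k -> \bar R).
Variable W : 'I_d -> test_function R k -> {RV P >-> R}.
Hypothesis noise : noise_with_covariance cov W.
Hypothesis c0 : 0 < c.
Hypothesis iso : spectral_isometry b c cov.
Variables (J : Type) (G : J -> R -> 'rV[R]_k -> R[i]) (X : 'I_d -> J -> T -> R).
Hypothesis mX : forall j p, mbl (X j p).
Hypothesis mre : forall p, mbl (re_part (G p)).
Hypothesis mim : forall p, mbl (im_part (G p)).
Hypothesis intX : forall j p, is_stochastic_integral b (W j) (G p) (X j p).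

Local Notation TR n := (n.-tuple (Borel R)).
Local Notation MR := (Borel R).
Local Notation slabT := (MR * TR k -> R).
Local Notation test := (test_function R k).
Local Notation idx := ('I_d * J)%type.
Local Notation tidx := ('I_d * test)%type.

Let XX (i : idx) : T -> R := X i.1 i.2.
Let WW (i : tidx) : T -> R := W i.1 i.2.
Definition zlist (L : seq (R * tidx)) : slabT := lin (fun i : tidx => zero_extend i.2) L.
Definition relist (L : seq (R * idx)) : slabT := lin (fun i : idx => re_part (G i.2)) L.
Definition imlist (L : seq (R * idx)) : slabT := lin (fun i : idx => im_part (G i.2)) L.

Let lin_cons (S U : Type) (Y : S -> U -> R) q L : lin Y (q :: L) = (fun x => q.1 * Y q.2 x + lin Y L x).
Proof. by apply/funext => x; rewrite /lin big_cons. Qed.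

Let lin_nil (S U : Type) (Y : S -> U -> R) : lin Y [::] = (fun x => 0).
Proof. by apply/funext => x; rewrite /lin big_nil. Qed.

Lemma measurable_lincomb (S : Type) d' (U : measurableType d') (Y : S -> U -> R) L :
  (forall i, mbl (Y i)) -> mbl (lin Y L).
Proof.
move=> mY; elim: L => [|q L IH]; first by rewrite lin_nil.
by rewrite lin_cons; apply: measurable_funD => //; exact: measurable_funM.
Qed.

Let mWW i : mbl (WW i).
Proof. by mauto. Qed.

Lemma slab_zlist L : exists2 M, 0 <= M & slab M (zlist L).
Proof.
elim: L => [|q L [M M0 sM]].
  exists 0 => //; rewrite /zlist lin_nil; split => //; last by move=> *; exact: cvg_cst.
  by move=> r u; rewrite normr0 !mul0r.
have [N N0 sN] := slab_test q.2.2.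
exists ((1 + `|q.1| + `|1|) * (N + M)).
  by rewrite mulr_ge0 ?addr_ge0.
rewrite /zlist lin_cons; have := slab_lin q.1 1 N0 M0 sN sM.
by congr slab; apply/funext => z; rewrite mul1r.
Qed.

Let E2 (Y : T -> R) : \bar R := (\int[P]_w (Y w ^+ 2)%:E)%E.

Let cvg0_small (u : nat -> \bar R) (e : R) : u @ \oo --> 0%E -> 0 < e -> \forall n \near \oo, (u n <= e%:E)%E.
Proof.
move=> /fine_cvgP[fin h] e0; near=> n.
have fn : u n \is a fin_num by near: n.
have : `|0 - fine (u n)| < e by near: n; move/cvgrPdist_lt : h => /(_ e e0).
rewrite sub0r normrN => hn; rewrite -(fineK fn) lee_fin; apply: le_trans (ltW hn); exact: ler_norm.
Unshelve. all: by end_near. Qed.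

Let EE (Y : {RV P >-> R}) : ('E_P[Y] = \int[P]_w (Y w)%:E)%E. Proof. exact: expectation_def. Qed.

Lemma stochastic_integral_approx j p (e : R) : 0 < e -> exists phi : test,
  (\int[P]_w ((X j p w - W j phi w) ^+ 2)%:E <= e%:E)%E /\
  (N2 b (fun z => FC (zero_extend phi) z - re_part (G p) z)%R (fun z => FS (zero_extend phi) z - im_part (G p) z)%R <= e%:E)%E.
Proof.
move=> e0; have [phi [h1 h2]] := intX j p.
have n1 := cvg0_small h1 e0; have n2 := cvg0_small h2 e0.
have [n [k1 k2]] : exists n, (spectral_dist2 b (phi n) (G p) <= e%:E)%E /\
    ('E_P[(fun w => (W j (phi n) w - X j p w) ^+ 2)%R] <= e%:E)%E.
  have [N _ hN] := filterI n1 n2; exists N; exact: (hN N (leqnn N)).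
exists (phi n); split; last by rewrite -spectral_dist2E.
move: k2; rewrite unlock /= => k2; apply: le_trans k2.
by apply: le_of_eq; apply: eq_integral => w _; rewrite -sqrrN opprB.
Qed.

Lemma square_step (a : R) (Y Z : T -> R) : mbl Y -> mbl Z ->
  (\int[P]_w ((a * Y w + Z w) ^+ 2)%:E <= (2 * a ^+ 2)%:E * E2 Y + 2%:E * E2 Z)%E.
Proof.
move=> mY mZ; have a2 : 0 <= 2 * a ^+ 2 by rewrite mulr_ge0 // sqr_ge0.
have mY2 : mbl (fun w => (Y w ^+ 2)%:E) by mauto.
have mZ2 : mbl (fun w => (Z w ^+ 2)%:E) by mauto.
have p0 (V : T -> R) w : setT w -> (0 <= (V w ^+ 2)%:E)%E by rewrite lee_fin sqr_ge0.
rewrite -!ge0_integralZl_EFin //; [|exact: p0|exact: p0].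
rewrite -ge0_integralD //; last 4 first.
- by move=> w _; rewrite mule_ge0 ?p0.
- by mauto.
- by move=> w _; rewrite mule_ge0 ?p0.
- by mauto.
apply: ge0_le_integral => //.
- by move=> w _; rewrite lee_fin sqr_ge0.
- by mauto.
- by apply: emeasurable_funD; exact: measurable_funeM.
move=> w _; rewrite -!EFinM -EFinD lee_fin.
by have := sqr_ge0 (a * Y w - Z w); rewrite !expr2; lra.
Qed.

(** The same test functions approximate in L2 of the probability space and in the spectral norm;
    this simultaneity transfers the isometry. The last clause keeps track of the noise components,
    whose covariances differ. *)
Lemma lin_approx (L : seq (R * idx)) (e : R) : 0 < e -> exists L' : seq (R * tidx),
  [/\ (\int[P]_w ((lin XX L w - lin WW L' w) ^+ 2)%:E <= e%:E)%E,
      (N2 b (fun z => FC (zlist L') z - relist L z)%R (fun z => FS (zlist L') z - imlist L z)%R <= e%:E)%E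
    & [seq q.2.1 | q <- L'] = [seq q.2.1 | q <- L]].
Proof.
elim: L e => [|q L IH] e e0.
  exists [::]; split => //.
    rewrite !lin_nil (eq_integral (cst 0%E)) ?integral0 ?lee_fin ?(ltW e0) // => w _.
    by rewrite subrr expr0n.
  have s0 : slab 0 (zlist [::] : slabT).
    rewrite /zlist lin_nil; split => //; last by move=> *; exact: cvg_cst.
    by move=> r u; rewrite normr0 !mul0r.
  have F0 : FC (zlist [::]) = (fun=> 0).
    have := FC_lin 0 0 (lexx 0) s0 s0; rewrite (_ : (fun z => 0 * _ + _) = zlist [::]).
      by move=> ->; apply/funext => z; rewrite !mul0r addr0.
    by apply/funext => z; rewrite /zlist lin_nil; ring.
  have S0 : FS (zlist [::]) = (fun=> 0).
    have := FS_lin 0 0 (lexx 0) s0 s0; rewrite (_ : (fun z => 0 * _ + _) = zlist [::]).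
      by move=> ->; apply/funext => z; rewrite !mul0r addr0.
    by apply/funext => z; rewrite /zlist lin_nil; ring.
  rewrite /N2 F0 S0 /relist /imlist !lin_nil (eq_integral (cst 0%E)) ?integral0 ?lee_fin ?(ltW e0) // => r _.
  by rewrite (eq_integral (cst 0%E)) ?integral0 // => x _; rewrite subrr expr0n /= addr0 mulr0.
case: q => a [j p].
(* With (a X + Y)^2 <= 2 a^2 X^2 + 2 Y^2, the new term receives at most e/2 and the rest 2 *
   (e/4). *)
pose d1 := e / (4 * (1 + a ^+ 2)).
have a2 := sqr_ge0 a; have d10 : 0 < d1 by rewrite divr_gt0 // mulr_gt0 //; lra.
have d1e : 2 * a ^+ 2 * d1 + 2 * (e / 4) <= e.
  have : d1 * (4 * (1 + a ^+ 2)) = e by rewrite divfK // gt_eqF // mulr_gt0 //; lra.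
  by lra.
have [phi [h1 h2]] := stochastic_integral_approx j p d10.
have e4 : 0 < e / 4 by rewrite divr_gt0.
have [L' [k1 k2 k3]] := IH _ e4.
have [M M0 sM] := slab_zlist L'; have [N N0 sN] := slab_test phi.
set K := M + N; have K0 : 0 <= K by rewrite addr_ge0.
have sM' : slab K (zlist L') by apply: slab_le sM => //; rewrite lerDl.
have sN' : slab K (zero_extend phi) by apply: slab_le sN => //; rewrite lerDr.
have bound (x y : \bar R) : (x <= d1%:E)%E -> (y <= (e / 4)%:E)%E ->
    ((2 * a ^+ 2)%:E * x + 2%:E * y <= e%:E)%E.
  move=> hx hy; apply: (le_via ((2 * a ^+ 2)%:E * d1%:E + 2%:E * (e / 4)%:E)%E).
    by apply: leeD; apply: lee_wpmul2l; rewrite // lee_fin mulr_ge0.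
  by rewrite -!EFinM -EFinD lee_fin.
exists ((a, (j, phi)) :: L'); split.
- apply: le_trans (bound _ _ h1 k1).
  have m1 : mbl (fun w => X j p w - W j phi w) by mauto.
  have m2 : mbl (fun w => lin XX L w - lin WW L' w).
    by apply: measurable_funB; apply: measurable_lincomb => // i; exact: mX.
  have := square_step a m1 m2; rewrite /E2; apply: le_trans.
  apply: le_of_eq; apply: eq_integral => w _.
  by rewrite !lin_cons /= /XX /WW /=; congr (_ ^+ 2)%:E; ring.
- have mz1 := slab_measurable sN'; have mz2 := slab_measurable sM'.
  have m1 := measurable_funB (measurable_FC mz1) (mre p).
  have m2 := measurable_funB (measurable_FS mz1) (mim p).
  have m3 : mbl (fun z => FC (zlist L') z - relist L z).
    by apply: measurable_funB; [exact: measurable_FC|apply: measurable_lincomb => i; exact: mre].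
  have m4 : mbl (fun z => FS (zlist L') z - imlist L z).
    by apply: measurable_funB; [exact: measurable_FS|apply: measurable_lincomb => i; exact: mim].
  have step := le_trans (N2_step b a m1 m2 m3 m4) (bound _ _ h2 k2).
  have zE : zlist ((a, (j, phi)) :: L') = (fun z => a * zero_extend phi z + 1 * zlist L' z).
    by rewrite /zlist lin_cons; apply/funext => z; rewrite mul1r.
  have alg (x y z t : R) : a * (x - z) + (y - t) = a * x + 1 * y - (a * z + t) by ring.
  apply: (eq_N2_le _ _ step) => z.
    by rewrite zE (FC_lin a 1 K0 sN' sM') /relist [lin _ (_ :: _)]lin_cons; exact: alg.
  by rewrite zE (FS_lin a 1 K0 sN' sM') /imlist [lin _ (_ :: _)]lin_cons; exact: alg.
- by rewrite /= k3.
Qed.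

Lemma lin_noise_like (L : seq (R * tidx)) : exists v, gauss_like P (lin WW L) v.
Proof.
have [gW _] := noise; apply: centered_gaussian_like; first exact: measurable_lincomb.
exact: gW.
Qed.

Lemma lin_field_like (L : seq (R * idx)) : exists v, gauss_like P (lin XX L) v.
Proof.
apply: gauss_like_limit; first by apply: measurable_lincomb => i; exact: mX.
move=> e e0; have [L' [h _ _]] := lin_approx L (exprn_gt0 2 e0).
have [v gv] := lin_noise_like L'; exists (lin WW L'), v; split => //.
by move: h; congr (_ <= _)%E; apply: eq_integral => w _; rewrite -sqrrN opprB.
Qed.

Definition field_gram (i i' : idx) : R := \int[P]_w (X i.1 i.2 w * X i'.1 i'.2 w).

Lemma field_gaussian : gaussian P (fun i : idx => X i.1 i.2) field_gram.
Proof. exact: gauss_like_family lin_field_like. Qed.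
Lemma covariance_zlist C (L L' : seq (R * tidx)) :
  (forall M F G H a e, 0 <= M -> slab M F -> slab M G -> slab M H ->
     C (fun z => a * F z + e * G z) H = a * C F H + e * C G H) ->
  (forall M F G H a e, 0 <= M -> slab M F -> slab M G -> slab M H ->
     C H (fun z => a * F z + e * G z) = a * C H F + e * C H G) ->
  C (zlist L) (zlist L') =
    \sum_(p <- L) \sum_(q <- L') p.1 * q.1 * C (zero_extend p.2.2) (zero_extend q.2.2) :> R.
Proof.
move=> Cl Cr.
have nilE : zlist ([::] : seq (R * tidx)) = (fun z => 0) :> (Borel R * k.-tuple (Borel R) -> R).
  by apply/funext => z; rewrite /zlist /lin big_nil.
have consE (q : R * tidx) (s : seq (R * tidx)) : zlist (q :: s) = (fun z => q.1 * zero_extend q.2.2 z + 1 * zlist s z).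
  by apply/funext => z; rewrite /zlist /lin big_cons mul1r.
have z0E : (fun z => 0) = (fun z => 0 * (zlist ([::] : seq (R * tidx)) : Borel R * k.-tuple (Borel R) -> R) z + 0 * zlist ([::] : seq (R * tidx)) z).
  by apply/funext => z; rewrite !mul0r addr0.
have [N0 N00 sN0] := slab_zlist ([::] : seq (R * tidx)).
have right (H : test) (s : seq (R * tidx)) :
    C (zero_extend H) (zlist s) = \sum_(q <- s) q.1 * C (zero_extend H) (zero_extend q.2.2).
  have [M1 M10 s1] := slab_test H.
  elim: s => [|q s IH].
    rewrite big_nil nilE z0E (Cr (M1 + N0)) ?mul0r ?addr0 ?addr_ge0 //.
    - by apply: slab_le sN0 => //; rewrite lerDr.
    - by apply: slab_le sN0 => //; rewrite lerDr.
    - by apply: slab_le s1 => //; rewrite lerDl.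
  have [M2 M20 s2] := slab_test q.2.2; have [M3 M30 s3] := slab_zlist s.
  rewrite big_cons consE (Cr (M1 + M2 + M3)) ?addr_ge0 ?IH ?mul1r //.
  - by apply: slab_le s2 => //; rewrite addrAC lerDr addr_ge0.
  - by apply: slab_le s3 => //; rewrite lerDr addr_ge0.
  - by apply: slab_le s1 => //; rewrite -addrA lerDl addr_ge0.
have [M1 M10 s1] := slab_zlist L'.
elim: L => [|p s IH].
  rewrite big_nil nilE z0E (Cl (M1 + N0)) ?mul0r ?addr0 ?addr_ge0 //.
  - by apply: slab_le sN0 => //; rewrite lerDr.
  - by apply: slab_le sN0 => //; rewrite lerDr.
  - by apply: slab_le s1 => //; rewrite lerDl.
have [M2 M20 s2] := slab_test p.2.2; have [M3 M30 s3] := slab_zlist s.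
rewrite big_cons consE (Cl (M1 + M2 + M3)) ?addr_ge0 ?IH ?mul1r //.
- congr (_ + _); rewrite right mulr_sumr; apply: eq_bigr => q _; by rewrite mulrA.
- by apply: slab_le s2 => //; rewrite addrAC lerDr addr_ge0.
- by apply: slab_le s3 => //; rewrite lerDr addr_ge0.
- by apply: slab_le s1 => //; rewrite -addrA lerDl addr_ge0.
Qed.

(** Within one component the second moment is the bilinear form [C] at the combined slab, hence c
    times its spectral norm. *)
Lemma noise_second_moment (j : 'I_d) (L : seq (R * tidx)) : (forall q, List.In q L -> q.2.1 = j) ->
  (E2 (lin WW L) = c%:E * N2 b (FC (zlist L)) (FS (zlist L)))%E.
Proof.
move=> Lj; have [C [CE Cr Cl Cn]] := iso.
have [M M0 sM] := slab_zlist L; rewrite -spectral_norm2E -(Cn _ _ M0 sM) covariance_zlist //.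
have hW L' : exists v, gauss_like P (lin WW L') v by exact: lin_noise_like L'.
have [v gv] := hW L.
have -> : E2 (lin WW L) = (\int[P]_w (lin WW L w ^+ 2))%:E by rewrite /Rintegral /E2 (gl_var gv).
rewrite gauss_like_second_moment //; congr _%:E; rewrite /bil.
have [_ hc] := noise.
have gram p q : List.In p L -> List.In q L ->
    \int[P]_w (WW p.2 w * WW q.2 w) = C (zero_extend p.2.2) (zero_extend q.2.2).
  move=> /Lj pj /Lj qj; have := hc p.2.1 q.2.1 p.2.2 q.2.2; rewrite pj qj eqxx CE unlock => h.
  by rewrite /Rintegral /WW pj qj h.
by apply: eq_sum_In => p hp; apply: eq_sum_In => q hq; rewrite gram.
Qed.

Definition on_component (j : 'I_d) (L : seq (R * J)) : seq (R * idx) := [seq (q.1, (j, q.2)) | q <- L].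

Lemma lin_on_component j L w : lin XX (on_component j L) w = lin (X j) L w.
Proof. by rewrite /lin big_map. Qed.

(** The second moment and the spectral norm are each compared with those of approximating test
    functions, up to factors 1 + e and errors of order e; letting e tend to 0 gives equality. The
    real [a] also records finiteness. *)
Lemma field_isometry j (L : seq (R * J)) : exists a : R,
  N2 b (lin (fun p => re_part (G p)) L) (lin (fun p => im_part (G p)) L) = a%:E /\
  (\int[P]_w (lin (X j) L w ^+ 2)%:E = (c * a)%:E)%E.
Proof.
have mXX i : mbl (XX i) by exact: mX.
have [v gv] := lin_field_like (on_component j L).
have v0 := gl_ge0 gv; have mS := gl_measurable gv.
have vE : (E2 (lin (X j) L) = v%:E)%E.
  by rewrite /E2 -(gl_var gv); apply: eq_integral => w _; rewrite lin_on_component.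
set A := lin _ L; set B := lin _ L.
have AE : A = relist (on_component j L) by apply/funext => z; rewrite /A /relist /lin big_map.
have BE : B = imlist (on_component j L) by apply/funext => z; rewrite /B /imlist /lin big_map.
have mA : mbl A by exact: measurable_lincomb.
have mB : mbl B by exact: measurable_lincomb.
have close e : 0 < e -> exists y : R, [/\ 0 <= y,
    v <= (1 + e) * (c * y) + e ^+ 2 + e, c * y <= (1 + e) * v + e ^+ 2 + e,
    (N2 b A B <= ((1 + e) * y + e ^+ 2 + e)%:E)%E &
    forall a, N2 b A B = a%:E -> y <= (1 + e) * a + e ^+ 2 + e].
  move=> e0; have [L' [h1 h2 h3]] := lin_approx (on_component j L) (exprn_gt0 2 e0).
  have L'j : forall q, List.In q L' -> q.2.1 = j.
    have all_j : all (fun l => l == j) [seq q.2.1 | q <- L'].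
      by rewrite h3 /on_component; elim: (L) => //= q s ->; rewrite eqxx.
    elim: L' all_j {h1 h2 h3} => [|q L' IH] //= /andP[/eqP qj hL'] q' [<-//|]; exact: IH.
  have [x gx] := lin_noise_like L'; have x0 := gl_ge0 gx.
  have xE := gl_var gx.
  have := noise_second_moment L'j; rewrite /E2 xE => NE.
  have [M M0 sM] := slab_zlist L'; have mz := slab_measurable sM.
  have mFC := measurable_FC mz; have mFS := measurable_FS mz.
  have yE : N2 b (FC (zlist L')) (FS (zlist L')) = (x / c)%:E.
    have := NE => /(congr1 (fun t => (c^-1)%:E * t)%E).
    by rewrite muleA -!EFinM mulVf ?gt_eqF // mul1e mulrC.
  have cy : c * (x / c) = x by rewrite mulrC divfK // gt_eqF.
  have swap (Y Z : T -> R) : (\int[P]_w ((Y w - Z w) ^+ 2)%:E = \int[P]_w ((Z w - Y w) ^+ 2)%:E)%E.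
    by apply: eq_integral => w _; rewrite -sqrrN opprB.
  exists (x / c); rewrite cy; split.
  - by rewrite divr_ge0 // ltW.
  - rewrite -lee_fin -(gl_var gv); apply: (sqr_perturb mS (gl_measurable gx) e0 h1).
    by rewrite xE.
  - rewrite -lee_fin -xE; apply: (sqr_perturb (gl_measurable gx) mS e0).
      by rewrite swap.
    by rewrite (gl_var gv).
  - have key := @N2_perturb R k b A B (FC (zlist L')) (FS (zlist L')) e (x / c) e0 mA mB mFC mFS.
    apply: key; last by rewrite yE.
    rewrite AE BE; apply: le_trans h2.
    by apply: eq_N2_sqr => z; rewrite -sqrrN opprB.
  - move=> a aE; rewrite -lee_fin -yE.
    have key := @N2_perturb R k b (FC (zlist L')) (FS (zlist L')) A B e a e0 mFC mFS mA mB.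
    apply: key; last by rewrite aE.
    by rewrite AE BE.
have [y1 [_ _ _ hN _]] := close 1 ltr01.
have Nfin : N2 b A B \is a fin_num by rewrite ge0_fin_numE ?N2_ge0 // (le_lt_trans hN) // ltry.
have a0 : 0 <= fine (N2 b A B) by rewrite fine_ge0 // N2_ge0.
set a := fine (N2 b A B) in a0; have aE : N2 b A B = a%:E by rewrite fineK.
exists a; split => //; rewrite -/(E2 _) vE; congr _%:E; apply/le_anti/andP; split.
  apply: (@le_of_small_excess _ _ _ (3 * (c * a) + 4 * c + 2)).
    by have := mulr_ge0 (ltW c0) a0; have := ltW c0; lra.
  move=> e /andP[e0 e1]; have [y [y0 h1 _ _ h4]] := close e e0.
  have h5 := h4 a aE; have ee : e ^+ 2 <= e by rewrite expr2 ler_piMl // ltW.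
  have ca0 := mulr_ge0 (ltW c0) a0.
  have h6 : c * y <= c * ((1 + e) * a + 2 * e) by rewrite ler_wpM2l ?(ltW c0) //; lra.
  have h7 : (1 + e) * (c * y) <= (1 + e) * (c * ((1 + e) * a + 2 * e)) by rewrite ler_wpM2l //; lra.
  apply: (le_trans h1); apply: (le_via ((1 + e) * (c * ((1 + e) * a + 2 * e)) + 2 * e)); first by lra.
  rewrite (_ : (1 + e) * _ = c * a + 2 * (e * (c * a)) + e ^+ 2 * (c * a) + 2 * (e * c) + 2 * (e ^+ 2 * c)); last by ring.
  have q1 : e ^+ 2 * (c * a) <= e * (c * a) by rewrite ler_wpM2r.
  have q2 : e ^+ 2 * c <= e * c by rewrite ler_wpM2r // ltW.
  by rewrite mulrDr mulrDr; lra.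
apply: (@le_of_small_excess _ _ _ (3 * v + 4 * c + 4)); first by have := ltW c0; lra.
move=> e /andP[e0 e1]; have [y [y0 _ h2 h3 _]] := close e e0.
rewrite aE lee_fin in h3; have ee : e ^+ 2 <= e by rewrite expr2 ler_piMl // ltW.
have h6 : c * a <= (1 + e) * (c * y) + 2 * (e * c).
  apply: (le_via (c * ((1 + e) * y + 2 * e))); first by rewrite ler_wpM2l ?(ltW c0) //; lra.
  by apply: le_of_eq; ring.
have h7 : (1 + e) * (c * y) <= (1 + e) * ((1 + e) * v + 2 * e) by rewrite ler_wpM2l //; lra.
have q0 : (1 + e) * ((1 + e) * v + 2 * e) = v + 2 * (e * v) + e ^+ 2 * v + 2 * e + 2 * e ^+ 2 by ring.
have q1 : e ^+ 2 * v <= e * v by rewrite ler_wpM2r.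
have q2 := ltW c0; have q3 := mulr_ge0 (ltW e0) q2; have q4 := mulr_ge0 (ltW e0) v0.
by rewrite mulrDr mulrDr; lra.
Qed.
End stochastic_integrals.

(** * Spectral size of increments of the wave kernel *)

Section wave_kernel_bounds.
Context {R : realType} (k : nat) (b : R).
Hypothesis k0 : (0 < k)%N.
Hypothesis b1 : 1 <= b.
Hypothesis b2 : b < 2.
Hypothesis bk : b <= k%:R.
Local Notation mu := (@lebesgue_measure R).
Local Notation TR n := (n.-tuple (Borel R)).
Local Notation lb := (leb (R:=R) (n:=k)).
Local Notation MR := (Borel R).
Local Notation slabT := (MR * TR k -> R).

Definition wave_re (t : R) (x : 'rV[R]_k) : slabT := fun z =>
  if (0 <= z.1) && (z.1 < t) then cos (dotp (to_row z.2) x) * (sin ((t - z.1) * tn z.2) / tn z.2) else 0.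
Definition wave_im (t : R) (x : 'rV[R]_k) : slabT := fun z =>
  if (0 <= z.1) && (z.1 < t) then sin (dotp (to_row z.2) x) * (sin ((t - z.1) * tn z.2) / tn z.2) else 0.

Lemma re_part_wave t x : re_part (wave_integrand t x) = wave_re t x.
Proof.
apply/funext => -[r u]; rewrite /re_part /wave_re /wave_integrand /=.
case: (0 <= r) => //=; case: (r < t) => //=.
by rewrite /wave_fourier mulr0 subr0.
Qed.

Lemma im_part_wave t x : im_part (wave_integrand t x) = wave_im t x.
Proof.
apply/funext => -[r u]; rewrite /im_part /wave_im /wave_integrand /=.
case: (0 <= r) => //=; case: (r < t) => //=; last by rewrite oppr0.
by rewrite /wave_fourier mulr0 add0r mulNr opprK.
Qed.

Lemma measurable_wave (w : R -> R) t (x : 'rV[R]_k) : mbl w ->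
  mbl (fun z : MR * TR k =>
    if (0 <= z.1) && (z.1 < t) then w (dotp (to_row z.2) x) * (sin ((t - z.1) * tn z.2) / tn z.2) else 0).
Proof.
move=> mw.
have m1 : mbl (fun z : MR * TR k => z.1 : R) by mauto.
have mt : mbl (fun z : MR * TR k => tn z.2) by mauto.
have md : mbl (fun z : MR * TR k => dotp (to_row z.2) x).
  apply: (measurableT_comp (f := fun u : TR k => dotp (to_row u) x)) => //.
  rewrite (_ : (fun u => _) = fun u : TR k => \sum_(i < k) tnth u i * x 0 i); last first.
    by apply/funext => u; apply: eq_bigr => i _; rewrite mxE.
  by apply: measurable_sum => i; apply: measurable_funM => //; exact: measurable_tnth.
apply: measurable_fun_ifT => //; first by apply: measurable_and; [exact: measurable_fun_ler|exact: measurable_fun_ltr].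
apply: measurable_funM; first exact: (measurableT_comp mw).
apply: measurable_funM; last exact: measurable_funV.
by mauto.
Qed.

Lemma measurable_wave_re t x : mbl (wave_re t x).
Proof. by apply: measurable_wave; exact: measurable_fun_cos. Qed.

Lemma measurable_wave_im t x : mbl (wave_im t x).
Proof. by apply: measurable_wave; exact: measurable_fun_sin. Qed.

Lemma strip_integral (lo hi : R) (H : TR k -> R) : lo <= hi -> mbl H -> (forall u, 0 <= H u) ->
  (\int[mu]_r \int[lb]_u ((if ((lo <= r) && (r <= hi))%R then 1 else 0) * H u)%:E = (hi - lo)%:E * \int[lb]_u (H u)%:E)%E.
Proof.
move=> lohi mH H0; have mHE : mbl (fun u => (H u)%:E) by exact/measurable_EFinP.
have I0 : (0 <= \int[lb]_u (H u)%:E)%E by apply: integral_ge0 => u _; rewrite lee_fin.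
rewrite (@eq_integral_leb _ _ (fun r => \int[lb]_u (H u)%:E * (\1_`[lo, hi]%classic r)%:E)%E); last first.
  move=> r; rewrite indicE; case: ifPn => hr.
    rewrite mem_set ?mule1; last by rewrite /= in_itv.
    by apply: eq_integral => u _; rewrite mul1r.
  rewrite memNset ?mule0; last by rewrite /= in_itv /=; exact/negP.
  by rewrite (eq_integral (cst 0%E)) ?integral0 // => u _; rewrite mul0r.
rewrite ge0_integralZl //; last by apply/measurable_EFinP; exact: measurable_indic.
rewrite integral_indic //= setIT lebesgue_measure_itv /= lte_fin muleC.
case: ltP => h; first by rewrite -EFinD.
by have -> : lo = hi by [apply/le_anti; rewrite lohi h]; rewrite subrr.
Qed.

Lemma N2_strip_le (A B : slabT) (tau : R) (H : TR k -> R) : 0 <= tau ->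
  mbl A -> mbl B -> mbl H -> (forall u, 0 <= H u) ->
  (forall r u, tn u `^ (b - k%:R) * (A (r, u) ^+ 2 + B (r, u) ^+ 2) <= (if (0 <= r) && (r <= tau) then 1 else 0) * H u) ->
  (N2 b A B <= tau%:E * \int[lb]_u (H u)%:E)%E.
Proof.
move=> tau0 mA mB mH H0 h; rewrite -[X in (X%:E * _)%E](subr0 tau) -strip_integral //.
have mI : mbl (fun z : MR * TR k => ((if ((0 <= z.1) && (z.1 <= tau))%R then 1 else 0) * H z.2)%:E).
  have m1 : mbl (fun z : MR * TR k => z.1 : R) by mauto.
  apply/measurable_EFinP; apply: measurable_funM; last exact: (measurableT_comp mH).
  by apply: measurable_fun_ifT => //; apply: measurable_and; exact: measurable_fun_ler.
have i0 (r : R) : 0 <= (if (0 <= r) && (r <= tau) then 1 else 0) :> R by case: ifP.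
have mN := measurable_N2_integrand b mA mB.
apply: ge0_le_integral => //.
- by move=> r _; apply: integral_ge0 => u _; exact: (N2_integrand_ge0 b A B (r, u)).
- exact: (@measurable_fun_fubini_tonelli_F _ _ _ _ _ lb _ mN (N2_integrand_ge0 b A B)).
- by apply: (@measurable_fun_fubini_tonelli_F _ _ _ _ _ lb _ mI) => z; rewrite lee_fin mulr_ge0.
move=> r _; apply: ge0_le_integral => //.
- by move=> u _; exact: (N2_integrand_ge0 b A B (r, u)).
- exact: (measurable_fun_pair2 r mN).
- by mauto.
by move=> u _; rewrite lee_fin.
Qed.

(** Variation of a sine or cosine when the argument moves by [a]: at most [a] by the Lipschitz
    bound, at most 2 in any case. *)
Definition cut (a : R) : R := Num.min 2 a.

Lemma cut_trig (w : R -> R) p q a : (forall x, `|w x| <= 1) -> (forall x y, `|w x - w y| <= `|x - y|) ->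
  `|p - q| <= a -> `|w p - w q| <= cut a.
Proof.
move=> w1 wl h; rewrite /cut le_min; apply/andP; split; last exact: le_trans (wl _ _) h.
by apply: (le_trans (ler_normB _ _)); rewrite -[2]/(1 + 1); exact: lerD.
Qed.

Lemma cut_ge0 a : 0 <= a -> 0 <= cut a. Proof. by move=> h; rewrite le_min h ler0n. Qed.

Lemma cut_powR a th : 0 <= a -> 0 < th <= 1 -> cut a <= 2 * a `^ th.
Proof.
move=> a0 /andP[th0 th1]; have [->|aN0] := eqVneq a 0.
  by apply: (le_via 0); [rewrite /cut ge_min lexx orbT|rewrite mulr_ge0 ?powR_ge0].
have ap : 0 < a by rewrite lt_def aN0.
have p0 := powR_ge0 a th.
have [a1|a1] := leP a 1.
  have h : a <= a `^ th by rewrite -[leLHS](powRr1 a0); apply: ger_powR => //; rewrite ap.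
  by apply: (le_via a); [rewrite /cut ge_min lexx orbT|lra].
have h : 1 <= a `^ th by rewrite -[leLHS](powRr0 a); apply: ler_powR; exact: ltW.
by apply: (le_via 2); [rewrite /cut ge_min lexx|lra].
Qed.

Ltac mleaf ::= first [ tuple_leaf | (apply: measurable_FC; done) | (apply: measurable_FS; done)
  | exact: measurable_spectral_weight
  | exact: measurable_wave_re | exact: measurable_wave_im ].

Section two_points.
Variables (tau eta t s : R) (x y : 'rV[R]_k).
Hypothesis t0 : 0 <= t <= tau.
Hypothesis s0 : 0 <= s <= tau.
Hypothesis ts : `|t - s| <= eta.
Hypothesis xy : forall u : TR k, `|dotp (to_row u) x - dotp (to_row u) y| <= tn u * eta.

(** If both kernels are active at time [r], the phase and the sine vary separately, hence the factor
    2. If only one is, [r] lies between the two end times, so the remaining time is at most [eta]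
    and the kernel itself is small. *)
Lemma wave_diff (w : R -> R) r (u : TR k) : (forall x, `|w x| <= 1) -> (forall x y, `|w x - w y| <= `|x - y|) ->
  `| (if (0 <= r) && (r < t) then w (dotp (to_row u) x) * (sin ((t - r) * tn u) / tn u) else 0)
   - (if (0 <= r) && (r < s) then w (dotp (to_row u) y) * (sin ((s - r) * tn u) / tn u) else 0) | <=
  (if (0 <= r) && (r <= tau) then 1 else 0) * (2 * (cut (eta * tn u) / tn u)).
Proof.
move=> w1 wl; have u0 := tn_ge0 u.
have eta0 : 0 <= eta by exact: le_trans (normr_ge0 _) ts.
have e0 : 0 <= eta * tn u by rewrite mulr_ge0.
have c0 := cut_ge0 e0.
have [r0|r0] := boolP (0 <= r); last by rewrite /= subr0 normr0 mul0r.
rewrite !andTb; have [tu0|tuN0] := eqVneq (tn u) 0.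
  have z (p : R) : p / tn u = 0 by rewrite tu0 invr0 mulr0.
  by rewrite !z !mulr0 !if_same subr0 normr0.
have u1 : 0 < tn u by rewrite lt_def tuN0.
have single (a p : R) : `|p * tn u| <= eta * tn u -> `|w a * (sin (p * tn u) / tn u)| <= 2 * (cut (eta * tn u) / tn u).
  move=> hp; rewrite mulrA normrM normfV (gtr0_norm u1) mulrA ler_pM2r ?invr_gt0 // normrM.
  have sp : `|sin (p * tn u)| <= cut (eta * tn u).
    rewrite /cut le_min; apply/andP; split; last exact: le_trans (sin_le_norm _) hp.
    by apply: (le_trans (sin_max _)); rewrite ler1n.
  apply: (le_via (1 * cut (eta * tn u))); first by apply: ler_pM.
  by rewrite ler_wpM2r // ler1n.
have [rt|rt] := ltP r t; have [rs|rs] := ltP r s.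
- have -> : r <= tau by have /andP[_] := t0; apply: le_trans; exact: ltW.
  rewrite mul1r; set cp := w _; set cq := w _; set sp := sin _; set sq := sin _.
  rewrite (_ : _ - _ = (cp * (sp - sq) + (cp - cq) * sq) / tn u); last by field.
  rewrite normrM normfV (gtr0_norm u1) mulrA ler_pM2r ?invr_gt0 //.
  apply: (le_trans (ler_normD _ _)); rewrite !normrM (_ : 2 * _ = 1 * cut (eta * tn u) + cut (eta * tn u) * 1); last by ring.
  apply: lerD; apply: ler_pM; rewrite ?normr_ge0 //.
  - exact: w1.
  - apply: cut_trig; [exact: sin_max|exact: sin_lipschitz|].
    by rewrite -mulrBl opprB addrA subrK normrM (ger0_norm u0) ler_wpM2r.
  - by apply: cut_trig => //; apply: (le_trans (xy u)); rewrite mulrC.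
  - exact: sin_max.
- have -> : r <= tau by have /andP[_] := t0; apply: le_trans; exact: ltW.
  rewrite mul1r subr0; apply: single; rewrite normrM (ger0_norm u0) ler_wpM2r //.
  rewrite ger0_norm ?subr_ge0 ?(ltW rt) //; apply: le_trans ts.
  by apply: le_trans (ler_norm _); rewrite lerD2l lerN2.
- have -> : r <= tau by have /andP[_] := s0; apply: le_trans; exact: ltW.
  rewrite mul1r sub0r normrN; apply: single; rewrite normrM (ger0_norm u0) ler_wpM2r //.
  rewrite ger0_norm ?subr_ge0 ?(ltW rs) //; apply: le_trans ts.
  rewrite distrC; by apply: le_trans (ler_norm _); rewrite lerD2l lerN2.
- rewrite subr0 normr0 mulr_ge0 //; first by case: ifP.
  by rewrite mulr_ge0 // divr_ge0.
Qed.

Lemma wave_re_diff r u : `|wave_re t x (r, u) - wave_re s y (r, u)| <=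
  (if (0 <= r) && (r <= tau) then 1 else 0) * (2 * (cut (eta * tn u) / tn u)).
Proof. by apply: wave_diff; [exact: cos_max|exact: cos_lipschitz]. Qed.

Lemma wave_im_diff r u : `|wave_im t x (r, u) - wave_im s y (r, u)| <=
  (if (0 <= r) && (r <= tau) then 1 else 0) * (2 * (cut (eta * tn u) / tn u)).
Proof. by apply: wave_diff; [exact: sin_max|exact: sin_lipschitz]. Qed.
End two_points.

Definition incr_profile (eta : R) (u : TR k) : R := tn u `^ (b - k%:R) * (cut (eta * tn u) / tn u) ^+ 2.

Lemma measurable_cut (f : TR k -> R) : mbl f -> mbl (fun u => cut (f u)).
Proof. by move=> mf; apply: measurable_minr. Qed.

Lemma measurable_incr_profile eta : mbl (incr_profile eta).
Proof.
have mt := @measurable_tn R k.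
apply: measurable_funM; first exact: measurable_fun_powR.
apply: measurable_funX; apply: measurable_funM; last exact: measurable_funV.
by apply: measurable_cut; exact: measurable_funM.
Qed.

Lemma incr_profile_ge0 eta u : 0 <= incr_profile eta u.
Proof. by rewrite mulr_ge0 ?powR_ge0 ?sqr_ge0. Qed.

(** Homogeneity under u |-> eta u. The power 2 - b is twice the Hoelder exponent of the solution. *)
Lemma incr_profile_scale eta : 0 < eta ->
  (\int[lb]_u (incr_profile eta u)%:E = (eta `^ (2 - b))%:E * \int[lb]_u (incr_profile 1 u)%:E)%E.
Proof.
move=> eta0; have mP : mbl (fun u => (incr_profile 1 u)%:E).
  by apply/measurable_EFinP; exact: measurable_incr_profile.
have P0 u : (0 <= (incr_profile 1 u)%:E)%E by rewrite lee_fin incr_profile_ge0.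
have := ge0_integral_scale eta0 mP P0.
have etaN : eta != 0 by rewrite gt_eqF.
have pN a : eta `^ a != 0 by rewrite gt_eqF // powR_gt0.
have -> : (\int[lb]_u (incr_profile eta u)%:E =
    (eta `^ (k%:R + 2 - b))%:E * \int[lb]_u (incr_profile 1 (scale_tuple eta u))%:E)%E.
  rewrite -ge0_integralZl_EFin ?powR_ge0 //; last first.
    by apply: (measurableT_comp mP); exact: measurable_scale_tuple.
  apply: eq_integral => u _; rewrite -EFinM /incr_profile tn_scale ?(ltW eta0) // mul1r; congr _%:E.
  rewrite powRM ?(ltW eta0) ?tn_ge0 // !expr_div_n [(eta * tn u) ^+ 2]exprMn.
  have -> : k%:R + 2 - b = - (b - k%:R) + 2 by ring.
  rewrite (@powRD _ eta (- (b - k%:R)) 2) ?etaN ?implybT // powRN powR_mulrn ?(ltW eta0) //.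
  have [->|tN] := eqVneq (tn u) 0; first by rewrite [0 ^+ 2]expr0n /= !(mulr0, invr0).
  by field; rewrite tN etaN pN.
move=> ->; rewrite muleA -EFinM; congr (_%:E * _)%E.
rewrite -powR_mulrn ?(ltW eta0) // -powRN -powRD ?etaN ?implybT //; congr (_ `^ _); ring.
Qed.

Lemma integrable_radial (f : TR k -> R) (a1 a2 C : R) : 0 <= C -> - k%:R < a1 -> a2 < - k%:R ->
  (forall u, 0 <= f u) ->
  (forall u, f u <= C * ((if (0 < tn u) && (tn u <= 1) then tn u `^ a1 else 0) + (if 1 < tn u then tn u `^ a2 else 0))) ->
  mbl f -> (\int[lb]_u (f u)%:E < +oo)%E.
Proof.
move=> C0 ha1 ha2 f0 h mf; have mt := @measurable_tn R k.
have m1 : mbl (fun u : TR k => if (0 < tn u) && (tn u <= 1) then tn u `^ a1 else 0) by mauto.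
have m2 : mbl (fun u : TR k => if 1 < tn u then tn u `^ a2 else 0) by mauto.
have p1 u : 0 <= (if (0 < tn u) && (tn u <= 1) then tn u `^ a1 else 0 : R) by case: ifP => // _; exact: powR_ge0.
have p2 u : 0 <= (if 1 < tn u then tn u `^ a2 else 0 : R) by case: ifP => // _; exact: powR_ge0.
apply: (@le_lt_trans _ _ (C%:E * (\int[lb]_u (if (0 < tn u) && (tn u <= 1) then tn u `^ a1 else 0 : R)%:E +
   \int[lb]_u (if 1 < tn u then tn u `^ a2 else 0 : R)%:E))%E); last first.
  apply: lte_mul_pinfty; rewrite ?lee_fin //; apply: lte_add_pinfty; [exact: integral_tn_small|exact: integral_tn_large].
rewrite -ge0_integralD //; last 4 first.
- by move=> u _; rewrite lee_fin.
- by mauto.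
- by move=> u _; rewrite lee_fin.
- by mauto.
rewrite -ge0_integralZl_EFin //; last 2 first.
- by move=> u _; rewrite -EFinD lee_fin addr_ge0.
- by apply: emeasurable_funD; exact/measurable_EFinP.
apply: ge0_le_integral => //.
- by move=> u _; rewrite lee_fin.
- by mauto.
- by apply: measurable_funeM; apply: emeasurable_funD; exact/measurable_EFinP.
by move=> u _; rewrite -EFinD -EFinM lee_fin.
Qed.

(** At low frequencies the profile is at most |u|^(b-k), at high ones 4 |u|^(b-k-2); these are
    integrable as b > 0 and b < 2. *)
Lemma incr_profile_fin : (\int[lb]_u (incr_profile 1 u)%:E < +oo)%E.
Proof.
have e1 : - k%:R < b - k%:R by rewrite ltrBrDr addNr (lt_le_trans ltr01 b1).
have e2 : b - k%:R - 2 < - k%:R by rewrite ltrBlDr [ltRHS]addrC ltrD2r.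
apply: (@integrable_radial _ (b - k%:R) (b - k%:R - 2) 4) => //; [exact: incr_profile_ge0| |exact: measurable_incr_profile].
move=> u; rewrite /incr_profile mul1r; have u0 := tn_ge0 u.
have c0 := cut_ge0 u0.
have [u1|u1] := leP (tn u) 1; rewrite ?andbT ?andbF ?addr0 ?add0r.
  have [tp|tN] := ltP 0 (tn u); last first.
    have -> : tn u = 0 by apply/le_anti; rewrite tN u0.
    by rewrite invr0 mulr0 expr0n /= !mulr0.
  have h : (cut (tn u) / tn u) ^+ 2 <= 1.
    have h0 : cut (tn u) / tn u <= 1 by rewrite ler_pdivrMr // mul1r /cut ge_min lexx orbT.
    by rewrite expr2 mulr_ile1 // divr_ge0.
  have p0 := powR_ge0 (tn u) (b - k%:R).
  by apply: (le_via (tn u `^ (b - k%:R) * 1)); [exact: ler_wpM2l|lra].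
have u0' : 0 < tn u by exact: lt_trans u1.
rewrite (@powRD _ (tn u) (b - k%:R) (- 2)) ?(gt_eqF u0') ?implybT // powRN powR_mulrn // [leRHS]mulrCA ler_wpM2l ?powR_ge0 //.
rewrite expr_div_n ler_pM2r ?invr_gt0 ?exprn_gt0 //.
have h : cut (tn u) <= 2 by rewrite /cut ge_min lexx.
by have := ler_pM c0 c0 h h; rewrite -expr2; lra.
Qed.

Lemma N2_wave_incr tau eta t s x y : 0 < eta -> 0 <= t <= tau -> 0 <= s <= tau -> `|t - s| <= eta ->
  (forall u : TR k, `|dotp (to_row u) x - dotp (to_row u) y| <= tn u * eta) ->
  (N2 b (fun z => wave_re t x z - wave_re s y z)%R (fun z => wave_im t x z - wave_im s y z)%R <=
   (8 * tau * fine (\int[lb]_u (incr_profile 1 u)%:E) * eta `^ (2 - b))%:E)%E.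
Proof.
move=> eta0 t0 s0 ts xy; have tau0 : 0 <= tau by have /andP[h1 h2] := t0; exact: le_trans h2.
have mP := measurable_incr_profile eta.
apply: (le_via (tau%:E * \int[lb]_u (8 * incr_profile eta u)%:E)%E).
  apply: N2_strip_le => //.
  - by mauto.
  - by apply: measurable_funB; exact: measurable_wave_im.
  - by mauto.
  - by move=> u; rewrite mulr_ge0 ?incr_profile_ge0.
  move=> r u; have h1 := wave_re_diff t0 s0 ts xy r u; have h2 := wave_im_diff t0 s0 ts xy r u.
  move: h1 h2; set i := if _ then _ else _; set A := _ - _; set B := wave_im _ _ _ - _.
  set m := cut _ / _ => h1 h2.
  have i0 : 0 <= i <= 1 by rewrite /i; case: ifP; rewrite ?lexx ler01.
  have ii : i ^+ 2 = i by rewrite /i; case: ifP; rewrite ?expr1n ?expr0n.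
  have sq (a : R) : `|a| <= i * (2 * m) -> a ^+ 2 <= i * (4 * m ^+ 2).
    move=> ha; rewrite -real_normK ?num_real // -[i in leRHS]ii (_ : i ^+ 2 * (4 * m ^+ 2) = (i * (2 * m)) ^+ 2); last by ring.
    by rewrite lerXn2r ?nnegrE // (le_trans _ ha).
  rewrite /incr_profile -/m (_ : i * _ = tn u `^ (b - k%:R) * (i * (4 * m ^+ 2) + i * (4 * m ^+ 2))); last by ring.
  by rewrite ler_wpM2l ?powR_ge0 // lerD // sq.
under eq_integral do rewrite EFinM.
rewrite ge0_integralZl_EFin //; last 2 first.
- by move=> u _; rewrite lee_fin incr_profile_ge0.
- by mauto.
have fP : (\int[lb]_u (incr_profile 1 u)%:E)%E \is a fin_num.
  rewrite ge0_fin_numE ?incr_profile_fin //; apply: integral_ge0 => u _; by rewrite lee_fin incr_profile_ge0.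
rewrite (incr_profile_scale eta0); set I := fine _.
have -> : (\int[lb]_u (incr_profile 1 u)%:E = I%:E)%E by rewrite fineK.
by rewrite -!EFinM lee_fin; apply: le_of_eq; ring.
Qed.
End wave_kernel_bounds.

(** * Smoothness of the covariance and lower bounds on the variance *)

Section wave_covariance_bounds.
Context {R : realType} (k : nat) (b : R).
Hypothesis k0 : (0 < k)%N.
Hypothesis b1 : 1 <= b.
Hypothesis b2 : b < 2.
Hypothesis bk : b <= k%:R.
Local Notation mu := (@lebesgue_measure R).
Local Notation TR n := (n.-tuple (Borel R)).
Local Notation lb := (leb (R:=R) (n:=k)).
Local Notation MR := (Borel R).
Local Notation slabT := (MR * TR k -> R).

(** With H = (2 - b) / 2 this is 3H/2, midway between H, which it must exceed, and 2H, below which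
    [cov_profile] is integrable at high frequencies. *)
Definition cov_exponent : R := 3 * ((2 - b) / 2) / 2.
Local Notation th := cov_exponent.

Lemma cov_exponent_itv : 0 < th <= 1.
Proof. by have h1 := b1; have h2 := b2; rewrite /cov_exponent; apply/andP; split; lra. Qed.
Let th01 := cov_exponent_itv.

(** The two bounds of |sin(t |u|) / |u|| for 0 <= t <= tau. *)
Definition decay_profile (tau : R) (u : TR k) : R := Num.min tau (tn u)^-1.
Definition cov_profile (tau : R) (u : TR k) : R :=
  tn u `^ (b - k%:R + (th - 1)) * decay_profile tau u.

Lemma decay_profile_ge0 tau u : 0 <= tau -> 0 <= decay_profile tau u.
Proof. by move=> h; rewrite le_min h invr_ge0 tn_ge0. Qed.

Lemma measurable_cov_profile tau : mbl (cov_profile tau).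
Proof.
have mt := @measurable_tn R k.
apply: measurable_funM; first exact: measurable_fun_powR.
by apply: measurable_minr => //; exact: measurable_funV.
Qed.

Lemma cov_profile_fin tau : 0 <= tau -> (\int[lb]_u (cov_profile tau u)%:E < +oo)%E.
Proof.
move=> tau0; have /andP[th0 th1] := th01; have hb1 := b1; have hb2 := b2.
have e1 : - k%:R < b - k%:R + (th - 1).
  have : 0 < b + (th - 1) by lra.
  by move=> h; rewrite addrAC ltrBrDr addNr.
have e2 : b - k%:R + (th - 2) < - k%:R.
  have : b + (th - 2) < 0 by rewrite /cov_exponent; lra.
  by move=> h; rewrite addrAC ltrBlDr addNr.
apply: (@integrable_radial _ _ _ (b - k%:R + (th - 1)) (b - k%:R + (th - 2)) (1 + tau)) => //.
- by rewrite addr_ge0.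
- by move=> u; rewrite mulr_ge0 ?powR_ge0 // decay_profile_ge0.
- move=> u; rewrite /cov_profile; have u0 := tn_ge0 u.
  have d0 := decay_profile_ge0 u tau0.
  have p0 := powR_ge0 (tn u) (b - k%:R + (th - 1)).
  have [u1|u1] := leP (tn u) 1; rewrite ?andbT ?andbF ?addr0 ?add0r.
    have [tp|tN] := ltP 0 (tn u); last first.
      have t0 : tn u = 0 by apply/le_anti; rewrite tN u0.
      have [h|h] := eqVneq tau 0; first by rewrite /decay_profile t0 invr0 h minxx !mulr0.
      by rewrite /decay_profile t0 invr0 min_r // mulr0 mulr0.
    have h : decay_profile tau u <= 1 + tau.
      by apply: (le_via tau); [rewrite /decay_profile ge_min lexx|lra].
    by rewrite mulrC ler_wpM2r.
  have u0' : 0 < tn u by exact: lt_trans u1.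
  have -> : b - k%:R + (th - 2) = b - k%:R + (th - 1) + - 1 by ring.
  rewrite (@powRD _ (tn u) (b - k%:R + (th - 1)) (- 1)) ?(gt_eqF u0') ?implybT // powR_inv1 //.
  rewrite [leRHS]mulrCA ler_wpM2l //.
  have h : decay_profile tau u <= (tn u)^-1 by rewrite /decay_profile ge_min lexx orbT.
  have i0 : 0 <= (tn u)^-1 by rewrite invr_ge0.
  apply: (le_trans h); rewrite mulrDl mul1r lerDl mulr_ge0 //.
- exact: measurable_cov_profile.
Qed.

Lemma wave_bound (w : R -> R) t tau x r (u : TR k) : (forall x, `|w x| <= 1) -> 0 <= t <= tau ->
  `|if (0 <= r) && (r < t) then w (dotp (to_row u) x) * (sin ((t - r) * tn u) / tn u) else 0| <= decay_profile tau u.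
Proof.
move=> w1 /andP[t0 tt]; have tau0 : 0 <= tau by exact: le_trans tt.
have u0 := tn_ge0 u; have d0 := decay_profile_ge0 u tau0.
case: ifPn => [/andP[r0 rt]|_]; last by rewrite normr0.
have [tu|tuN] := eqVneq (tn u) 0; first by rewrite tu invr0 !mulr0 normr0.
have u1 : 0 < tn u by rewrite lt_def tuN.
rewrite normrM -[leRHS]mul1r; apply: ler_pM => //.
rewrite normrM normfV (gtr0_norm u1) /decay_profile le_min; apply/andP; split.
  rewrite ler_pdivrMr //; apply: (le_trans (sin_le_norm _)).
  rewrite normrM (gtr0_norm u1) ler_wpM2r // ger0_norm ?subr_ge0 ?(ltW rt) //.
  by apply: le_trans tt; rewrite lerBlDr lerDl.
by rewrite -[leRHS]mul1r ler_wpM2r ?invr_ge0 // sin_max.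
Qed.

Section cross.
Variables (tau eta t s q : R) (x y z0 : 'rV[R]_k).
Hypothesis t0 : 0 <= t <= tau.
Hypothesis s0 : 0 <= s <= tau.
Hypothesis q0 : 0 <= q <= tau.
Hypothesis ts : `|t - s| <= eta.
Hypothesis xy : forall u : TR k, `|dotp (to_row u) x - dotp (to_row u) y| <= tn u * eta.

Definition cov_const : R := 32 * tau * fine (\int[lb]_u (cov_profile tau u)%:E).

(** Polarisation: the difference of the two norms is 4 [sg] times the inner product of an increment
    with a kernel. Cauchy-Schwarz would give order H only; multiplying pointwise bounds, with
    [cut_powR] for the increment and the decay of the fixed kernel, gives the better order
    [cov_exponent]. *)
Lemma N2_wave_cross (sg : R) : `|sg| = 1 ->
  (N2 b (fun z => (wave_re t x z - wave_re s y z) + sg * wave_re q z0 z)%R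
        (fun z => (wave_im t x z - wave_im s y z) + sg * wave_im q z0 z)%R <=
   N2 b (fun z => (wave_re t x z - wave_re s y z) - sg * wave_re q z0 z)%R
        (fun z => (wave_im t x z - wave_im s y z) - sg * wave_im q z0 z)%R +
   (cov_const * eta `^ th)%:E)%E.
Proof.
move=> sg1; have tau0 : 0 <= tau by have /andP[h1 h2] := t0; exact: le_trans h2.
have eta0 : 0 <= eta by exact: le_trans (normr_ge0 _) ts.
have mre t' x' : mbl (wave_re t' x' : slabT) by exact: measurable_wave_re.
have mim t' x' : mbl (wave_im t' x' : slabT) by exact: measurable_wave_im.
pose DA (z : MR * TR k) := wave_re t x z - wave_re s y z.
pose DB (z : MR * TR k) := wave_im t x z - wave_im s y z.
have mDA : mbl DA by exact: measurable_funB.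
have mDB : mbl DB by exact: measurable_funB.
(* Square roots, so that the error term of the polarisation is itself of the form [N2]. *)
pose A2 (z : MR * TR k) := Num.sqrt (4 * (`|DA z| * `|wave_re q z0 z|)).
pose B2 (z : MR * TR k) := Num.sqrt (4 * (`|DB z| * `|wave_im q z0 z|)).
have mA2 : mbl A2.
  by apply: measurable_fun_sqrt; apply: measurable_funM => //; apply: measurable_funM; exact: measurable_fun_norm.
have mB2 : mbl B2.
  by apply: measurable_fun_sqrt; apply: measurable_funM => //; apply: measurable_funM; exact: measurable_fun_norm.
have A2E z : A2 z ^+ 2 = 4 * (`|DA z| * `|wave_re q z0 z|) by rewrite sqr_sqrtr // !mulr_ge0.
have B2E z : B2 z ^+ 2 = 4 * (`|DB z| * `|wave_im q z0 z|) by rewrite sqr_sqrtr // !mulr_ge0.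
have expand (a g : R) : (a + sg * g) ^+ 2 <= (a - sg * g) ^+ 2 + 4 * (`|a| * `|g|).
  have h : sg * (a * g) <= `|a| * `|g|.
    by apply: (le_trans (ler_norm _)); rewrite !normrM sg1 mul1r.
  rewrite (_ : (a + sg * g) ^+ 2 = (a - sg * g) ^+ 2 + 4 * (sg * (a * g))); last by ring.
  by rewrite lerD2l ler_wpM2l.
have step : (N2 b (fun z => DA z + sg * wave_re q z0 z)%R (fun z => DB z + sg * wave_im q z0 z)%R <=
    1%:E * N2 b (fun z => DA z - sg * wave_re q z0 z)%R (fun z => DB z - sg * wave_im q z0 z)%R + 1%:E * N2 b A2 B2)%E.
  apply: N2_le => //.
  - by apply: measurable_funD => //; exact: measurable_funM.
  - by mauto.
  - by mauto.
  - by apply: measurable_funB => //; exact: measurable_funM.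
  - by move=> z; rewrite !mul1r A2E.
  - by move=> z; rewrite !mul1r B2E.
rewrite !mul1e in step; apply: (le_trans step); rewrite leeD2l //.
have mP := measurable_cov_profile tau.
have P0 u : 0 <= cov_profile tau u by rewrite mulr_ge0 ?powR_ge0 // decay_profile_ge0.
have c16 : 0 <= 16 * eta `^ th by rewrite mulr_ge0 ?powR_ge0 // ler0n.
apply: (le_via (tau%:E * \int[lb]_u ((32 * eta `^ th) * cov_profile tau u)%:E)%E).
  apply: N2_strip_le => //.
  - by mauto.
  - by move=> u; rewrite mulr_ge0 // mulr_ge0 ?powR_ge0 // ler0n.
  move=> r u; rewrite A2E B2E.
  have h1 := wave_re_diff t0 s0 ts xy r u; have h2 := wave_im_diff t0 s0 ts xy r u.
  have g1 := @wave_bound cos q tau z0 r u (@cos_max R) q0.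
  have g2 := @wave_bound sin q tau z0 r u (@sin_max R) q0.
  rewrite -/(wave_re q z0 (r, u)) in g1; rewrite -/(wave_im q z0 (r, u)) in g2.
  rewrite -/(DA (r, u)) in h1; rewrite -/(DB (r, u)) in h2.
  move: h1 h2; set i := if _ then _ else _; set m := cut _ / _ => h1 h2.
  have i0 : 0 <= i by rewrite /i; case: ifP.
  have u0 := tn_ge0 u; have D0 := decay_profile_ge0 u tau0.
  have k1 := ler_pM (normr_ge0 _) (normr_ge0 _) h1 g1.
  have k2 := ler_pM (normr_ge0 _) (normr_ge0 _) h2 g2.
  have w0 := powR_ge0 (tn u) (b - k%:R).
  have mb : tn u `^ (b - k%:R) * m <= 2 * (eta `^ th * tn u `^ (b - k%:R + (th - 1))).
    rewrite /m; have [tu|tuN] := eqVneq (tn u) 0.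
      by rewrite tu invr0 !mulr0 mulr_ge0 // mulr_ge0 // powR_ge0.
    have u1 : 0 < tn u by rewrite lt_def tuN.
    rewrite mulrA ler_pdivrMr //.
    have h := @cut_powR R (eta * tn u) th (mulr_ge0 eta0 u0) th01.
    apply: (le_trans (ler_wpM2l w0 h)); rewrite powRM //.
    rewrite le_eqVlt; apply/orP; left; apply/eqP.
    have -> : tn u `^ (b - k%:R + (th - 1)) = tn u `^ (b - k%:R) * tn u `^ th / tn u.
      by rewrite addrA !(@powRD _ (tn u)) ?tuN ?implybT // powR_inv1.
    by field.
  rewrite (_ : _ * (_ + _) = 4 * (tn u `^ (b - k%:R) * (`|DA (r, u)| * `|wave_re q z0 (r, u)|)) +
     4 * (tn u `^ (b - k%:R) * (`|DB (r, u)| * `|wave_im q z0 (r, u)|))); last by ring.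
  have key (X : R) : X <= i * (2 * m) * decay_profile tau u ->
      4 * (tn u `^ (b - k%:R) * X) <= 16 * (i * (eta `^ th * cov_profile tau u)).
    move=> hX; have := ler_wpM2l w0 hX => hX'.
    have iD : 0 <= 2 * (i * decay_profile tau u) by rewrite mulr_ge0 // mulr_ge0.
    have hm := ler_wpM2l iD mb.
    rewrite (_ : 16 * _ = 4 * (2 * (i * decay_profile tau u) * (2 * (eta `^ th * tn u `^ (b - k%:R + (th - 1)))))); last first.
      by rewrite /cov_profile; ring.
    apply: ler_wpM2l => //; apply: le_trans hm; apply: (le_trans hX').
    by apply: le_of_eq; ring.
  apply: (le_trans (lerD (key _ k1) (key _ k2))).
  by apply: le_of_eq; ring.
under eq_integral do rewrite EFinM.
rewrite ge0_integralZl_EFin //; last 3 first.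
- by move=> u _; rewrite lee_fin.
- by mauto.
- by rewrite mulr_ge0 ?powR_ge0 // ler0n.
have fP : (\int[lb]_u (cov_profile tau u)%:E)%E \is a fin_num.
  rewrite ge0_fin_numE ?cov_profile_fin //; apply: integral_ge0 => u _; by rewrite lee_fin.
rewrite /cov_const; set I := fine _.
have -> : (\int[lb]_u (cov_profile tau u)%:E = I%:E)%E by rewrite fineK.
by rewrite -!EFinM lee_fin; apply: le_of_eq; ring.
Qed.
End cross.

Let ind (lo hi y : R) : R := if (lo <= y) && (y <= hi) then 1 else 0.

Let measurable_ind lo hi : mbl (ind lo hi : MR -> R).
Proof. by rewrite /ind; apply: measurable_fun_ifT => //; apply: measurable_and; exact: measurable_fun_ler. Qed.

Let ind_ge0 lo hi y : 0 <= ind lo hi y. Proof. by rewrite /ind; case: ifP. Qed.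

Definition cube_ind n (lo hi : R) (u : TR n) : R := \prod_(i < n) ind lo hi (tnth u i).

Lemma measurable_cube_ind n lo hi : mbl (@cube_ind n lo hi).
Proof.
apply: measurable_prod => i _.
by apply: (measurableT_comp (measurable_ind lo hi)); exact: measurable_tnth.
Qed.

Lemma cube_ind_ge0 n lo hi u : 0 <= @cube_ind n lo hi u.
Proof. by apply: prodr_ge0 => i _; exact: ind_ge0. Qed.

Lemma integral_cube_ind n lo hi : lo <= hi ->
  (\int[leb (n:=n)]_u (@cube_ind n lo hi u)%:E = ((hi - lo) ^+ n)%:E)%E.
Proof.
move=> lohi; have mE n' : mbl (fun u => (@cube_ind n' lo hi u)%:E).
  by apply/measurable_EFinP; exact: measurable_cube_ind.
elim: n => [|n IH]; first by rewrite integral_leb0 /cube_ind big_ord0.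
rewrite integral_lebS //; last by move=> u; rewrite lee_fin cube_ind_ge0.
rewrite (eq_integral (fun u => (hi - lo)%:E * (@cube_ind n lo hi u)%:E)%E); last first.
  move=> u _; rewrite (@eq_integral_leb _ _ (fun x => (@cube_ind n lo hi u)%:E * (\1_`[lo, hi]%classic x)%:E)%E); last first.
    move=> x; rewrite -EFinM; congr _%:E; rewrite /cube_ind big_ord_recl tnth0 mulrC; congr (_ * _).
      by apply: eq_bigr => i _; rewrite tnthS.
    rewrite /ind indicE; case: ifPn => hx; first by rewrite mem_set //= in_itv.
    by rewrite memNset //= in_itv /=; exact/negP.
  rewrite ge0_integralZl_EFin ?cube_ind_ge0 //; last by apply/measurable_EFinP; exact: measurable_indic.
  rewrite integral_indic //= setIT lebesgue_measure_itv /= lte_fin muleC.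
  case: ltP => h; first by rewrite -EFinD.
  by have -> : lo = hi by [apply/le_anti; rewrite lohi h]; rewrite subrr.
rewrite ge0_integralZl_EFin //; last 3 first.
- by move=> u _; rewrite lee_fin cube_ind_ge0.
- exact: mE.
- by rewrite subr_ge0.
by rewrite IH -EFinM exprS.
Qed.

Definition var_const (sg : R) : R :=
  (sg / 2) * ((sg ^+ 2 / 16) * ((k%:R^-1 - k%:R^-1 / 2) ^+ k)).

Lemma var_const_gt0 sg : 0 < sg -> 0 < var_const sg.
Proof.
move=> s0; have kp : 0 < k%:R^-1 :> R by rewrite invr_gt0 ltr0n.
have h : 0 < k%:R^-1 - k%:R^-1 / 2 :> R by lra.
have h1 : 0 < sg / 2 by lra.
have h2 : 0 < sg ^+ 2 / 16 by rewrite divr_gt0 // exprn_gt0.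
exact: mulr_gt0 h1 (mulr_gt0 h2 (exprn_gt0 _ h)).
Qed.

(** Restrict to t - sg <= r <= t - sg/2 and to frequencies in a cube with |u| <= 1. There the weight
    is at least 1 because b <= k, and sin a >= a/2, so the kernel is at least sg/4; squares of
    cosine and sine of the phase add up to 1. *)
Lemma N2_wave_lower sg t (x : 'rV[R]_k) : 0 < sg <= 1 -> sg <= t ->
  ((var_const sg)%:E <= N2 b (wave_re t x) (wave_im t x))%E.
Proof.
move=> /andP[sg0 sg1] sgt; pose eps : R := k%:R^-1.
have kp : 0 < eps by rewrite invr_gt0 ltr0n.
pose H u := sg ^+ 2 / 16 * @cube_ind k (eps / 2) eps u.
have c0 : 0 <= sg ^+ 2 / 16 by rewrite divr_ge0 // sqr_ge0.
have mH : mbl H by apply: measurable_funM => //; exact: measurable_cube_ind.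
have H0 u : 0 <= H u by rewrite mulr_ge0 // cube_ind_ge0.
have l1 : t - sg <= t - sg / 2 by lra.
have l2 : eps / 2 <= eps by lra.
have -> : ((var_const sg)%:E = ((t - sg / 2) - (t - sg))%:E * \int[lb]_u (H u)%:E)%E.
  under [in RHS]eq_integral do rewrite EFinM.
  rewrite ge0_integralZl_EFin //; last 2 first.
  - by move=> u _; rewrite lee_fin cube_ind_ge0.
  - by apply/measurable_EFinP; exact: measurable_cube_ind.
  rewrite integral_cube_ind // -!EFinM /var_const -/eps; congr (_ * _)%:E; by field.
rewrite -strip_integral //.
have mA := @measurable_wave_re R k t x; have mB := @measurable_wave_im R k t x.
have mN := measurable_N2_integrand b mA mB.
have mI : mbl (fun z : MR * TR k => ((if ((t - sg <= z.1) && (z.1 <= t - sg / 2))%R then 1 else 0) * H z.2)%:E).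
  have m1 : mbl (fun z : MR * TR k => z.1 : R) by mauto.
  apply/measurable_EFinP; apply: measurable_funM; last exact: (measurableT_comp mH).
  by apply: measurable_fun_ifT => //; apply: measurable_and; exact: measurable_fun_ler.
have i0 (r : R) : 0 <= (if (t - sg <= r) && (r <= t - sg / 2) then 1 else 0) :> R by case: ifP.
apply: ge0_le_integral => //.
- by move=> r _; apply: integral_ge0 => u _; rewrite lee_fin mulr_ge0.
- by apply: (@measurable_fun_fubini_tonelli_F _ _ _ _ _ lb _ mI) => z; rewrite lee_fin mulr_ge0.
- exact: (@measurable_fun_fubini_tonelli_F _ _ _ _ _ lb _ mN (N2_integrand_ge0 b _ _)).
move=> r _; apply: ge0_le_integral => //.
- by move=> u _; rewrite lee_fin mulr_ge0.
- by mauto.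
- exact: (measurable_fun_pair2 r mN).
move=> u _; rewrite lee_fin; case: ifPn => [/andP[r1 r2]|_]; last first.
  by rewrite mul0r mulr_ge0 ?powR_ge0 // addr_ge0 // sqr_ge0.
rewrite mul1r /H; have [all_in|] := boolP [forall i, (eps / 2 <= tnth u i) && (tnth u i <= eps)]; last first.
  move=> /forallPn[i hi]; rewrite /cube_ind (bigD1 i) //= /ind (negbTE hi) mul0r mulr0.
  by rewrite mulr_ge0 ?powR_ge0 // addr_ge0 // sqr_ge0.
have cube1 : @cube_ind k (eps / 2) eps u = 1.
  by apply: big1 => i _; have := forallP all_in i; rewrite /ind => ->.
rewrite cube1 mulr1 /wave_re /wave_im /=.
have r0 : 0 <= r by apply: le_trans r1; rewrite subr_ge0.
have rt : r < t by apply: (le_lt_trans r2); lra.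
rewrite r0 rt /=; set w := _ / tn u.
rewrite (_ : (cos _ * w) ^+ 2 + (sin _ * w) ^+ 2 = (cos (dotp (to_row u) x) ^+ 2 + sin (dotp (to_row u) x) ^+ 2) * w ^+ 2); last by ring.
rewrite cos2Dsin2 mul1r.
have u0 := tn_ge0 u.
have up : 0 < tn u.
  pose i0' : 'I_k := Ordinal k0.
  apply: lt_le_trans (le_tn u i0'); apply: lt_le_trans (ler_norm _).
  by have /andP[h _] := forallP all_in i0'; apply: lt_le_trans h; lra.
have u1 : tn u <= 1.
  have : tn u ^+ 2 <= 1.
    rewrite sqr_tn /dott; apply: (le_via (\sum_(i < k) eps ^+ 2)).
      apply: ler_sum => i _; have /andP[h1 h2] := forallP all_in i; rewrite expr2.
      by apply: ler_pM => //; lra.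
    rewrite sumr_const card_ord -mulr_natl /eps exprVn expr2 invfM mulrA mulfV ?mul1r ?pnatr_eq0 ?lt0n_neq0 //.
    by rewrite invf_le1 ?ltr0n // ler1n.
  by move=> h; rewrite -(expr1n _ 2) ler_pXn2r // in h; rewrite nnegrE.
have p1 : 1 <= tn u `^ (b - k%:R).
  rewrite -[leLHS](powRr0 (tn u)); apply: ger_powR; first by rewrite up.
  by rewrite subr_le0.
have w1 : sg / 4 <= w.
  set a := (t - r) * tn u in w *; have tr : sg / 2 <= t - r by lra.
  have tr1 : t - r <= 1 by lra.
  have tr0 : 0 <= t - r by lra.
  have a0 : 0 <= a by rewrite mulr_ge0.
  have a1 : a <= 1 by rewrite mulr_ile1.
  have := sin_cubic a; rewrite (ger0_norm a0) ler_norml => /andP[_ hs].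
  have a3 : a ^+ 3 <= a by rewrite exprS ler_piMr // expr2 mulr_ile1.
  have sa : a / 2 <= sin a by lra.
  rewrite /w ler_pdivlMr //; apply: le_trans sa.
  by have := ler_wpM2r u0 tr; rewrite -/a; lra.
have w2 : sg ^+ 2 / 16 <= w ^+ 2.
  have s4 : 0 <= sg / 4 by lra.
  have := ler_pM s4 s4 w1 w1; rewrite -!expr2; lra.
by rewrite -[leLHS]mul1r; apply: ler_pM.
Qed.
End wave_covariance_bounds.

Lemma eq_N2 (R : realType) k (b : R) (A A' B B' : Borel R * k.-tuple (Borel R) -> R) :
  (forall z, A z = A' z) -> (forall z, B z = B' z) -> N2 b A B = N2 b A' B'.
Proof. by move=> /funext -> /funext ->. Qed.

(** * Moments and covariances of the solution *)

Section solution_covariance.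
Context {R : realType} (k d : nat) {disp : measure_display} {T : measurableType disp}.
Variable P : probability T R.
Variables (b c : R) (cov : test_function R k -> test_function R k -> \bar R).
Variable W : 'I_d -> test_function R k -> {RV P >-> R}.
Hypothesis k0 : (0 < k)%N.
Hypothesis b1 : 1 <= b.
Hypothesis b2 : b < 2.
Hypothesis bk : b <= k%:R.
Hypothesis noise : noise_with_covariance cov W.
Hypothesis c0 : 0 < c.
Hypothesis iso : spectral_isometry b c cov.
Variables (J : Type) (pos : J -> R * 'rV[R]_k) (X : 'I_d -> J -> T -> R) (tau : R).
Hypothesis mX : forall j p, mbl (X j p).
Hypothesis intX : forall j p, is_stochastic_integral b (W j) (wave_integrand (pos p).1 (pos p).2) (X j p).
Hypothesis pos_tau : forall p, 0 <= (pos p).1 <= tau.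

Let GG (p : J) := wave_integrand (pos p).1 (pos p).2.
Let mre p : mbl (re_part (GG p)).
Proof. by rewrite re_part_wave; exact: measurable_wave_re. Qed.
Let mim p : mbl (im_part (GG p)).
Proof. by rewrite im_part_wave; exact: measurable_wave_im. Qed.

Definition gram (j : 'I_d) (p q : J) : R := \int[P]_w (X j p w * X j q w).

Lemma gramC j p q : gram j p q = gram j q p.
Proof. by apply: eq_Rintegral => w _; rewrite mulrC. Qed.

Lemma lin_component_like j L : exists v, gauss_like P (lin (X j) L) v.
Proof.
have [v gv] := lin_field_like noise mX mre mim intX (on_component j L); exists v.
by have -> : lin (X j) L = lin (fun i : 'I_d * J => X i.1 i.2) (on_component j L)
  by [apply/funext => w; rewrite lin_on_component].
Qed.

Local Notation wre p := (@wave_re R k (pos p).1 (pos p).2).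
Local Notation wim p := (@wave_im R k (pos p).1 (pos p).2).

Lemma gram_isometry j (L : seq (R * J)) : exists a : R,
  N2 b (lin (fun p => wre p) L) (lin (fun p => wim p) L) = a%:E /\ bil (gram j) L L = c * a /\
  (\int[P]_w (lin (X j) L w ^+ 2)%:E = (c * a)%:E)%E.
Proof.
have [a [aE hE]] := field_isometry noise c0 iso mX mre mim intX j L.
exists a; split; last split => //.
  have e1 : (fun p => re_part (GG p)) = (fun p => wre p) by apply/funext => p; exact: re_part_wave.
  have e2 : (fun p => im_part (GG p)) = (fun p => wim p) by apply/funext => p; exact: im_part_wave.
  by move: aE; rewrite e1 e2.
have h := gauss_like_second_moment L (lin_component_like j).
by rewrite -/(gram j) in h; rewrite -h /Rintegral hE.
Qed.

Lemma lin1 (I S : Type) (Y : I -> S -> R) p : lin Y [:: (1, p)] = Y p.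
Proof. by apply/funext => w; rewrite /lin big_seq1 mul1r. Qed.

Lemma lin2 (I S : Type) (Y : I -> S -> R) p q : lin Y [:: (1, p); (- 1, q)] = (fun w => Y p w - Y q w).
Proof. by apply/funext => w; rewrite /lin !big_cons big_nil; rewrite mul1r mulN1r addr0. Qed.

Lemma lin3 (I S : Type) (Y : I -> S -> R) p q z s :
  lin Y [:: (1, p); (- 1, q); (s, z)] = (fun w => Y p w - Y q w + s * Y z w).
Proof. by apply/funext => w; rewrite /lin !big_cons big_nil; rewrite mul1r mulN1r addr0 addrA. Qed.

(** By the isometry the quadratic form does not depend on the component; its values on p + q and p -
    q determine the mixed entry. *)
Lemma gram_same_component j j' p q : gram j p q = gram j' p q.
Proof.
have h3 l s : bil (gram l) [:: (1, p); (s, q)] [:: (1, p); (s, q)] =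
    gram l p p + 2 * s * gram l p q + s ^+ 2 * gram l q q.
  by rewrite /bil !big_cons !big_nil /= (gramC l q p); ring.
have eq L : bil (gram j) L L = bil (gram j') L L.
  have [a [aE [-> _]]] := gram_isometry j L; have [a' [aE' [-> _]]] := gram_isometry j' L.
  by move: aE'; rewrite aE => -[->].
by have := eq [:: (1, p); (1, q)]; have := eq [:: (1, p); (- 1, q)]; rewrite !h3; lra.
Qed.

Definition incr_const : R := c * (8 * tau * fine (\int[leb (R:=R) (n:=k)]_u (incr_profile b 1 u)%:E)).

Section pair.
Variables (j : 'I_d) (p q : J) (eta : R).
Hypothesis eta0 : 0 < eta.
Hypothesis ts : `|(pos p).1 - (pos q).1| <= eta.
Hypothesis xy : forall u : k.-tuple (Borel R),
  `|dotp (to_row u) (pos p).2 - dotp (to_row u) (pos q).2| <= tn u * eta.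

Lemma gram_incr : gram j p p - 2 * gram j p q + gram j q q <= incr_const * eta `^ (2 - b).
Proof.
have [a [aE [aB _]]] := gram_isometry j [:: (1, p); (- 1, q)].
have -> : gram j p p - 2 * gram j p q + gram j q q = c * a.
  by rewrite -aB /bil !big_cons !big_nil /= (gramC j q p); ring.
rewrite /incr_const -mulrA ler_wpM2l ?(ltW c0) // -lee_fin -aE !lin2.
exact: (N2_wave_incr b1 b2 eta0 (pos_tau p) (pos_tau q) ts xy).
Qed.

Lemma incr_moment m : (\int[P]_w ((X j p w - X j q w) ^+ (2 * m))%:E <=
  (moment_const m * (incr_const * eta `^ (2 - b)) ^+ m)%:E)%E.
Proof.
have [a [aE [aB aV]]] := gram_isometry j [:: (1, p); (- 1, q)].
have [v gv] := lin_component_like j [:: (1, p); (- 1, q)].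
have v0 := gl_ge0 gv.
have va : v = c * a by have := gl_var gv; rewrite aV => -[->].
have := gl_moment gv m; rewrite lin2 => h; apply: (le_trans h); rewrite lee_fin.
apply: ler_wpM2l; first exact: moment_const_ge0.
have gE : gram j p p - 2 * gram j p q + gram j q q = v.
  by rewrite va -aB /bil !big_cons !big_nil /= (gramC j q p); ring.
have vle : v <= incr_const * eta `^ (2 - b) by rewrite -gE; exact: gram_incr.
by apply: lerXn2r; rewrite ?nnegrE // (le_trans v0).
Qed.

(** Adding and subtracting the value at [z] to the increment changes its variance by 4 times the
    left-hand difference, which [N2_wave_cross] bounds with either sign. *)
Lemma gram_cross z : `|gram j p z - gram j q z| <= c * cov_const k b tau * eta `^ cov_exponent b.
Proof.
have bilE s : bil (gram j) [:: (1, p); (- 1, q); (s, z)] [:: (1, p); (- 1, q); (s, z)] =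
    gram j p p - 2 * gram j p q + gram j q q + 2 * s * (gram j p z - gram j q z) + s ^+ 2 * gram j z z.
  by rewrite /bil !big_cons !big_nil /= (gramC j q p) (gramC j z p) (gramC j z q); ring.
have [a [aE [aB _]]] := gram_isometry j [:: (1, p); (- 1, q); (1, z)].
have [a' [aE' [aB' _]]] := gram_isometry j [:: (1, p); (- 1, q); (- 1, z)].
rewrite !lin3 in aE; rewrite !lin3 in aE'; rewrite bilE in aB; rewrite bilE in aB'.
have up := N2_wave_cross b1 b2 (pos z).2 (pos_tau p) (pos_tau q) (pos_tau z) ts xy (normr1 R).
have um : `|- 1 : R| = 1 by rewrite normrN1.
have dn := N2_wave_cross b1 b2 (pos z).2 (pos_tau p) (pos_tau q) (pos_tau z) ts xy um.
set C := cov_const k b tau * eta `^ cov_exponent b.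
have r1 : N2 b (fun w => wre p w - wre q w - 1 * wre z w) (fun w => wim p w - wim q w - 1 * wim z w) = a'%:E.
  by rewrite -aE'; apply: eq_N2 => w; rewrite mulN1r mul1r.
have r2 : N2 b (fun w => wre p w - wre q w - - 1 * wre z w) (fun w => wim p w - wim q w - - 1 * wim z w) = a%:E.
  by rewrite -aE; apply: eq_N2 => w; rewrite mulN1r opprK mul1r.
have aC : a <= a' + C by move: up; rewrite aE r1 -EFinD lee_fin.
have aC' : a' <= a + C by move: dn; rewrite aE' r2 -EFinD lee_fin.
have cC : c * a <= c * a' + c * C by rewrite -mulrDr ler_wpM2l // ltW.
have cC' : c * a' <= c * a + c * C by rewrite -mulrDr ler_wpM2l // ltW.
rewrite -mulrA -/C ler_norml; set D := c * C in cC cC' *.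
rewrite -aB -aB' sqrrN in cC cC'.
have C0 : 0 <= D by lra.
by apply/andP; split; lra.
Qed.
End pair.

Lemma gram_lower j p sg : 0 < sg <= 1 -> sg <= (pos p).1 -> c * var_const k sg <= gram j p p.
Proof.
move=> sg01 h; have [a [aE [aB _]]] := gram_isometry j [:: (1, p)].
have -> : gram j p p = c * a by rewrite -aB /bil !big_cons !big_nil /=; ring.
rewrite ler_wpM2l ?(ltW c0) // -lee_fin -aE !lin1.
exact: (N2_wave_lower k0 bk (pos p).2 sg01 h).
Qed.

(** For approximating noise integrals, sum and difference have the same second moment because
    distinct components are uncorrelated. This equality survives the L2 limit and says that the
    mixed moment vanishes. *)
Lemma cross_component j j' p q : j != j' -> \int[P]_w (X j p w * X j' q w) = 0.
Proof.
move=> jj'; pose Z (s : R) w := X j p w + s * X j' q w.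
have mZ s : mbl (Z s) by apply: measurable_funD => //; exact: measurable_funM.
have like L := lin_field_like noise mX mre mim intX L.
have linZ s w : lin (fun i : 'I_d * J => X i.1 i.2) [:: (1, (j, p)); (s, (j', q))] w = Z s w.
  by rewrite /lin !big_cons big_nil /= mul1r addr0.
have main s : `|s| = 1 -> \int[P]_w (Z s w ^+ 2) <= \int[P]_w (Z (- s) w ^+ 2).
  move=> s1; have [v gv] := like [:: (1, (j, p)); (s, (j', q))].
  have [v' gv'] := like [:: (1, (j, p)); (- s, (j', q))].
  have eZ t : lin (fun i : 'I_d * J => X i.1 i.2) [:: (1, (j, p)); (t, (j', q))] = Z t by apply/funext => w; exact: linZ.
  rewrite eZ in gv; rewrite eZ in gv'.
  rewrite /Rintegral (gl_var gv) (gl_var gv') /=.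
  have v0 := gl_ge0 gv; have v0' := gl_ge0 gv'.
  apply: (@le_of_small_excess _ _ _ (3 * v' + 6)); first lra.
  move=> e /andP[e0 e1]; have e4 : 0 < (e / 2) ^+ 2 by rewrite exprn_gt0 // divr_gt0.
  have [f [hf _]] := stochastic_integral_approx intX j p e4.
  have [g [hg _]] := stochastic_integral_approx intX j' q e4.
  pose Y t w := W j f w + t * W j' g w.
  have mY t : mbl (Y t) by apply: measurable_funD => //; exact: measurable_funM.
  have close t : `|t| = 1 -> (\int[P]_w ((Z t w - Y t w) ^+ 2)%:E <= (e ^+ 2)%:E)%E.
    move=> t1; have mD1 : mbl (fun w => X j p w - W j f w) by exact: measurable_funB.
    have mD2 : mbl (fun w => X j' q w - W j' g w) by mauto.
    have := square_step P t mD2 mD1.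
    have t2 : t ^+ 2 = 1 by rewrite -real_normK ?num_real // t1 expr1n.
    rewrite t2 mulr1 => hs.
    have -> : (\int[P]_w ((Z t w - Y t w) ^+ 2)%:E =
       \int[P]_w ((t * (X j' q w - W j' g w) + (X j p w - W j f w)) ^+ 2)%:E)%E.
      by apply: eq_integral => w _; congr (_ ^+ 2)%:E; rewrite /Z /Y; ring.
    apply: (le_trans hs); apply: (le_via (2%:E * ((e / 2) ^+ 2)%:E + 2%:E * ((e / 2) ^+ 2)%:E)%E).
      by apply: leeD; apply: lee_wpmul2l.
    rewrite -!EFinM -EFinD lee_fin; apply: le_of_eq; by field.
  have [_ hc] := noise.
  have YE t : `|t| = 1 -> (\int[P]_w (Y t w ^+ 2)%:E = \int[P]_w (Y (- t) w ^+ 2)%:E)%E.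
    move=> t1; have [x gx] := lin_noise_like noise [:: (1, (j, f)); (t, (j', g))].
    have [x' gx'] := lin_noise_like noise [:: (1, (j, f)); (- t, (j', g))].
    have eY t' : lin (fun i : 'I_d * test_function R k => W i.1 i.2 : T -> R) [:: (1, (j, f)); (t', (j', g))] = Y t'.
      by apply/funext => w; rewrite /lin !big_cons big_nil /= mul1r addr0.
    have hW L := lin_noise_like noise L.
    have b1' := gauss_like_second_moment [:: (1, (j, f)); (t, (j', g))] hW.
    have b2' := gauss_like_second_moment [:: (1, (j, f)); (- t, (j', g))] hW.
    have z1 : \int[P]_w (W j f w * W j' g w) = 0.
      by have := hc j j' f g; rewrite (negbTE jj') unlock => h; rewrite /Rintegral h.
    have z2 : \int[P]_w (W j' g w * W j f w) = 0.
      by rewrite -z1; apply: eq_Rintegral => w _; rewrite mulrC.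
    have EE : \int[P]_w (Y t w ^+ 2) = \int[P]_w (Y (- t) w ^+ 2).
      rewrite -!eY b1' b2' /bil !big_cons !big_nil /= z1 z2; ring.
    rewrite eY in gx; rewrite eY in gx'.
    move: EE; rewrite /Rintegral (gl_var gx) (gl_var gx') /= => ->.
    by [].
  have [x gx] := lin_noise_like noise [:: (1, (j, f)); (s, (j', g))].
  have eY t' : lin (fun i : 'I_d * test_function R k => W i.1 i.2 : T -> R) [:: (1, (j, f)); (t', (j', g))] = Y t'.
    by apply/funext => w; rewrite /lin !big_cons big_nil /= mul1r addr0.
  rewrite eY in gx; have xE := gl_var gx; have x0 := gl_ge0 gx.
  have q1 : v <= (1 + e) * x + e ^+ 2 + e.
    rewrite -lee_fin -(gl_var gv); apply: (sqr_perturb (mZ _) (mY _) e0 (close _ s1)); by rewrite xE.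
  have q2 : x <= (1 + e) * v' + e ^+ 2 + e.
    rewrite -lee_fin -xE YE //.
    apply: (sqr_perturb (mY (- s)) (mZ (- s)) e0); last by rewrite (gl_var gv').
    have := close (- s); rewrite normrN => /(_ s1); congr (_ <= _)%E.
    by apply: eq_integral => w _; rewrite -sqrrN opprB.
  have ee : e ^+ 2 <= e by rewrite expr2 ler_piMl // ltW.
  have q3 : (1 + e) * x <= (1 + e) * ((1 + e) * v' + 2 * e) by rewrite ler_wpM2l //; lra.
  have q4 : e ^+ 2 * v' <= e * v' by rewrite ler_wpM2r.
  have q5 : (1 + e) * ((1 + e) * v' + 2 * e) = v' + 2 * (e * v') + e ^+ 2 * v' + 2 * e + 2 * e ^+ 2 by ring.
  by rewrite mulrDr; lra.
have m1 := main 1 (normr1 _); have := main (- 1); rewrite opprK normrN1 => /(_ erefl) m2.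
have bE s := gauss_like_second_moment [:: (1, (j, p)); (s, (j', q))] like.
have eZ t : lin (fun i : 'I_d * J => X i.1 i.2) [:: (1, (j, p)); (t, (j', q))] = Z t by apply/funext => w; exact: linZ.
have h1 := bE 1; have h2 := bE (- 1); rewrite eZ in h1; rewrite eZ in h2.
have sym : \int[P]_w (X j' q w * X j p w) = \int[P]_w (X j p w * X j' q w).
  by apply: eq_Rintegral => w _; rewrite mulrC.
move: m1 m2; rewrite h1 h2 /bil !big_cons !big_nil /= sym; lra.
Qed.
End solution_covariance.

Lemma countable_union_null (R : realType) disp (T : measurableType disp) (P : probability T R)
    (I : countType) (A : I -> set T) :
  (forall i, measurable (A i)) -> (forall i, P (A i) = 0%E) ->
  measurable (\bigcup_i A i) /\ P (\bigcup_i A i) = 0%E.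
Proof.
move=> mA A0; pose F n := if unpickle n is Some i then A i else set0.
have -> : \bigcup_i A i = \bigcup_n F n.
  apply/seteqP; split => [w [i _ Aw]|w [n _]]; first by exists (pickle i); rewrite // /F pickleK.
  by rewrite /F; case: unpickle => // i Aw; exists i.
have mF n : measurable (F n) by rewrite /F; case: unpickle.
have F0 n : P (F n) = 0%E by rewrite /F; case: unpickle.
have mU : measurable (\bigcup_n F n) by exact: bigcupT_measurable.
split => //; apply/(negligibleP P mU); apply: negligible_bigcup => n.
by apply/negligibleP; [exact: mF|exact: F0].
Qed.

Lemma powR_dyadic (R : realType) (s : R) l : (2 ^- l) `^ s = (2 `^ (- s)) ^+ l.
Proof.
rewrite -powR_mulrn ?powR_ge0 // -powRrM -(powR_invn l (ler0n _ 2)).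
by rewrite -powRrM; congr (_ `^ _); ring.
Qed.

(** * Space-time cubes parametrised by the unit cube *)

Section cube.
Context {R : realType} (k : nat).

(** [critical_field] quantifies over all parameters, while the estimates hold on a bounded cube of
    positive times. Clamping to [0, 1] extends them and, being 1-Lipschitz, does not enlarge
    distances. *)
Definition clamp (s : R) : R := Num.max 0 (Num.min 1 s).

Lemma clamp_itv s : 0 <= clamp s <= 1.
Proof. by rewrite le_max lexx /= ge_max ler01 ge_min lexx. Qed.

Lemma clamp_id s : 0 <= s <= 1 -> clamp s = s.
Proof. by case/andP=> s0 s1; rewrite /clamp min_r // max_r. Qed.

Lemma clamp_lipschitz s t : `|clamp s - clamp t| <= `|s - t|.
Proof.
rewrite /clamp !maxEle !minEle.
case: (leP 1 s); case: (leP 1 t); move=> ? ?; rewrite ?ler01;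
  try case: (leP 0 s); try case: (leP 0 t); move=> *; rewrite ler_norml; apply/andP; split;
  have := ler_norm (s - t); have := ler_norm (t - s); rewrite (distrC t s); lra.
Qed.

Variables (t0 : R) (a : 'rV[R]_k) (L : R).

Definition cube (y : 'I_k.+1 -> R) : R * 'rV[R]_k :=
  (t0 + L * clamp (y ord0), \row_i (a 0 i + L * clamp (y (lift ord0 i)))).

Definition cube_hull : set (R * 'rV[R]_k) :=
  `[t0, t0 + L] `*` [set x : 'rV_k | forall i, `[a 0 i, a 0 i + L]%classic (x 0 i)].

Lemma compact_cube_hull : compact cube_hull.
Proof.
apply: compact_setX; first exact: segment_compact.
apply: (@rV_compact R k (fun i => `[a 0 i, a 0 i + L]%classic)) => i.
exact: segment_compact.
Qed.

Hypothesis L0 : 0 < L.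

Lemma cube_in_hull y : cube_hull (cube y).
Proof.
have h s : 0 <= L * clamp s <= L.
  have /andP[h0 h1] := clamp_itv s; rewrite mulr_ge0 ?(ltW L0) //=.
  by rewrite ger_pMr.
split => [|i] /=; rewrite ?mxE; rewrite in_itv /=.
  by have := h (y ord0); lra.
by have := h (y (lift ord0 i)); set s := L * _ => hs; apply/andP; split; lra.
Qed.

Lemma cube_close (x y : 'I_k.+1 -> R) h : (0 < k)%N ->
  (forall c, `|clamp (x c) - clamp (y c)| <= h) ->
  `|(cube x).1 - (cube y).1| <= k%:R * L * h /\
  forall u : k.-tuple (Borel R),
    `|dotp (to_row u) (cube x).2 - dotp (to_row u) (cube y).2| <= tn u * (k%:R * L * h).
Proof.
move=> k0 xy; have h0 : 0 <= h by exact: le_trans (xy ord0).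
have k1 : 1 <= k%:R :> R by rewrite ler1n.
split=> [|u] /=.
  have -> : t0 + L * clamp (x ord0) - (t0 + L * clamp (y ord0)) = L * (clamp (x ord0) - clamp (y ord0)) by ring.
  rewrite normrM gtr0_norm // -mulrA -[leLHS]mul1r ler_pM ?mulr_ge0 ?(ltW L0) //.
  by rewrite ler_wpM2l // ltW.
rewrite /dotp -sumrB; apply: (le_trans (ler_norm_sum _ _ _)).
apply: (le_via (\sum_(i < k) tn u * (L * h))); last first.
  by rewrite sumr_const card_ord -mulr_natl; apply: le_of_eq; ring.
apply: ler_sum => i _; rewrite !mxE -mulrBr normrM ler_pM //; first exact: le_tn.
have -> : a 0 i + L * clamp (x (lift ord0 i)) - (a 0 i + L * clamp (y (lift ord0 i))) =
  L * (clamp (x (lift ord0 i)) - clamp (y (lift ord0 i))) by ring.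
by rewrite normrM gtr0_norm // ler_wpM2l // ltW.
Qed.
End cube.

Definition cube_field (R : realType) k d (T : Type) (v : T -> R -> 'rV[R]_k -> 'rV[R]_d) t0 a L
    (j : 'I_d) (y : 'I_k.+1 -> R) (w : T) : R :=
  v w (cube t0 a L y).1 (cube t0 a L y).2 0 j.

Lemma entry_le_norm (R : realType) d (x y : 'rV[R]_d) j : `|x 0 j - y 0 j| <= `|x - y|.
Proof.
have -> : x 0 j - y 0 j = (x - y) 0 j by rewrite !mxE.
rewrite [leRHS]/Num.Def.normr /= mx_normrE.
by apply/bigmax_geP; right; exists (0, j).
Qed.

(** * Exact and approximate hits of a continuous path *)

Section topology.
Context {R : realType} (k d : nat) {disp : measure_display} {T : measurableType disp}.
Variables (v : T -> R -> 'rV[R]_k -> 'rV[R]_d) (w : T).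
Hypothesis cv : {within [set p : R * 'rV[R]_k | 0 <= p.1], continuous (fun p => v w p.1 p.2)}.
Variables (t0 : R) (a : 'rV[R]_k) (L : R).
Hypothesis t00 : 0 <= t0.
Hypothesis L0 : 0 < L.

Local Notation Q := (cube t0 a L).
Local Notation X := (cube_field v t0 a L).

Let time_pos y : 0 <= (Q y).1.
Proof.
have [] := cube_in_hull t0 a L0 y; rewrite /= in_itv /= => /andP[h _] _.
exact: le_trans h.
Qed.

Lemma inside_fl n l (y : 'I_n -> R) : (forall e, 0 <= y e < 1) -> inside l (fl l y).
Proof.
move=> y01 e; have /andP[y0 y1] := y01 e.
rewrite ffunE truncn_lt_nat ?mulr_ge0 ?exprn_ge0 //.
by rewrite natrX gtr_pMr // exprn_gt0.
Qed.

Lemma pt_fl n l (y : 'I_n -> R) e : (forall e, 0 <= y e < 1) -> `|y e - pt l (fl l y) e| <= 2 ^- l.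
Proof.
move=> y01; have /andP[y0 y1] := y01 e.
have l0 : 0 < 2 ^+ l :> R by rewrite exprn_gt0.
have x0 : 0 <= 2 ^+ l * y e by rewrite mulr_ge0 // ltW.
have := truncn_itv x0; rewrite /pt ffunE.
set m := Num.truncn _ => /andP[h1]; rewrite -natr1 => h2.
have -> : y e - m%:R / 2 ^+ l = (2 ^+ l * y e - m%:R) / 2 ^+ l by field; rewrite gt_eqF.
rewrite normrM [X in _ * X]ger0_norm ?invr_ge0 ?(ltW l0) // ler_piMl ?invr_ge0 ?(ltW l0) //.
by rewrite ger0_norm; lra.
Qed.

(** Rounding [y] down on finer and finer grids gives dyadic points converging to it, and the path is
    continuous at its image. *)
Lemma hit_approx (y : 'I_k.+1 -> R) : (forall e, 0 <= y e < 1) ->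
  approx_hit (fun j => v w (Q y).1 (Q y).2 0 j) X w.
Proof.
move=> y01 m _.
have m0 : 0 < m.+1%:R^-1 :> R by rewrite invr_gt0.
have /subspace_continuousP/(_ (Q y) (time_pos y))/cvgrPdist_lt/(_ _ m0) := cv.
rewrite /= => /nbhs_ballP[r /= r0 hr].
have [l hl] : exists l : nat, L * 2 ^- l < r.
  have h : `|2^-1 : R| < 1 by rewrite ger0_norm ?invr_ge0 // invf_lt1 // ltr1n.
  have [l _ hl] := cvgr0_norm_lt (fun n => geometric L 2^-1 n) (cvg_geometric L h) r r0.
  exists l; have := hl l (leqnn l); rewrite /geometric /= => /(le_lt_trans (ler_norm _)).
  by rewrite exprVn.
have cl e : `|L * clamp (y e) - L * clamp (pt l (fl l y) e)| < r.
  apply: le_lt_trans hl; rewrite -mulrBr normrM gtr0_norm // ler_wpM2l ?(ltW L0) //.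
  exact: le_trans (clamp_lipschitz _ _) (pt_fl l e y01).
exists l => //; exists (fl l y); first by apply/mem_desc_origin; exact: inside_fl.
move=> j; rewrite distrC ltW //.
have := hr (Q (pt l (fl l y))); rewrite /from_subspace /= => /(_ _ (time_pos _)) h.
apply: le_lt_trans (h _).
  exact: entry_le_norm.
split => /=.
  rewrite /ball /=.
  by have -> : t0 + L * clamp (y ord0) - (t0 + L * clamp (pt l (fl l y) ord0)) =
    L * clamp (y ord0) - L * clamp (pt l (fl l y) ord0) by ring.
split => // i i'; rewrite !mxE /ball /=.
have -> : a 0 i' + L * clamp (y (lift ord0 i')) - (a 0 i' + L * clamp (pt l (fl l y) (lift ord0 i'))) =
    L * clamp (y (lift ord0 i')) - L * clamp (pt l (fl l y) (lift ord0 i')) by ring.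
exact: cl.
Qed.

(** The image of the closed cube is compact, hence closed, and contains points arbitrarily close to
    [z]. *)
Lemma approx_hit_hit (z : 'rV[R]_d) : approx_hit (fun j => z 0 j) X w ->
  exists2 p, cube_hull t0 a L p & v w p.1 p.2 = z.
Proof.
move=> hz; pose f (p : R * 'rV[R]_k) := v w p.1 p.2.
have cK : compact (f @` cube_hull t0 a L).
  apply: continuous_compact; last exact: compact_cube_hull.
  apply: continuous_subspaceW cv => p [+ _]; rewrite /= in_itv /= => /andP[h _].
  exact: le_trans h.
have clK : closed (f @` cube_hull t0 a L) by apply: compact_closed => //; exact: norm_hausdorff.
suff : (f @` cube_hull t0 a L) z by case=> p bp <-; exists p.
apply: clK => B /nbhs_ballP[r /= r0 hr].
have [m hm] : exists m : nat, m.+1%:R^-1 < r.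
  by have [m _ hm] := near_infty_natSinv_lt (PosNum r0); exists m; apply: (hm m) => /=.
have [l _ [q _ hq]] := hz m I.
exists (f (Q (pt l q))); split; first by exists (Q (pt l q)) => //; exact: cube_in_hull.
apply: hr; split => // i j; rewrite (ord1 i) /ball /= distrC.
exact: le_lt_trans (hq j) hm.
Qed.
End topology.

(** * The solution on one cube, and the union over all cubes *)

Section solution.
Context {R : realType} (k d : nat) {disp : measure_display} {T : measurableType disp}.
Variable P : probability T R.
Variables (b c : R) (cov : test_function R k -> test_function R k -> \bar R).
Variable W : 'I_d -> test_function R k -> {RV P >-> R}.
Variable v : T -> R -> 'rV[R]_k -> 'rV[R]_d.
Hypothesis k0 : (0 < k)%N.
Hypothesis b1 : 1 <= b.
Hypothesis b2 : b < 2.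
Hypothesis bk : b <= k%:R.
Hypothesis noise : noise_with_covariance cov W.
Hypothesis c0 : 0 < c.
Hypothesis iso : spectral_isometry b c cov.
Hypothesis sol : is_wave_solution b W v.
Hypothesis dk : d%:R = 2 * (k%:R + 1) / (2 - b).

Lemma dim_gt0 : (0 < d)%N.
Proof.
by rewrite -(ltr_nat R) dk divr_gt0 // ?mulr_gt0 // subr_gt0.
Qed.

Section one_cube.
Variables (t0 : R) (a : 'rV[R]_k) (L sg tau : R).
Hypothesis L0 : 0 < L.
Hypothesis sg01 : 0 < sg <= 1.
Hypothesis sgt0 : sg <= t0.
Hypothesis t0tau : t0 + L <= tau.
Hypothesis small : incr_const k b c tau * (k%:R * L) `^ (2 - b) <= c * var_const k sg.

Local Notation Q := (cube t0 a L).
Local Notation X := (cube_field v t0 a L).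

Let time_pos y : 0 <= (Q y).1.
Proof.
have [] := cube_in_hull t0 a L0 y; rewrite /= in_itv /= => /andP[h _] _.
by have := sgt0; have := sg01; lra.
Qed.

Let mX j y : mbl (X j y).
Proof. by have [h _ _] := sol; apply: h; exact: time_pos. Qed.

Let intX j y : is_stochastic_integral b (W j) (wave_integrand (Q y).1 (Q y).2) (X j y).
Proof. by have [_ h _] := sol; apply: h; exact: time_pos. Qed.

Let pos_tau y : 0 <= (Q y).1 <= tau.
Proof.
rewrite time_pos /=; have [] := cube_in_hull t0 a L0 y; rewrite /= in_itv /= => /andP[_ h] _.
by have := t0tau; lra.
Qed.

Let j0 : 'I_d := Ordinal dim_gt0.
Let K := gram P X j0.

Let o : 'I_k.+1 -> R := pt 0 origin.

Let kL0 : 0 < k%:R * L.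
Proof. by rewrite mulr_gt0 // ltr0n. Qed.

Let IC := incr_const k b c tau.
Let CC := c * cov_const k b tau.

Let dist0 (y : 'I_k.+1 -> R) e : 0 <= e -> `|(Q y).1 - (Q y).1| <= e /\ forall u : k.-tuple (Borel R),
    `|dotp (to_row u) (Q y).2 - dotp (to_row u) (Q y).2| <= tn u * e.
Proof. by move=> e0; split=> [|u]; rewrite subrr normr0 ?mulr_ge0 // tn_ge0. Qed.

Let IC0 : 0 <= IC.
Proof.
have [h1 h2] := dist0 o (@ler01 R).
have := gram_incr b1 b2 noise c0 iso mX intX pos_tau j0 (ltr01 : 0 < 1 :> R) h1 h2.
by rewrite powR1 mulr1; rewrite -/IC; lra.
Qed.

Let CC0 : 0 <= CC.
Proof.
have [h1 h2] := dist0 o (@ler01 R).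
have := gram_cross b1 b2 noise c0 iso mX intX pos_tau j0 h1 h2 o.
by rewrite subrr normr0 powR1 mulr1.
Qed.

Let eta0 l : 0 < k%:R * L * 2 ^- l.
Proof. by rewrite mulr_gt0 // invr_gt0 exprn_gt0. Qed.

Let close l x y : near_points l x y -> `|(Q x).1 - (Q y).1| <= k%:R * L * 2 ^- l /\
  forall u : k.-tuple (Borel R),
    `|dotp (to_row u) (Q x).2 - dotp (to_row u) (Q y).2| <= tn u * (k%:R * L * 2 ^- l).
Proof.
move=> xy; apply: cube_close => // e; apply: le_trans (xy e); exact: clamp_lipschitz.
Qed.

Let KoE x : K x x - 2 * K x o + K o o <= c * var_const k sg.
Proof.
have [h1 h2] : `|(Q x).1 - (Q o).1| <= k%:R * L * 1 /\ forall u : k.-tuple (Borel R),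
    `|dotp (to_row u) (Q x).2 - dotp (to_row u) (Q o).2| <= tn u * (k%:R * L * 1).
  apply: cube_close => // e.
  have := clamp_itv (x e); have := clamp_itv (o e); rewrite ler_norml.
  by set s := clamp _; set t := clamp _; lra.
rewrite mulr1 in h1 h2.
exact: le_trans (gram_incr b1 b2 noise c0 iso mX intX pos_tau j0 kL0 h1 h2) small.
Qed.

Let Klow x : c * var_const k sg <= K x x.
Proof.
apply: (gram_lower k0 bk noise c0 iso mX intX j0 sg01).
by have [] := cube_in_hull t0 a L0 x; rewrite /= in_itv /= => /andP[h _] _; exact: le_trans h.
Qed.

(** [H] is the Hoelder exponent; [A] and [B] are the factors per dyadic generation for increments
    and for covariances. [rho] is the mean of 1 and [A], so rho^2 > A by the inequality between the
    means. *)
Let H : R := (2 - b) / 2.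
Let A : R := 2 `^ (- H).
Let B : R := 2 `^ (- cov_exponent b).
Let rho : R := (1 + A) / 2.
Let C : R := moment_const d * (IC * (k%:R * L) `^ (2 - b)) ^+ d + CC * (k%:R * L) `^ cov_exponent b.

Let powR2_lt (s t : R) : s < t -> 2 `^ s < 2 `^ t.
Proof.
move=> st; rewrite /powR (gt_eqF (ltr0n R 2)) ltr_expR ltr_pM2r // ln_gt0 //.
by rewrite ltr1n.
Qed.

Let A0 : 0 < A. Proof. exact: powR_gt0. Qed.

Let A1 : A < 1.
Proof.
have -> : 1 = 2 `^ (0 : R) by rewrite powRr0.
by apply: powR2_lt; have := b2; rewrite /H; lra.
Qed.

Let CI : 0 <= moment_const d * (IC * (k%:R * L) `^ (2 - b)) ^+ d.
Proof. exact: (mulr_ge0 (moment_const_ge0 d) (exprn_ge0 d (mulr_ge0 IC0 (powR_ge0 _ _)))). Qed.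

Let CII : 0 <= CC * (k%:R * L) `^ cov_exponent b.
Proof. exact: mulr_ge0 CC0 (powR_ge0 _ _). Qed.

Lemma cube_field_critical : critical_field P X K A B rho C.
Proof.
have d0 := dim_gt0.
split.
- have gf : gaussian P (fun i : 'I_d * ('I_k.+1 -> R) => X i.1 i.2) (field_gram P X).
    apply: (field_gaussian noise mX _ _ intX) => y.
      by rewrite re_part_wave; exact: measurable_wave_re.
    by rewrite im_part_wave; exact: measurable_wave_im.
  move/eq_gaussian : gf; apply => [//|[j x] [j' y]].
  rewrite /field_cov /field_gram /=; case: eqP => [->|/eqP jj'].
    exact: (gram_same_component noise c0 iso mX intX).
  exact: (cross_component noise mX intX).
- move=> j l x y xy; have [h1 h2] := close xy.
  apply: (le_trans (incr_moment b1 b2 noise c0 iso mX intX pos_tau j (eta0 l) h1 h2 d)).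
  rewrite lee_fin powRM ?(ltW kL0) ?invr_ge0 ?exprn_ge0 // -/IC mulrA exprMn mulrA.
  have -> : ((2 ^- l) `^ (2 - b)) ^+ d = (A ^+ l) ^+ (2 * d).
    rewrite powR_dyadic [RHS]exprM; congr (_ ^+ d).
    rewrite -[RHS]exprM mulnC exprM; congr (_ ^+ l).
    rewrite -powR_mulrn ?ltW // -powRrM; congr (_ `^ _); rewrite /H; by field.
  apply: ler_wpM2r; first by rewrite !exprn_ge0 // ltW.
  by rewrite /C lerDl.
- by move=> x y; exact: gramC.
- move=> l x y z xy; have [h1 h2] := close xy.
  apply: (le_trans (gram_cross b1 b2 noise c0 iso mX intX pos_tau j0 h1 h2 z)).
  rewrite powRM ?(ltW kL0) ?invr_ge0 ?exprn_ge0 // -/CC mulrA powR_dyadic -/B.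
  rewrite ler_wpM2r ?exprn_ge0 ?powR_ge0 //.
  by rewrite /C lerDr.
(* The increment from the corner has variance at most the lower bound of K x x, which leaves K o o
   <= 2 K x o. *)
- by move=> x; rewrite -/o; have := KoE x; have := Klow x; lra.
- apply: lt_le_trans (Klow o); rewrite mulr_gt0 //; apply: var_const_gt0 => //.
  by case/andP: sg01.
- exact: addr_ge0.
- exact: powR_gt0.
- by apply: powR2_lt; rewrite /H /cov_exponent; have := b2; lra.
- rewrite -subr_gt0; have -> : rho ^+ 2 - A = ((1 - A) / 2) ^+ 2 by rewrite /rho; field.
  by rewrite exprn_gt0 // divr_gt0 // subr_gt0.
- by rewrite /rho; have := A0; have := A1; move=> *; apply/andP; split; lra.
- by [].
(* The value of d enters here: H d = k + 1, so A^d = 2^-(k+1). *)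
- rewrite -powR_mulrn ?ltW // -powRrM -(powR_invn k.+1 (ler0n _ 2)) dk /H; congr (_ `^ _).
  rewrite -natr1; field; apply/eqP => h; have := b2; lra.
Qed.

Lemma cube_field_null z : P (approx_hit z X) = 0%E.
Proof. exact: (approx_hit_null cube_field_critical). Qed.

Lemma measurable_cube_field z : measurable (approx_hit z X).
Proof. exact: measurable_approx_hit. Qed.
End one_cube.

(** On a cube this small the increments from the corner have variance below the lower bound of the
    variance of the field, which makes [gain] at least 1/2. *)
Lemma small_side tau sg : 0 < sg -> exists2 L, 0 < L <= 1 &
  incr_const k b c tau * (k%:R * L) `^ (2 - b) <= c * var_const k sg.
Proof.
move=> s0; have v0 : 0 < c * var_const k sg by rewrite mulr_gt0 // var_const_gt0.
have kR : 0 < k%:R :> R by rewrite ltr0n.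
set I := incr_const k b c tau; set V := c * _ in v0 *.
have hb : 0 < 2 - b by rewrite subr_gt0.
pose J := 1 + `|I|; have J0 : 0 < J by rewrite /J; have := normr_ge0 I; lra.
pose M := (V / J) `^ (2 - b)^-1; have M0 : 0 < M by rewrite powR_gt0 // divr_gt0.
exists (Num.min 1 (M / k%:R)); first by rewrite lt_min ltr01 divr_gt0 // ge_min lexx.
have h : (k%:R * Num.min 1 (M / k%:R)) `^ (2 - b) <= V / J.
  apply: (le_via (M `^ (2 - b))).
    apply: ge0_ler_powR; rewrite ?nnegrE ?(ltW hb) ?(ltW M0) //.
      by rewrite mulr_ge0 // le_min ler01 ltW // divr_gt0.
    by rewrite mulrC -ler_pdivlMr // ge_min lexx orbT.
  by rewrite /M -powRrM mulVf ?gt_eqF // powRr1 // ltW // divr_gt0.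
apply: (le_via (J * (V / J))); last by rewrite mulrC divfK // gt_eqF.
apply: (le_trans (ler_norm _)); rewrite normrM (ger0_norm (powR_ge0 _ _)).
by apply: ler_pM => //; rewrite ?powR_ge0 // /J lerDr.
Qed.

(** Countably many cubes cover the positive times, with a side that depends on the time window
    [1/(m+1), m+1], as the constants degenerate at 0 and at infinity. The hitting event equals the
    union of the approximate hits, which yields its measurability as well as its nullity. *)
Lemma solution_points_polar : points_polar P v.
Proof.
move=> z /=.
pose sg (m : nat) : R := m.+1%:R^-1.
have sg01 m : 0 < sg m <= 1 by rewrite invr_gt0 ltr0n invf_le1 // ler1n.
have side m := small_side (m.+2%:R) (proj1 (andP (sg01 m))).
have /choice[L hL] : forall m, exists L, 0 < L <= 1 /\
    incr_const k b c m.+2%:R * (k%:R * L) `^ (2 - b) <= c * var_const k (sg m).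
  by move=> m; have [L h1 h2] := side m; exists L.
have L0 m : 0 < L m by have [/andP[]] := hL m.
(* Capping the starting time keeps every cube of window m below m + 2, for all i. *)
pose t0 m (i : nat) : R := Num.min (sg m + i%:R * L m) m.+1%:R.
pose a m (u : {ffun 'I_k -> int}) : 'rV[R]_k := \row_j ((u j)%:~R * L m).
pose I := (nat * nat * {ffun 'I_k -> int})%type.
pose A (q : I) := approx_hit (fun j => z 0 j) (cube_field v (t0 q.1.1 q.1.2) (a q.1.1 q.2) (L q.1.1)).
have sgt0 m i : sg m <= t0 m i.
  rewrite le_min lerDl mulr_ge0 ?(ltW (L0 m)) //=.
  by have /andP[_ h] := sg01 m; apply: (le_trans h); rewrite ler1n.
have tL m i : t0 m i + L m <= m.+2%:R.
  have [/andP[_ h] _] := hL m; rewrite -(natr1 m.+1); apply: lerD => //.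
  by rewrite ge_min lexx orbT.
have t00 m i : 0 <= t0 m i by apply: le_trans (sgt0 m i); have /andP[/ltW] := sg01 m.
have [_ _ cont] := sol.
have -> : [set w | exists t x, 0 < t /\ v w t x = z] = \bigcup_q A q.
  apply/seteqP; split => [w [t [x [tp vz]]]|w [[[m i] u] _ Aw]]; last first.
    have [[t x] [+ _] vz] := approx_hit_hit (cont w) (t00 m i) (L0 m) Aw.
    rewrite /= in_itv /= => /andP[h _]; exists t, x; split => //.
    by apply: lt_le_trans h; apply: lt_le_trans (sgt0 m i); have /andP[] := sg01 m.
  have [m [mt tm]] : exists m, sg m <= t /\ t <= m.+1%:R.
    pose n1 := (Num.truncn t); pose n2 := Num.truncn t^-1.
    have h1 : t < n1.+1%:R by have /andP[] := truncn_itv (ltW tp).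
    have h2 : t^-1 < n2.+1%:R by have /andP[] := truncn_itv (ltW (eq_ind _ (fun x => is_true x) tp _ (esym (invr_gt0 t)))).
    exists (maxn n1 n2); split.
      rewrite /sg -[leRHS]invrK lef_pV2 ?posrE ?invr_gt0 //.
      by apply: (le_trans (ltW h2)); rewrite ler_nat ltnS leq_maxr.
    by apply: (le_trans (ltW h1)); rewrite ler_nat ltnS leq_maxl.
  have Lm := L0 m.
  have q0 : 0 <= (t - sg m) / L m by rewrite divr_ge0 ?(ltW Lm) // subr_ge0.
  pose i := Num.truncn ((t - sg m) / L m).
  have /andP[i1 i2] := truncn_itv q0; rewrite -/i in i1 i2.
  rewrite ler_pdivlMr // in i1; rewrite ltr_pdivrMr // -natr1 mulrDl mul1r in i2.
  have tE : t0 m i = sg m + i%:R * L m by rewrite /t0 min_l //; lra.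
  pose u := [ffun j : 'I_k => Num.floor (x 0 j / L m)].
  (* Local coordinates of (t, x) in its half-open cube; they lie in [0, 1), so [clamp] fixes
     them. *)
  pose y (e : 'I_k.+1) : R := if unlift ord0 e is Some j then x 0 j / L m - (u j)%:~R
    else (t - t0 m i) / L m.
  have y01 e : 0 <= y e < 1.
    rewrite /y; case: unliftP => [j _|_].
      rewrite /u ffunE; have /andP[f1 f2] := floor_itv (x 0 j / L m).
      by rewrite intrD in f2; apply/andP; split; lra.
    apply/andP; split; first by rewrite divr_ge0 ?(ltW Lm) // tE; lra.
    by rewrite ltr_pdivrMr // mul1r tE; lra.
  have clE e : clamp (y e) = y e by apply: clamp_id; have /andP[h1 /ltW h2] := y01 e; rewrite h1.
  exists (m, i, u) => //=.
  have := hit_approx (cont w) (a m u) (t00 m i) Lm y01; rewrite /A.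
  have -> : cube (t0 m i) (a m u) (L m) y = (t, x); last by rewrite /= vz.
  have Ln : L m != 0 by rewrite gt_eqF.
  congr pair.
    by rewrite clE /y unlift_none mulrC divfK //; lra.
  apply/rowP => j; rewrite mxE clE /y liftK mxE mulrBr [L m * (_ / _)]mulrC divfK //.
  by rewrite (mulrC (L m)); lra.
have AmP q : measurable (A q) /\ P (A q) = 0%E.
  have [_ sm] := hL q.1.1; split.
    exact: (measurable_cube_field _ (L0 _) (sg01 q.1.1) (sgt0 _ _)).
  exact: (cube_field_null _ (L0 _) (sg01 q.1.1) (sgt0 _ _) (tL _ _) sm).
by apply: countable_union_null => q; have [] := AmP q.
Qed.
End solution.

Theorem theorem8p1 (R : realType) (disp : measure_display)
    (T : measurableType disp) (P : probability T R) :
  (forall (k d : nat) (beta : R)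
      (W : 'I_d -> test_function R k -> {RV P >-> R})
      (v : T -> R -> 'rV[R]_k -> 'rV[R]_d),
    (0 < k)%N ->
    [/\ k = 1%N, beta = 1 & is_white_noise W] \/
    [/\ 1 < beta, beta < Num.min k%:R 2 & is_riesz_noise beta W] ->
    d%:R = 2 * (k%:R + 1) / (2 - beta) ->
    is_wave_solution beta W v ->
    points_polar P v) /\
  (forall (W : 'I_4 -> test_function R 1 -> {RV P >-> R})
      (v : T -> R -> 'rV[R]_1 -> 'rV[R]_4),
    is_white_noise W ->
    is_wave_solution 1 W v ->
    points_polar P v).
Proof.
(* Serves the first case and the last claim, where 2 (1 + 1) / (2 - 1) = 4. *)
have white k d (W : 'I_d -> test_function R k -> {RV P >-> R}) v : k = 1%N -> is_white_noise W ->
    d%:R = 2 * (k%:R + 1) / (2 - 1) :> R -> is_wave_solution 1 W v -> points_polar P v.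
  move=> k1 noise dk sol; have h : (1 : R) <= k%:R by rewrite k1.
  apply: (solution_points_polar _ _ _ h noise (white_c_gt0 k) (white_isometry k1) sol dk) => //.
    by rewrite k1.
  by rewrite ltr1n.
split=> [k d b W v k0 [[k1 -> noise]|[b1 + noise]] dk sol|W v noise sol].
- exact: white dk sol.
- rewrite lt_min => /andP[bk b2].
  have b12 : 1 < b < 2 by rewrite b1.
  exact: (solution_points_polar k0 (ltW b1) b2 (ltW bk) noise (riesz_c_gt0 b12 bk)
    (riesz_isometry k0 b12 bk) sol dk).
- by apply: white noise _ sol => //; field.
Qed.
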